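(* Let $T>0$, $\mu,\omega_0\in\mathbb R$, let $V\in C^1(\mathbb R)$ be real-valued and $T$-periodic, and let $\psi_0\in H^2(\mathbb R)$ be a real-valued nondegenerate solution of $-\psi''+\mu V\psi+\omega\psi-\psi^3=0$ at $\omega=\omega_0$ such that, at $\omega=\omega_0$: (1) $L_{+,\mu}(\psi_0)$ has precisely one negative eigenvalue (counting algebraic multiplicities); (2) $L_{-,\mu}(\psi_0)$ has no negative eigenvalues; (3) $\langle\partial_\omega\tilde\psi(\omega_0),\psi_0\rangle_{L^2}\ne0$, where $\tilde\psi$ is the continuation of $\psi_0$ in $\omega$. Suppose $\omega_0$ is larger than the spectral bound (supremum of the spectrum) of $\partial_x^2-\mu V$ acting on $L^2(\mathbb R)$. Let $\psi_{{\rm per},n}\in H^2_{\rm per}(0,nT)$ be the periodic pulse solutions associated with $\psi_0$ (at $\omega=\omega_0$) described in the context. Then there exists $N\in\mathbb N$ such that for all $n\in\mathbb N$ with $n\ge N$ the following are equivalent: 1. $\psi_0$ is spectrally stable, i.e. $\sigma(L_\mu(\psi_0))\subset\{\lambda\in\mathbb C:\operatorname{Re}\lambda\le0\}$. 2. $\langle\partial_\omega\tilde\psi(\omega_0),\psi_0\rangle_{L^2}>0$. 3. $\psi_{{\rm per},n}$ is spectrally stable against co-periodic perturbations, i.e. the spectrum of $L_{\mu,\rm per}(\psi_{{\rm per},n})$ is confined to the imaginary axis. Moreover, if one of these statements holds, then: a. $L_{-,\mu,\rm per}(\psi_{{\rm per},n})$ has no negative eigenvalues and a simple eigenvalue at $0$.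 b. $L_{+,\mu,\rm per}(\psi_{{\rm per},n})$ is invertible and has precisely one negative eigenvalue, which is simple. c. There exist $\nu_n>0$ and a smooth map $\tilde\psi_{{\rm per},n}:(\omega_0-\nu_n,\omega_0+\nu_n)\to H^2_{\rm per}(0,nT)$ such that $\tilde\psi_{{\rm per},n}(\omega_0)=\psi_{{\rm per},n}$ and $\tilde\psi_{{\rm per},n}(\omega)$ solves $-\psi''+\mu V\psi+\omega\psi-\psi^3=0$ for all $\omega\in(\omega_0-\nu_n,\omega_0+\nu_n)$; and $$\langle\partial_\omega\tilde\psi_{{\rm per},n}(\omega_0),\psi_{{\rm per},n}\rangle_{L^2_{\rm per}(0,nT)}>0.$$
   Context: Focusing Gross–Pitaevskii equation in the rotating frame: $i\partial_t\psi=-\partial_x^2\psi+\mu V(x)\psi+\omega\psi-|\psi|^2\psi$. Its real-valued stationary solutions satisfy $-\psi''+\mu V(x)\psi+\omega\psi-\psi^3=0$. For real-valued $\underline\psi\in L^\infty(\mathbb R)$ define on $L^2(\mathbb R)$, with domain $H^2(\mathbb R)$, the operators $L_{-,\mu}(\underline\psi)\varphi=-\varphi''+\mu V\varphi+\omega\varphi-\underline\psi^2\varphi$, $L_{+,\mu}(\underline\psi)\varphi=-\varphi''+\mu V\varphi+\omega\varphi-3\underline\psi^2\varphi$, and on $L^2(\mathbb R)^2$ with domain $H^2(\mathbb R)^2$ $$L_\mu(\underline\psi)=J\begin{pmatrix}L_{+,\mu}(\underline\psi)&0\\0&L_{-,\mu}(\underline\psi)\end{pmatrix},\qquad J=\begin{pmatrix}0&1\\-1&0\end{pmatrix}.$$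 For $nT$-periodic $\underline\psi$, the operators $L_{\pm,\mu,\rm per}(\underline\psi)$ and $L_{\mu,\rm per}(\underline\psi)$ are given by the same expressions on $L^2_{\rm per}(0,nT)$ (resp. its square) with domain $H^2_{\rm per}(0,nT)$ (resp. its square). All operators are taken at $\omega=\omega_0$. $H^2_{\rm per}(0,L)$: $L$-periodic, locally $H^2$ functions with the $H^2(0,L)$-norm. A real-valued solution $\psi_0$ of the stationary equation is called nondegenerate if $L_{+,\mu}(\psi_0):H^2(\mathbb R)\to L^2(\mathbb R)$ is invertible. In that case there are $\nu>0$ and a locally unique smooth map $\tilde\psi:(\omega_0-\nu,\omega_0+\nu)\to H^2(\mathbb R)$ with $\tilde\psi(\omega_0)=\psi_0$ such that $\tilde\psi(\omega)$ solves the stationary equation at frequency $\omega$; this is the continuation in $\omega$. Periodic pulse solutions: there is $N_0\in\mathbb N$ such that for each $n\ge N_0$ there is an $nT$-periodic real-valued solution $\psi_{{\rm per},n}$ of the stationary equation at $\omega=\omega_0$ of the form $\psi_{{\rm per},n}=\chi_n\psi_0+a_n$ on $[-\frac n2T,\frac n2T)$, with $a_n\in H^2_{\rm per}(0,nT)$, $\|a_n\|_{H^2_{\rm per}(0,nT)}\to0$ as $n\to\infty$. Here $\chi_n:\mathbb R\to[0,1]$ is (for large $n$) a smooth $nT$-periodic cut-off with $\|\chi_n\|_{W^{2,\infty}}\le1$ (maximum of sup norms of derivatives of order $\le2$), $\chi_n=1$ on $[-\frac n6T,\frac n6T]$, $\chi_n=0$ on $[-\frac n2T,-\frac n3T]\cup[\frac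 n3T,\frac n2T]$. In the claim $N\ge N_0$. *)

(* Defs.v *)
From HB Require Import structures.
From mathcomp Require Import all_boot all_order all_algebra.
From mathcomp Require Import all_classical all_reals all_analysis.
From mathcomp.real_closed Require Import complex.
Import Order.TTheory GRing.Theory Num.Theory.
Import numFieldNormedType.Exports.

Set Implicit Arguments.
Unset Strict Implicit.
Unset Printing Implicit Defensive.

Local Open Scope classical_set_scope.
Local Open Scope ring_scope.
Local Open Scope complex_scope.

(* Elements of L^2 and H^2 are represented by Borel functions on the whole real
   line, considered up to equality Lebesgue-almost everywhere.  [Line] stands
   for the spaces over R, [Circle L] for the spaces of L-periodic functions. *)
Inductive domain (R : realType) : Type := Line | Circle of R.
Arguments Line {R}.

Section Sobolev.
Variable R : realType.
Implicit Types (s : domain R) (f g u v : R -> R).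

Local Notation leb := (@lebesgue_measure R).

Definition smooth f : Prop := forall k x, derivable (derive1n k f) x 1.

Definition test_function f : Prop :=
  smooth f /\ exists M : R, forall x, M < `|x| -> f x = 0.

Definition weak_derivative u g : Prop :=
  locally_integrable setT g /\
  forall f, test_function f ->
    \int[leb]_x (u x * derive1 f x) = - \int[leb]_x (g x * f x).

Definition weakly_derivable u : Prop :=
  locally_integrable setT u /\ exists g, weak_derivative u g.

(* Determined up to a null set when [weakly_derivable u]. *)
Definition wD u : R -> R := xget (cst 0) [set g | weak_derivative u g].

Definition cell s : set R := if s is Circle L then `[0, L]%classic else setT.

Definition ae_periodic s u : Prop :=
  if s is Circle L then {ae leb, forall x, u (x + L) = u x} else True.

Definition L2 s u : Prop :=
  [/\ measurable_fun setT u, ae_periodic s u &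
      u \_ (cell s) \in Lfun leb 2%:E].

Definition L2norm s u : R := fine ('N[leb]_2%:E [EFin \o u \_ (cell s)])%E.

Definition L2inner s u v : R := \int[leb]_(x in cell s) (u x * v x).

Definition H2 s u : Prop :=
  [/\ weakly_derivable u, weakly_derivable (wD u),
      L2 s u, L2 s (wD u) & L2 s (wD (wD u))].

Definition H2norm s u : R :=
  Num.sqrt (L2norm s u ^+ 2 + L2norm s (wD u) ^+ 2
            + L2norm s (wD (wD u)) ^+ 2).

(* [P w] is the derivative at [w] of a curve [P] with values in H^2, as a limit
   of difference quotients in the H^2 norm. *)
Definition is_H2_derivative s (P : R -> R -> R) (w : R) v : Prop :=
  H2 s v /\
  H2norm s (fun x => h^-1 * (P (w + h) x - P w x) - v x) @[h --> 0^'] --> 0.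

Definition dH2 s (P : R -> R -> R) (w : R) : R -> R :=
  xget (cst 0) [set v | is_H2_derivative s P w v].

Definition smooth_H2_curve s (I : set R) (P : R -> R -> R) : Prop :=
  (forall w, I w -> H2 s (P w)) /\
  forall k w, I w -> exists v, is_H2_derivative s (iter k (dH2 s) P) w v.

End Sobolev.

Section Operators.
Variable R : realType.
Variable m : nat.

Definition vfun : Type := R -> 'cV[R[i]]_m.
Implicit Types (s : domain R) (u v f : vfun) (A : vfun -> vfun) (z : R[i]).

Local Notation leb := (@lebesgue_measure R).

Definition re u (i : 'I_m) : R -> R := fun x => complex.Re (u x i 0).
Definition im u (i : 'I_m) : R -> R := fun x => complex.Im (u x i 0).

Definition ae_equal u v : Prop := {ae leb, forall x, u x = v x}.

Definition cL2 s u : Prop := forall i, L2 s (re u i) /\ L2 s (im u i).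
Definition cH2 s u : Prop := forall i, H2 s (re u i) /\ H2 s (im u i).

Definition cL2norm s u : R :=
  Num.sqrt (\sum_i (L2norm s (re u i) ^+ 2 + L2norm s (im u i) ^+ 2)).
Definition cH2norm s u : R :=
  Num.sqrt (\sum_i (H2norm s (re u i) ^+ 2 + H2norm s (im u i) ^+ 2)).

Definition cwD u : vfun := fun x => \col_i (wD (re u i) x +i* wD (im u i) x).

Definition shift_op A z : vfun -> vfun := fun u x => A u x - z *: u x.

(* In what follows [A] is an operator on L^2 with domain H^2. *)
Definition bijective_op s A : Prop :=
  (forall u v, cH2 s u -> cH2 s v -> ae_equal (A u) (A v) -> ae_equal u v) /\
  (forall f, cL2 s f -> exists2 u, cH2 s u & ae_equal (A u) f).

Definition invertible_op s A : Prop :=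
  bijective_op s A /\
  exists C : R, forall u, cH2 s u -> cH2norm s u <= C * cL2norm s (A u).

Definition resolvent_set s A : set R[i] :=
  [set z | bijective_op s (shift_op A z) /\
     exists C : R, forall u, cH2 s u ->
       cL2norm s u <= C * cL2norm s (shift_op A z u)].

Definition spectrum s A : set R[i] := ~` resolvent_set s A.

Definition eigenvalue_op s A z : Prop :=
  exists u, [/\ cH2 s u, ~ ae_equal u (fun=> 0) &
                ae_equal (A u) (fun x => z *: u x)].

(* u lies in the domain of (A - z)^k and (A - z)^k u = 0 *)
Fixpoint power_kernel s A z (k : nat) u : Prop :=
  if k is k'.+1 then cH2 s u /\ power_kernel s A z k' (shift_op A z u)
  else cH2 s u /\ ae_equal u (fun=> 0).

Definition generalized_eigenspace s A z : set vfun :=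
  [set u | exists k, power_kernel s A z k u].

Definition algebraic_multiplicity s A z (d : nat) : Prop :=
  exists b : 'I_d -> vfun,
    (forall j, generalized_eigenspace s A z (b j)) /\
    forall u, generalized_eigenspace s A z u ->
      exists! c : 'rV[R[i]]_d, ae_equal u (fun x => \sum_j c 0 j *: b j x).

Definition simple_eigenvalue s A z : Prop :=
  eigenvalue_op s A z /\ algebraic_multiplicity s A z 1.

Definition no_negative_eigenvalue s A : Prop :=
  forall r : R, r < 0 -> ~ eigenvalue_op s A r%:C.

Definition one_simple_negative_eigenvalue s A : Prop :=
  exists r : R, [/\ r < 0, simple_eigenvalue s A r%:C &
    forall r' : R, r' < 0 -> eigenvalue_op s A r'%:C -> r' = r].

End Operators.

Section GrossPitaevskii.
Variable R : realType.
Implicit Types (s : domain R) (V psi chi a : R -> R) (mu omega T : R).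

Local Notation leb := (@lebesgue_measure R).

Definition C1 V : Prop := (forall x, derivable V x 1) /\ continuous (derive1 V).

Definition stationary V mu omega psi : Prop :=
  {ae leb, forall x, - wD (wD psi) x + mu * V x * psi x + omega * psi x
                     - psi x ^+ 3 = 0}.

(* The operator d^2/dx^2 - mu V. *)
Definition Hill V mu (u : vfun R 1) : vfun R 1 :=
  fun x => cwD (cwD u) x - (mu * V x)%:C *: u x.

Definition Lminus V mu omega psi (u : vfun R 1) : vfun R 1 :=
  fun x => - cwD (cwD u) x + (mu * V x)%:C *: u x + omega%:C *: u x
           - (psi x ^+ 2)%:C *: u x.

Definition Lplus V mu omega psi (u : vfun R 1) : vfun R 1 :=
  fun x => - cwD (cwD u) x + (mu * V x)%:C *: u x + omega%:C *: u x
           - (3 * psi x ^+ 2)%:C *: u x.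

Definition J : 'M[R[i]]_(1 + 1) := block_mx 0 1%:M (- 1%:M) 0.

Definition Lfull V mu omega psi (u : vfun R (1 + 1)) : vfun R (1 + 1) :=
  fun x => J *m col_mx (Lplus V mu omega psi (fun y => usubmx (u y)) x)
                       (Lminus V mu omega psi (fun y => dsubmx (u y)) x).

Definition nondegenerate_solution V mu omega psi : Prop :=
  [/\ H2 Line psi, stationary V mu omega psi &
      invertible_op Line (Lplus V mu omega psi)].

(* [P w] is a smooth family of solutions at frequency [w], for
   [`|w - omega0| < nu], through [psi]. *)
Definition continuation s V mu omega0 psi nu (P : R -> R -> R) : Prop :=
  [/\ 0 < nu,
      smooth_H2_curve s `]omega0 - nu, omega0 + nu[%classic P,
      {ae leb, forall x, P omega0 x = psi x} &
      forall w, omega0 - nu < w < omega0 + nu -> stationary V mu w (P w)].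

Definition cutoff T (n : nat) chi : Prop :=
  [/\ smooth chi, periodic chi (n%:R * T) & forall x, 0 <= chi x <= 1] /\
  [/\ forall k x, (k <= 2)%N -> `|derive1n k chi x| <= 1,
      forall x, - (n%:R / 6 * T) <= x <= n%:R / 6 * T -> chi x = 1 &
      forall x, n%:R / 3 * T <= `|x| <= n%:R / 2 * T -> chi x = 0].

(* [N0] is the threshold from which the solutions [psi_per n] exist; the
   cut-offs need only be as prescribed for large [n]. *)
Definition periodic_pulses T V mu omega psi0 (N0 : nat)
    (psi_per chi a : nat -> R -> R) : Prop :=
  [/\ forall n, (N0 <= n)%N ->
        [/\ H2 (Circle (n%:R * T)) (psi_per n),
            stationary V mu omega (psi_per n),
            H2 (Circle (n%:R * T)) (a n) &
            {ae leb, forall x, - (n%:R / 2 * T) <= x < n%:R / 2 * T ->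
                     psi_per n x = chi n x * psi0 x + a n x}],
      \forall n \near \oo, cutoff T n (chi n) &
      H2norm (Circle (n%:R * T)) (a n) @[n --> \oo] --> 0].

Definition spectrally_stable V mu omega psi0 : Prop :=
  forall z, spectrum Line (Lfull V mu omega psi0) z -> complex.Re z <= 0.

Definition coperiodically_stable T V mu omega (n : nat) psi : Prop :=
  forall z, spectrum (Circle (n%:R * T)) (Lfull V mu omega psi) z ->
    complex.Re z = 0.

End GrossPitaevskii.

(* Main.v *)
Require Import Defs.
From HB Require Import structures.
From mathcomp Require Import all_boot all_order all_algebra.
From mathcomp Require Import all_classical all_reals all_analysis.
From mathcomp Require Import measurable_realfun ring lra.
From mathcomp.real_closed Require Import complex.
Import Order.TTheory GRing.Theory Num.Theory.
Import numFieldNormedType.Exports.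

Set Implicit Arguments.
Unset Strict Implicit.
Unset Printing Implicit Defensive.

Local Open Scope classical_set_scope.
Local Open Scope ring_scope.
Local Open Scope complex_scope.

(* Write L+, L- for the real operators at a pulse psi.  By the stationary equation L- psi = 0
   and <L+ psi, psi> < 0, and differentiating the equation in the frequency gives
   L+ (d_w psi) = - psi.  Hence, once L- is coercive on the complement of psi, stability is decided
   by the sign of L+ on that complement, and there L+ is coercive when <d_w psi, psi> > 0 and takes
   a negative value when <d_w psi, psi> < 0.  In the first case J L - z is invertible off the
   imaginary axis by a direct energy estimate; in the second an unstable real eigenvalue is found by
   minimizing <L+ u, u> / <L-^-1 u, u>.
   A smooth partition of unity with two members, whose squares sum to one, splits functions on a
   long circle into a part near the pulse and a part away from it: the former is compared with the
   operators on the line, the latter with - d^2/dx^2 + mu V + w, which is coercive by the spectral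
   assumption.  So coercivity, invertibility and the slope itself pass to the circle up to errors
   that vanish with 1/n, and both stability criteria have the same sign.  The continuation on the
   circle is an explicit power series in the frequency. *)

(** * Absolutely continuous functions and Sobolev spaces *)

(** Functions are never quotiented by null sets: the abstract arguments live on semi-inner product
    spaces, with zero distance in place of equality. An operator is a map from a domain into such a
    space, and a resolvent is split into two properties, a lower bound and solvability. Lower bounds
    come from quadratic forms and survive localization; solvability does not, so apart from the
    resolvents given on the line it is recovered from a lower bound for the adjoint by a contraction
    argument. This is why [J L - z] is bounded below both at [z] and at its conjugate, and why on
    the circle only [- d^2/dx^2 + 1] is inverted by hand. Instability follows the same pattern: no
    minimizer is constructed; if the resolvent existed at the candidate [lambda], its bound would
    raise the infimum. The threshold for [n] must come before any operator on a circle, so all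
    constants are fixed on the line, then one small parameter [k], then the length. Exact
    orthogonality is lost under cut-offs, so estimates under one constraint are first rewritten with
    a penalty term. *)

Section AbsolutelyContinuous.
Variable R : realType.
Notation leb := (@lebesgue_measure R).
Implicit Types (f g F G : R -> R) (a b c x : R).

Lemma aeS (P Q : R -> Prop) : (forall x, P x -> Q x) ->
  {ae leb, forall x, P x} -> {ae leb, forall x, Q x}.
Proof. by move=> PQ; apply: filterS PQ; exact: (ae_filter_ringOfSetsType leb). Qed.

Lemma aeS2 (P Q S : R -> Prop) : (forall x, P x -> Q x -> S x) ->
  {ae leb, forall x, P x} -> {ae leb, forall x, Q x} -> {ae leb, forall x, S x}.
Proof. by move=> PQ; apply: filterS2 PQ; exact: (ae_filter_ringOfSetsType leb). Qed.

Lemma measurable_cc a b :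
  measurable (`[a, b]%classic : set (g_sigma_algebraType R.-ocitv.-measurable)).
Proof. exact: measurable_itv. Qed.

Definition lint f := measurable_fun [set: R] f /\
  forall a b, leb.-integrable `[a, b] (EFin \o f).

(** The fundamental theorem of calculus is taken as the definition: [F] is fixed at every point, [f]
    only up to a null set. Density and differentiation arguments then act on the pair. *)
Definition ac F f := lint f /\
  forall a b, a <= b -> F b - F a = \int[leb]_(x in `[a, b]) f x.

Lemma lintE f : lint f <-> locally_integrable setT f.
Proof.
split=> [[mf itf]|[mf _ lf]].
  split=> //; first exact: openT.
  move=> K _ cK.
  have [M [_ HM]] := compact_bounded cK.
  have KM : K `<=` `[- (`|M| + 1), `|M| + 1].
    move=> x Kx; have := HM (`|M| + 1) _ x Kx.
    rewrite (le_lt_trans (ler_norm _)) ?ltrDl// => /(_ isT) /=.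
    by rewrite in_itv/= -ler_norml.
  have mK : measurable (K : set (g_sigma_algebraType R.-ocitv.-measurable)).
    exact: compact_measurable.
  by have /integrableP[] := integrableS (measurable_cc _ _) mK KM
    (itf (- (`|M| + 1)) (`|M| + 1)).
split=> // a b; apply/integrableP; split.
  by apply/measurable_EFinP; exact: measurable_funS mf.
by apply: lf => //; exact: segment_compact.
Qed.

Lemma lintD f g : lint f -> lint g -> lint (fun x => f x + g x).
Proof. by move=> /lintE lf /lintE lg; apply/lintE; exact: locally_integrableD. Qed.

Lemma lintZ k f : lint f -> lint (fun x => k * f x).
Proof.
move=> [mf lf]; split; first exact: measurable_funM.
by move=> a b; have := integrableZl (measurable_cc _ _) k (lf a b).
Qed.

Lemma lintN f : lint f -> lint (fun x => - f x).
Proof. by move=> lf; have := lintZ (-1) lf; under eq_fun do rewrite mulN1r. Qed.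

Lemma lintB f g : lint f -> lint g -> lint (fun x => f x - g x).
Proof. by move=> lf lg; apply: lintD => //; exact: lintN. Qed.

Lemma cont_meas f : continuous f -> measurable_fun [set: R] f.
Proof. by move=> cf; exact: continuous_measurable_fun. Qed.

Lemma cont_lint f : continuous f -> lint f.
Proof.
move=> cf; split; first exact: cont_meas.
move=> a b; apply: continuous_compact_integrable; first exact: segment_compact.
exact: continuous_subspaceT.
Qed.

Lemma cont_bnd f a b : continuous f ->
  exists M : R, 0 <= M /\ forall x, a <= x <= b -> `|f x| <= M.
Proof.
move=> cf; have [ab|ba] := leP a b; last first.
  by exists 0; split => // x /andP[h1 h2]; have := lt_le_trans ba (le_trans h1 h2); rewrite ltxx.
have := @EVT_max R (fun x => `|f x|) a b ab _.
case=> [|c _ H].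
  by apply: continuous_subspaceT => x; apply: continuous_comp; [exact: cf|exact: norm_continuous].
by exists `|f c|; split => // x xab; apply: H; rewrite in_itv.
Qed.

Lemma lintM f g : lint f -> continuous g -> lint (fun x => f x * g x).
Proof.
move=> [mf lf] cg; split; first by apply: measurable_funM => //; exact: cont_meas.
move=> a b; have [M [_ HM]] := cont_bnd a b cg.
have := integrableMl (measurable_cc a b) (lf a b) (h := g).
apply.
  by apply: measurable_funS (cont_meas cg).
exists M; split; first exact: num_real.
by move=> y My x /= xab; rewrite (le_trans (HM x _))// ltW.
Qed.

Lemma int_split f a b c : lint f -> a <= b -> b <= c ->
  \int[leb]_(x in `[a, c]) f x =
  \int[leb]_(x in `[a, b]) f x + \int[leb]_(x in `[b, c]) f x.
Proof.
move=> [mf lf] ab bc.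
have := @Rintegral_itvB R f (BLeft a) (BRight c) b (lf a c).
rewrite !bnd_simp => /(_ ab bc) h.
rewrite -(@Rintegral_itv_obnd_cbnd R b (BRight c) f).
  by rewrite -h addrC subrK.
by apply: integrableS (lf b c) => //; apply: subset_itvr; rewrite bnd_simp.
Qed.

Lemma int_pt f a : \int[leb]_(x in `[a, a]) f x = 0.
Proof. by rewrite set_itv1 Rintegral_set1. Qed.

(** The oriented integral from 0, so that one primitive serves the whole line. *)
Definition prim f x : R := if 0 <= x then \int[leb]_(t in `[0, x]) f t
  else - \int[leb]_(t in `[x, 0]) f t.

Lemma ac_prim f : lint f -> ac (prim f) f.
Proof.
move=> lf; split=> // a b ab; rewrite /prim.
have [b0|b0] := leP 0 b; have [a0|a0] := leP 0 a.
- by rewrite (int_split lf a0 ab); ring.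
- by rewrite opprK (int_split lf (ltW a0) b0); ring.
- by have := lt_le_trans b0 (le_trans a0 ab); rewrite ltxx.
- by rewrite (int_split lf ab (ltW b0)); ring.
Qed.

Lemma ac_lint F f : ac F f -> lint f. Proof. by case. Qed.

Lemma ac_continuous F f : ac F f -> continuous F.
Proof.
move=> [lf H] x.
have h1 : x - 1 <= x + 1 by lra.
have h2 : x - 1 < x + 1 by lra.
have := parameterized_integral_continuous h1 (lf.2 (x - 1) (x + 1)).
move/continuous_within_itvP => /(_ h2) [+ _ _].
have xx : x \in `]x - 1, x + 1[ by rewrite in_itv/=; lra.
move=> /(_ x xx) c1.
have c2 : {for x, continuous (fun y => F (x - 1) + \int[leb]_(t in `[x - 1, y]) f t)}.
  by apply: cvgD; [exact: cvg_cst|exact: c1].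
rewrite /prop_for /continuous_at in c2.
have E : F (x - 1) + \int[leb]_(t in `[x - 1, x]) f t = F x.
  by rewrite -H; [ring|lra].
rewrite E in c2.
apply: cvg_trans c2; apply: near_eq_cvg.
near=> y; rewrite -H; first ring.
apply/ltW; near: y; apply: lt_nbhsr; lra.
Unshelve. all: by end_near. Qed.

Lemma acD F f G g : ac F f -> ac G g -> ac (fun x => F x + G x) (fun x => f x + g x).
Proof.
move=> [lf Hf] [lg Hg]; split; first exact: lintD.
move=> a b ab; rewrite RintegralD//; [|exact: lf.2|exact: lg.2].
by rewrite -Hf// -Hg//; ring.
Qed.

Lemma acZ k F f : ac F f -> ac (fun x => k * F x) (fun x => k * f x).
Proof.
move=> [lf Hf]; split; first exact: lintZ.
move=> a b ab; rewrite RintegralZl//; last exact: lf.2.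
by rewrite -Hf//; ring.
Qed.

Lemma acN F f : ac F f -> ac (fun x => - F x) (fun x => - f x).
Proof. by move/(acZ (-1)); under eq_fun do rewrite mulN1r; under [X in ac _ X]eq_fun do rewrite mulN1r. Qed.

Lemma acB F f G g : ac F f -> ac G g -> ac (fun x => F x - G x) (fun x => f x - g x).
Proof. by move=> Ff Gg; apply: acD => //; exact: acN. Qed.

Lemma ac_cst k : ac (fun=> k) (fun=> 0).
Proof.
split; first by apply: cont_lint; exact: cst_continuous.
by move=> a b ab; rewrite Rintegral_cst// mul0r subrr.
Qed.

Lemma ac_C1 f g : (forall x, is_derive x 1 f (g x)) -> continuous g -> ac f g.
Proof.
move=> df cg; split; first exact: cont_lint.
move=> a b; rewrite le_eqVlt => /predU1P[->|ab]; first by rewrite int_pt subrr.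
have cf : continuous f by move=> x; apply/differentiable_continuous/derivable1_diffP; case: (df x).
rewrite /Rintegral (@continuous_FTC2 R g f a b ab)//.
- exact: continuous_subspaceT.
- split.
  + by move=> x _; case: (df x).
  + exact/cvg_at_right_filter/cf.
  + exact/cvg_at_left_filter/cf.
- by move=> x _; rewrite derive1E; exact: derive_val.
Qed.

Lemma ac_derive F f : ac F f -> continuous f -> forall x, is_derive x 1 F (f x).
Proof.
move=> [lf H] cf x.
have h2 : x < x + 1 by lra.
have := @continuous_FTC1 R f (BLeft (x - 1)) x (x + 1) h2 (lf.2 (x - 1) (x + 1)).
move=> /= []; first by rewrite lte_fin; lra.
  exact: cf.
move=> dG G'.
have dG1 : is_derive x 1 (fun y => \int[leb]_(t in `[x - 1, y]) f t : R) (f x).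
  by rewrite -G' derive1E; apply: derivableP.
have dG2 : is_derive x 1 (fun y => F (x - 1) + \int[leb]_(t in `[x - 1, y]) f t) (f x).
  have := is_deriveD (is_derive_cst (F (x - 1)) x 1) dG1.
  by rewrite add0r.
apply: near_eq_is_derive dG2.
near=> y; rewrite -H; first ring.
apply/ltW; near: y; apply: lt_nbhsr; lra.
Unshelve. all: by end_near. Qed.

Lemma lint_norm f : lint f -> lint (fun x => `|f x|).
Proof.
move=> [mf lf]; split; first exact: measurableT_comp.
by move=> a b; exact: integrable_norm (lf a b).
Qed.

Lemma int_ge0 f a b : (forall x, a <= x <= b -> 0 <= f x) ->
  0 <= \int[leb]_(x in `[a, b]) f x.
Proof. by move=> H; apply: Rintegral_ge0 => x /=; rewrite in_itv/= => /H. Qed.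

Lemma le_int f g a b : lint f -> lint g ->
  (forall x, a <= x <= b -> f x <= g x) ->
  \int[leb]_(x in `[a, b]) f x <= \int[leb]_(x in `[a, b]) g x.
Proof.
move=> lf lg H; apply: (le_Rintegral (measurable_cc a b) (lf.2 a b) (lg.2 a b)).
by move=> x /=; rewrite in_itv/= => /H.
Qed.

Lemma norm_int f a b : lint f ->
  `|\int[leb]_(x in `[a, b]) f x| <= \int[leb]_(x in `[a, b]) `|f x|.
Proof. by move=> lf; apply: le_normr_Rintegral => //; exact: lf.2. Qed.

Lemma intD f g a b : lint f -> lint g ->
  \int[leb]_(x in `[a, b]) (f x + g x) =
  \int[leb]_(x in `[a, b]) f x + \int[leb]_(x in `[a, b]) g x.
Proof. by move=> lf lg; rewrite RintegralD//; [exact: lf.2|exact: lg.2]. Qed.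

Lemma intZ k f a b : lint f ->
  \int[leb]_(x in `[a, b]) (k * f x) = k * \int[leb]_(x in `[a, b]) f x.
Proof. by move=> lf; rewrite RintegralZl//; exact: lf.2. Qed.

Lemma int_subset f a b c d : lint f -> (forall x, c <= x <= d -> 0 <= f x) ->
  c <= a -> b <= d -> a <= b ->
  \int[leb]_(x in `[a, b]) f x <= \int[leb]_(x in `[c, d]) f x.
Proof.
move=> lf f0 ca bd ab.
rewrite (int_split lf ca (le_trans ab bd)) (int_split lf ab bd).
have := @int_ge0 f c a; have := @int_ge0 f b d.
have h1 : forall x, b <= x <= d -> 0 <= f x by move=> x /andP[h1 h2]; apply: f0; lra.
have h2 : forall x, c <= x <= a -> 0 <= f x by move=> x /andP[h3 h2]; apply: f0; lra.
move=> /(_ h1) + /(_ h2); lra.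
Qed.

Lemma approx_l1 f a b (e : R) : lint f -> 0 < e ->
  exists h, continuous h /\ \int[leb]_(x in `[a, b]) `|f x - h x| <= e.
Proof.
move=> lf e0.
have fi : (leb `[a, b]%classic < +oo)%E.
  by rewrite lebesgue_measure_itv/=; case: ifP => _; rewrite ?ltry// -EFinB ltry.
have [h [ch ih]] := @approximation_continuous_integrable R `[a, b]%classic f
  (measurable_itv _) fi (lf.2 a b).
move/fine_cvgP => [_ /cvgrPdist_le /(_ e e0) [N _ /(_ N (leqnn N))]] /=.
rewrite sub0r normrN => H; exists (h N); split; first exact: ch.
by apply: le_trans (ler_norm _) _.
Qed.

Definition product_rule F f G g := forall a b, a <= b ->
  F b * G b - F a * G a = \int[leb]_(x in `[a, b]) (f x * G x + F x * g x).

Lemma product_ruleC F f G g : product_rule F f G g -> product_rule G g F f.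
Proof.
move=> H a b ab; rewrite [G b * _]mulrC [G a * _]mulrC H//.
by apply: eq_Rintegral => x _; ring.
Qed.

Lemma lint_product F f G g : ac F f -> ac G g -> lint (fun x => f x * G x + F x * g x).
Proof.
move=> Ff Gg; apply: lintD; first exact: lintM (ac_lint Ff) (ac_continuous Gg).
by under eq_fun do rewrite mulrC; exact: lintM (ac_lint Gg) (ac_continuous Ff).
Qed.

Lemma ac_norm_le F f a b x : ac F f -> a <= x <= b ->
  `|F x - F a| <= \int[leb]_(x in `[a, b]) `|f x|.
Proof.
move=> [lf H] /andP[ax xb]; rewrite H//; apply: le_trans (norm_int _ _ lf) _.
by apply: int_subset => //; exact: lint_norm.
Qed.

(** The product rule passes to L^1 limits of one derivative: if [f] is replaced by a continuous [h]
    that is close in L^1, the primitives with the same value at [a] stay uniformly close on the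
    segment. *)
Lemma product_rule_dense F f G g : ac F f -> ac G g ->
  (forall H h, continuous h -> ac H h -> product_rule H h G g) ->
  product_rule F f G g.
Proof.
move=> Ff Gg P a b ab.
have [M [M0 HM]] := cont_bnd a b (ac_continuous Gg).
pose N := \int[leb]_(x in `[a, b]) `|g x|.
have N0 : 0 <= N by apply: int_ge0 => x _.
apply/eqP; rewrite -subr_eq0 -normr_le0; apply/ler_addgt0Pl => e e0; rewrite addr0.
have K0 : 0 < 2 * M + N + 1 by lra.
have [h [ch he]] := approx_l1 a b (ac_lint Ff) (divr_gt0 e0 K0).
pose H x := prim h x - prim h a + F a.
have Hh : ac H h.
  have := acD (ac_prim (cont_lint ch)) (ac_cst (F a - prim h a)).
  have -> : (fun x => prim h x + (F a - prim h a)) = H by apply/funext => x; rewrite /H; ring.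
  by under eq_fun do rewrite addr0.
have D := acB Ff Hh.
have lD := lint_product D Gg.
rewrite (_ : _ - _ = (F b - H b) * G b -
   \int[leb]_(x in `[a, b]) ((f x - h x) * G x + (F x - H x) * g x)); last first.
  have E : \int[leb]_(x in `[a, b]) (f x * G x + F x * g x) =
    \int[leb]_(x in `[a, b]) (h x * G x + H x * g x) +
    \int[leb]_(x in `[a, b]) ((f x - h x) * G x + (F x - H x) * g x).
    rewrite -intD//; last exact: lint_product Hh Gg.
    by apply: eq_Rintegral => x _; ring.
  rewrite E -(P _ _ ch Hh a b ab).
  have -> : H a = F a by rewrite /H subrr add0r.
  ring.
pose ee := \int[leb]_(x in `[a, b]) `|f x - h x|.
have ee0 : 0 <= ee by apply: int_ge0.
have bd x : a <= x <= b -> `|F x - H x| <= ee.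
  move=> xab; have := ac_norm_le D xab.
  by rewrite (_ : H a = F a) ?subrr ?subr0// /H subrr add0r.
have t1 : `|(F b - H b) * G b| <= ee * M.
  by rewrite normrM ler_pM//; [apply: bd|apply: HM]; rewrite ab lexx.
have t2 : `|\int[leb]_(x in `[a, b]) ((f x - h x) * G x + (F x - H x) * g x)|
   <= ee * M + ee * N.
  apply: le_trans (norm_int _ _ lD) _.
  have l1 := lint_norm (ac_lint D); have l2 := lint_norm (ac_lint Gg).
  rewrite /ee /N [X in X + _]mulrC -!intZ// -intD; [|exact: lintZ..].
  apply: le_int; [exact: lint_norm|by apply: lintD; exact: lintZ|].
  move=> x xab; apply: le_trans (ler_normD _ _) _; rewrite !normrM.
  apply: lerD; first by rewrite mulrC ler_wpM2r//; exact: HM.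
  by rewrite ler_wpM2r//; exact: bd.
apply: le_trans (ler_normB _ _) _.
have : ee * (2 * M + N + 1) <= e by rewrite -ler_pdivlMr.
nra.
Qed.

(** The density lemma is used once in each factor, which leaves two C^1 functions and the classical
    product rule. *)
Lemma acM F f G g : ac F f -> ac G g ->
  ac (fun x => F x * G x) (fun x => f x * G x + F x * g x).
Proof.
move=> Ff Gg; split; first exact: lint_product.
apply: (product_rule_dense Ff Gg) => H h ch Hh.
apply: product_ruleC; apply: (product_rule_dense Gg Hh) => K k ck Kk.
suff [_ +] : ac (fun x => K x * H x) (fun x => k x * H x + K x * h x) by [].
apply: ac_C1.
  move=> x; have := is_deriveM (ac_derive Kk ck x) (ac_derive Hh ch x).
  by move=> h1; apply: is_derive_eq h1 _; rewrite addrC /GRing.scale/=; ring.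
by move=> x; apply: cvgD; apply: cvgM; try exact: ck; try exact: ch;
  [exact: (ac_continuous Hh)|exact: (ac_continuous Kk)].
Qed.

(** By Lebesgue differentiation both densities are the classical derivative of [F] almost
    everywhere. *)
Lemma ac_unique F f g : ac F f -> ac F g -> {ae leb, forall x, f x = g x}.
Proof.
have key h : ac F h -> {ae leb, forall x, F^`()%classic x = h x}.
  move=> [lh H]; have := lebesgue_differentiation ((lintE h).1 lh).
  apply: aeS => x lx.
  have h2 : x < x + 1 by lra.
  have := @FTC1_lebesgue_pt R h (BLeft (x - 1)) x (x + 1) h2 (lh.2 (x - 1) (x + 1)).
  move=> /= []//; first by rewrite lte_fin; lra.
  move=> dG <-.
  have dG1 : is_derive x 1 (fun y => \int[leb]_(t in `[x - 1, y]) h t : R)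
     ((fun y => \int[leb]_(t in `[x - 1, y]) h t : R)^`()%classic x).
    by rewrite derive1E; apply: derivableP.
  have dG2 := is_deriveD (is_derive_cst (F (x - 1)) x 1) dG1.
  rewrite derive1E; apply: derive_val; rewrite -[X in is_derive _ _ _ X]add0r.
  apply: near_eq_is_derive dG2.
  near=> y.
  change (F (x - 1) + \int[leb]_(t in `[x - 1, y]) h t = F y).
  rewrite -H; first ring.
  apply/ltW; near: y; apply: lt_nbhsr; lra.
move=> /key Hf /key Hg; by apply: aeS2 Hf Hg => x <- <-.
Unshelve. all: by end_near. Qed.

End AbsolutelyContinuous.

(** * Translation invariance and integrals over a period *)

Section Translation.
Variable R : realType.
Notation leb := (@lebesgue_measure R).
Implicit Types (f g F G : R -> R) (a b c x L : R).

Let shf c : measurableTypeR R -> measurableTypeR R := fun x : R => x + c.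

Lemma measurable_shift c : measurable_fun [set: R] (fun x : R => x + c).
Proof. by apply: measurable_funD => //; exact: measurable_cst. Qed.

Let mshf c : measurable_fun [set: R] (shf c).
Proof. exact: measurable_shift. Qed.

Lemma preimage_shift c (i j : bool) a b :
  (fun x : R => x + c) @^-1` [set` Interval (BSide i a) (BSide j b)] =
  [set` Interval (BSide i (a - c)) (BSide j (b - c))].
Proof.
by apply/seteqP; split => x /=; rewrite !in_itv/=; case: i; case: j => /=;
  rewrite ?lerBlDr ?lerBrDr ?ltrBlDr ?ltrBrDr.
Qed.

(** The translated measure has the right value on half-open intervals, and these determine Lebesgue
    measure. *)
Lemma lebesgue_measure_shift c (A : set R) : measurable A ->
  pushforward leb (fun x : R => (x + c : measurableTypeR R)) A = leb A.
Proof.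
move=> mA; apply/esym.
pose sf : {mfun measurableTypeR R >-> measurableTypeR R} := mfun_Sub (mem_set (mshf c)).
change (leb A = pushforward leb sf A).
apply: lebesgue_measure_unique => //= _ [[a b]] _ <-.
rewrite /pushforward /shf preimage_shift !lebesgue_measure_itv/=.
rewrite !lte_fin ltrD2r; case: ifP => // _.
by rewrite -!EFinB; congr EFin; ring.
Qed.

Lemma integral_shift c (D : set R) (f : R -> \bar R) : measurable D ->
  measurable_fun [set: R] f -> (forall x, 0 <= f x)%E ->
  (\int[leb]_(x in D) f x = \int[leb]_(x in (fun x => x + c)%R @^-1` D) f (x + c)%R)%E.
Proof.
move=> mD mf f0.
have := @ge0_integral_pushforward _ _ _ _ R (shf c) (mshf c) leb D f mD.
move=> <- //; last exact: measurable_funTS.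
by apply: eq_measure_integral => [|m0 A mA _]; [exact: mshf|exact: (esym (lebesgue_measure_shift c mA))].
Qed.

Lemma integrable_shift c (D : set R) f : measurable D -> measurable_fun [set: R] f ->
  leb.-integrable ((fun x => x + c) @^-1` D) (EFin \o (fun x => f (x + c))) <->
  leb.-integrable D (EFin \o f).
Proof.
move=> mD mf.
have mf' : measurable_fun [set: R] (fun x => f (x + c)).
  by apply: (measurableT_comp mf); exact: measurable_shift.
have E : (\int[leb]_(x in D) `|f x|%:E =
   \int[leb]_(x in (fun x => x + c)%R @^-1` D) `|f (x + c)%R|%:E)%E.
  apply: (@integral_shift c D (fun x => `|f x|%:E)) => //.
    by apply/measurable_EFinP; exact: measurableT_comp.
split=> /integrableP[_ H]; apply/integrableP; split.
- by apply/measurable_EFinP; exact: measurable_funTS.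
- by rewrite /= E.
- by apply/measurable_EFinP; exact: measurable_funTS.
- by rewrite /= -E.
Qed.

Lemma Rint_shift c (D : set R) f : measurable D -> lint f ->
  leb.-integrable D (EFin \o f) ->
  \int[leb]_(x in D) f x = \int[leb]_(x in (fun x => x + c) @^-1` D) f (x + c).
Proof.
move=> mD lf iD; rewrite /Rintegral; congr fine.
have := @integral_pushforward _ _ _ _ R (shf c) (mshf c) leb D (EFin \o f).
move=> <- //.
- by apply: eq_measure_integral => [|m0 A mA _]; [exact: mshf|exact: (esym (lebesgue_measure_shift c mA))].
- by apply/measurable_EFinP; case: lf.
- exact/(integrable_shift c mD lf.1).
Qed.

Lemma lint_shift c f : lint f -> lint (fun x => f (x + c)).
Proof.
move=> [mf lf]; split.
  by apply: (measurableT_comp mf); exact: measurable_shift.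
move=> a b; have := (integrable_shift c (measurable_cc (a + c) (b + c)) mf).2 (lf _ _).
by rewrite preimage_shift !addrK.
Qed.

Lemma int_shift c f a b : lint f ->
  \int[leb]_(x in `[a + c, b + c]) f x = \int[leb]_(x in `[a, b]) f (x + c).
Proof.
move=> lf; rewrite (Rint_shift c _ lf) ?preimage_shift ?addrK//.
exact: lf.2.
Qed.

Lemma ac_shift c F f : ac F f -> ac (fun x => F (x + c)) (fun x => f (x + c)).
Proof.
move=> [lf H]; split; first exact: lint_shift.
by move=> a b ab; rewrite H ?lerD2r// int_shift.
Qed.

Lemma ae_shift c (P : R -> Prop) :
  {ae leb, forall x, P x} -> {ae leb, forall x, P (x + c)}.
Proof.
move=> [N [mN N0 HN]]; exists ((fun x => x + c) @^-1` N); split.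
- have : measurable_fun [set: R] (shf c) by exact: mshf.
  by move=> /(_ measurableT N mN); rewrite setTI.
- by rewrite -N0 -(lebesgue_measure_shift c mN).
- by move=> x /= Px; apply: HN.
Qed.

Lemma int_ae f g a b : lint f -> lint g -> {ae leb, forall x, f x = g x} ->
  \int[leb]_(x in `[a, b]) f x = \int[leb]_(x in `[a, b]) g x.
Proof.
move=> [mf _] [mg _] fg; rewrite /Rintegral; congr fine; apply: ae_eq_integral => //.
- by apply/measurable_EFinP; exact: measurable_funTS mf.
- by apply/measurable_EFinP; exact: measurable_funTS mg.
- by apply: aeS fg => x -> _.
Qed.

(* Telescoping through a primitive: the integral over a window of one period does
   not depend on the window. *)
Lemma int_period f L x : lint f -> {ae leb, forall x, f (x + L) = f x} -> 0 <= L ->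
  \int[leb]_(t in `[x, x + L]) f t = \int[leb]_(t in `[0, L]) f t.
Proof.
move=> lf pf L0; pose F := prim f; have [_ HF] := ac_prim lf.
have h1 : x <= x + L by lra.
have D : ac (fun x => F (x + L) - F x) (fun x => f (x + L) - f x).
  by apply: acB; [apply: ac_shift; exact: ac_prim|exact: ac_prim].
have Z a b : a <= b -> F (b + L) - F b = F (a + L) - F a.
  move=> ab; apply/eqP; rewrite -subr_eq0 D.2//.
  rewrite (@int_ae _ (fun=> 0)); first by rewrite Rintegral_cst// mul0r.
  - by case: D.
  - by apply: cont_lint; exact: cst_continuous.
  - by apply: aeS pf => y ->; rewrite subrr.
rewrite -(HF _ _ h1) -(HF _ _ L0) -/F.
have [x0|x0] := leP 0 x; first by rewrite (Z _ _ x0) add0r.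
by rewrite -(Z _ _ (ltW x0)) add0r.
Qed.

(** Adjoining the translates by [L] and [- L] carries integrability from [[- k L, (k + 1) L]] to the
    next such interval, and these exhaust the line. *)
Lemma period_integrable f L : measurable_fun [set: R] f -> 0 < L ->
  {ae leb, forall x, f (x + L) = f x} -> leb.-integrable `[0, L] (EFin \o f) ->
  lint f.
Proof.
move=> mf L0 pf i0.
have step (D : set R) : measurable D -> leb.-integrable D (EFin \o f) ->
    leb.-integrable ((fun x => x + L) @^-1` D) (EFin \o f).
  move=> mD iD; have /(integrable_shift L mD mf).2 := iD.
  move=> /integrableP[_ H]; apply/integrableP; split.
    by apply/measurable_EFinP; exact: measurable_funTS.
  apply: le_lt_trans H; rewrite le_eqVlt; apply/orP; left; apply/eqP.
  have m1 : measurable ((fun x => x + L) @^-1` D).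
    have : measurable_fun [set: R] (shf L) by exact: mshf.
    by move=> /(_ measurableT D mD); rewrite setTI.
  apply: ae_eq_integral => //.
  - by apply/measurable_EFinP/measurableT_comp => //; exact: measurable_funTS.
  - apply/measurable_EFinP/measurableT_comp => //; apply: measurable_funTS.
    by apply: (measurableT_comp mf); exact: measurable_shift.
  - by apply: aeS pf => x /= -> _.
have step2 (D : set R) : measurable D -> leb.-integrable D (EFin \o f) ->
    leb.-integrable ((fun x => x - L) @^-1` D) (EFin \o f).
  move=> mD iD; have pf' := ae_shift (- L) pf.
  have /(integrable_shift (- L) mD mf).2 := iD.
  move=> /integrableP[_ H]; apply/integrableP; split.
    by apply/measurable_EFinP; exact: measurable_funTS.
  apply: le_lt_trans H; rewrite le_eqVlt; apply/orP; left; apply/eqP.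
  have m1 : measurable ((fun x => x - L) @^-1` D).
    have : measurable_fun [set: R] (shf (- L)) by exact: mshf.
    by move=> /(_ measurableT D mD); rewrite setTI.
  apply: ae_eq_integral => //.
  - by apply/measurable_EFinP/measurableT_comp => //; exact: measurable_funTS.
  - apply/measurable_EFinP/measurableT_comp => //; apply: measurable_funTS.
    by apply: (measurableT_comp mf); exact: measurable_shift.
  - by apply: aeS pf' => x /=; rewrite subrK => -> _.
have iU (A B : set (measurableTypeR R)) : measurable A -> measurable B -> leb.-integrable A (EFin \o f) ->
    leb.-integrable B (EFin \o f) -> leb.-integrable (A `|` B) (EFin \o f).
  move=> mA mB iA iB; rewrite -(setDUK (@subsetUl _ A B)).
  have -> : (A `|` B) `\` A = B `\` A by rewrite setDUl setDv set0U.
  apply/integrableP; split; first by apply/measurable_EFinP; exact: measurable_funTS.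
  rewrite ge0_integral_setU//=.
  - case/integrableP: iA => _ /= iA.
    have /integrableP[_ /= iB'] := integrableS mB (measurableD mB mA) (@subDsetl _ B A) iB.
    by rewrite lte_add_pinfty.
  - exact: measurableD.
  - apply/measurable_EFinP; apply: measurableT_comp => //; exact: measurable_funTS.
  - by apply/disj_setPS => x [/= h1 [_ h2]].
have big k : leb.-integrable `[- (k%:R * L), k.+1%:R * L] (EFin \o f).
  elim: k => [|k IH]; first by rewrite mul0r oppr0 mul1r.
  have m0 := measurable_cc (- (k%:R * L)) (k.+1%:R * L).
  have := iU _ _ _ _ (iU _ _ _ _ (step _ m0 IH) (step2 _ m0 IH)) IH.
  have -> : (fun x => x - L) @^-1` `[- (k%:R * L), k.+1%:R * L] =
     `[- (k%:R * L) - - L, k.+1%:R * L - - L]%classic by rewrite -preimage_shift.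
  rewrite preimage_shift.
  have m2 := measurableU _ _ (measurable_cc (- (k%:R * L) - L) (k.+1%:R * L - L))
   (measurable_cc (- (k%:R * L) - - L) (k.+1%:R * L - - L)).
  move=> /(_ m2 m0 (measurable_cc _ _) (measurable_cc _ _)).
  have m3 := measurableU _ _ m2 m0.
  apply: (integrableS m3) => //.
  have kL : 0 <= k%:R * L by rewrite mulr_ge0// ltW.
  move=> x /=; rewrite !in_itv/= -!natr1 !mulrDl => /andP[h1 h2].
  have [h|h] := leP x (k%:R * L); first by left; left; apply/andP; split; lra.
  have [h'|h'] := leP x (k%:R * L + 1 * L); first by right; apply/andP; split; lra.
  by left; right; apply/andP; split; lra.
split=> // a b.
have [k Hk] : exists k, `|a| + `|b| <= k%:R * L.
  exists (Num.bound ((`|a| + `|b|) / L)); rewrite -ler_pdivrMr//; apply/ltW.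
  by apply: archi_boundP; rewrite divr_ge0// ?addr_ge0// ltW.
apply: integrableS (big k) => // x /=; rewrite !in_itv/= -natr1 mulrDl => /andP[h1 h2].
have := ler_norm b; have := ler_norm (- a); rewrite normrN; have := normr_ge0 a.
have := normr_ge0 b.
move=> ? ? ? ?; apply/andP; split; lra.
Qed.

End Translation.

(** * L^2 of the line and of a circle *)

Section SquareIntegrable.
Variable R : realType.
Notation leb := (@lebesgue_measure R).
Implicit Types (s : domain R) (f g u v w : R -> R) (a b c x L : R).

Lemma measurable_cell s : measurable (cell s : set (measurableTypeR R)).
Proof. by case: s => [|L] /=; [exact: measurableT|exact: measurable_cc]. Qed.

Definition integ s f := leb.-integrable (cell s) (EFin \o f).

Lemma integD s f g : integ s f -> integ s g -> integ s (fun x => f x + g x).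
Proof. by move=> h1 h2; have := integrableD (measurable_cell s) h1 h2. Qed.

Lemma integZ s k f : integ s f -> integ s (fun x => k * f x).
Proof. by move=> h; have := integrableZl (measurable_cell s) k h. Qed.

Lemma integN s f : integ s f -> integ s (fun x => - f x).
Proof. by move=> h; have := integZ (-1) h; rewrite /integ; under eq_fun do rewrite /= mulN1r. Qed.

Lemma integB s f g : integ s f -> integ s g -> integ s (fun x => f x - g x).
Proof. by move=> h1 h2; apply: integD => //; exact: integN. Qed.

Lemma integ_le s f g : measurable_fun [set: R] f -> (forall x, `|f x| <= g x) ->
  integ s g -> integ s f.
Proof.
move=> mf fg ig; apply: (le_integrable (measurable_cell s) _ _ ig).
  by apply/measurable_EFinP; exact: measurable_funTS.
by move=> x _; rewrite /= lee_fin (le_trans (fg x))// ler_norm.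
Qed.

Lemma integ_ae s f g : measurable_fun [set: R] f -> measurable_fun [set: R] g ->
  {ae leb, forall x, f x = g x} -> integ s f -> integ s g.
Proof.
move=> mf mg fg /integrableP[_ H]; apply/integrableP; split.
  by apply/measurable_EFinP; exact: measurable_funTS.
apply: le_lt_trans H; rewrite le_eqVlt; apply/orP; left; apply/eqP.
apply: ae_eq_integral => //.
- exact: measurable_cell.
- by apply/measurable_EFinP/measurableT_comp => //; exact: measurable_funTS.
- by apply/measurable_EFinP/measurableT_comp => //; exact: measurable_funTS.
- by apply: aeS fg => x /= -> _.
Qed.

Lemma cint_ae s f g : measurable_fun [set: R] f -> measurable_fun [set: R] g ->
  {ae leb, forall x, f x = g x} ->
  \int[leb]_(x in cell s) f x = \int[leb]_(x in cell s) g x.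
Proof.
move=> mf mg fg; rewrite /Rintegral; congr fine; apply: ae_eq_integral => //.
- exact: measurable_cell.
- by apply/measurable_EFinP; exact: measurable_funTS.
- by apply/measurable_EFinP; exact: measurable_funTS.
- by apply: aeS fg => x -> _.
Qed.

Lemma cintD s f g : integ s f -> integ s g ->
  \int[leb]_(x in cell s) (f x + g x) =
  \int[leb]_(x in cell s) f x + \int[leb]_(x in cell s) g x.
Proof. by move=> h1 h2; rewrite RintegralD//; exact: measurable_cell. Qed.

Lemma cintZ s k f : integ s f ->
  \int[leb]_(x in cell s) (k * f x) = k * \int[leb]_(x in cell s) f x.
Proof. by move=> h1; rewrite RintegralZl//; exact: measurable_cell. Qed.

Lemma cint_le s f g : integ s f -> integ s g -> (forall x, f x <= g x) ->
  \int[leb]_(x in cell s) f x <= \int[leb]_(x in cell s) g x.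
Proof. by move=> h1 h2 fg; apply: (le_Rintegral (measurable_cell s) h1 h2) => x _. Qed.

Lemma cint_ge0 s f : (forall x, 0 <= f x) -> 0 <= \int[leb]_(x in cell s) f x.
Proof. by move=> f0; apply: Rintegral_ge0 => x _. Qed.

Definition meas u := measurable_fun [set: R] u.

Lemma measD u v : meas u -> meas v -> meas (fun x => u x + v x).
Proof. exact: measurable_funD. Qed.
Lemma measM u v : meas u -> meas v -> meas (fun x => u x * v x).
Proof. exact: measurable_funM. Qed.
Lemma meas_cst a : meas (fun=> a). Proof. exact: measurable_cst. Qed.
Lemma measZ a u : meas u -> meas (fun x => a * u x).
Proof. by move=> mu; apply: measM => //; exact: meas_cst. Qed.
Lemma measN u : meas u -> meas (fun x => - u x).
Proof. by move=> mu; exact: measurableT_comp. Qed.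
Lemma measB u v : meas u -> meas v -> meas (fun x => u x - v x).
Proof. by move=> mu mv; apply: measD => //; exact: measN. Qed.
Lemma measX u n : meas u -> meas (fun x => u x ^+ n).
Proof. by move=> mu; exact: measurable_funX. Qed.

Lemma L2P s u : L2 s u <->
  [/\ meas u, ae_periodic s u & integ s (fun x => u x ^+ 2)].
Proof.
have mc := measurable_cell s.
split=> [[mu pu l2]|[mu pu iu]]; split=> //.
  have /(integrable_mkcond _ mc).2 : leb.-integrable setT
      ((EFin \o (fun x => u x ^+ 2)) \_ (cell s)).
    have := Lfun2_integrable_sqr l2.
    rewrite (_ : EFin \o _ = (EFin \o (fun x => u x ^+ 2)) \_ (cell s))//.
    by apply/funext => x; rewrite /= !patchE; case: ifP => //; rewrite expr0n.
  by [].
have mr : measurable_fun [set: R] (u \_ (cell s)).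
  by apply/(measurable_restrictT _ _).1 => //; exact: measurable_funTS.
rewrite inE; apply/andP; split; rewrite inE//=.
rewrite /finite_norm unlock poweR_lty//.
have /(integrable_mkcond _ mc).1/integrableP[_] := iu.
apply: le_lt_trans; rewrite le_eqVlt; apply/orP; left; apply/eqP.
apply: eq_integral => x _; rewrite /= !patchE; case: ifP => _ /=.
  by rewrite powR_mulrn// normrX.
by rewrite !normr0 powR0// normr0.
Qed.

Lemma L2_meas s u : L2 s u -> meas u. Proof. by case. Qed.

Lemma L2_ae s u v : L2 s u -> meas v -> {ae leb, forall x, u x = v x} -> L2 s v.
Proof.
move=> /L2P[mu pu iu] mv uv; apply/L2P; split=> //.
  case: s pu {iu} => // L /= pu.
  have uv' := ae_shift L uv.
  have H : {ae leb, forall x, u (x + L) = u x -> v (x + L) = v x}.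
    by apply: aeS2 uv uv' => x -> ->.
  by apply: aeS2 pu H => x E1; exact.
by apply: integ_ae iu; [exact: measX..|apply: aeS uv => x ->].
Qed.

Lemma L2_mul s u v : L2 s u -> L2 s v -> integ s (fun x => u x * v x).
Proof.
move=> /L2P[mu _ iu] /L2P[mv _ iv].
apply: (integ_le _ _ (integD iu iv)); first exact: measM.
move=> x; rewrite ler_norml; apply/andP; split; nra.
Qed.

Lemma ae_periodic_lin s k u v : ae_periodic s u -> ae_periodic s v ->
  ae_periodic s (fun x => k * u x + v x).
Proof. by case: s => //= L; apply: aeS2 => x -> ->. Qed.

Lemma L2_lin s k u v : L2 s u -> L2 s v -> L2 s (fun x => k * u x + v x).
Proof.
move=> lu lv; have iuv := L2_mul lu lv.
move: lu lv => /L2P[mu pu iu] /L2P[mv pv iv]; apply/L2P; split.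
- by apply: measD => //; exact: measZ.
- exact: ae_periodic_lin.
- have := integD (integZ (k ^+ 2) iu) (integD (integZ (2 * k) iuv) iv).
  rewrite /integ; congr (leb.-integrable _ _).
  by apply/funext => x /=; congr EFin; ring.
Qed.

Lemma L2_cst0 s : L2 s (fun=> 0).
Proof.
apply/L2P; split; [exact: meas_cst|by case: s => //= L; exact: aeW|].
rewrite /integ; have := integrable0 leb (cell s).
by congr (leb.-integrable _ _); apply/funext => x /=; rewrite expr0n.
Qed.

Lemma L2Z s k u : L2 s u -> L2 s (fun x => k * u x).
Proof. by move=> lu; have := L2_lin k lu (L2_cst0 s); under eq_fun do rewrite addr0. Qed.

Lemma L2D s u v : L2 s u -> L2 s v -> L2 s (fun x => u x + v x).
Proof. by move=> lu lv; have := L2_lin 1 lu lv; under eq_fun do rewrite mul1r. Qed.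

Lemma L2N s u : L2 s u -> L2 s (fun x => - u x).
Proof. by move=> lu; have := L2Z (-1) lu; under eq_fun do rewrite mulN1r. Qed.

Lemma L2B s u v : L2 s u -> L2 s v -> L2 s (fun x => u x - v x).
Proof. by move=> lu lv; apply: L2D => //; exact: L2N. Qed.

Lemma L2_mulb s u w (M : R) : L2 s u -> meas w -> ae_periodic s w ->
  (forall x, `|w x| <= M) -> L2 s (fun x => w x * u x).
Proof.
move=> /L2P[mu pu iu] mw pw wM; apply/L2P; split; first exact: measM.
  by case: s pu pw {iu} => //= L; apply: aeS2 => x -> ->.
apply: (integ_le _ _ (integZ (M ^+ 2) iu)); first by apply: measX; exact: measM.
move=> x; rewrite ger0_norm ?sqr_ge0// exprMn ler_wpM2r ?sqr_ge0//.
by rewrite -[w x ^+ 2]real_normK ?num_real// ler_sqr ?nnegrE ?(le_trans _ (wM x)).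
Qed.

Notation ip := (@L2inner R).

Lemma ipC s u v : ip s u v = ip s v u.
Proof. by apply: eq_Rintegral => x _; rewrite mulrC. Qed.

Lemma ip_lin s k u v w : L2 s u -> L2 s v -> L2 s w ->
  ip s (fun x => k * u x + v x) w = k * ip s u w + ip s v w.
Proof.
move=> lu lv lw; rewrite /L2inner -cintZ; last exact: L2_mul.
rewrite -cintD; [|by apply: integZ; exact: L2_mul|exact: L2_mul].
by apply: eq_Rintegral => x _; ring.
Qed.

Lemma ip_ge0 s u : 0 <= ip s u u.
Proof. by apply: cint_ge0 => x; rewrite -expr2 sqr_ge0. Qed.

Lemma ip_ae s u u' v v' : meas u -> meas v -> meas u' -> meas v' ->
  {ae leb, forall x, u x = u' x} -> {ae leb, forall x, v x = v' x} ->
  ip s u v = ip s u' v'.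
Proof.
move=> mu mv mu' mv' uu vv; apply: cint_ae; [exact: measM..|].
by apply: aeS2 uu vv => x -> ->.
Qed.

Lemma L2norm_ge0 s u : 0 <= L2norm s u.
Proof. by rewrite /L2norm fine_ge0// Lnorm_ge0. Qed.

Lemma L2norm_sqr s u : L2 s u -> L2norm s u ^+ 2 = ip s u u.
Proof.
move=> lu; have [mu pu l2] := lu.
have fin : ('N[leb]_2%:E [EFin \o u \_ (cell s)] \is a fin_num)%E.
  rewrite ge0_fin_numE ?Lnorm_ge0//.
  by move: l2; rewrite inE => /andP[_]; rewrite inE.
apply: EFin_inj; rewrite -powR_mulrn ?L2norm_ge0// -poweR_EFin /L2norm fineK//.
rewrite poweR_Lnorm ?pnatr_eq0// /L2inner /Rintegral fineK; last first.
  by apply: integrable_fin_num; [exact: measurable_cell|exact: L2_mul].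
rewrite [RHS]integral_mkcond; apply: eq_integral => x _.
rewrite /= !patchE; case: ifP => _ /=.
  by rewrite powR_mulrn// real_normK ?num_real// expr2.
by rewrite normr0 powR0.
Qed.

(** Countably many translates of one period cover the line, so the union of the translated
    exceptional sets is still null; the floor of [x / L] tells which translate contains [x]. *)
Lemma ae_cell L (P : R -> Prop) : 0 < L -> (forall x, P (x + L) <-> P x) ->
  {ae leb, forall x, `[0, L]%classic x -> P x} -> {ae leb, forall x, P x}.
Proof.
move=> L0 pP H.
have H' (k : int) : {ae leb, forall x, `[0, L]%classic (x + k%:~R * L) -> P x}.
  have PZ (n : nat) x : P (x + n%:R * L) <-> P x.
    elim: n x => [|n IH] x; first by rewrite mul0r addr0.
    by rewrite -natr1 mulrDl mul1r addrA pP IH.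
  have := ae_shift (k%:~R * L) H; apply: aeS => x /[apply].
  case: k => n; first by move/PZ.
  rewrite NegzE mulrNz => h; have := PZ n.+1 (x + - n.+1%:~R * L).
  by rewrite -addrA -mulrDl addNr mul0r addr0 => /iffRL; apply.
have Hn : {ae leb, forall x, forall n : nat, (`[0, L]%classic (x + n%:R * L) -> P x) /\
    (`[0, L]%classic (x - n%:R * L) -> P x)}.
  apply: ae_foralln => n; apply: aeS2 (H' n%:Z) (H' (- n%:Z)) => x.
  by rewrite mulrNz mulNr.
apply: aeS Hn => x Hx; pose k := Num.floor (x / L).
have h1 : k%:~R * L <= x by rewrite -ler_pdivlMr// Num.Theory.floor_le.
have h2 : x < (k + 1)%:~R * L by rewrite -ltr_pdivrMr// Num.Theory.floorD1_gt.
rewrite intrD mulrDl mul1r in h2.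
case: k h1 h2 => n h1 h2.
  by apply: (Hx n).2; rewrite /= in_itv/=; apply/andP; split; rewrite -?pmulrn in h1 h2 *; lra.
by apply: (Hx n.+1).1; rewrite NegzE mulrNz in h1 h2; rewrite /= in_itv/=; apply/andP; split; rewrite -?pmulrn in h1 h2 *; lra.
Qed.

(** For [L <= 0] the cell is a null set and the L^2 norm would not separate functions. *)
Definition dpos s := if s is Circle L then 0 < L else True.

Lemma ip0_ae s u : dpos s -> L2 s u -> ip s u u = 0 -> {ae leb, forall x, u x = 0}.
Proof.
move=> ds lu; have [mu pu _] := lu.
rewrite /L2inner /Rintegral => E.
have fin : ((\int[leb]_(x in cell s) (u x * u x)%:E) \is a fin_num)%E.
  by apply: integrable_fin_num; [exact: measurable_cell|exact: L2_mul].
have E0 : (\int[leb]_(x in cell s) `|(u x * u x)%:E| = 0)%E.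
  rewrite -[RHS](_ : (0%R)%:E = 0%E)// -E fineK//; apply: eq_integral => x _.
  by rewrite /= ger0_norm// -expr2 sqr_ge0.
have H : {ae leb, forall x, cell s x -> u x = 0}.
  have := (ae_eq_integral_abs leb (measurable_cell s) _).1 E0.
  case=> [|]; first by apply/measurable_EFinP; apply: measurable_funTS; exact: measM.
  move=> N [mN N0 HN]; exists N; split=> //.
  move=> x /= nx; apply: HN => /= h; apply: nx => cx; have := h cx.
  by move=> [] /eqP; rewrite mulf_eq0 orbb => /eqP.
case: s ds lu pu {E fin E0} H => [_ _ _|L /= L0 lu pu] H; first by apply: aeS H => x; apply.
have H1 : {ae leb, forall x, forall n : nat, u (x + n%:R * L) = u x /\ u (x - n%:R * L) = u x}.
  apply: ae_foralln => n.
  have pn m : {ae leb, forall x, u (x + m%:R * L) = u x}.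
    elim: m => [|m IH]; first by apply: aeW => x; rewrite mul0r addr0.
    have := ae_shift (m%:R * L) pu; apply: aeS2 IH => x E1 E2.
    by rewrite -natr1 mulrDl mul1r addrA E2.
  apply: aeS2 (pn n) (ae_shift (- (n%:R * L)) (pn n)) => x -> E.
  by split=> //; rewrite -E subrK.
(* [ae_cell] wants a property that is invariant at every point, while [u] is periodic only almost
   everywhere; quantifying over the translates makes it exactly invariant. *)
have := ae_cell L0 (P := fun x => exists k : int, u (x + k%:~R * L) = 0).
have : {ae leb, forall x, `[0, L]%classic x -> exists k : int, u (x + k%:~R * L) = 0}.
  by apply: aeS H => x /[apply] ux; exists 0; rewrite mul0r addr0.
move=> /[swap] /[apply]; apply: _ => //.
move=> HH; apply: aeS2 H1 (HH _) => [x Hx [k]|x].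
  case: k => n; first by rewrite (Hx n).1.
  by rewrite NegzE mulrNz mulNr (Hx n.+1).2.
split=> -[k Hk].
  by exists (1 + k); rewrite intrD mulrDl mul1r addrA.
by exists (-1 + k); rewrite intrD mulrDl mulN1r -addrA [L + _]addrA subrr add0r.
Qed.

End SquareIntegrable.

(** * Completeness of L^2 *)

Section RieszFischer.
Variable R : realType.
Notation leb := (@lebesgue_measure R).
Implicit Types (s : domain R) (f g u v w : R -> R) (a b c x L : R).
Notation ip := (@L2inner R).

Definition nsq s u : R := ip s u u.

Lemma nsq_ge0 s u : 0 <= nsq s u. Proof. exact: ip_ge0. Qed.

Lemma EFin_nsq s u : L2 s u ->
  (nsq s u)%:E = (\int[leb]_(x in cell s) (u x ^+ 2)%:E)%E.
Proof.
move=> lu; rewrite /nsq /L2inner /Rintegral fineK; last first.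
  by apply: integrable_fin_num; [exact: measurable_cell|exact: L2_mul].
by apply: eq_integral => x _; rewrite expr2.
Qed.

Lemma sum_half_le n : \sum_(0 <= j < n) (2 ^+ j)^-1 <= 2 :> R.
Proof.
suff -> : \sum_(0 <= j < n) (2 ^+ j)^-1 = 2 - 2 * (2 ^+ n)^-1 :> R.
  by rewrite gerBl mulr_ge0// invr_ge0 exprn_ge0.
elim: n => [|n IH]; first by rewrite big_geq// expr0 invr1; ring.
rewrite big_nat_recr//= IH exprS invfM.
by field; rewrite expf_neq0.
Qed.

(* [2 |d_j| <= 2^j d_j^2 + 2^-j] turns summability of the weighted squares into
   absolute convergence. *)
Lemma cvg_weighted_squares (w : nat -> R) (B : R) :
  (forall n, \sum_(0 <= j < n) 2 ^+ j * (w j.+1 - w j) ^+ 2 <= B) ->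
  cvgn (fun j => w j).
Proof.
move=> HB.
have geo n := sum_half_le n.
have cs : cvgn (series (fun j => w j.+1 - w j)).
  apply: normed_cvg.
  apply: nondecreasing_is_cvgn.
    apply/nondecreasing_seqP => n.
    change (\sum_(0 <= j < n) `|w j.+1 - w j| <= \sum_(0 <= j < n.+1) `|w j.+1 - w j|).
    by rewrite big_nat_recr//= lerDl.
  exists (B + 2) => _ [n _ <-].
  change (\sum_(0 <= j < n) `|w j.+1 - w j| <= B + 2).
  apply: le_trans (lerD (HB n) (geo n)); rewrite -big_split/=.
  apply: ler_sum => j _; set d := w j.+1 - w j; set t := 2 ^+ j.
  have t0 : 0 < t :> R by rewrite exprn_gt0.
  have tv0 : 0 < t^-1 by rewrite invr_gt0.
  have -> : d ^+ 2 = `|d| ^+ 2 by rewrite real_normK ?num_real.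
  have : 0 <= (t * `|d| - 1) ^+ 2 * t^-1 by rewrite mulr_ge0 ?sqr_ge0// ltW.
  have -> : (t * `|d| - 1) ^+ 2 * t^-1 = t * `|d| ^+ 2 - 2 * `|d| + t^-1.
    by field; rewrite gt_eqF.
  have := normr_ge0 d; lra.
have -> : (fun j => w j) = (fun j => series (fun j => w j.+1 - w j) j + w 0%N).
  by apply/funext => n; rewrite seriesEnat/= telescope_sumr// subrK.
by apply: is_cvgD => //; exact: is_cvg_cst.
Qed.

(** Used after Fatou, where the bound on the integrals holds only from some index on. *)
Lemma limn_einf_le (h : nat -> \bar R) (c : \bar R) j :
  (forall n, (j <= n)%N -> (h n <= c)%E) -> (limn_einf h <= c)%E.
Proof.
move=> H; rewrite limn_einf_lim; apply: lime_le; first exact: is_cvg_einfs.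
near=> n; rewrite /einfs; apply: le_trans (H n _).
  by apply: ereal_inf_lbound; exists n => /=.
by near: n; exists j.
Unshelve. all: by end_near. Qed.

(** A subsequence with rapidly decreasing gaps converges almost everywhere, and Fatou's lemma shows
    that the whole sequence converges in norm to the pointwise limit. *)
Lemma L2_complete s (u_ : nat -> R -> R) :
  (forall n, L2 s (u_ n)) ->
  (forall e : R, 0 < e -> exists N, forall m n, (N <= m)%N -> (N <= n)%N ->
     nsq s (fun x => u_ m x - u_ n x) <= e) ->
  exists u, L2 s u /\ forall e : R, 0 < e -> exists N, forall n, (N <= n)%N ->
     nsq s (fun x => u_ n x - u x) <= e.
Proof.
move=> lu cu.
have e8 j : 0 < (8 ^+ j)^-1 :> R by rewrite invr_gt0 exprn_gt0.
have [N HN] := choice (fun j => cu _ (e8 j)).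
(* The sum dominates every [N i] with [i <= j], so no monotone choice of [N] has to be arranged. *)
pose K j := (\sum_(0 <= i < j.+1) N i)%N.
have NK i j : (i <= j)%N -> (N i <= K j)%N.
  move=> ij; rewrite /K (big_cat_nat (n := i.+1))//= big_nat_recr//=.
  by rewrite -addnA addnCA leq_addr.
pose w j := u_ (K j).
have lw j : L2 s (w j) by exact: lu.
have mw j : meas (w j) by exact: L2_meas (lw j).
have mc := measurable_cell s.
have wd j m : (j <= m)%N -> nsq s (fun x => w m x - w j x) <= (8 ^+ j)^-1.
  by move=> jm; apply: HN; apply: NK.
(* The upper limit is measurable everywhere, before any convergence is known. *)
pose u x := fine (limn_esup (fun j => (w j x)%:E)).
have mu : meas u.
  have : measurable_fun [set: R] (fun x => limn_esup (fun j => (w j x)%:E)).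
    by apply: measurable_fun_limn_esup => j; apply/measurable_EFinP; exact: mw.
  by move=> h; apply: (measurableT_comp (fine_measurable _) h).
have pu : ae_periodic s u.
  case: s lu cu HN lw mw wd mc => //= L lu _ _ lw _ _ _.
  have : {ae leb, forall x, forall j, w j (x + L) = w j x}.
    by apply: ae_foralln => j; case: (lw j).
  apply: aeS => x E; rewrite /u; congr (fine (limn_esup _)).
  by apply/funext => j; rewrite E.
have wu : {ae leb, forall x, cell s x -> w j x @[j --> \oo] --> u x}.
  (* The squared gaps are at most [8^-j], so even with the weights [2^j] the series has a finite
     integral and is finite almost everywhere. *)
  pose S x := (\sum_(0 <= j <oo) (2 ^+ j * (w j.+1 x - w j x) ^+ 2)%:E)%E.
  have ld j : L2 s (fun x => w j.+1 x - w j x) by exact: L2B.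
  have md j : measurable_fun (cell s) (fun x => (2 ^+ j * (w j.+1 x - w j x) ^+ 2)%:E).
    apply/measurable_EFinP; apply: measurable_funTS; apply: measZ; apply: measX.
    exact: L2_meas (ld j).
  have fS : leb.-integrable (cell s) S.
    apply/integrableP; split.
      apply: ge0_emeasurable_sum; first by move=> k x _ _; rewrite lee_fin mulr_ge0// sqr_ge0.
      by move=> k _; exact: md.
    have -> : (\int[leb]_(x in cell s) `|S x| = \int[leb]_(x in cell s) S x)%E.
      apply: eq_integral => x _; rewrite gee0_abs// nneseries_ge0// => j _ _.
      by rewrite lee_fin mulr_ge0// sqr_ge0.
    rewrite /S integral_nneseries//; last first.
      by move=> j x _; rewrite lee_fin mulr_ge0// sqr_ge0.
    apply: (@le_lt_trans _ _ (\sum_(0 <= j <oo) ((2^+ j)^-1)%:E)%E); last first.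
      apply: (@le_lt_trans _ _ 2%:E); last exact: ltry.
      apply: lime_le.
        by apply: is_cvg_nneseries => j _ _; rewrite lee_fin invr_ge0 exprn_ge0.
      by apply: nearW => n; rewrite sumEFin lee_fin; exact: sum_half_le.
    apply: lee_nneseries => [|j _].
      by move=> *; apply: integral_ge0 => x _; rewrite lee_fin mulr_ge0// sqr_ge0.
    under eq_integral do rewrite EFinM.
    have mdj : measurable_fun (cell s) (fun x => ((w j.+1 x - w j x) ^+ 2)%:E).
      by apply/measurable_EFinP; apply: measurable_funTS; apply: measX; exact: L2_meas (ld j).
    rewrite (ge0_integralZl leb mc mdj (fun x _ => sqr_ge0 _ : (0%:E <= _%:E)%E)) ?lee_fin ?exprn_ge0//.
    rewrite -(EFin_nsq (ld j)) -EFinM lee_fin.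
    apply: le_trans (ler_wpM2l _ (wd j j.+1 (leqnSn j))) _; first by rewrite exprn_ge0.
    by rewrite -!exprVn -exprMn lerXn2r ?nnegrE//; lra.
  have := integrable_ae mc fS; apply: aeS => x /[apply] Sx.
  have cw : cvgn (fun j => w j x).
    apply: (@cvg_weighted_squares _ (fine (S x))) => n.
    rewrite -lee_fin fineK// -sumEFin; apply: nneseries_lim_ge => j _ _.
    by rewrite lee_fin mulr_ge0// sqr_ge0.
  suff -> : u x = limn (fun j => w j x) by [].
  have cv : (fun j => (w j x)%:E) @ \oo --> (limn (fun j => w j x))%:E.
    by apply: cvg_EFin; [exact: nearW|exact: cw].
  by rewrite /u (cvg_limn_einf_sup cv).2.
have fat n j : (forall m, (j <= m)%N -> nsq s (fun x => u_ n x - w m x) <= (8 ^+ j)^-1) ->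
    (\int[leb]_(x in cell s) ((u_ n x - u x) ^+ 2)%:E <= ((8 ^+ j)^-1)%:E)%E.
  move=> H.
  have ldm m : L2 s (fun x => u_ n x - w m x) by exact: L2B.
  have msq m : measurable_fun (cell s) (fun x => ((u_ n x - w m x) ^+ 2)%:E).
    apply/measurable_EFinP; apply: measurable_funTS; apply: measX.
    exact: L2_meas (ldm m).
  have F := fatou leb mc msq (fun m x _ => sqr_ge0 _ : (0%:E <= _%:E)%E).
  apply: (@le_trans _ _ (\int[leb]_(x in cell s) limn_einf (fun m => ((u_ n x - w m x) ^+ 2)%:E))%E).
    apply: ae_ge0_le_integral => //.
    - by move=> x _; rewrite lee_fin sqr_ge0.
    - apply/measurable_EFinP; apply: measurable_funTS; apply: measX; apply: measB => //.
      exact: L2_meas (lu n).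
    - move=> x _; rewrite limn_einf_lim; apply: lime_ge; first exact: is_cvg_einfs.
      by apply: nearW => i; apply: le_ereal_inf_tmp => _ [m _ <-]; rewrite lee_fin sqr_ge0.
    - rewrite /limn_einf; apply: measurableT_comp => //.
      apply: (@measurable_fun_limn_esup _ _ R (cell s) (fun m x => (- ((u_ n x - w m x) ^+ 2)%:E)%E)) => m.
      exact: measurableT_comp.
    - apply: aeS wu => x /[apply] cx.
      have cv : (fun m => ((u_ n x - w m x) ^+ 2)%:E) @ \oo --> ((u_ n x - u x) ^+ 2)%:E.
        apply: cvg_EFin; first by apply: nearW.
        by rewrite /comp/=; under eq_fun do rewrite expr2; rewrite expr2; apply: cvgM;
          apply: cvgB => //; exact: cvg_cst.
      by rewrite (cvg_limn_einf_sup cv).1.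
  apply: le_trans F _; apply: (@limn_einf_le _ _ j) => m jm.
  by rewrite -(EFin_nsq (ldm m)) lee_fin; exact: H.
have nu n j : (K j <= n)%N ->
    (\int[leb]_(x in cell s) ((u_ n x - u x) ^+ 2)%:E <= ((8 ^+ j)^-1)%:E)%E.
  move=> Kn; apply: fat => m jm; apply: HN; first exact: leq_trans (NK _ _ (leqnn j)) Kn.
  exact: NK.
have lun n j : (K j <= n)%N -> L2 s (fun x => u_ n x - u x).
  move=> Kn; have mun : meas (fun x => u_ n x - u x).
    by apply: measB => //; exact: L2_meas (lu n).
  apply/L2P; split=> //.
    have [_ pn _] := lu n; have := ae_periodic_lin (-1) pu pn.
    by congr ae_periodic; apply/funext => x; rewrite mulN1r addrC.
  apply/integrableP; split.
    by apply/measurable_EFinP; apply: measurable_funTS; apply: measX.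
  apply: (@le_lt_trans _ _ ((8 ^+ j)^-1)%:E); last exact: ltry.
  apply: le_trans (nu _ _ Kn); rewrite le_eqVlt; apply/orP; left; apply/eqP.
  by apply: eq_integral => x _; rewrite /= ger0_norm ?sqr_ge0.
exists u; split.
  have := L2B (lu (K 0)) (lun _ _ (leqnn (K 0))).
  by under eq_fun do rewrite opprB addrC subrK.
move=> e e0.
have [j Hj] : exists j, (8 ^+ j)^-1 <= e :> R.
  exists (Num.bound e^-1); rewrite invf_ple ?posrE ?exprn_gt0//.
  have := archi_boundP (ltW (_ : 0 < e^-1)); rewrite invr_gt0 => /(_ e0) h.
  apply: le_trans (ltW h) _; rewrite -natrX ler_nat.
  exact/ltnW/ltn_expl.
exists (K j) => n Kn; have := nu _ _ Kn; rewrite -(EFin_nsq (lun _ _ Kn)) lee_fin => h.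
exact: le_trans h Hj.
Qed.

End RieszFischer.

(** * A smooth bump with compact support *)

Section TestFunctions.
Variable R : realType.
Implicit Types (f g : R -> R) (a b c x : R).

(** Recursion on the derivative makes closure under sums, products and affine substitutions an
    induction on [k]. *)
Fixpoint smooth_upto k f : Prop :=
  if k is k'.+1 then (forall x, derivable f x 1) /\ smooth_upto k' (derive1 f) else True.

Lemma smoothP f : smooth f <-> forall k, smooth_upto k f.
Proof.
split=> [sf k|sf k x].
  have : forall j, (j < k)%N -> forall x, derivable (derive1n j f) x 1 by move=> j _; exact: sf.
  elim: k f {sf} => //= k IH f H; split; first exact: (H 0%N).
  by apply: IH => j jk x; have := H j.+1 jk x; rewrite /derive1n iterSr.
elim: k f sf => [|k IH] f sf; first by case: (sf 1%N).
by rewrite /derive1n iterSr; apply: IH => j; case: (sf j.+1).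
Qed.

Lemma smooth_uptoS k f : smooth_upto k.+1 f -> smooth_upto k f.
Proof. by elim: k f => //= k IH f [df H]; split=> //; exact: IH. Qed.

Lemma smooth_upto_lin k c f g : smooth_upto k f -> smooth_upto k g ->
  smooth_upto k (fun x => c * f x + g x).
Proof.
elim: k f g => //= k IH f g [df sf] [dg sg].
have D x : is_derive x 1 (fun x => c * f x + g x) (c * derive1 f x + derive1 g x).
  have /derivableP h1 := df x; have /derivableP h2 := dg x.
  have := is_deriveD (is_deriveZ c h1) h2; rewrite -!derive1E.
  by [].
split=> [x|]; first by case: (D x).
have -> : derive1 (fun x => c * f x + g x) = fun x => c * derive1 f x + derive1 g x.
  by apply/funext => x; rewrite derive1E; apply: derive_val.
exact: IH.
Qed.

Lemma smooth_upto_mul k f g : smooth_upto k f -> smooth_upto k g ->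
  smooth_upto k (fun x => f x * g x).
Proof.
elim: k f g => //= k IH f g [df sf] [dg sg].
have D x : is_derive x 1 (fun x => f x * g x) (f x * derive1 g x + g x * derive1 f x).
  have /derivableP h1 := df x; have /derivableP h2 := dg x.
  have := is_deriveM h1 h2; rewrite -!derive1E.
  by [].
split=> [x|]; first by case: (D x).
have -> : derive1 (fun x => f x * g x) =
    fun x => 1 * (f x * derive1 g x) + g x * derive1 f x.
  by apply/funext => x; rewrite derive1E mul1r; apply: derive_val.
apply: smooth_upto_lin; apply: IH => //; apply: smooth_uptoS; split=> //.
Qed.

Lemma is_derive_affine c a x : is_derive x 1 (fun x : R => c * x + a) c.
Proof.
have := is_deriveD (is_deriveZ c (is_derive_id x (1 : R))) (is_derive_cst a x 1).
by rewrite addr0 /GRing.scale/= mulr1.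
Qed.

Lemma smooth_upto_affine k f c a : smooth_upto k f -> smooth_upto k (fun x => f (c * x + a)).
Proof.
elim: k f => //= k IH f [df sf].
have D x : is_derive x 1 (fun x => f (c * x + a)) (c * derive1 f (c * x + a)).
  have /derivableP h1 := df (c * x + a).
  have := @is_derive1_comp R f (fun x => c * x + a) x _ _ h1 (is_derive_affine c a x).
  by rewrite -derive1E mulrC.
split=> [x|]; first by case: (D x).
have -> : derive1 (fun x => f (c * x + a)) = fun x => c * derive1 f (c * x + a) + 0.
  by apply/funext => x; rewrite derive1E addr0; apply: derive_val.
apply: smooth_upto_lin; first exact: IH.
have z : derive1 (fun=> 0 : R) = (fun=> 0 : R) by apply/funext => x; rewrite derive1_cst.
by elim: (k) => [|j IHj]; [exact: I|split; [move=> x; exact: derivable_cst|rewrite z]].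
Qed.

Lemma is_derive_flat f a (C : R) : f a = 0 ->
  (forall x, `|f x| <= C * (x - a) ^+ 2) -> is_derive a 1 f 0.
Proof.
move=> fa Hf.
have C0 : 0 <= C.
  by have := Hf (a + 1); rewrite addrAC subrr add0r expr1n mulr1 => /(le_trans (normr_ge0 _)).
suff L : (fun h : R => h^-1 *: ((f \o shift a) (h *: (1 : R)) - f a)) @ 0^' --> (0 : R).
  split; first by apply/cvg_ex; exists 0.
  exact/cvg_lim.
apply/cvgrPdist_le => e e0; near=> h.
rewrite sub0r normrN fa subr0 /= /GRing.scale/= mulr1 normrM normfV.
have h0 : 0 < `|h| by rewrite normr_gt0; near: h; exact: nbhs_dnbhs_neq.
rewrite mulrC ler_pdivrMr//; apply: le_trans (Hf _) _.
rewrite addrK -real_normK ?num_real// expr2 mulrA ler_wpM2r//.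
rewrite (le_trans (ler_wpM2r (normr_ge0 h) (ler_wpDr ler01 (lexx C))))//.
rewrite mulrC -ler_pdivlMr ?ltr_wpDl//.
near: h; apply: dnbhs0_le; rewrite divr_gt0// ltr_wpDl//.
Unshelve. all: by end_near. Qed.

(** The powers of [x^-1] make the family of functions [exp (- 1 / x)] closed under differentiation,
    so smoothness of all members is one induction. *)
Definition flat_exp n x : R := if 0 < x then x^-1 ^+ n * expR (- x^-1) else 0.

(** From [exp y >= y^(n+2) / (n+2)!] at [y = 1 / x]. Quadratic flatness is what makes the derivative
    at 0 exist and vanish. *)
Lemma flat_exp_le n x : `|flat_exp n x| <= n.+2`!%:R * x ^+ 2.
Proof.
rewrite /flat_exp; case: ltP => x0; last by rewrite normr0 mulr_ge0// sqr_ge0.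
have v0 : 0 < x^-1 by rewrite invr_gt0.
rewrite ger0_norm; last by rewrite mulr_ge0 ?expR_ge0 ?exprn_ge0// ltW.
have := expR_ge1Dxn n.+1 (ltW v0); set F := n.+2`!%:R => H.
have F0 : 0 < F :> R by rewrite ltr0n fact_gt0.
have {}H : x^-1 ^+ n.+2 / F <= expR x^-1 by apply: le_trans H; rewrite lerDr.
rewrite expRN ler_pdivrMr ?expR_gt0//.
rewrite (_ : F * x ^+ 2 * expR x^-1 = (F * expR x^-1) * x ^+ 2); last ring.
rewrite -ler_pdivrMr ?exprn_gt0// -exprVn -exprD addn2.
by rewrite mulrC -ler_pdivrMr.
Qed.

Lemma flat_exp_derive n x :
  is_derive x 1 (flat_exp n) (- n%:R * flat_exp n.+1 x + flat_exp n.+2 x).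
Proof.
have [x0|x0|->] := ltgtP x 0.
- rewrite /flat_exp ltNge (ltW x0) /= mulr0 addr0.
  apply: near_eq_is_derive (is_derive_cst 0 x 1).
  near=> y; rewrite /cst ltNge ltW//.
  by near: y; exact: lt_nbhsl.
- have -> : - n%:R * flat_exp n.+1 x + flat_exp n.+2 x =
     (x^-1 ^+ n * (- n%:R * x^-1 + x^-1 ^+ 2)) * expR (- x^-1).
    by rewrite /flat_exp x0 !exprS; ring.
  have D : is_derive x 1 (fun y : R => y^-1 ^+ n * expR (- y^-1))
     ((x^-1 ^+ n * (- n%:R * x^-1 + x^-1 ^+ 2)) * expR (- x^-1)).
    have dV : is_derive x 1 (fun y : R => y^-1) (- x^-1 ^+ 2).
      have := @is_deriveV R id x 1 1 (lt0r_neq0 x0) (is_derive_id x 1).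
      by rewrite /= /GRing.scale/= mulr1 exprVn.
    have dE : is_derive x 1 (fun y : R => expR (- y^-1)) (expR (- x^-1) * x^-1 ^+ 2).
      have := @is_derive1_comp R expR (fun y => - y^-1) x _ _
        (is_derive_expR (- x^-1)) (is_deriveN dV).
      by rewrite opprK.
    have dX : is_derive x 1 (fun y : R => y^-1 ^+ n) (- (n%:R * (x^-1 ^+ n.+1))).
      elim: (n) => [|m IH].
        by rewrite mul0r oppr0; under eq_fun do rewrite expr0; exact: is_derive_cst.
      under eq_fun do rewrite exprS.
      have := is_deriveM dV IH.
      by move=> h; apply: is_derive_eq h _; rewrite /GRing.scale/= -natr1 !exprS; ring.
    have := is_deriveM dX dE.
    move=> h; apply: is_derive_eq h _; rewrite /GRing.scale/= (exprS x^-1 n).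
    move: (x^-1 ^+ n) (expR (- x^-1)) => p E; ring.
  apply: near_eq_is_derive D.
  near=> y; rewrite /flat_exp ifT//.
  by near: y; exact: lt_nbhsr.
- have -> : - n%:R * flat_exp n.+1 0 + flat_exp n.+2 0 = 0.
    by rewrite /flat_exp ltxx mulr0 addr0.
  apply: (@is_derive_flat _ _ n.+2`!%:R); first by rewrite /flat_exp ltxx.
  by move=> y; rewrite subr0; exact: flat_exp_le.
Unshelve. all: by end_near. Qed.

Lemma smooth_flat_exp k n : smooth_upto k (flat_exp n).
Proof.
elim: k n => //= k IH n; split=> [x|]; first by case: (flat_exp_derive n x).
have -> : derive1 (flat_exp n) = fun x => - n%:R * flat_exp n.+1 x + flat_exp n.+2 x.
  by apply/funext => x; rewrite derive1E; have D := flat_exp_derive n x; apply: derive_val.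
exact: smooth_upto_lin.
Qed.

Definition bump x : R := flat_exp 0 x * flat_exp 0 (- 1 * x + 1).

Lemma smooth_bump k : smooth_upto k bump.
Proof.
apply: smooth_upto_mul; first exact: smooth_flat_exp.
exact: (smooth_upto_affine _ _ (smooth_flat_exp k 0)).
Qed.

Lemma bump_ge0 x : 0 <= bump x.
Proof.
by rewrite mulr_ge0// /flat_exp; case: ifP => // _; rewrite expr0 mul1r expR_ge0.
Qed.

Lemma bump_gt0 x : 0 < x < 1 -> 0 < bump x.
Proof.
move=> /andP[h1 h2]; rewrite /bump /flat_exp h1 ifT; last lra.
by rewrite !expr0 !mul1r mulr_gt0// expR_gt0.
Qed.

Lemma bump_eq0 x : ~~ (0 < x < 1) -> bump x = 0.
Proof.
rewrite negb_and -!leNgt => /orP[h|h]; rewrite /bump /flat_exp.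
  by rewrite ltNge h /= mul0r.
by rewrite [X in _ * X]ifF ?mulr0//; apply/negbTE; rewrite -leNgt; lra.
Qed.

Lemma cont_bump : continuous bump.
Proof.
move=> x; apply/differentiable_continuous/derivable1_diffP.
by have [h _] := smooth_bump 1; exact: h.
Qed.

End TestFunctions.

(** * Weak derivatives and absolutely continuous representatives *)

Section WeakDerivative.
Variable R : realType.
Notation leb := (@lebesgue_measure R).
Implicit Types (f g u v F G U : R -> R) (a b c x : R).

Lemma weak_derivative_ae u v g : meas u -> meas v -> {ae leb, forall x, u x = v x} ->
  weak_derivative u g -> weak_derivative v g.
Proof.
move=> mu mv uv [lg H]; split=> // f tf; rewrite -H//.
have mf' : meas (derive1 f).
  apply: cont_meas => x; apply/differentiable_continuous/derivable1_diffP.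
  by case: tf => sf _; exact: (sf 1%N).
have := @cint_ae R Line (fun x => v x * derive1 f x) (fun x => u x * derive1 f x).
by move=> ->//; [exact: measM|exact: measM|apply: aeS uv => x ->].
Qed.

Lemma Rint_support f a b : (forall x, ~~ (a <= x <= b) -> f x = 0) ->
  \int[leb]_x f x = \int[leb]_(x in `[a, b]) f x.
Proof.
move=> H; rewrite [RHS]Rintegral_mkcond; congr (Rintegral _ _ _).
apply/funext => x; rewrite patchE; case: ifPn => // /negP.
by rewrite inE /= in_itv/= => /negP /H.
Qed.

Lemma test_function_derive f : test_function f ->
  [/\ forall x, is_derive x 1 f (derive1 f x), continuous (derive1 f) &
   exists M : R, 0 < M /\ forall x, ~~ (- M <= x <= M) -> f x = 0 /\ derive1 f x = 0].
Proof.
move=> [sf [M HM]]; split.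
- by move=> x; rewrite derive1E; apply: derivableP; exact: (sf 0%N).
- by move=> x; apply/differentiable_continuous/derivable1_diffP; exact: (sf 1%N).
- have M0 : 0 < `|M| + 1 by rewrite ltr_wpDl.
  exists (`|M| + 1); split=> // x nx.
  have Mx : M < `|x|.
    rewrite ltNge; apply: contra nx => h.
    by rewrite -ler_norml (le_trans h)// (le_trans (ler_norm _))// lerDl.
  split; first exact: HM.
  rewrite derive1E; apply: derive_val; apply: near_eq_is_derive (is_derive_cst 0 x 1).
  have cn : {for x, continuous (fun y : R => `|y|)} by exact: norm_continuous.
  near=> y; rewrite /cst HM//; near: y.
  exact: (cvgr_gt _ cn).
Unshelve. all: by end_near. Qed.

Lemma ac_weak_derivative U g : ac U g -> weak_derivative U g.
Proof.
move=> Ug; split; first exact/lintE/(ac_lint Ug).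
move=> f /test_function_derive[df cdf [M [M0 HM]]].
have acf := ac_C1 df cdf.
have P := acM Ug acf.
have cU := ac_continuous Ug; have cf := ac_continuous acf.
rewrite (@Rint_support _ (- M) M); last by move=> x /HM[_ ->]; rewrite mulr0.
rewrite (@Rint_support _ (- M) M); last by move=> x /HM[-> _]; rewrite mulr0.
have l1 : lint (fun x => g x * f x) by apply: lintM => //; exact: ac_lint Ug.
have l2 : lint (fun x => U x * derive1 f x).
  by apply: cont_lint => x; apply: cvgM; [exact: cU|exact: cdf].
have z y : M < `|y| -> f y = 0.
  move=> My; suff [] : f y = 0 /\ derive1 f y = 0 by [].
  by apply: HM; rewrite -ler_norml -ltNge.
(* The test function is only known to vanish strictly outside [[- M, M]], so the product rule is
   applied on a larger segment. *)
have MM : - (M + 1) <= M + 1 by lra.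
have fz (y : R) : y = M + 1 \/ y = - (M + 1) -> f y = 0.
  move=> h; apply: z; case: h => ->; rewrite ?normrN ger0_norm; lra.
have := P.2 _ _ MM; rewrite (fz _ (or_introl erefl)) (fz _ (or_intror erefl)).
rewrite !mulr0 subr0 intD// => /esym/eqP; rewrite addr_eq0 => /eqP E.
rewrite -(@Rint_support _ (- M) M); last by move=> x /HM[_ ->]; rewrite mulr0.
rewrite -(@Rint_support _ (- M) M); last by move=> x /HM[-> _]; rewrite mulr0.
have out x : ~~ (- (M + 1) <= x <= M + 1) -> ~~ (- M <= x <= M).
  by apply: contra => /andP[h1 h2]; lra.
rewrite (@Rint_support _ (- (M + 1)) (M + 1)); last by move=> x /out/HM[_ ->]; rewrite mulr0.
rewrite (@Rint_support _ (- (M + 1)) (M + 1)); last by move=> x /out/HM[-> _]; rewrite mulr0.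
by rewrite E opprK.
Qed.

Lemma intB f g a b : lint f -> lint g ->
  \int[leb]_(x in `[a, b]) (f x - g x) =
  \int[leb]_(x in `[a, b]) f x - \int[leb]_(x in `[a, b]) g x.
Proof. by move=> lf lg; rewrite RintegralB//; [exact: lf.2|exact: lg.2]. Qed.

Lemma int_cst a b c : a <= b -> \int[leb]_(x in `[a, b]) c = c * (b - a).
Proof.
move=> ab; have := (ac_C1 (is_derive_affine c 0) (@cst_continuous _ _ c)).2 a b ab.
by move=> <-; ring.
Qed.

Definition bump_prim x : R := prim (@bump R) x.
Local Notation B := bump_prim.

Lemma ac_bump_prim : ac B (@bump R). Proof. exact/ac_prim/cont_lint/cont_bump. Qed.

Lemma bump_prim_derive x : is_derive x 1 B (@bump R x).
Proof. exact: (ac_derive ac_bump_prim (@cont_bump R)). Qed.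

Lemma bump_prim_le0 x : x <= 0 -> B x = 0.
Proof.
move=> x0; have -> : B x = B x - B 0 + B 0 by ring.
have -> : B 0 = 0 by rewrite /B /prim lexx int_pt.
have : B 0 - B x = 0.
  rewrite (ac_bump_prim.2 _ _ x0) (@eq_Rintegral _ _ _ _ _ (fun=> 0)) ?Rintegral_cst ?mul0r//.
  move=> y; rewrite inE /= in_itv/= => /andP[_ y0]; apply: bump_eq0.
  by rewrite negb_and -leNgt y0.
by rewrite /B [prim _ 0](_ : _ = 0) ?sub0r; [lra|rewrite /prim lexx int_pt].
Qed.

Lemma bump_prim_ge1 x : 1 <= x -> B x = B 1.
Proof.
move=> x1; apply/eqP; rewrite -subr_eq0 (ac_bump_prim.2 _ _ x1).
rewrite (@eq_Rintegral _ _ _ _ _ (fun=> 0)) ?Rintegral_cst ?mul0r//.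
move=> y; rewrite inE /= in_itv/= => /andP[y0 _]; apply: bump_eq0.
by rewrite negb_and -!leNgt y0 orbT.
Qed.

Lemma bump_prim1_gt0 : 0 < B 1.
Proof.
have h : 4^-1 <= 3 / 4 :> R by lra.
have := ac_bump_prim.2 _ _ h.
have [|c cI Hc] := @EVT_min R (@bump R) 4^-1 (3 / 4) h.
  exact/continuous_subspaceT/cont_bump.
have bc : 0 < bump c by apply: bump_gt0; move: cI; rewrite in_itv/=; lra.
have : bump c * (3 / 4 - 4^-1) <= \int[leb]_(x in `[4^-1, 3 / 4]) bump x.
  have -> : bump c * (3 / 4 - 4^-1) = \int[leb]_(x in `[4^-1, 3 / 4]) bump c.
    by rewrite int_cst.
  apply: le_int; [exact/cont_lint/cst_continuous|exact/cont_lint/cont_bump|].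
  by move=> x xI; apply: Hc; rewrite in_itv.
have mon a b : a <= b -> B a <= B b.
  by move=> ab; rewrite -subr_ge0 (ac_bump_prim.2 _ _ ab) int_ge0// => x _; exact: bump_ge0.
have b0 : B 0 = 0 by exact: bump_prim_le0.
have := mon 0 4^-1; have := mon (3/4) 1; rewrite b0.
have /[swap] /[apply] : 3 / 4 <= 1 :> R by lra.
have q : 0 <= 4^-1 :> R by lra.
move=> + /(_ q); have : 0 < bump c * (3 / 4 - 4^-1) by rewrite mulr_gt0//; lra.
lra.
Qed.

(** A smooth step rising from 0 at [a] to [B 1] at [a + 1 / k]. The difference of two steps has
    compact support, and its derivative is a difference of two mollifiers. *)
Definition bump_step k a x : R := B (k%:R * x + - (k%:R * a)).
Local Notation psi := bump_step.

Lemma test_bump_step k a b : (0 < k)%N -> test_function (fun x => psi k a x + (-1) * psi k b x).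
Proof.
move=> k0; split.
  apply/smoothP => j.
  have sB : smooth_upto j B.
    case: j => //= j; split; first by move=> x; case: (bump_prim_derive x).
    rewrite (_ : derive1 B = @bump R); first exact: smooth_bump.
    by apply/funext => x; rewrite derive1E; have D := bump_prim_derive x; apply: derive_val.
  under eq_fun do rewrite addrC.
  by apply: smooth_upto_lin; apply: (smooth_upto_affine _ _ sB).
have k1 : 1 <= k%:R :> R by rewrite ler1n.
exists (`|a| + `|b| + 1) => x; rewrite /psi.
have := ler_norm a; have := ler_norm (- a); have := ler_norm b; have := ler_norm (- b).
rewrite !normrN => h1 h2 h3 h4.
rewrite -!mulrN -!mulrDr.
have [x0|x0] := leP 0 x.
  rewrite (ger0_norm x0) => hx; rewrite !bump_prim_ge1 ?mulN1r ?subrr//; nra.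
rewrite (ltr0_norm x0) => hx; rewrite !bump_prim_le0 ?mulr0 ?add0r//; nra.
Qed.

Lemma bump_step_derive k a b x : derive1 (fun x => psi k a x + (-1) * psi k b x) x =
  k%:R * bump (k%:R * x + - (k%:R * a)) - k%:R * bump (k%:R * x + - (k%:R * b)).
Proof.
have D c : is_derive x 1 (psi k c) (k%:R * bump (k%:R * x + - (k%:R * c))).
  have := @is_derive1_comp R B (fun x => k%:R * x + - (k%:R * c)) x _ _ (bump_prim_derive _)
    (is_derive_affine k%:R (- (k%:R * c)) x).
  by rewrite [X in is_derive _ _ _ X -> _]mulrC.
have := is_deriveD (D a) (is_deriveZ (-1) (D b)).
rewrite scaleN1r => h; rewrite derive1E; exact: (@derive_val _ _ _ _ _ _ _ h).
Qed.

(** The segment lies in the ball of radius [2 r], whose measure is [4 r]; hence the precision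
    [e / 4] for the averages. *)
Lemma lebesgue_ptE f x : lint f -> lebesgue_pt f x ->
  forall e : R, 0 < e -> exists r0 : R, 0 < r0 /\ forall r, 0 < r < r0 ->
    \int[leb]_(y in `[x, x + r]) `|f y - f x| <= e * r.
Proof.
move=> lf /fine_cvgP[fin /cvgrPdist_lt H] e e0.
have e4 : 0 < e / 4 by rewrite divr_gt0.
have {H fin} := filterI fin (H _ e4).
move=> [d /= d0 Hd]; exists (d / 2); split; first by rewrite divr_gt0.
move=> r /andP[r0 rd].
have := Hd (2 * r); rewrite /ball/= sub0r normrN gtr0_norm; last lra.
have t1 : 2 * r < d by lra.
have t2 : 0 < 2 * r by lra.
move=> /(_ t1 t2) [fin]; rewrite sub0r normrN => h.
have h' : fine (davg f x (2 * r)) < e / 4 by apply: le_lt_trans (ler_norm _) h.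
have lfx : lint (fun y => `|f y - f x|).
  by apply: lint_norm; apply: lintB => //; apply: cont_lint; exact: cst_continuous.
have : (davg f x (2 * r) < (e / 4)%:E)%E by rewrite -(fineK fin) lte_fin.
rewrite /davg /iavg lebesgue_measure_ball ?(ltW t2)// inver.
rewrite gt_eqF; last by rewrite mulr2n; lra.
have iB : leb.-integrable (ball x (2 * r)) (EFin \o (fun y => `|f y - f x|)).
  rewrite ball_itv; apply: integrableS (lfx.2 (x - 2 * r) (x + 2 * r)) => //.
  exact: subset_itv_oo_cc.
have -> : (\int[leb]_(y in ball x (2 * r)) `|((center (f x) \o f) y)%:E| =
  (\int[leb]_(y in ball x (2 * r)) `|f y - f x|)%R%:E)%E.
  rewrite /Rintegral fineK; last by apply: integrable_fin_num iB; exact: measurable_ball.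
  by apply: eq_integral.
rewrite -EFinM lte_fin => h2.
have h3 : \int[leb]_(y in ball x (2 * r)) `|f y - f x| <= e * r.
  move: h2; rewrite mulrC ltr_pdivrMr; last by rewrite mulr2n; lra.
  by rewrite mulr2n; lra.
apply: le_trans h3; rewrite /Rintegral fine_le//.
- exact: (integrable_fin_num (measurable_cc _ _) (lfx.2 _ _)).
- by apply: integrable_fin_num iB; exact: measurable_ball.
- apply: ge0_subset_integral => //.
  + exact: measurable_ball.
  + by case/integrableP: iB.
  + move=> y; rewrite /= in_itv/= /ball/= => /andP[y1 y2].
    by rewrite ltr_distlC; apply/andP; split; lra.
Qed.

(** The mollifier has mass [B 1], height at most [k M] and support in [[a, a + 1 / k]], so the error
    is at most [M] times the mean oscillation of [d] there. *)
Lemma bump_average d a : lint d -> lebesgue_pt d a ->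
  forall e : R, 0 < e -> exists K : nat, forall k, (K <= k)%N -> (0 < k)%N /\
   `|\int[leb]_x (d x * (k%:R * bump (k%:R * x + - (k%:R * a)))) - d a * B 1| <= e.
Proof.
move=> ld lp e e0.
have [M [M0 HM]] := cont_bnd 0 1 (@cont_bump R).
have HM' x : bump x <= M.
  have [h|h] := boolP (0 < x < 1).
    by apply: le_trans (ler_norm _) _; apply: HM; lra.
  by rewrite bump_eq0.
have M1 : 0 < M + 1 by lra.
have [r0 [r0p Hr]] := lebesgue_ptE ld lp (divr_gt0 e0 M1).
exists (Num.bound r0^-1).+1 => k Kk.
have k0 : (0 < k)%N by apply: leq_trans Kk.
split=> //; set q : R := k%:R.
have q0 : 0 < q by rewrite ltr0n.
have qr : q^-1 < r0.
  rewrite invf_plt ?posrE//; apply: lt_le_trans (_ : (Num.bound r0^-1)%:R <= _).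
    by apply: archi_boundP; rewrite invr_ge0 ltW.
  by rewrite ler_nat ltnW.
have supp x : ~~ (a <= x <= a + q^-1) -> bump (q * x + - (q * a)) = 0.
  move=> h; apply: bump_eq0; apply: contra h; rewrite -mulrN -mulrDr.
  move=> /andP[h1 h2]; have xa : 0 < x - a by rewrite -(pmulr_rgt0 _ q0).
  have : x - a < q^-1 by rewrite -[q^-1]mul1r ltr_pdivlMr// mulrC.
  lra.
rewrite (@Rint_support _ a (a + q^-1)); last by move=> x /supp ->; rewrite !mulr0.
have qv : 0 < q^-1 by rewrite invr_gt0.
have aq : a <= a + q^-1 by rewrite lerDl ltW.
have cb : continuous (fun x => q * bump (q * x + - (q * a))).
  move=> x; apply: cvgM; first exact: cvg_cst.
  apply: (@continuous_comp _ _ _ (fun x => q * x + - (q * a)) (@bump R)); last exact: cont_bump.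
  by have [h _] := is_derive_affine q (- (q * a)) x; apply/differentiable_continuous/derivable1_diffP.
have Ep : d a * B 1 = \int[leb]_(x in `[a, a + q^-1]) (d a * (q * bump (q * x + - (q * a)))).
  have acp : ac (psi k a) (fun x => q * bump (q * x + - (q * a))).
    apply: ac_C1 => // x.
    have := @is_derive1_comp R B (fun x => q * x + - (q * a)) x _ _ (bump_prim_derive _)
      (is_derive_affine q (- (q * a)) x).
    by rewrite [X in is_derive _ _ _ X -> _]mulrC.
  have := (acZ (d a) acp).2 _ _ aq; move=> <-.
  rewrite /psi -/q mulrDr mulfV ?gt_eqF// addrAC subrr add0r.
  by rewrite (bump_prim_le0 (lexx 0)) mulr0 subr0.
have l1 : lint (fun x => d x * (q * bump (q * x + - (q * a)))) by exact: lintM.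
rewrite Ep -intB//; last by apply: lintZ; exact: cont_lint.
under eq_Rintegral do rewrite -mulrBl.
have ldd : lint (fun x => d x - d a).
  by apply: lintB => //; apply: cont_lint; exact: cst_continuous.
apply: le_trans (norm_int _ _ (lintM ldd cb)) _.
have : \int[leb]_(y in `[a, a + q^-1]) `|d y - d a| <= e / (M + 1) * q^-1.
  by apply: Hr; rewrite qv qr.
move=> h; apply: (@le_trans _ _ (q * M * (e / (M + 1) * q^-1))); last first.
  rewrite (_ : _ * _ = e * (M / (M + 1))); last by field; rewrite !gt_eqF.
  by rewrite (ler_piMr (ltW e0))// ler_pdivrMr// mul1r lerDl.
apply: le_trans (ler_wpM2l _ h); last by rewrite mulr_ge0// ltW.
rewrite -intZ; last exact: lint_norm.
apply: le_int; [exact/lint_norm/lintM|by apply: lintZ; exact: lint_norm|].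
move=> x _; rewrite normrM mulrC ler_wpM2r// normrM gtr0_norm//.
by rewrite (ler_wpM2l (ltW q0))// (ger0_norm (bump_ge0 _)).
Qed.

(** The lemma of du Bois-Reymond. Testing with the difference of the steps at two Lebesgue points
    [a] and [b] and letting the steps steepen gives [d a = d b]. *)
Lemma weak_derivative0 d : lint d ->
  (forall f, test_function f -> \int[leb]_x (d x * derive1 f x) = 0) ->
  exists c, {ae leb, forall x, d x = c}.
Proof.
move=> ld H.
have lae := lebesgue_differentiation ((lintE d).1 ld).
have B0 := bump_prim1_gt0.
have key a b : lebesgue_pt d a -> lebesgue_pt d b -> d a = d b.
  move=> pa pb; apply: (mulIf (lt0r_neq0 B0)); apply/eqP; rewrite -subr_eq0 -mulrBl -normr_le0.
  apply/ler_addgt0Pl => e e0; rewrite addr0.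
  have e2 : 0 < e / 2 by rewrite divr_gt0.
  have [Ka HKa] := bump_average ld pa e2.
  have [Kb HKb] := bump_average ld pb e2.
  pose k := maxn Ka Kb.
  have [k0 ha] := HKa k (leq_maxl _ _).
  have [_ hb] := HKb k (leq_maxr _ _).
  have := H _ (test_bump_step a b k0).
  have lk c : leb.-integrable setT (EFin \o (fun x => d x * (k%:R * bump (k%:R * x + - (k%:R * c))))).
    have k1 : 0 < k%:R :> R by rewrite ltr0n.
    have cb : continuous (fun x => k%:R * bump (k%:R * x + - (k%:R * c))).
      move=> x; apply: cvgM; first exact: cvg_cst.
      apply: (@continuous_comp _ _ _ (fun x => k%:R * x + - (k%:R * c)) (@bump R)); last exact: cont_bump.
      by have [h _] := is_derive_affine k%:R (- (k%:R * c)) x; apply/differentiable_continuous/derivable1_diffP.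
    have := (lintM ld cb).2 c (c + k%:R^-1).
    rewrite integrable_mkcond; last exact: measurable_cc.
    congr (leb.-integrable _ _); apply/funext => x; rewrite patchE; case: ifPn => // /negP.
    rewrite inE /= in_itv/= => /negP h; rewrite bump_eq0 ?mulr0//.
    apply: contra h; rewrite -mulrN -mulrDr => /andP[h1 h2].
    have xa : 0 < x - c by rewrite -(pmulr_rgt0 _ k1).
    have : x - c < k%:R^-1 by rewrite -[k%:R^-1]mul1r ltr_pdivlMr// mulrC.
    lra.
  under eq_Rintegral do rewrite bump_step_derive mulrBr.
  rewrite RintegralB// => /eqP; rewrite subr_eq0 => /eqP E.
  rewrite E in ha.
  move: (\int[leb]_x _) ha hb => I ha hb.
  have -> : (d a - d b) * B 1 = (I - d b * B 1) - (I - d a * B 1) by ring.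
  apply: le_trans (ler_normB _ _) _; clear -ha hb; lra.
have [[a pa]|no] := pselect (exists a, lebesgue_pt d a).
  by exists (d a); apply: aeS lae => x px; exact: key.
by exists 0; apply: aeS lae => x px; case: no; exists x.
Qed.

(** [u] minus a primitive of [g] has weak derivative zero, hence is constant almost everywhere. *)
Lemma weak_derivative_ac u g : lint u -> weak_derivative u g ->
  exists U, ac U g /\ {ae leb, forall x, u x = U x}.
Proof.
move=> lu [/lintE lg H].
have acP := ac_prim lg.
have ldP : lint (prim g) by exact/cont_lint/(ac_continuous acP).
have [|c Hc] := @weak_derivative0 (fun x => u x - prim g x) (lintB lu ldP).
  move=> f tf; have [_ /(_ f tf) HP] := ac_weak_derivative acP.
  have [df cdf [M [M0 HM]]] := test_function_derive tf.
  rewrite (@Rint_support _ (- M) M); last by move=> x /HM[_ ->]; rewrite mulr0.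
  under eq_Rintegral do rewrite mulrBl -[- _]mulN1r.
  rewrite intD; [|exact: lintM|by apply: lintZ; exact: lintM].
  rewrite intZ; last exact: lintM.
  rewrite -(@Rint_support _ (- M) M); last by move=> x /HM[_ ->]; rewrite mulr0.
  rewrite -(@Rint_support _ (- M) M); last by move=> x /HM[_ ->]; rewrite mulr0.
  by rewrite H// HP; ring.
exists (fun x => prim g x + c); split.
  by have := acD acP (ac_cst c); under [X in ac _ X]eq_fun do rewrite addr0.
by apply: aeS Hc => x <-; ring.
Qed.

Lemma cont_ae_eq f g : continuous f -> continuous g ->
  {ae leb, forall x, f x = g x} -> forall x, f x = g x.
Proof.
move=> cf cg fg x; apply/eqP; rewrite -subr_eq0; apply/eqP.
have lf := cont_lint cf; have lg := cont_lint cg.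
have ch : continuous (fun x => f x - g x) by move=> y; apply: cvgB; [exact: cf|exact: cg].
have D := ac_derive (ac_prim (cont_lint ch)) ch x.
have z a b : \int[leb]_(t in `[a, b]) (f t - g t) = 0 by rewrite intB// (int_ae _ _ lf lg fg) subrr.
have Z : prim (fun x => f x - g x) = fun=> 0.
  by apply/funext => y; rewrite /prim !z oppr0; case: ifP.
rewrite Z in D; rewrite -(@derive_val _ _ _ _ _ _ _ D).
exact: (@derive_val _ _ _ _ _ _ _ (is_derive_cst 0 x 1)).
Qed.

Lemma weak_derivative_unique u g g' : lint u -> weak_derivative u g ->
  weak_derivative u g' -> {ae leb, forall x, g x = g' x}.
Proof.
move=> lu wg wg'.
have [U [Ug uU]] := weak_derivative_ac lu wg.
have [V [Vg uV]] := weak_derivative_ac lu wg'.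
have UV : U = V.
  apply/funext; apply: cont_ae_eq; [exact: ac_continuous Ug|exact: ac_continuous Vg|].
  by apply: aeS2 uU uV => x <-.
by apply: (@ac_unique _ U) => //; rewrite UV.
Qed.

End WeakDerivative.

(** * H^2: integration by parts and a uniform sup bound *)

Section Sobolev.
Variable R : realType.
Notation leb := (@lebesgue_measure R).
Implicit Types (s : domain R) (f g h u v w F G U : R -> R) (a b c x L : R).
Notation ip := (@L2inner R).

Lemma lint_ae u v : lint u -> meas v -> {ae leb, forall x, u x = v x} -> lint v.
Proof.
move=> [mu iu] mv uv; split=> // a b.
have /integrableP[_ H] := iu a b; apply/integrableP; split.
  by apply/measurable_EFinP; exact: measurable_funTS.
apply: le_lt_trans H; rewrite le_eqVlt; apply/orP; left; apply/eqP.
apply: ae_eq_integral => //.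
- by apply/measurable_EFinP/measurableT_comp => //; exact: measurable_funTS.
- by apply/measurable_EFinP/measurableT_comp => //; exact: measurable_funTS.
- by apply: aeS uv => x /= -> _.
Qed.

Lemma ac_ae F f g : ac F f -> lint g -> {ae leb, forall x, f x = g x} -> ac F g.
Proof. by move=> [lf H] lg fg; split=> // a b ab; rewrite H//; exact: int_ae. Qed.

Lemma integ_cc a b f : integ Line f -> leb.-integrable `[a, b] (EFin \o f).
Proof.
move=> h; have mT : measurable (setT : set (measurableTypeR R)) by exact: measurableT.
exact: (integrableS mT (measurable_cc a b) (@subsetT _ _) h).
Qed.

Lemma integ_lint f : integ Line f -> lint f.
Proof.
move=> h; split; last by move=> a b; exact: integ_cc.
by case/integrableP: h => /measurable_EFinP.
Qed.

Lemma ge0_tail g (e : R) : integ Line g -> (forall x, 0 <= g x) -> 0 < e ->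
  exists M, 0 <= M /\ \int[leb]_x g x - \int[leb]_(x in `[- M, M]) g x <= e.
Proof.
move=> ig g0 e0.
pose gn n x := g x * \1_`[- n%:R, n%:R] x.
have mg : meas g by case: (integ_lint ig).
have mgn n : meas (gn n).
  apply: measM => //; apply: measurable_indic; exact: measurable_cc.
have mgE n : measurable_fun [set: R] (EFin \o gn n) by apply/measurable_EFinP; exact: mgn.
have mgE0 : measurable_fun [set: R] (EFin \o g) by apply/measurable_EFinP.
have cvx : {ae leb, forall x, [set: R] x -> (EFin \o gn n) x @[n --> \oo] --> (EFin \o g) x}.
  apply: aeW => x _; apply: cvg_near_cst.
  near=> n; congr EFin; rewrite /gn indicE mem_set ?mulr1//=.
  rewrite in_itv/= -ler_norml.
  near: n; exists (Num.bound `|x|) => // n /= hn.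
  rewrite (le_trans (ltW (archi_boundP (normr_ge0 _))))// ler_nat//.
have bnd : {ae leb, forall x n, [set: R] x -> (`|(EFin \o gn n) x| <= (EFin \o g) x)%E}.
  apply: aeW => x n _; rewrite /= lee_fin /gn indicE.
  by case: (_ \in _); rewrite ?mulr1 ?mulr0 ?normr0// ger0_norm.
have [_ _ cv] := @dominated_convergence _ _ R leb setT measurableT
   (fun n => EFin \o gn n) _ _ mgE mgE0 cvx ig bnd.
have cv2 : \int[leb]_(x in `[- n%:R, n%:R]) g x @[n --> \oo] --> \int[leb]_x g x.
  have /fine_cvgP[_] : ([sequence \int[leb]_x (gn n x)%:E]_n)%E @ \oo --> (\int[leb]_x g x)%:E.
    by rewrite /Rintegral fineK//; apply: integrable_fin_num.
  apply: cvg_trans; apply: near_eq_cvg; near=> n => /=.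
  rewrite [RHS]Rintegral_mkcond; congr fine; apply: eq_integral => x _.
  rewrite patchE /gn indicE; case: ifP => _; by rewrite ?mulr1 ?mulr0.
have /cvgrPdist_le /(_ e e0) [N _ /(_ N (leqnn N))] := cv2.
move=> H; exists N%:R; split=> //; apply: le_trans (ler_norm _) H.
Unshelve. all: by end_near. Qed.

Lemma int_le_line g a b : integ Line g -> (forall x, 0 <= g x) ->
  \int[leb]_(x in `[a, b]) g x <= \int[leb]_x g x.
Proof.
move=> ig g0; rewrite /Rintegral fine_le//.
- exact: (integrable_fin_num (measurable_cc _ _) (integ_cc a b ig)).
- by apply: integrable_fin_num.
- apply: ge0_subset_integral => //.
  + by case/integrableP: ig.
  + by move=> x _; rewrite lee_fin.
Qed.

Lemma line_split f a b : integ Line f -> a <= b ->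
  \int[leb]_x f x = \int[leb]_(x in `[a, b]) f x + \int[leb]_x (f x * \1_(~` `[a, b]) x).
Proof.
move=> ig ab.
have mA : measurable (~` `[a, b] : set (measurableTypeR R)).
  by apply: measurableC; exact: measurable_cc.
have mf : meas f by case: (integ_lint ig).
have i1 : integ Line (fun x => f x * \1_`[a, b] x).
  have := integ_cc a b ig; rewrite integrable_mkcond; last exact: measurable_cc.
  congr (leb.-integrable _ _); apply/funext => x; rewrite patchE /= indicE.
  by case: (_ \in _); rewrite ?mulr1 ?mulr0.
have i2 : integ Line (fun x => f x * \1_(~` `[a, b]) x).
  have := integB ig i1; congr (leb.-integrable _ _); apply/funext => x /=.
  rewrite !indicE in_setC; case: (_ \in _); congr EFin => /=; ring.
rewrite [\int[leb]_(x in `[a, b]) f x]Rintegral_mkcond.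
have -> : f \_ `[a, b] = fun x => f x * \1_`[a, b] x.
  by apply/funext => x; rewrite patchE indicE; case: (_ \in _); rewrite ?mulr1 ?mulr0.
rewrite -(@cintD R Line)//; apply: eq_Rintegral => x _.
rewrite !indicE in_setC; case: (_ \in _) => /=; ring.
Qed.

Lemma line_tail f (e : R) : integ Line f -> 0 < e ->
  exists M, 0 <= M /\ forall a b, a <= - M -> M <= b ->
    `|\int[leb]_x f x - \int[leb]_(x in `[a, b]) f x| <= e.
Proof.
move=> ig e0.
have ign : integ Line (fun x => `|f x|) by exact: integrable_norm ig.
have [M [M0 HM]] := ge0_tail ign (fun x => normr_ge0 _) e0.
exists M; split=> // a b aM Mb.
have ab : a <= b by lra.
rewrite (line_split ig ab) addrAC subrr add0r.
have mA : measurable (~` `[a, b] : set (measurableTypeR R)).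
  by apply: measurableC; exact: measurable_cc.
have i2 : integ Line (fun x => f x * \1_(~` `[a, b]) x).
  apply: integ_le ign.
    by apply: measM; [case: (integ_lint ig)|exact: measurable_indic].
  by move=> x; rewrite indicE; case: (_ \in _); rewrite ?mulr1 ?mulr0 ?normr0.
apply: le_trans (le_normr_Rintegral measurableT i2) _.
have := line_split ign ab.
have -> : \int[leb]_x (`|f x| * \1_(~` `[a, b]) x) = \int[leb]_x `|f x * \1_(~` `[a, b]) x|.
  by apply: eq_Rintegral => x _; rewrite normrM indicE; case: (_ \in _); rewrite ?normr1 ?normr0.
have := @int_subset R (fun x => `|f x|) (- M) M a b (integ_lint ign) (fun x _ => normr_ge0 _) aM Mb.
have MM : - M <= M by lra.
move=> /(_ MM); move: HM; lra.
Qed.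

(** If [|h|] exceeded [e] throughout a segment longer than its L^1 norm divided by [e], the integral
    over that segment would exceed the L^1 norm. *)
Lemma line_small h (e M : R) : continuous h -> integ Line h -> 0 < e ->
  (exists2 b, M <= b & `|h b| <= e) /\ (exists2 a, a <= - M & `|h a| <= e).
Proof.
move=> ch ig e0.
have ign : integ Line (fun x => `|h x|) by exact: integrable_norm ig.
have key c : exists2 b, c <= b <= c + (\int[leb]_x `|h x| / e + 1) & `|h b| <= e.
  apply: contrapT => no.
  have I0 : 0 <= \int[leb]_x `|h x| by apply: Rintegral_ge0 => x _.
  set d := _ / e + 1 in no *.
  have d0 : 0 < d by rewrite ltr_wpDl// divr_ge0// ltW.
  have := @int_le_line (fun x => `|h x|) c (c + d) ign (fun x => normr_ge0 _).
  have : \int[leb]_(x in `[c, c + d]) e <= \int[leb]_(x in `[c, c + d]) `|h x|.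
    apply: le_int; [exact/cont_lint/cst_continuous|exact: integ_lint|].
    move=> x xcd; rewrite leNgt; apply/negP => hx; apply: no; exists x => //; exact: ltW.
  rewrite int_cst; last lra.
  rewrite addrAC subrr add0r => h1 /(le_trans h1).
  have -> : e * d = \int[leb]_x `|h x| + e.
    by rewrite /d mulrDr mulr1 mulrC divfK// gt_eqF.
  by rewrite leNgt ltrDl e0.
split.
  by have [b /andP[b1 b2] hb] := key M; exists b.
have [b /andP[b1 b2] hb] := key (- M - (\int[leb]_x `|h x| / e + 1)).
by exists b => //; move: b2; rewrite subrK.
Qed.

Definition periodic_on s u := if s is Circle L then forall x, u (x + L) = u x else True.

Lemma ae_periodic_cont s u : continuous u -> ae_periodic s u -> periodic_on s u.
Proof.
case: s => //= L cu pu; apply: cont_ae_eq => // x.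
apply: (@continuous_comp _ _ _ (fun x => x + L) u); last exact: cu.
by apply: cvgD; [exact: cvg_id|exact: cvg_cst].
Qed.

Lemma periodic_ae s u : periodic_on s u -> ae_periodic s u.
Proof. by case: s => //= L pu; exact: aeW. Qed.

(** On the circle the boundary terms cancel by periodicity. On the line no decay of [h] is assumed:
    integrability supplies endpoints as far out as needed where [h] is small, and the integral of
    [h'] over large segments is close to the full one. *)
Lemma cint_derive0 s h h' : dpos s -> ac h h' -> ae_periodic s h -> integ s h -> integ s h' ->
  \int[leb]_(x in cell s) h' x = 0.
Proof.
move=> ds ah ph ih ih'.
case: s ds ph ih ih' => [_ _|L /= L0 ph _ _]; last first.
  have pL := ae_periodic_cont (s := Circle L) (ac_continuous ah) ph.
  have := ah.2 0 L (ltW L0); move=> <-.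
  by rewrite -[X in h X](add0r L) pL subrr.
move=> /= ih ih'; apply/eqP; rewrite -normr_le0.
apply/ler_addgt0Pl => e e0; rewrite addr0.
have e3 : 0 < e / 3 by rewrite divr_gt0.
have [M [M0 HM]] := line_tail ih' e3.
have [[b Mb hb] [a aM ha]] := line_small M (ac_continuous ah) ih e3.
have ab : a <= b by lra.
have := HM a b aM Mb; rewrite -(ah.2 a b ab) => h1.
have -> : \int[leb]_x h' x = (\int[leb]_x h' x - (h b - h a)) + h b - h a by ring.
apply: le_trans (ler_normB _ _) _; apply: le_trans (lerD (ler_normD _ _) (lexx _)) _.
lra.
Qed.

(** The derivatives travel with the function, so that no choice of weak derivative enters the
    computations. *)
Definition H2r s u u1 u2 := [/\ ac u u1, ac u1 u2, L2 s u, L2 s u1 & L2 s u2].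

Lemma parts s u u1 u2 v v1 v2 : dpos s -> H2r s u u1 u2 -> H2r s v v1 v2 ->
  ip s u2 v = - ip s u1 v1.
Proof.
move=> ds [a0 a1 l0 l1 l2] [a0' a1' l0' l1' l2'].
have P := acM a1 a0'.
have i1 := L2_mul l2 l0'; have i2 := L2_mul l1 l1'.
have := cint_derive0 ds P _ (L2_mul l1 l0') (integD i1 i2).
rewrite cintD// => H; apply/eqP; rewrite -addr_eq0; apply/eqP; apply: H.
case: s {ds i1 i2} l1 l0' l0 l1' l2 l2' => //= L [_ p1 _] [_ p0 _] _ _ _ _.
by apply: aeS2 p1 p0 => x -> ->.
Qed.

Lemma H2_rep s u : H2 s u -> exists v v1 v2, [/\ H2r s v v1 v2, {ae leb, forall x, u x = v x},
  {ae leb, forall x, wD u x = v1 x} & {ae leb, forall x, wD (wD u) x = v2 x}].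
Proof.
move=> [[lu [g wg]] [lu1 [g1 wg1]] l0 l1 l2].
have w0 : weak_derivative u (wD u) by apply: xgetPex; exists g.
have w1 : weak_derivative (wD u) (wD (wD u)) by apply: xgetPex; exists g1.
have [U0 [a0 e0]] := weak_derivative_ac ((lintE u).2 lu) w0.
have [U1 [a1 e1]] := weak_derivative_ac ((lintE _).2 lu1) w1.
exists U0, U1, (wD (wD u)); split=> //=; last exact: aeW.
have c1 := ac_continuous a1.
split=> //=; first exact: ac_ae a0 (cont_lint c1) e1.
- exact: (L2_ae l0 (cont_meas (ac_continuous a0)) e0).
- exact: (L2_ae l1 (cont_meas c1) e1).
Qed.

Lemma rep_H2 s v v1 v2 u : H2r s v v1 v2 -> meas u -> {ae leb, forall x, u x = v x} ->
  [/\ H2 s u, {ae leb, forall x, wD u x = v1 x} & {ae leb, forall x, wD (wD u) x = v2 x}].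
Proof.
move=> [a0 a1 l0 l1 l2] mu e0.
have sy f g : {ae leb, forall x, f x = g x :> R} -> {ae leb, forall x, g x = f x}.
  by apply: aeS => x ->.
have c0 := cont_lint (ac_continuous a0); have c1 := cont_lint (ac_continuous a1).
have lu : lint u by exact: lint_ae c0 mu (sy _ _ e0).
have w0 : weak_derivative u v1.
  by apply: weak_derivative_ae (ac_weak_derivative a0) => //; [case: c0|exact: sy].
have w0' : weak_derivative u (wD u) by apply: xgetPex; exists v1.
have e1 := weak_derivative_unique lu w0' w0.
have lu1 : lint (wD u) by apply/lintE; case: w0'.
have w1 : weak_derivative (wD u) v2.
  apply: weak_derivative_ae (ac_weak_derivative a1); [by case: c1|by case: lu1|exact: sy].
have w1' : weak_derivative (wD u) (wD (wD u)) by apply: xgetPex; exists v2.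
have e2 := weak_derivative_unique lu1 w1' w1.
have lu2 : lint (wD (wD u)) by apply/lintE; case: w1'.
split=> //; split.
- by split; [exact/lintE|exists v1].
- by split; [exact/lintE|exists v2].
- by apply: L2_ae l0 mu (sy _ _ e0).
- by apply: L2_ae l1 _ (sy _ _ e1); case: lu1.
- by apply: L2_ae l2 _ (sy _ _ e2); case: lu2.
Qed.

Lemma H2norm_sqr s v v1 v2 u : H2r s v v1 v2 -> meas u -> {ae leb, forall x, u x = v x} ->
  H2norm s u ^+ 2 = nsq s v + nsq s v1 + nsq s v2.
Proof.
move=> Ht mu e0; have [Hu e1 e2] := rep_H2 Ht mu e0.
have [_ _ l0 l1 l2] := Hu; have [_ _ l0' l1' l2'] := Ht.
rewrite /H2norm sqr_sqrtr ?addr_ge0 ?sqr_ge0// !L2norm_sqr//.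
have [m1 m2] := (L2_meas l1, L2_meas l2); have [m0' [m1' m2']] := (L2_meas l0', (L2_meas l1', L2_meas l2')).
by rewrite /nsq (ip_ae s mu mu m0' m0' e0 e0) (ip_ae s m1 m1 m1' m1' e1 e1) (ip_ae s m2 m2 m2' m2' e2 e2).
Qed.

Lemma int_le_cell s g x : (if s is Circle L then 1 <= L else True) ->
  lint g -> integ s g -> (forall y, 0 <= g y) -> ae_periodic s g ->
  \int[leb]_(y in `[x, x + 1]) g y <= \int[leb]_(y in cell s) g y.
Proof.
case: s => [_ _ ig g0 _|L /= L1 lg ig g0 pg]; first exact: int_le_line.
have L0 : 0 <= L by lra.
rewrite -(int_period x lg pg L0); apply: int_subset => //; lra.
Qed.

(** On [[x, x + 1]] the minimum of [u^2] is at most its mean, and the product rule bounds the rise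
    from there to [x]. The constants are the same on the line and on every circle of length at least
    1, which the passage to long circles relies on. *)
Lemma sup_bound s u u' u2 x : (if s is Circle L then 1 <= L else True) -> H2r s u u' u2 ->
  u x ^+ 2 <= 2 * nsq s u + nsq s u'.
Proof.
move=> hs [a0 a1 l0 l1 l2].
have c0 : continuous u := ac_continuous a0; have c1 : continuous u' := ac_continuous a1.
have cs v : continuous v -> continuous (fun y => v y ^+ 2).
  by move=> cv y; under eq_fun do rewrite expr2; apply: cvgM; exact: cv.
have x1 : x <= x + 1 by lra.
have [|y yI Hy] := @EVT_min R (fun y => u y ^+ 2) x (x + 1) x1.
  exact/continuous_subspaceT/cs.
have hy : u y ^+ 2 <= \int[leb]_(y in `[x, x + 1]) u y ^+ 2.
  have -> : u y ^+ 2 = \int[leb]_(z in `[x, x + 1]) u y ^+ 2 by rewrite int_cst//; ring.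
  apply: le_int; [exact/cont_lint/cst_continuous|exact/cont_lint/cs|].
  by move=> z zI; apply: Hy; rewrite in_itv.
move: yI; rewrite in_itv/= => /andP[xy yx].
have P := acM a0 a0.
have E := P.2 _ _ xy.
have l3 : lint (fun z => u z ^+ 2 + u' z ^+ 2).
  by apply: lintD; exact/cont_lint/cs.
have B : u x ^+ 2 - u y ^+ 2 <= \int[leb]_(z in `[x, y]) (u z ^+ 2 + u' z ^+ 2).
  have -> : u x ^+ 2 - u y ^+ 2 = - (u y * u y - u x * u x) by ring.
  rewrite E -mulN1r -intZ; last by case: P.
  apply: le_int => //; first by apply: lintZ; case: P.
  have aux (p q : R) : -1 * (q * p + p * q) <= p ^+ 2 + q ^+ 2.
    rewrite -subr_ge0 (_ : _ - _ = (p + q) ^+ 2) ?sqr_ge0//; ring.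
  by move=> z _; exact: aux.
have B2 : \int[leb]_(z in `[x, y]) (u z ^+ 2 + u' z ^+ 2) <=
   \int[leb]_(z in `[x, x + 1]) (u z ^+ 2 + u' z ^+ 2).
  by apply: int_subset => // z _; rewrite addr_ge0 ?sqr_ge0.
rewrite [X in _ <= X]intD in B2; [|exact/cont_lint/cs..].
have C v : continuous v -> L2 s v -> \int[leb]_(z in `[x, x + 1]) v z ^+ 2 <= nsq s v.
  move=> cv /L2P[mv pv iv]; rewrite /nsq /L2inner.
  under [leRHS]eq_Rintegral do rewrite -expr2.
  apply: int_le_cell => //; [exact/cont_lint/cs|by move=> z; rewrite sqr_ge0|].
  by case: s hs l0 l1 l2 {iv} pv => //= L _ _ _ _; apply: aeS => z ->.
have := C u c0 l0; have := C u' c1 l1; lra.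
Qed.

End Sobolev.

(** * Symmetric operators on semi-inner product spaces *)

Section SemiInnerProduct.
Variable R : realType.

Lemma discriminant (a b c : R) : 0 <= c -> (forall t, 0 <= a - 2 * t * b + t ^+ 2 * c) ->
  b ^+ 2 <= a * c.
Proof.
move=> c0 H.
have [c1|] := ltP 0 c.
  have := H (b / c).
  have -> : a - 2 * (b / c) * b + (b / c) ^+ 2 * c = (a * c - b ^+ 2) / c.
    by field; rewrite gt_eqF.
  by rewrite pmulr_lge0 ?invr_gt0// subr_ge0.
move=> c1; have cz : c = 0 by apply/eqP; rewrite eq_le c0 c1.
rewrite cz mulr0 in H *.
have [->|b0] := eqVneq b 0; first by rewrite expr0n.
have := H ((a + 1) / (2 * b)); rewrite mulr0 addr0.
have -> : a - 2 * ((a + 1) / (2 * b)) * b = -1 by field; rewrite b0.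
by rewrite oppr_ge0 ler10.
Qed.

Definition lin (U V : lmodType R) (f : U -> V) := forall a u v, f (a *: u + v) = a *: f u + f v.

Section Lin.
Variables (U V : lmodType R) (f : U -> V) (lf : lin f).
Lemma linD u v : f (u + v) = f u + f v.
Proof. by have := lf 1 u v; rewrite !scale1r. Qed.
Lemma lin0 : f 0 = 0.
Proof. by have := linD 0 0; rewrite addr0 => /eqP; rewrite -{1}[f 0]addr0 (inj_eq (addrI _)) => /eqP. Qed.
Lemma linZ a u : f (a *: u) = a *: f u.
Proof. by have := lf a u 0; rewrite lin0 !addr0. Qed.
Lemma linN u : f (- u) = - f u.
Proof. by rewrite -scaleN1r linZ scaleN1r. Qed.
Lemma linB u v : f (u - v) = f u - f v.
Proof. by rewrite linD linN. Qed.
End Lin.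

Definition sip (V : lmodType R) (B : V -> V -> R) :=
  [/\ forall u v, B u v = B v u,
      forall a u v w, B (a *: u + v) w = a * B u w + B v w &
      forall u, 0 <= B u u].

Section Sip.
Variables (V : lmodType R) (B : V -> V -> R) (sB : sip B).

Lemma sipC u v : B u v = B v u. Proof. by case: sB. Qed.
Lemma sipP u : 0 <= B u u. Proof. by case: sB. Qed.
Lemma sipDl u v w : B (u + v) w = B u w + B v w.
Proof. by case: sB => _ l _; have := l 1 u v w; rewrite scale1r mul1r. Qed.
Lemma sip0l w : B 0 w = 0.
Proof. by have := sipDl 0 0 w; rewrite addr0; lra. Qed.
Lemma sipZl a u w : B (a *: u) w = a * B u w.
Proof. by case: sB => _ l _; have := l a u 0 w; rewrite addr0 sip0l addr0. Qed.
Lemma sipNl u w : B (- u) w = - B u w.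
Proof. by rewrite -scaleN1r sipZl mulN1r. Qed.
Lemma sipDr u v w : B w (u + v) = B w u + B w v.
Proof. by rewrite ![B w _]sipC sipDl. Qed.
Lemma sip0r w : B w 0 = 0. Proof. by rewrite sipC sip0l. Qed.
Lemma sipZr a u w : B w (a *: u) = a * B w u.
Proof. by rewrite ![B w _]sipC sipZl. Qed.
Lemma sipNr u w : B w (- u) = - B w u.
Proof. by rewrite ![B w _]sipC sipNl. Qed.

Definition sipE := (sipDl, sipDr, sipZl, sipZr, sipNl, sipNr, sip0l, sip0r).

Lemma cauchy_schwarz u v : B u v ^+ 2 <= B u u * B v v.
Proof.
apply: discriminant; first exact: sipP.
move=> t; have := sipP (u - t *: v); rewrite !sipE (sipC v u).
by congr (_ <= _); ring.
Qed.

Definition nrm u := Num.sqrt (B u u).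

Lemma nrm_ge0 u : 0 <= nrm u. Proof. exact: sqrtr_ge0. Qed.
Lemma nrm_sqr u : nrm u ^+ 2 = B u u. Proof. by rewrite sqr_sqrtr ?sipP. Qed.
Lemma cs_nrm u v : `|B u v| <= nrm u * nrm v.
Proof.
rewrite -(ler_sqr (x := `|_|)) ?nnegrE ?mulr_ge0 ?nrm_ge0//.
by rewrite real_normK ?num_real// exprMn !nrm_sqr cauchy_schwarz.
Qed.
Lemma nrmD u v : nrm (u + v) <= nrm u + nrm v.
Proof.
rewrite -ler_sqr ?nnegrE ?addr_ge0 ?nrm_ge0// nrm_sqr !sipE (sipC v u) sqrrD !nrm_sqr.
have := le_trans (ler_norm _) (cs_nrm u v); rewrite mulr2n; lra.
Qed.
Lemma nrmZ a u : nrm (a *: u) = `|a| * nrm u.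
Proof. by rewrite /nrm !sipE mulrA -expr2 sqrtrM ?sqr_ge0// sqrtr_sqr. Qed.
Lemma nrmN u : nrm (- u) = nrm u.
Proof. by rewrite /nrm !sipE opprK. Qed.
Lemma nrmB u v : nrm (u - v) <= nrm u + nrm v.
Proof. by rewrite -(nrmN v) nrmD. Qed.
Lemma nrmBC u v : nrm (u - v) = nrm (v - u). Proof. by rewrite -nrmN opprB. Qed.
Lemma nrm0 : nrm 0 = 0. Proof. by rewrite /nrm sip0l sqrtr0. Qed.
Lemma nrm_le_dist u v : nrm u <= nrm v + nrm (u - v).
Proof. by rewrite -{1}[u](subrK v) [X in nrm X]addrC nrmD. Qed.

(** Stands for equality almost everywhere: the form is only semidefinite, and the lemmas below say
    that norms and products respect it. *)
Definition eqv u v := nrm (u - v) = 0.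
Lemma eqv_refl u : eqv u u. Proof. by rewrite /eqv subrr nrm0. Qed.
Lemma eqv_sym u v : eqv u v -> eqv v u. Proof. by rewrite /eqv nrmBC. Qed.
Lemma nrm_le0 u : nrm u <= 0 -> nrm u = 0.
Proof. by move=> h; apply/eqP; rewrite eq_le h nrm_ge0. Qed.
Lemma eqv_trans u v w : eqv u v -> eqv v w -> eqv u w.
Proof.
move=> h1 h2; apply: nrm_le0; apply: le_trans (_ : nrm (u - v) + nrm (v - w) <= 0).
  by rewrite (le_trans _ (nrmD _ _))// addrA subrK.
by rewrite h1 h2 addr0.
Qed.
Lemma eqvD u v u' v' : eqv u u' -> eqv v v' -> eqv (u + v) (u' + v').
Proof.
move=> h1 h2; apply: nrm_le0; rewrite opprD addrACA.
by apply: le_trans (nrmD _ _) _; rewrite h1 h2 addr0.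
Qed.
Lemma eqvZ a u v : eqv u v -> eqv (a *: u) (a *: v).
Proof. by move=> h; rewrite /eqv -scalerBr nrmZ h mulr0. Qed.
Lemma eqvN u v : eqv u v -> eqv (- u) (- v).
Proof. by move=> h; rewrite -[- u]scaleN1r -[- v]scaleN1r; exact: eqvZ. Qed.
Lemma eqvB u v u' v' : eqv u u' -> eqv v v' -> eqv (u - v) (u' - v').
Proof. by move=> h1 h2; apply: eqvD => //; exact: eqvN. Qed.
Lemma eqv_ipl u v w : eqv u v -> B u w = B v w.
Proof.
move=> h; apply/eqP; rewrite -subr_eq0 -sipNl -sipDl -normr_le0.
by apply: le_trans (cs_nrm _ _) _; rewrite h mul0r.
Qed.
Lemma eqv_ipr u v w : eqv u v -> B w u = B w v.
Proof. by move=> h; rewrite ![B w _]sipC; exact: eqv_ipl. Qed.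
Lemma eqv_nrm u v : eqv u v -> nrm u = nrm v.
Proof. by move=> h; rewrite /nrm (eqv_ipl _ h) (eqv_ipr _ h). Qed.
Lemma nrm_eq0 u : nrm u = 0 <-> B u u = 0.
Proof.
by rewrite -nrm_sqr; split => [->|/eqP]; [rewrite expr0n|rewrite sqrf_eq0 => /eqP].
Qed.
Lemma nrm_gt0 u : 0 < nrm u <-> 0 < B u u.
Proof. by rewrite -nrm_sqr exprn_even_gt0//= lt0r nrm_ge0 andbT. Qed.

End Sip.

Record hspace := Hspace {
  hX :> lmodType R;
  hip : hX -> hX -> R;
  hsip : sip hip;
  hcomplete : forall u : nat -> hX,
    (forall e, 0 < e -> exists N, forall m n, (N <= m)%N -> (N <= n)%N ->
       nrm hip (u m - u n) <= e) ->
    exists l, forall e, 0 < e -> exists N, forall n, (N <= n)%N -> nrm hip (u n - l) <= e }.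

End SemiInnerProduct.
Arguments hip {R h}.

Section ProductSpace.
Variables (R : realType) (S T : hspace R).

Definition prod_ip (u v : (S * T)%type) : R := hip u.1 v.1 + hip u.2 v.2.

Lemma prod_sip : sip (prod_ip : (S * T)%type -> (S * T)%type -> R).
Proof.
have sS := hsip S; have sT := hsip T; split=> [u v|a u v w|u]; rewrite /prod_ip.
- by rewrite (sipC sS) (sipC sT).
- by rewrite /= !(sipE sS) !(sipE sT); ring.
- by rewrite addr_ge0// sipP.
Qed.

Lemma prod_nrm_ge1 (u : (S * T)%type) : nrm hip u.1 <= nrm prod_ip u.
Proof.
rewrite -ler_sqr ?nnegrE ?nrm_ge0// (nrm_sqr (hsip S)) (nrm_sqr prod_sip).
by rewrite lerDl (sipP (hsip T)).
Qed.

Lemma prod_nrm_ge2 (u : (S * T)%type) : nrm hip u.2 <= nrm prod_ip u.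
Proof.
rewrite -ler_sqr ?nnegrE ?nrm_ge0// (nrm_sqr (hsip T)) (nrm_sqr prod_sip).
by rewrite lerDr (sipP (hsip S)).
Qed.

Lemma prod_nrm_le (u : (S * T)%type) : nrm prod_ip u <= nrm hip u.1 + nrm hip u.2.
Proof.
have p1 := nrm_ge0 (@hip R S) u.1; have p2 := nrm_ge0 (@hip R T) u.2.
rewrite -ler_sqr ?nnegrE ?nrm_ge0 ?addr_ge0// (nrm_sqr prod_sip) /prod_ip.
rewrite -(nrm_sqr (hsip S)) -(nrm_sqr (hsip T)); nra.
Qed.

Lemma prod_complete (u : nat -> (S * T)%type) :
    (forall e, 0 < e -> exists N, forall m n, (N <= m)%N -> (N <= n)%N ->
       nrm prod_ip (u m - u n) <= e) ->
    exists l, forall e, 0 < e -> exists N, forall n, (N <= n)%N -> nrm prod_ip (u n - l) <= e.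
Proof.
move=> cu.
have [|l1 H1] := @hcomplete R S (fun n => (u n).1).
  move=> e /cu[N HN]; exists N => m n Nm Nn.
  exact: le_trans (prod_nrm_ge1 (u m - u n)) (HN m n Nm Nn).
have [|l2 H2] := @hcomplete R T (fun n => (u n).2).
  move=> e /cu[N HN]; exists N => m n Nm Nn.
  exact: le_trans (prod_nrm_ge2 (u m - u n)) (HN m n Nm Nn).
exists (l1, l2) => e e0; have e2 : 0 < e / 2 by rewrite divr_gt0.
have [N1 h1] := H1 _ e2; have [N2 h2] := H2 _ e2.
exists (maxn N1 N2) => n; rewrite geq_max => /andP[n1 n2].
apply: le_trans (prod_nrm_le _) _; rewrite [e]splitr.
by apply: lerD; [exact: h1|exact: h2].
Qed.

Definition prodh : hspace R := Hspace prod_sip prod_complete.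

End ProductSpace.

(** * Solvability from a lower bound for the adjoint *)

Section Continuity.
Variables (R : realType) (S : hspace R) (Y : lmodType R) (i : Y -> S).
Hypothesis li : lin i.
Implicit Types (A : Y -> S) (B : S -> S).
Notation no := (nrm hip).
Notation "u ~~> v" := (eqv hip u v) (at level 70).

(** The domain [Y] carries no norm; it is seen only through the embedding [i], and unbounded
    operators are maps [Y -> S]. *)
Definition solv A := forall f, exists y, A y ~~> f.
Definition lb A C := forall y, no (i y) <= C * no (A y).
Definition bdd B b := forall u, no (B u) <= b * no u.

Lemma banach (F : S -> S) q : 0 <= q < 1 -> (forall u v, no (F u - F v) <= q * no (u - v)) ->
  exists u, F u ~~> u.
Proof.
move=> /andP[q0 q1] HF; have sS := hsip S.
pose u n := iter n F 0.
have d n : no (u n.+1 - u n) <= q ^+ n * no (u 1%N - u 0%N).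
  elim: n => [|n IH]; first by rewrite expr0 mul1r.
  by apply: le_trans (HF _ _) _; rewrite exprS -mulrA ler_wpM2l.
set K := no (u 1%N - u 0%N) in d; have K0 : 0 <= K by exact: nrm_ge0.
have p0 : 0 < 1 - q by rewrite subr_gt0.
have dd n k : (1 - q) * no (u (n + k)%N - u n) <= q ^+ n * K * (1 - q ^+ k).
  elim: k => [|k IH]; first by rewrite addn0 subrr (nrm0 sS) expr0 subrr !mulr0.
  rewrite addnS.
  have -> : u (n + k).+1 - u n = (u (n + k).+1 - u (n + k)%N) + (u (n + k)%N - u n).
    by rewrite addrA subrK.
  apply: le_trans (ler_wpM2l (ltW p0) (nrmD sS _ _)) _; rewrite mulrDr.
  apply: le_trans (lerD (ler_wpM2l (ltW p0) (d _)) IH) _.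
  rewrite exprD exprS -subr_ge0.
  set a := q ^+ n; set c := q ^+ k.
  have -> : a * K * (1 - q * c) - ((1 - q) * (a * c * K) + a * K * (1 - c)) = 0 by ring.
  exact: lexx.
have dd2 n k : no (u (n + k)%N - u n) <= q ^+ n * (K / (1 - q)).
  rewrite mulrA ler_pdivlMr// mulrC; apply: le_trans (dd n k) _.
  by rewrite ler_piMr ?mulr_ge0 ?exprn_ge0// gerBl exprn_ge0.
have small e : 0 < e -> exists N, forall n, (N <= n)%N -> q ^+ n * (K / (1 - q)) <= e.
  move=> e0; have K1 : 0 < K / (1 - q) + 1 by rewrite ltr_wpDl ?divr_ge0// ltW.
  have := @cvg_expr _ q; rewrite ger0_norm// => /(_ q1) /cvgrPdist_le.
  move=> /(_ (e / (K / (1 - q) + 1))) []; first by rewrite divr_gt0.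
  move=> N _ HN; exists N => n Nn; have := HN n Nn.
  rewrite /= sub0r normrN ger0_norm ?exprn_ge0// ler_pdivlMr//; apply: le_trans.
  by rewrite ler_wpM2l ?exprn_ge0// lerDl.
have [|l Hl] := @hcomplete R S u.
  move=> e e0; have [N HN] := small _ e0.
  exists N => m n Nm Nn; case/orP: (leq_total m n) => mn.
    by rewrite (nrmBC sS) -(subnKC mn); apply: le_trans (dd2 _ _) _; exact: HN.
  by rewrite -(subnKC mn); apply: le_trans (dd2 _ _) _; exact: HN.
exists l; apply: nrm_le0; apply/ler_addgt0Pl => e e0; rewrite addr0.
have e2 : 0 < e / 2 by rewrite divr_gt0.
have [N HN] := Hl _ e2.
have -> : F l - l = (F l - F (u N)) + (u N.+1 - l) by rewrite addrA subrK.
apply: le_trans (nrmD sS _ _) _; rewrite [e]splitr; apply: lerD; last exact: HN.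
apply: le_trans (HF _ _) _; rewrite (nrmBC sS); apply: le_trans (HN N (leqnn _)).
by rewrite ler_piMl ?nrm_ge0// ltW.
Qed.

(* [u |-> u - (c / b ^ 2) (P u - f)] is a contraction. *)
Lemma monotone_surjective (P : S -> S) b c : 0 < c -> 0 < b ->
  (forall u v, no (P u - P v) <= b * no (u - v)) ->
  (forall u v, c * hip (u - v) (u - v) <= hip (P u - P v) (u - v)) ->
  forall f, exists u, P u ~~> f.
Proof.
move=> c0 b0 bP cP f; have sS := hsip S.
pose B := b + c; have B0 : 0 < B by rewrite addr_gt0.
have cB : c <= B by rewrite lerDr ltW.
have bP' u v : no (P u - P v) <= B * no (u - v).
  by apply: le_trans (bP u v) _; rewrite ler_wpM2r ?nrm_ge0// lerDl ltW.
pose r := c / B ^+ 2; have r0 : 0 < r by rewrite divr_gt0 ?exprn_gt0.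
pose Q := 1 - c ^+ 2 / B ^+ 2.
have Q0 : 0 <= Q by rewrite subr_ge0 ler_pdivrMr ?exprn_gt0// mul1r ler_sqr ?nnegrE ?(ltW c0) ?(ltW B0).
have Q1 : Q < 1 by rewrite gtrBl divr_gt0 ?exprn_gt0.
have [||u Hu] := @banach (fun u => u - r *: (P u - f)) (Num.sqrt Q).
- by rewrite sqrtr_ge0/= -[ltRHS]sqrtr1 ltr_sqrt.
- move=> u v.
  have -> : u - r *: (P u - f) - (v - r *: (P v - f)) = (u - v) - r *: (P u - P v).
    have -> : P u - P v = (P u - f) - (P v - f) by rewrite opprB addrA subrK.
    by rewrite [in RHS]scalerBr; move: (r *: _) (r *: _) => x y; rewrite !opprB [LHS]addrACA [RHS]addrACA [- _ - v]addrC.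
  rewrite -ler_sqr ?nnegrE ?mulr_ge0 ?nrm_ge0 ?sqrtr_ge0// exprMn (sqr_sqrtr Q0).
  have : no (P u - P v) ^+ 2 <= (B * no (u - v)) ^+ 2.
    by rewrite ler_sqr ?nnegrE ?mulr_ge0 ?nrm_ge0 ?(ltW B0).
  rewrite exprMn.
  have := cP u v; move: (P u - P v) (u - v) => p e; rewrite !(nrm_sqr sS) !(sipE sS) (sipC sS e).
  move: (hip e e) (hip p e) (hip p p) => E pe pp h1 h2.
  have rB : r * B ^+ 2 = c by rewrite divfK// expf_neq0 ?gt_eqF.
  have -> : Q = 1 - r * c by rewrite /Q /r expr2 mulrAC.
  have h3 := ler_wpM2l (ltW r0) h1; have h4 := ler_wpM2l (sqr_ge0 r) h2.
  have h5 : r ^+ 2 * (B ^+ 2 * E) = r * c * E by rewrite -rB; ring.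
  rewrite h5 in h4; move: h3 h4.
  have -> : E - r * pe + (- (r * pe) - r * - (r * pp)) = E - 2 * (r * pe) + r ^+ 2 * pp by ring.
  move: (r ^+ 2 * pp) (r * pe) => x y; rewrite mulrA; have -> : (1 - r * c) * E = E - r * c * E by ring.
  move: (r * c * E) => z; lra.
exists u; apply: nrm_le0; rewrite -(ler_pM2l r0) mulr0 -{1}(ger0_norm (ltW r0)) -(nrmZ sS).
move: Hu; rewrite /eqv addrAC subrr add0r (nrmN sS) => ->; exact: lexx.
Qed.

(* With [T = (A + B) A^-1] and its adjoint [T'], the map [T T'] is bounded and coercive. *)
Lemma solv_adjoint A A' B B' (C0 C b : R) : lin A -> lin A' -> lin B -> lin B' ->
  (forall y z, hip (A y) (i z) = hip (i y) (A' z)) ->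
  (forall u v, hip (B u) v = hip u (B' v)) ->
  solv A -> solv A' -> lb A C0 -> lb A' C0 -> bdd B b -> bdd B' b ->
  0 <= C0 -> 0 <= C -> 0 <= b ->
  lb (fun y => A' y + B' (i y)) C -> solv (fun y => A y + B (i y)).
Proof.
move=> lA lA' lB lB' adA adB oA oA' bA bA' bB bB' C00 C1 b0 bAB f; have sS := hsip S.
have [g Hg] := choice oA; have [g' Hg'] := choice oA'.
(* Here [s] is [T' = 1 + A'^-1 B'] and [P] is [T T'], with the inverses replaced by chosen
   preimages. These need not be linear, but their differences solve the difference equations up to
   zero distance. *)
pose y' u := g' (B' u); pose s u := u + i (y' u); pose P u := s u + B (i (g (s u))).
have D u v : let e := u - v in let ds := s u - s v in
    [/\ no (P u - P v) <= (1 + b * C0) * no ds, no ds <= (1 + C0 * b) * no e,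
     no e <= (1 + C * b) * no ds & hip (P u - P v) e = hip ds ds].
  set dy' := y' u - y' v; move=> e ds.
  have h1 : A' dy' ~~> B' e by rewrite (linB lA') (linB lB'); apply: (eqvB sS); exact: Hg'.
  have dsE : ds = e + i dy' by rewrite /ds /s (linB li) opprD addrACA.
  set dy := g (s u) - g (s v).
  have h2 : A dy ~~> ds by rewrite (linB lA); apply: (eqvB sS); exact: Hg.
  have PE : P u - P v = ds + B (i dy) by rewrite /P (linB li) (linB lB) opprD addrACA.
  split.
  - rewrite PE mulrDl mul1r; apply: le_trans (nrmD sS _ _) _; rewrite lerD2l.
    apply: le_trans (bB _) _; rewrite -mulrA ler_wpM2l// -(eqv_nrm sS h2); exact: bA.
  - rewrite dsE mulrDl mul1r; apply: le_trans (nrmD sS _ _) _; rewrite lerD2l.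
    apply: le_trans (bA' _) _; rewrite (eqv_nrm sS h1) -mulrA ler_wpM2l//; exact: bB'.
  - have -> : e = ds - i dy' by rewrite dsE addrK.
    rewrite mulrDl mul1r; apply: le_trans (nrmB sS _ _) _; rewrite lerD2l.
    apply: le_trans (bAB _) _; rewrite -mulrA ler_wpM2l//.
    have : A' dy' + B' (i dy') ~~> B' ds.
      by rewrite dsE (linD lB'); apply: (eqvD sS h1); exact: eqv_refl.
    move=> /(eqv_nrm sS) ->; exact: bB'.
  - rewrite PE (sipDl sS) adB -(eqv_ipr sS _ h1) -adA (eqv_ipl sS _ h2) -(sipDr sS).
    by rewrite -dsE.
have c0 : 0 < 1 + C * b by rewrite ltr_wpDr// mulr_ge0.
have d0 : 0 < (1 + b * C0) * (1 + C0 * b) by rewrite mulr_gt0// ltr_wpDr// mulr_ge0.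
have [|||u Hu] := @monotone_surjective P _ ((1 + C * b) ^- 2) _ d0 _ _ f; last first.
- exists (g (s u)); apply: eqv_trans Hu => //.
  by apply: (eqvD sS); [exact: Hg|exact: eqv_refl].
- move=> u v; have [_ _ h ->] := D u v; rewrite mulrC ler_pdivrMr ?exprn_gt0// -!(nrm_sqr sS).
  by rewrite mulrC -exprMn ler_sqr ?nnegrE ?mulr_ge0 ?nrm_ge0// ltW.
- move=> u v; have [h1 h2 _ _] := D u v; apply: le_trans h1 _; rewrite -mulrA ler_wpM2l//.
  by rewrite addr_ge0// mulr_ge0.
- by rewrite invr_gt0 exprn_gt0.
Qed.

End Continuity.

Section LinearMaps.
Variables (R : realType) (U V W : lmodType R).
Lemma lin_add (f g : U -> V) : lin f -> lin g -> lin (fun y => f y + g y).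
Proof. by move=> lf lg a u v; rewrite lf lg scalerDr addrACA. Qed.
Lemma lin_comp (f : U -> V) (g : V -> W) : lin f -> lin g -> lin (fun y => g (f y)).
Proof. by move=> lf lg a u v; rewrite lf lg. Qed.
Lemma lin_scale k (f : U -> V) : lin f -> lin (fun y => k *: f y).
Proof. by move=> lf a u v; rewrite lf scalerDr !scalerA mulrC. Qed.
End LinearMaps.

(** * Symmetric operators and constrained minimization *)

Section SymmetricOperators.
Variables (R : realType) (S : hspace R) (Y : lmodType R) (i : Y -> S).
Hypothesis li : lin i.
Implicit Types (A : Y -> S) (B W : S -> S).
Notation no := (nrm hip).
Notation "u ~~> v" := (eqv hip u v) (at level 70).
Let sS := hsip S.

Definition symop A := forall y z, hip (A y) (i z) = hip (A z) (i y).
Definition symb W := forall u v : S, hip (W u) v = hip (W v) u.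
Definition coer A (c : R) := forall y, c * hip (i y) (i y) <= hip (A y) (i y).

Lemma form_sip A : lin A -> symop A -> coer A 0 -> sip (fun y z => hip (A y) (i z)).
Proof.
move=> lA sA pA; split => // [a u v w|u]; first by rewrite lA !(sipE sS).
by have := pA u; rewrite mul0r.
Qed.

Lemma coer_lb A c : 0 < c -> coer A c -> lb i A c^-1.
Proof.
move=> c0 H y; rewrite mulrC ler_pdivlMr//.
have [h|h] := ltP 0 (no (i y)); last first.
  have -> : no (i y) = 0 by apply/eqP; rewrite eq_le h nrm_ge0.
  by rewrite mul0r nrm_ge0.
rewrite -(ler_pM2r h) mulrAC -expr2 (nrm_sqr sS) mulrC.
by apply: le_trans (H y) _; apply: le_trans (ler_norm _) (cs_nrm sS _ _).
Qed.

(* [y] is paired with the solution of [A z = i y] through the positive form of [A]. *)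
Lemma coer_of_inverse A C : lin A -> symop A -> coer A 0 -> solv A -> lb i A C -> 0 < C ->
  coer A C^-1.
Proof.
move=> lA sA pA oA lbA C0 y; have sF := form_sip lA sA pA.
have [z Hz] := oA (i y).
set N := hip (i y) (i y); have N0 : 0 <= N by exact: sipP.
rewrite mulrC ler_pdivrMr// mulrC.
have E : hip (A z) (i y) = N by rewrite (eqv_ipl sS _ Hz).
have Z : hip (A z) (i z) <= C * N.
  rewrite (eqv_ipl sS _ Hz); apply: le_trans (ler_norm _) _.
  apply: le_trans (cs_nrm sS _ _) _.
  have h : no (i z) <= C * no (i y) by rewrite -(eqv_nrm sS Hz); exact: lbA.
  apply: le_trans (ler_wpM2l (nrm_ge0 _ _) h) _.
  by rewrite mulrCA -expr2 (nrm_sqr sS).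
have := cauchy_schwarz sF z y; rewrite /= E => h.
have [N1|] := ltP 0 N; last by move=> N1; rewrite (le_trans N1)// mulr_ge0 ?(ltW C0)//; have := pA y; rewrite mul0r.
have p := pA y; rewrite mul0r in p.
rewrite -(ler_pM2r N1) -expr2; apply: le_trans h _.
by rewrite mulrAC ler_wpM2r.
Qed.

(** The operator is its own adjoint, so its lower bound is the one required of the adjoint. *)
Lemma solv_symmetric A0 W d b C : lin A0 -> lin W -> symop A0 -> symb W ->
  coer A0 d -> 0 < d -> solv A0 -> bdd W b -> 0 <= b ->
  lb i (fun y => A0 y + W (i y)) C -> 0 <= C -> solv (fun y => A0 y + W (i y)).
Proof.
move=> lA lW sA sW cA d0 oA bW b0 H C0.
have lbA := coer_lb d0 cA.
apply: (@solv_adjoint _ _ _ _ li A0 A0 W W d^-1 C b) => //.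
- by move=> y z; rewrite sA (sipC sS).
- by move=> u v; rewrite sW (sipC sS).
- by rewrite invr_ge0 ltW.
Qed.

(* [W] is compact on the form domain of [A0], tested in the quadratic form of [W]. *)
Definition rel_compact (A0 : Y -> S) (W : S -> S) := forall (y : nat -> Y) (M : R),
  (forall k, hip (i (y k)) (i (y k)) <= M) -> (forall k, hip (A0 (y k)) (i (y k)) <= M) ->
  exists s : nat -> nat, (forall k, (k <= s k)%N) /\
    forall e, 0 < e -> exists N, forall j k, (N <= j)%N -> (N <= k)%N ->
      hip (W (i (y (s j)) - i (y (s k)))) (i (y (s j)) - i (y (s k))) <= e.

(** The form of [A] is minimized over unit vectors orthogonal to the eigenvector [e]. A positive
    infimum is the gap. Otherwise a minimizing sequence has a subsequence that converges in [S], the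
    limit satisfies the eigenvalue equation weakly, and solvability of [A0] returns it to the
    domain. *)
Lemma gap_or_eigenvector (A0 A : Y -> S) W d b r (e : Y) :
  lin A0 -> lin W -> symop A0 -> symb W -> coer A0 d -> 0 < d -> solv A0 -> bdd W b ->
  rel_compact A0 W ->
  (forall y, A y = A0 y - W (i y)) ->
  A e ~~> r *: i e ->
  (exists c, 0 < c /\ forall y, hip (i y) (i e) = 0 -> c * hip (i y) (i y) <= hip (A y) (i y)) \/
  (exists m y, [/\ m <= 0, 0 < hip (i y) (i y), hip (i y) (i e) = 0 & A y ~~> m *: i y]).
Proof.
move=> lA0 lW sA0 sW cA0 d0 oA0 bW cW AE He.
have lA : lin A.
  by move=> a u v; rewrite !AE lA0 li lW opprD scalerBr addrACA.
have sA : symop A by move=> y z; rewrite !AE !(sipE sS) sA0 sW.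
pose q y := hip (A y) (i y).
pose N y := hip (i y) (i y).
have N0 y : 0 <= N y by exact: sipP.
have Wb y : `|hip (W (i y)) (i y)| <= b * N y.
  apply: le_trans (cs_nrm sS _ _) _.
  by rewrite /N -(nrm_sqr sS) expr2 mulrA ler_wpM2r ?nrm_ge0.
pose E := [set q y | y in [set y | N y = 1 /\ hip (i y) (i e) = 0]].
have qZ a y : q (a *: y) = a ^+ 2 * q y.
  by rewrite /q (linZ lA) (linZ li) !(sipE sS); ring.
have NZ a y : N (a *: y) = a ^+ 2 * N y.
  by rewrite /N (linZ li) !(sipE sS); ring.
have qN y : N y = 0 -> q y = 0.
  move=> Ny; apply/eqP; rewrite -normr_le0; apply: le_trans (cs_nrm sS _ _) _.
  by rewrite (nrm_eq0 sS (i y)).2// mulr0.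
have scal y : hip (i y) (i e) = 0 -> 0 < N y -> E (q y / N y).
  move=> ye Ny; exists ((Num.sqrt (N y))^-1 *: y); last first.
    by rewrite qZ exprVn sqr_sqrtr// mulrC.
  rewrite /= NZ exprVn sqr_sqrtr// mulVf ?gt_eqF//; split=> //.
  by rewrite (linZ li) (sipE sS) ye mulr0.
have [[y0 [y0e Ny0]]|noE] := pselect (exists y, hip (i y) (i e) = 0 /\ 0 < N y); last first.
  left; exists 1; split=> // y ye; rewrite mul1r.
  have Ny : N y = 0.
    by apply/eqP; rewrite eq_le N0 andbT leNgt; apply/negP => h; apply: noE; exists y.
  by rewrite -/(N y) -/(q y) Ny qN.
have E0 : E !=set0 by exists (q y0 / N y0); exact: scal.
have Elb : has_lbound E.
  exists (- b) => _ [y [Ny _] <-]; rewrite /q AE !(sipE sS).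
  have := cA0 y; have := Wb y; rewrite -/(N y) Ny ler_norml => /andP[_ h1] h2.
  move: (hip (A0 y) _) (hip (W _) _) h1 h2 => p1 p2; lra.
pose m := inf E.
have mq y : hip (i y) (i e) = 0 -> m * N y <= q y.
  move=> ye; have [Ny|] := ltP 0 (N y).
    by rewrite -ler_pdivlMr//; apply: ge_inf => //; exact: scal.
  move=> h; have Ny : N y = 0 by apply/eqP; rewrite eq_le h N0.
  by rewrite Ny mulr0 qN.
have [m0|m0] := ltP 0 m; first by left; exists m; split.
right.
have mk k : exists y, [/\ N y = 1, hip (i y) (i e) = 0 & q y <= m + k.+1%:R^-1].
  have [] := @inf_adherent R E k.+1%:R^-1 _ (conj E0 Elb); first by rewrite invr_gt0.
  by move=> _ [y [Ny ye] <-] h; exists y; split=> //; exact: ltW.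
have [y Hy] := choice mk.
have small (e1 : R) : 0 < e1 -> exists n0, forall k, (n0 <= k)%N -> k.+1%:R^-1 <= e1.
  move=> e10; exists (Num.bound e1^-1) => k hk; rewrite invf_ple ?posrE//.
  apply: le_trans (ltW (archi_boundP _)) _; first by rewrite invr_ge0 ltW.
  by rewrite ler_nat ltnW.
have [||s [sk Hs]] := cW y (1 + `|b| + 1).
- by move=> k; rewrite -/(N (y k)); case: (Hy k) => -> _ _; rewrite -addrA lerDl addr_ge0.
- move=> k; case: (Hy k) => Ny _; rewrite /q AE !(sipE sS) => h.
  have := Wb (y k); rewrite Ny ler_norml => /andP[_ h1].
  have h2 : k.+1%:R^-1 <= 1 :> R by rewrite invf_ple ?posrE// invr1 ler1n.
  have := ler_norm b; move: k.+1%:R^-1 h h2 => r1 h h2.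
  move: (hip (A0 _) _) (hip (W _) _) h h1 => p1 p2 h h1 hb; lra.
pose z k := y (s k).
(* Parallelogram identity: the form at [z j + z k] is at least [m * (4 - N (z j - z k))], so the
   form at the difference is small because [m <= 0]. Adding the [W] term restores the form of [A0],
   which is coercive. *)
have zz j k : d * N (z j - z k) <= 2 * (s j).+1%:R^-1 + 2 * (s k).+1%:R^-1 +
    hip (W (i (z j) - i (z k))) (i (z j) - i (z k)).
  have [N1 e1 q1] := Hy (s j); have [N2 e2 q2] := Hy (s k).
  have o1 : hip (i (z j + z k)) (i e) = 0 by rewrite (linD li) (sipE sS) e1 e2 addr0.
  have := mq _ o1; have := cA0 (z j - z k).
  have := Wb (z j - z k).
  have Np : N (z j + z k) = 4 - N (z j - z k).
    have : N (z j + z k) + N (z j - z k) = 2 * N (z j) + 2 * N (z k).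
      by rewrite /N (linB li) (linD li) !(sipE sS); ring.
    by rewrite N1 N2; lra.
  have qp : q (z j + z k) = 2 * q (z j) + 2 * q (z k) - q (z j - z k).
    by rewrite /q !(linD li, linN li, linD lA, linN lA) !(sipE sS); ring.
  rewrite Np qp.
  have -> : hip (A0 (z j - z k)) (i (z j - z k)) = q (z j - z k) + hip (W (i (z j) - i (z k))) (i (z j) - i (z k)).
    by rewrite /q AE -(linB li) (sipDl sS) (sipNl sS) subrK.
  rewrite -/(N _); have := N0 (z j - z k).
  move: (N _) (q (z j - z k)) (q (z j)) (q (z k)) q1 q2 (hip (W (i (z j) - _)) _) => n1 q3 q4 q5 q1 q2 w h0 _ h2 h3.
  have h4 : m * n1 <= 0 by rewrite mulr_le0_ge0.
  move: (s j).+1%:R^-1 (s k).+1%:R^-1 q1 q2 => r1 r2 q1 q2.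
  clear -h2 h3 h4 q1 q2; lra.
have [|u Hu] := @hcomplete R S (fun k => i (z k)).
  move=> e1 e10; have e2 : 0 < d * e1 ^+ 2 / 5 by rewrite divr_gt0 ?mulr_gt0 ?exprn_gt0.
  have [n1 H1] := Hs _ e2; have [n2 H2] := small _ e2.
  exists (maxn n1 n2) => j k; rewrite !geq_max => /andP[j1 j2] /andP[k1 k2].
  rewrite -(ler_sqr (x := nrm _ _)) ?nnegrE ?nrm_ge0 ?(ltW e10)// (nrm_sqr sS) -(linB li) -/(N _).
  rewrite -(ler_pM2l d0); apply: le_trans (zz j k) _.
  have := H1 j k j1 k1; have := H2 _ (leq_trans j2 (sk j)); have := H2 _ (leq_trans k2 (sk k)).
  rewrite -/(z j) -/(z k).
  move: (hip (W (i (z j) - i (z k))) (i (z j) - i (z k))) (s j).+1%:R^-1 (s k).+1%:R^-1 (e1 ^+ 2) => w r1 r2 ee; lra.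
have lim w c : (forall k, hip (i (z k)) w = c) -> hip u w = c.
  move=> H; apply/eqP; rewrite -subr_eq0 -normr_le0; apply/ler_addgt0Pl => e1 e10; rewrite addr0.
  have w0 : 0 < no w + 1 by rewrite ltr_wpDl// nrm_ge0.
  have [n1 H1] := Hu _ (divr_gt0 e10 w0).
  have -> : hip u w - c = - hip (i (z n1) - u) w by rewrite -(H n1) !(sipE sS) opprB.
  rewrite normrN; apply: le_trans (cs_nrm sS _ _) _.
  apply: le_trans (ler_wpM2r (nrm_ge0 _ _) (H1 n1 (leqnn _))) _.
  by rewrite mulrAC ler_pdivrMr// ler_wpM2l ?(ltW e10)// lerDl.
have ue : hip u (i e) = 0 by apply: lim => k; case: (Hy (s k)).
have Nu : hip u u = 1.
  apply/eqP; rewrite -subr_eq0 -normr_le0; apply/ler_addgt0Pl => e1 e10; rewrite addr0.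
  have w0 : 0 < no u + 1 by rewrite ltr_wpDl// nrm_ge0.
  have [n1 H1] := Hu _ (divr_gt0 e10 w0).
  have [Nz _ _] := Hy (s n1).
  have nz : no (i (z n1)) = 1.
    by apply/eqP; rewrite -(@eqrXn2 _ 2) ?nrm_ge0// (nrm_sqr sS) expr1n -/(N _) Nz.
  have -> : hip u u - 1 = - (hip (i (z n1) - u) u + hip (i (z n1)) (i (z n1) - u)).
    by rewrite -Nz /N !(sipE sS) /z; ring.
  rewrite normrN; apply: le_trans (ler_normD _ _) _.
  apply: le_trans (lerD (cs_nrm sS _ _) (cs_nrm sS _ _)) _.
  rewrite nz mul1r -[X in _ + X]mulr1 -mulrDr.
  apply: le_trans (ler_wpM2r (ltW w0) (H1 n1 (leqnn _))) _.
  by rewrite divfK// gt_eqF.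
pose qm y1 y2 := hip (A y1 - m *: i y1) (i y2).
(* First variation without differentiating: the form of [A - m] is nonnegative on the constraint
   space and almost zero at [z k], so by the discriminant inequality its pairing with any [v] tends
   to 0. *)
have orth v : hip (i v) (i e) = 0 -> hip u (A v - m *: i v) = 0.
  move=> ve; apply/eqP; rewrite -normr_le0; apply/ler_addgt0Pl => e1 e10; rewrite addr0.
  pose v1 := A v - m *: i v.
  pose K := q v - m * N v; have K0 : 0 <= K by rewrite subr_ge0; exact: mq.
  have w0 : 0 < no v1 + 1 by rewrite ltr_wpDl// nrm_ge0.
  have e2 : 0 < e1 / 2 by rewrite divr_gt0.
  have [n1 H1] := Hu _ (divr_gt0 e2 w0).
  have K1 : 0 < K + 1 by rewrite ltr_wpDl.
  have e3 : 0 < (e1 / 2) ^+ 2 / (K + 1) by rewrite divr_gt0 ?exprn_gt0.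
  have [n2 H2] := small _ e3.
  pose k := maxn n1 n2.
  have [Nz ez qz] := Hy (s k).
  have cs : hip (i (z k)) v1 ^+ 2 <= (q (z k) - m * N (z k)) * K.
    have : forall t, 0 <= (q (z k) - m * N (z k)) - 2 * t * hip (i (z k)) v1 + t ^+ 2 * K.
      move=> t.
      have o1 : hip (i (z k - t *: v)) (i e) = 0.
        by rewrite (linB li) (linZ li) !(sipE sS) ez ve; ring.
      have := mq _ o1; rewrite -subr_ge0; congr (_ <= _).
      rewrite /q /N /K /v1 !(linD li, linN li, linZ li, linD lA, linN lA, linZ lA) !(sipE sS).
      rewrite /q /N (sipC sS (i v) (i (z k))) (sA v (z k)) (sipC sS (i (z k)) (A v)) (sA v (z k)).
      ring.
    by move=> H; apply: discriminant.
  have h1 : `|hip (i (z k)) v1| <= e1 / 2.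
    rewrite -(ler_sqr (x := `|_|)) ?nnegrE ?(ltW e2)// real_normK ?num_real//.
    apply: le_trans cs _; rewrite Nz mulr1.
    apply: (@le_trans _ _ ((e1 / 2) ^+ 2 / (K + 1) * K)); last first.
      by rewrite mulrAC ler_pdivrMr// ler_wpM2l ?sqr_ge0// lerDl.
    rewrite ler_wpM2r// lerBlDl; apply: le_trans qz _; rewrite lerD2l.
    exact: H2 (s k) (leq_trans (leq_maxr _ _) (sk k)).
  have -> : hip u (A v - m *: i v) = hip (i (z k)) v1 - hip (i (z k) - u) v1.
    by rewrite -/v1 (sipDl sS) (sipNl sS) opprD opprK addrA subrr add0r.
  apply: le_trans (ler_normB _ _) _; rewrite [e1]splitr; apply: lerD => //.
  apply: le_trans (cs_nrm sS _ _) _.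
  apply: le_trans (ler_wpM2r (nrm_ge0 _ _) (H1 k (leq_maxl _ _))) _.
  by rewrite mulrAC ler_pdivrMr// ler_wpM2l ?(ltW e2)// lerDl.
(* No Lagrange multiplier appears: in the direction [e] the pairing vanishes because [e] is an
   eigenvector and [u] is orthogonal to it. *)
have orth2 v : hip u (A v - m *: i v) = 0.
  have [Ne|] := ltP 0 (N e).
    pose t := hip (i v) (i e) / N e.
    have o1 : hip (i (v - t *: e)) (i e) = 0.
      by rewrite (linB li) (linZ li) !(sipE sS) /t -/(N e) divfK ?gt_eqF// subrr.
    have := orth _ o1; rewrite !(linD li, linN li, linZ li, linD lA, linN lA, linZ lA) !(sipE sS).
    rewrite (eqv_ipr sS u He) (sipE sS) ue; move=> h; rewrite -h; ring.
  move=> h; apply: orth; have Ne : N e = 0 by apply/eqP; rewrite eq_le h N0.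
  by apply/eqP; rewrite -normr_le0; apply: le_trans (cs_nrm sS _ _) _; rewrite (nrm_eq0 sS (i e)).2// mulr0.
(* Regularity of the weak solution: [i w - u] is orthogonal to the range of [A0], which is
   everything, so [u] is represented by the domain element [w]. *)
have [w Hw] := oA0 (W u + m *: u).
have adj v : hip (i w - u) (A0 v) = 0.
  have h := orth2 v; rewrite AE !(sipE sS) in h.
  rewrite !(sipE sS) (sipC sS (i w)) sA0 (eqv_ipl sS _ Hw) !(sipE sS) sW (sipC sS (W _) u).
  by move: (m * _) (hip u (W _)) (hip u (A0 v)) h => p1 p2 p3; lra.
have wu : i w ~~> u.
  have [v Hv] := oA0 (i w - u).
  by apply/(nrm_eq0 sS); rewrite -(eqv_ipr sS _ Hv); exact: adj.
exists m, w; split=> //.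
- by rewrite (eqv_ipl sS _ wu) (eqv_ipr sS _ wu) Nu.
- by rewrite (eqv_ipl sS _ wu) ue.
- have Ww : W (i w) ~~> W u.
    by apply: nrm_le0; rewrite -(linB lW); apply: le_trans (bW _) _; rewrite wu mulr0.
  rewrite AE; apply: (eqv_trans sS (eqvB sS Hw Ww)).
  rewrite addrAC subrr add0r; apply: (eqvZ sS); exact: (eqv_sym sS).
Qed.

End SymmetricOperators.

Ltac nneg := solve [repeat first [done | apply: sqr_ge0 | apply: normr_ge0 | apply: ltW; assumption
  | apply: nrm_ge0 | apply: addr_ge0 | rewrite invr_ge0 | apply: exprn_ge0 | apply: mulr_ge0 | apply: ltW; done]].

(** * Forms that are positive under one constraint *)

Section QuadraticForms.
Variables (R : realType) (S : hspace R) (Y : lmodType R) (i : Y -> S).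
Hypothesis li : lin i.
Variables (L : Y -> S).
Hypotheses (lL : lin L) (sL : symop i L).
Notation "u ~~> v" := (eqv hip u v) (at level 70).
Let sS := hsip S.
Let N y := hip (i y) (i y).
Let q y := hip (L y) (i y).
Let N0 y : 0 <= N y. Proof. exact: sipP. Qed.

Definition gap (e : Y) c := forall y, hip (i y) (i e) = 0 -> c * N y <= q y.

Lemma qD y z : q (y + z) = q y + 2 * hip (L y) (i z) + q z.
Proof. by rewrite /q (linD lL) (linD li) !(sipE sS) (sL z y); ring. Qed.
Lemma qZ a y : q (a *: y) = a ^+ 2 * q y.
Proof. by rewrite /q (linZ lL) (linZ li) !(sipE sS); ring. Qed.
Lemma qDZ a y z : q (y + a *: z) = q y + 2 * a * hip (L y) (i z) + a ^+ 2 * q z.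
Proof. by rewrite qD qZ (linZ li) (sipZr sS); ring. Qed.
Let ND y z : N (y + z) = N y + 2 * hip (i y) (i z) + N z.
Proof. by rewrite /N (linD li) !(sipE sS) (sipC sS (i z)); ring. Qed.
Let NZ a y : N (a *: y) = a ^+ 2 * N y.
Proof. by rewrite /N (linZ li) !(sipE sS); ring. Qed.
Let NDZ a y z : N (y + a *: z) = N y + 2 * a * hip (i y) (i z) + a ^+ 2 * N z.
Proof. by rewrite ND NZ (linZ li) (sipZr sS); ring. Qed.
Let ND_le a y z : N (y + a *: z) <= 2 * N y + 2 * a ^+ 2 * N z.
Proof.
have := N0 (y - a *: z); rewrite -scaleNr !NDZ sqrrN.
by rewrite -!(mulrA 2) mulNr; move: (a * _) (N y) (a ^+ 2 * N z) => h n1 n2; lra.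
Qed.

(** The penalized form of the estimate holds for every [y], hence also for localized functions that
    are only nearly orthogonal to [e]. *)
Lemma gap_full e c : 0 < N e -> 0 < c -> gap e c ->
  exists c' K, [/\ 0 < c', 0 <= K & forall y, c' * N y <= q y + K * hip (i y) (i e) ^+ 2].
Proof.
move=> Ne c0 H.
pose l := hip (L e) (L e); have l0 : 0 <= l by exact: sipP.
(* For [y = x + t e] with [x] orthogonal to [e]: the first summand pays for the cross term by
   Young's inequality, the second for [t^2 q e], the third for the part of [N y] along [e]. *)
pose K1 := 2 * l / c + `|q e| + c * N e.
have K10 : 0 <= K1 by rewrite /K1; nneg.
exists (c / 4), (K1 / N e ^+ 2); split; [by rewrite divr_gt0|by rewrite divr_ge0// sqr_ge0|].
move=> y; pose t := hip (i y) (i e) / N e; pose x := y - t *: e.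
have xe : hip (i x) (i e) = 0.
  by rewrite /x (linB li) (linZ li) !(sipE sS) /t -/(N e) divfK ?subrr// gt_eqF.
have yE : y = x + t *: e by rewrite /x subrK.
have -> : K1 / N e ^+ 2 * hip (i y) (i e) ^+ 2 = K1 * t ^+ 2.
  by rewrite /t exprMn exprVn mulrAC -mulrA.
have hx := H x xe.
have h1 := ND_le t x e; rewrite -yE in h1.
have qE := qDZ t x e; rewrite -yE in qE.
have cs := cauchy_schwarz sS (i x) (L e).
rewrite -/l -/(N x) (sipC sS (i x)) (sL e x) in cs.
have key : - (2 * t * hip (L x) (i e)) <= c / 2 * N x + 2 * l / c * t ^+ 2.
  rewrite -subr_ge0 -(pmulr_rge0 _ c0).
  have -> : c * (c / 2 * N x + 2 * l / c * t ^+ 2 - - (2 * t * hip (L x) (i e))) =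
    c ^+ 2 / 2 * N x + 2 * c * t * hip (L x) (i e) + 2 * t ^+ 2 * l by field; rewrite gt_eqF.
  have := sipP sS (c *: i x + (2 * t) *: L e); rewrite !(sipE sS) -/(N x) -/l.
  rewrite (sipC sS (i x) (L e)) (sL e x); move: (hip _ _) (N x) => p n h.
  have -> : c ^+ 2 / 2 * n + 2 * c * t * p + 2 * t ^+ 2 * l =
    2^-1 * (c * (c * n) + c * (2 * t * p) + (2 * t * (c * p) + 2 * t * (2 * t * l))) by field.
  by rewrite mulr_ge0// invr_ge0.
have h2 : - q e * t ^+ 2 <= `|q e| * t ^+ 2 by rewrite ler_wpM2r ?sqr_ge0// -normrN ler_norm.
have h3 : c / 4 * N y <= c / 4 * (2 * N x + 2 * t ^+ 2 * N e) by rewrite ler_wpM2l// divr_ge0// ltW.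
apply: le_trans h3 _; rewrite qE /K1.
have := mulr_ge0 (mulr_ge0 (ltW c0) (sqr_ge0 t)) (N0 e).
move: (hip (L x) _) (q x) (q e) (`|q e|) (2 * l / c) (N x) (N e) key h2 hx => p qx qe qa k n ne key h2 hx.
have -> : (k + qa + c * ne) * t ^+ 2 = k * t ^+ 2 + qa * t ^+ 2 + c * t ^+ 2 * ne by ring.
have -> : c / 4 * (2 * n + 2 * t ^+ 2 * ne) = c / 2 * n + c * t ^+ 2 * ne / 2 by field.
move: (c * t ^+ 2 * ne) (t ^+ 2) key h2 hx => a1 a2 key h2 hx h4.
move: (k * a2) (qa * a2) (2 * t * p) key h2 => b1 b2 b3 key h2.
lra.
Qed.

(* A constraint at [e] may be replaced by one at [eta] when [L e = 0]. *)
Lemma gap_kernel e eta c : L e ~~> 0 -> 0 < N e -> 0 < c -> gap e c -> hip (i eta) (i e) != 0 ->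
  exists c' K, [/\ 0 < c', 0 <= K & forall y, c' * N y <= q y + K * hip (i y) (i eta) ^+ 2].
Proof.
move=> Le Ne c0 H s0; pose sg := hip (i eta) (i e).
have s20 : 0 < sg ^+ 2 by rewrite exprn_even_gt0.
pose k := N e / sg ^+ 2; have k0 : 0 < k by rewrite divr_gt0.
pose D := 2 + 4 * k * N eta; have D0 : 0 < D by rewrite ltr_wpDr//; nneg.
exists (c / D), (4 * k * (c / D)); split; first by rewrite divr_gt0.
  nneg.
move=> y; pose t := hip (i y) (i e) / N e; pose x := y - t *: e.
have xe : hip (i x) (i e) = 0.
  by rewrite /x (linB li) (linZ li) !(sipE sS) /t -/(N e) divfK ?subrr// gt_eqF.
have yE : y = x + t *: e by rewrite /x subrK.
have hx := H x xe.
have h1 := ND_le t x e; rewrite -yE in h1.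
have qE : q y = q x.
  rewrite {1}yE qDZ (sL x e) (eqv_ipl sS _ Le) /q (eqv_ipl sS _ Le) !(sip0l sS); ring.
have ts : t * sg = hip (i y) (i eta) - hip (i x) (i eta).
  by rewrite [in hip (i y) _]yE (linD li) (linZ li) !(sipE sS) /sg (sipC sS (i eta)); ring.
have cs := cauchy_schwarz sS (i x) (i eta); rewrite -/(N x) -/(N eta) in cs.
have h2 : t ^+ 2 * sg ^+ 2 <= 2 * hip (i y) (i eta) ^+ 2 + 2 * (N x * N eta).
  rewrite -exprMn ts; move: (hip (i y) _) (hip (i x) _) cs => a b cs.
  have := sqr_ge0 (a + b); rewrite sqrrB sqrrD !mulr2n; move: (a ^+ 2) (b ^+ 2) (a * b) cs => a2 b2 ab; lra.
have h3 : 2 * t ^+ 2 * N e <= 4 * k * hip (i y) (i eta) ^+ 2 + 4 * k * N eta * N x.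
  have -> : 2 * t ^+ 2 * N e = 2 * k * (t ^+ 2 * sg ^+ 2) by rewrite /k; field; rewrite -/sg.
  apply: le_trans (ler_wpM2l _ h2) _; first by rewrite mulr_ge0// ltW.
  by rewrite le_eqVlt; apply/orP; left; apply/eqP; ring.
have h4 : N y <= D * N x + 4 * k * hip (i y) (i eta) ^+ 2.
  rewrite /D mulrDl; move: h1 h3.
  by move: (4 * k * hip _ _ ^+ 2) (2 * t ^+ 2 * N e) (4 * k * N eta * N x) => a1 a2 a3; lra.
apply: le_trans (ler_wpM2l _ h4) _; first nneg.
rewrite qE; have -> : forall h, c / D * (D * N x + 4 * k * h) = c * N x + 4 * k * (c / D) * h.
  by move=> h; field; rewrite gt_eqF.
by rewrite lerD2r.
Qed.

Lemma gap_ge0 e c : L e ~~> 0 -> 0 < N e -> 0 <= c -> gap e c -> coer i L 0.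
Proof.
move=> Le Ne c0 H y; rewrite mul0r -/(q y).
pose t := hip (i y) (i e) / N e; pose x := y - t *: e.
have xe : hip (i x) (i e) = 0.
  by rewrite /x (linB li) (linZ li) !(sipE sS) /t -/(N e) divfK ?subrr// gt_eqF.
have -> : q y = q x.
  rewrite -[y](subrK (t *: e)) -/x qDZ (sL x e) (eqv_ipl sS _ Le) /q (eqv_ipl sS _ Le) !(sip0l sS); ring.
by apply: le_trans (H x xe); rewrite mulr_ge0.
Qed.

(** The Vakhitov-Kolokolov argument. Since [q eta = - <eta, psi>] is negative, [eta] is not
    orthogonal to [e], and any [u] can be moved along [eta] until it is. If [u] is orthogonal to
    [psi] the cross term vanishes, so [q u] equals the form at the moved vector plus
    [t^2 <eta, psi>]; both summands are positive contributions. *)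
Lemma gap_slope_pos e psi eta c : 0 < c -> gap e c -> L eta ~~> - i psi ->
  0 < hip (i eta) (i psi) -> exists2 c', 0 < c' & gap psi c'.
Proof.
move=> c0 H He s0; pose sg := hip (i eta) (i psi).
have qeta : q eta = - sg by rewrite /q (eqv_ipl sS _ He) (sipNl sS) (sipC sS).
have ee : hip (i eta) (i e) != 0.
  apply/eqP => h; have := H _ h; rewrite qeta leNgt => /negP; apply.
  by rewrite (@lt_le_trans _ _ 0) ?oppr_lt0 ?mulr_ge0// ltW.
have Neta : 0 < N eta.
  rewrite lt0r N0 andbT; apply/eqP => h; move/eqP: ee; apply; apply/eqP.
  rewrite -normr_le0; apply: le_trans (cs_nrm sS _ _) _.
  by rewrite (nrm_eq0 sS (i eta)).2// mul0r.
exists (Num.min (c / 2) (sg / (2 * N eta))).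
  by rewrite lt_min !divr_gt0// mulr_gt0.
move=> u up; pose t := - hip (i u) (i e) / hip (i eta) (i e); pose v := u + t *: eta.
have ve : hip (i v) (i e) = 0.
  by rewrite /v (linD li) (linZ li) !(sipE sS) /t divfK// subrr.
have qv : q v = q u - t ^+ 2 * sg.
  rewrite /v qDZ qeta (sL u eta) (eqv_ipl sS _ He) (sipNl sS) (sipC sS (i psi)) up; ring.
have h1 := H v ve.
have h2 : N u <= 2 * N v + 2 * t ^+ 2 * N eta.
  have -> : u = v + (- t) *: eta by rewrite /v scaleNr addrK.
  by apply: le_trans (ND_le _ _ _) _; rewrite sqrrN.
set m := Num.min _ _.
have m0 : 0 <= m by rewrite le_min !divr_ge0 ?mulr_ge0// ltW.
have m1 : m * (2 * N v) <= c * N v.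
  rewrite mulrA ler_wpM2r// -ler_pdivlMr// ge_min lexx//.
have m2 : m * (2 * t ^+ 2 * N eta) <= t ^+ 2 * sg.
  have : m <= sg / (2 * N eta) by rewrite ge_min lexx orbT.
  rewrite ler_pdivlMr ?mulr_gt0// => h.
  have -> : m * (2 * t ^+ 2 * N eta) = t ^+ 2 * (m * (2 * N eta)) by ring.
  by rewrite ler_wpM2l ?sqr_ge0.
apply: le_trans (ler_wpM2l m0 h2) _; rewrite mulrDr -/(q u).
have -> : q u = q v + t ^+ 2 * sg by rewrite qv subrK.
by apply: lerD => //; apply: le_trans h1.
Qed.

(** Project [psi] along [eta] onto the complement of [psi]: the form becomes
    [q psi + |psi|^4 / <eta, psi>], and the second term has the sign of the slope. *)
Lemma slope_neg_direction psi eta : L eta ~~> - i psi -> hip (i eta) (i psi) < 0 ->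
  q psi < 0 -> exists2 u, hip (i u) (i psi) = 0 & q u < 0.
Proof.
move=> He s0 qp; pose sg := hip (i eta) (i psi).
have qeta : q eta = - sg by rewrite /q (eqv_ipl sS _ He) (sipNl sS) (sipC sS).
exists (psi + (- N psi / sg) *: eta).
  by rewrite (linD li) (linZ li) !(sipE sS) -/sg divfK ?lt_eqF// -/(N psi) subrr.
rewrite qDZ qeta (sL psi eta) (eqv_ipl sS _ He) (sipNl sS) -/(N psi).
have -> : q psi + 2 * (- N psi / sg) * - N psi + (- N psi / sg) ^+ 2 * - sg = q psi + N psi ^+ 2 / sg.
  by field; rewrite lt_eqF.
by rewrite -[ltRHS]addr0 ltr_leD// mulr_ge0_le0 ?sqr_ge0// invr_le0 ltW.
Qed.

End QuadraticForms.

(** * Stability of J L *)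

Section Hamiltonian.
Variables (R : realType) (S : hspace R) (Y : lmodType R) (i : Y -> S).
Hypothesis li : lin i.
Variables (A0 : Y -> S) (Wp Wm : S -> S) (Lp Lm : Y -> S) (d bW : R).
Hypotheses (lA0 : lin A0) (sA0 : symop i A0) (d0 : 0 < d) (cA0 : coer i A0 d) (oA0 : @solv R S Y A0).
Hypotheses (lWp : lin Wp) (sWp : symb Wp) (bWp : bdd Wp bW).
Hypotheses (lWm : lin Wm) (sWm : symb Wm) (bWm : bdd Wm bW) (bW0 : 0 <= bW).
Hypotheses (LpE : forall y, Lp y = A0 y - Wp (i y)) (LmE : forall y, Lm y = A0 y - Wm (i y)).
Notation "u ~~> v" := (eqv hip u v) (at level 70).
Notation no := (nrm hip).
Let sS := hsip S.

Definition S4 : hspace R := prodh (prodh S S) (prodh S S).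
Definition Y4 : lmodType R := ((Y * Y) * (Y * Y))%type.
Definition emb4 (y : Y4) : S4 := ((i y.1.1, i y.1.2), (i y.2.1, i y.2.2)).

(* [J L - (a + i b)] on [v + i v'], [w + i w'], coded as [((v, v'), (w, w'))]. *)
Definition JL a b (y : Y4) : S4 :=
  ((Lm y.2.1 - a *: i y.1.1 + b *: i y.1.2, Lm y.2.2 - a *: i y.1.2 - b *: i y.1.1),
   (- Lp y.1.1 - a *: i y.2.1 + b *: i y.2.2, - Lp y.1.2 - a *: i y.2.2 - b *: i y.2.1)).

Let s4 : sip (@hip R S4). Proof. exact: hsip. Qed.

Lemma nrm4_sqr (u : S4) :
  no u ^+ 2 = no u.1.1 ^+ 2 + no u.1.2 ^+ 2 + no u.2.1 ^+ 2 + no u.2.2 ^+ 2.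
Proof.
by rewrite (nrm_sqr s4) !(nrm_sqr sS) /hip /= /prod_ip /hip/= /prod_ip addrA.
Qed.

Lemma nrm4_ge (u : S4) :
  [/\ no u.1.1 <= no u, no u.1.2 <= no u, no u.2.1 <= no u & no u.2.2 <= no u].
Proof.
have s2 x y : 0 <= y -> x ^+ 2 <= y ^+ 2 -> x <= y :> R.
  by move=> y0; rewrite -[x ^+ 2]real_normK ?num_real// ler_sqr ?nnegrE// => /(le_trans (ler_norm _)).
have h := nrm4_sqr u.
by split; apply: s2; rewrite ?nrm_ge0// h; move: (no u.1.1) (no u.1.2) (no u.2.1) (no u.2.2) => x y z t;
  have := sqr_ge0 x; have := sqr_ge0 y; have := sqr_ge0 z; have := sqr_ge0 t;
  move: (x ^+ 2) (y ^+ 2) (z ^+ 2) (t ^+ 2) => {}x {}y {}z {}t; lra.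
Qed.

Lemma nrm4_le (u : S4) : no u <= no u.1.1 + no u.1.2 + no u.2.1 + no u.2.2.
Proof.
have p1 := nrm_ge0 hip u.1.1; have p2 := nrm_ge0 hip u.1.2.
have p3 := nrm_ge0 hip u.2.1; have p4 := nrm_ge0 hip u.2.2.
rewrite -ler_sqr ?nnegrE ?nrm_ge0 ?addr_ge0// nrm4_sqr.
move: (no u.1.1) (no u.1.2) (no u.2.1) (no u.2.2) p1 p2 p3 p4 => x y z t p1 p2 p3 p4; nra.
Qed.

Let sA0' W L : symb W -> (forall y, L y = A0 y - W (i y)) -> symop i L.
Proof. by move=> sW LE y z; rewrite !LE !(sipE sS) sA0 sW. Qed.
Let sLp : symop i Lp. Proof. exact: sA0' sWp LpE. Qed.
Let sLm : symop i Lm. Proof. exact: sA0' sWm LmE. Qed.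
Let lL W L : lin W -> (forall y, L y = A0 y - W (i y)) -> lin L.
Proof. by move=> lW LE a u v; rewrite !LE lA0 li lW opprD scalerBr addrACA. Qed.
Let lLp : lin Lp. Proof. exact: lL lWp LpE. Qed.
Let lLm : lin Lm. Proof. exact: lL lWm LmE. Qed.

Let Bm (L : S -> S) (K : S -> S) a b (u : S4) : S4 :=
  ((K u.2.1 - a *: u.1.1 + b *: u.1.2, K u.2.2 - a *: u.1.2 - b *: u.1.1),
   (L u.1.1 - a *: u.2.1 + b *: u.2.2, L u.1.2 - a *: u.2.2 - b *: u.2.1)).

Let bddB L K a b k : 0 <= k -> bdd L k -> bdd K k -> bdd (Bm L K a b) (4 * (k + `|a| + `|b|)).
Proof.
move=> k0 bL bK u; have [h1 h2 h3 h4] := nrm4_ge u.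
have H (x y z : S) T : bdd T k -> no x <= no u -> no y <= no u -> no z <= no u ->
    no (T x - a *: y + b *: z) <= (k + `|a| + `|b|) * no u.
  move=> bT hx hy hz; rewrite !mulrDl; apply: le_trans (nrmD sS _ _) _; apply: lerD.
    apply: le_trans (nrmB sS _ _) _; apply: lerD.
      by apply: le_trans (bT _) _; rewrite ler_wpM2l.
    by rewrite (nrmZ sS) ler_wpM2l.
  by rewrite (nrmZ sS) ler_wpM2l.
have H' (x y z : S) T : bdd T k -> no x <= no u -> no y <= no u -> no z <= no u ->
    no (T x - a *: y - b *: z) <= (k + `|a| + `|b|) * no u.
  by move=> bT hx hy hz; rewrite -[- (b *: z)]scalerN; apply: H => //; rewrite (nrmN sS).
apply: le_trans (nrm4_le _) _ => /=.
have e1 := H u.2.1 u.1.1 u.1.2 K bK h3 h1 h2; have e2 := H' u.2.2 u.1.2 u.1.1 K bK h4 h2 h1.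
have e3 := H u.1.1 u.2.1 u.2.2 L bL h1 h3 h4; have e4 := H' u.1.2 u.2.2 u.2.1 L bL h2 h4 h3.
rewrite -mulrA; move: e1 e2 e3 e4; move: (no _) (no _) (no _) (no _) (_ * no u) => x y z t w; lra.
Qed.

Let linB' L K a b : lin L -> lin K -> lin (Bm L K a b).
Proof.
move=> lL' lK c u v.
have E (x y z x' y' z' : S) : c *: x + x' - a *: (c *: y + y') + b *: (c *: z + z') =
    c *: (x - a *: y + b *: z) + (x' - a *: y' + b *: z').
  rewrite !scalerDr !scalerN !scalerA [a * c]mulrC [b * c]mulrC opprD.
  by rewrite [c *: x + x' + _]addrACA [RHS]addrACA.
have E' (x y z x' y' z' : S) : c *: x + x' - a *: (c *: y + y') - b *: (c *: z + z') =
    c *: (x - a *: y - b *: z) + (x' - a *: y' - b *: z').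
  rewrite !scalerDr !scalerN !scalerA [a * c]mulrC [b * c]mulrC !opprD.
  by rewrite [c *: x + x' + _]addrACA [RHS]addrACA.
by congr ((_, _), (_, _)); rewrite /= ?lL' ?lK ?E ?E'.
Qed.

(** The adjoint of [J L - z] is conjugate, by exchanging the two components, to [J L] minus the
    complex conjugate of [z]. The leading part maps [(v, w)] to [(A0 w, - A0 v)] and is inverted
    through [A0]. *)
Lemma solv_JL a b C : 0 <= C -> lb emb4 (JL a (- b)) C -> solv (JL a b).
Proof.
move=> C0 H.
have li4 : lin emb4 by move=> c u v; rewrite /emb4 /= !li.
pose A (y : Y4) : S4 := ((A0 y.2.1, A0 y.2.2), (- A0 y.1.1, - A0 y.1.2)).
pose A' (y : Y4) : S4 := ((- A0 y.2.1, - A0 y.2.2), (A0 y.1.1, A0 y.1.2)).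
have lA : lin A by move=> c u v; congr ((_, _), (_, _)); rewrite /= ?lA0// opprD scalerN.
have lA' : lin A' by move=> c u v; congr ((_, _), (_, _)); rewrite /= ?lA0// opprD scalerN.
have lbA0 := coer_lb d0 cA0.
have di0 : 0 <= d^-1 by rewrite invr_ge0 ltW.
have lbA T : (forall y, [/\ no (A0 y.1.1) <= no (T y), no (A0 y.1.2) <= no (T y),
    no (A0 y.2.1) <= no (T y) & no (A0 y.2.2) <= no (T y)]) -> lb emb4 T (4 * d^-1).
  move=> HT y; apply: le_trans (nrm4_le _) _ => /=; have [h1 h2 h3 h4] := HT y.
  have K x : no (A0 x) <= no (T y) -> no (i x) <= d^-1 * no (T y).
    by move=> h; apply: le_trans (lbA0 x) _; rewrite ler_wpM2l.
  have := K _ h1; have := K _ h2; have := K _ h3; have := K _ h4.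
  by rewrite -mulrA; move: (no _) (no _) (no _) (no _) (_ * no _) => x1 x2 x3 x4 w; lra.
have oA T : (forall f : S4, exists v w v' w', T ((v, w), (v', w')) ~~> f) -> solv T.
  by move=> HT f; have [v [w [v' [w' h]]]] := HT f; exists ((v, w), (v', w')).
have z4 (u v : S4) : u.1.1 ~~> v.1.1 -> u.1.2 ~~> v.1.2 -> u.2.1 ~~> v.2.1 -> u.2.2 ~~> v.2.2 -> u ~~> v.
  move=> h1 h2 h3 h4; apply: nrm_le0; apply: le_trans (nrm4_le _) _ => /=.
  by rewrite [no (u.1.1 - _)]h1 [no (u.1.2 - _)]h2 [no (u.2.1 - _)]h3 [no (u.2.2 - _)]h4 !addr0.
have N x y : x ~~> - y -> - x ~~> y.
  by move=> h; rewrite -[y]opprK; exact: eqvN (hsip _) _ _ h.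
pose B := Bm Wp (fun u => - Wm u) a b.
pose B' (u : S4) := let r := Bm Wp (fun u => - Wm u) a (- b) (u.2, u.1) in (r.2, r.1) : S4.
have lNm : lin (fun u => - Wm u) by move=> c u v; rewrite lWm opprD scalerN.
have bNm : bdd (fun u => - Wm u) bW by move=> u; rewrite (nrmN sS).
have swap (u : S4) : no ((u.2, u.1) : S4) = no u by rewrite /nrm {1}/hip/= /prod_ip addrC.
have := @solv_adjoint _ _ _ _ li4 A A' B B' (4 * d^-1) C (4 * (bW + `|a| + `|b|)) lA lA'.
have -> : (fun y => A y + B (emb4 y)) = JL a b.
  apply/funext => y; congr ((_, _), (_, _)) => /=; rewrite ?LpE ?LmE ?opprB !addrA//.
    by congr (_ - _ + _); rewrite addrC.
  by congr (_ - _ - _); rewrite addrC.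
have E' y : A' y + B' (emb4 y) = ((JL a (- b) (y.2, y.1)).2, (JL a (- b) (y.2, y.1)).1) :> S4.
  congr ((_, _), (_, _)) => /=; rewrite ?LpE ?LmE ?opprB !addrA//.
    by congr (_ - _ + _); rewrite addrC.
  by congr (_ - _ - _); rewrite addrC.
apply=> //.
- exact: linB'.
- by move=> c u v; rewrite /B' /=; have := linB' a (- b) lWp lNm c (u.2, u.1) (v.2, v.1); case=> -> -> -> ->.
- move=> y z; rewrite /hip/= /prod_ip /hip/= /prod_ip /= !(sipNl sS) !(sipNr sS).
  rewrite ![hip (i _) (A0 _)](sipC sS) (sA0 z.2.1) (sA0 z.2.2) (sA0 z.1.1) (sA0 z.1.2); ring.
- move=> u v; rewrite /hip/= /prod_ip /hip/= /prod_ip /= !(sipE sS).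
  rewrite (sWm u.2.1) (sWm u.2.2) (sWp u.1.1) (sWp u.1.2).
  by rewrite ![hip _ (Wm _)](sipC sS) ![hip _ (Wp _)](sipC sS); ring.
- move=> f; have [v hv] := oA0 (- f.2.1); have [v' hv'] := oA0 (- f.2.2).
  have [w hw] := oA0 f.1.1; have [w' hw'] := oA0 f.1.2.
  by exists ((v, v'), (w, w')); apply: z4 => //=; exact: N.
- move=> f; have [w hw] := oA0 (- f.1.1); have [w' hw'] := oA0 (- f.1.2).
  have [v hv] := oA0 f.2.1; have [v' hv'] := oA0 f.2.2.
  by exists ((v, v'), (w, w')); apply: z4 => //=; exact: N.
- by apply: lbA => y; have [] := nrm4_ge (A y); rewrite /= !(nrmN sS).
- by apply: lbA => y; have [] := nrm4_ge (A' y); rewrite /= !(nrmN sS).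
- exact: bddB.
- move=> u; rewrite /B'; set r := Bm _ _ _ _ _; rewrite (swap r) -(swap u) -normrN.
  by rewrite /r normrN -[`|b|]normrN; exact: bddB.
- by rewrite mulr_ge0.
- by rewrite !mulr_ge0// !addr_ge0.
- by move=> y; rewrite E' (swap (JL a (- b) _)) -(swap (emb4 y)); exact: (H (y.2, y.1)).
Qed.

(** If the conclusion failed then [n <= N], so [n^2] could be replaced by [n * N] and one factor [N]
    cancelled. *)
Lemma quadratic_le (c k1 k2 n N : R) : 0 < c -> 0 <= k1 -> 0 <= k2 -> 0 <= n -> 0 <= N ->
  c * N ^+ 2 <= k1 * (n * N) + k2 * n ^+ 2 -> N <= ((k1 + k2) / c + 1) * n.
Proof.
move=> c0 k10 k20 n0 N0 H; rewrite leNgt; apply/negP => h.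
have nN : n <= N.
  by apply: le_trans (ltW h); rewrite ler_peMl// lerDr divr_ge0 ?addr_ge0// ltW.
have : c * N ^+ 2 <= (k1 + k2) * (n * N).
  apply: le_trans H _; rewrite mulrDl lerD2l expr2 ler_wpM2l// ler_wpM2l//.
apply/negP; rewrite -ltNge.
have N1 : 0 < N by apply: le_lt_trans h; nneg.
rewrite expr2 !mulrA ltr_pM2r//.
have : c * (((k1 + k2) / c + 1) * n) < c * N by rewrite ltr_pM2l.
apply: le_lt_trans; have -> : c * (((k1 + k2) / c + 1) * n) = (k1 + k2) * n + c * n by field; rewrite gt_eqF.
by rewrite lerDl; nneg.
Qed.

(** The forms of [L_+] at [v, v'] and of [L_-] at [w, w'] control the norm up to the pairings with
    [psi] and [eta]. The forms are read off by pairing the equation with the swapped components, and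
    the pairings from the equation itself through [L_- psi = 0] and [L_+ eta = - psi]. *)
Lemma lb_JL a b psi eta cp kp cm km : a != 0 -> Lm psi ~~> 0 -> Lp eta ~~> - i psi ->
  0 < cp -> 0 <= kp -> 0 < cm -> 0 <= km ->
  (forall v, cp * hip (i v) (i v) <= hip (Lp v) (i v) + kp * hip (i v) (i psi) ^+ 2) ->
  (forall w, cm * hip (i w) (i w) <= hip (Lm w) (i w) + km * hip (i w) (i eta) ^+ 2) ->
  exists2 C, 0 <= C & lb emb4 (JL a b) C.
Proof.
move=> a0 Hpsi Heta cp0 kp0 cm0 km0 HP HM.
pose c := Num.min cp cm; have c0 : 0 < c by rewrite lt_min cp0 cm0.
pose P := no (i psi) ^+ 2; pose Q := no (i eta) ^+ 2.
have P0 : 0 <= P by exact: sqr_ge0.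
have Q0 : 0 <= Q by exact: sqr_ge0.
have a2 : 0 < a ^+ 2 by rewrite exprn_even_gt0.
pose K1 := 4 + `|b| * (4 / `|a|).
pose K2 := kp * (2 * P / a ^+ 2) + km * (2 * (2 * Q + 2 * P / a ^+ 2) / a ^+ 2).
have K10 : 0 <= K1 by rewrite /K1; nneg.
have K20 : 0 <= K2 by rewrite /K2; nneg.
exists ((K1 + K2) / c + 1); first nneg.
move=> [[v v'] [w w']]; set F := JL a b _; set n := no F; set N := no (emb4 _).
have n0 : 0 <= n by exact: nrm_ge0.
have N0 : 0 <= N by exact: nrm_ge0.
apply: quadratic_le => //.
have NE := nrm4_sqr (emb4 (v, v', (w, w'))); rewrite -/N /= in NE.
have [N1 N2 N3 N4] := nrm4_ge (emb4 (v, v', (w, w'))); rewrite -/N /= in N1 N2 N3 N4.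
have [n1 n2 n3 n4] := nrm4_ge F; rewrite -/n in n1 n2 n3 n4.
rewrite !(nrm_sqr sS) in NE.
have cs (f x : S) : no f <= n -> no x <= N -> `|hip f x| <= n * N.
  by move=> h1 h2; apply: le_trans (cs_nrm sS _ _) _; rewrite ler_pM ?nrm_ge0.
have cs2 (f x : S) : no f <= n -> hip f x ^+ 2 <= n ^+ 2 * no x ^+ 2.
  move=> h1; apply: le_trans (cauchy_schwarz sS _ _) _; rewrite -!(nrm_sqr sS).
  by rewrite ler_wpM2r ?sqr_ge0// ler_sqr ?nnegrE ?nrm_ge0.
set f1 := F.1.1 in n1; set f1' := F.1.2 in n2; set f2 := F.2.1 in n3; set f2' := F.2.2 in n4.
(* The only term that the imaginary part [b] leaves in the energy identity [XE]. A second pairing,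
   [DE], isolates it with the factor [2 a], and this is where [a != 0] enters. *)
pose D := hip (i v) (i w') - hip (i v') (i w).
pose X := hip (Lp v) (i v) + hip (Lp v') (i v') + hip (Lm w) (i w) + hip (Lm w') (i w').
have XE : X = hip f1 (i w) + hip f1' (i w') - hip f2 (i v) - hip f2' (i v') + 2 * b * D.
  rewrite /f1 /f1' /f2 /f2' /= !(sipE sS) /X /D.
  rewrite (sipC sS (i w) (i v)) (sipC sS (i w') (i v')) (sipC sS (i w) (i v')) (sipC sS (i w') (i v)); ring.
have DE : 2 * a * D = hip f2 (i v') - hip f2' (i v) - hip f1 (i w') + hip f1' (i w).
  rewrite /f1 /f1' /f2 /f2' /= !(sipE sS) /D (sLp v v') (sLm w w').
  rewrite (sipC sS (i w) (i v)) (sipC sS (i w') (i v')) (sipC sS (i w) (i v')) (sipC sS (i w') (i v)); ring.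
have absD : `|D| <= 2 / `|a| * (n * N).
  rewrite mulrAC ler_pdivlMr ?normr_gt0// -normrM.
  have : `|2 * a * D| <= 4 * (n * N).
    rewrite DE.
    have := cs _ _ n3 N2; have := cs _ _ n4 N1; have := cs _ _ n1 N4; have := cs _ _ n2 N3.
    rewrite !ler_norml; move: (hip _ _) (hip _ _) (hip _ _) (hip _ _) (n * N) => x1 x2 x3 x4 nN; lra.
  have -> : 2 * a * D = 2 * (D * a) by ring.
  by rewrite [`|2 * _|]normrM [`|2|]ger0_norm//; move: (`|D * a|) (n * N) => x1 x2; lra.
have Xle : X <= K1 * (n * N).
  have : 2 * b * D <= `|b| * (4 / `|a|) * (n * N).
    apply: le_trans (ler_norm _) _; rewrite normrM normrM ger0_norm//.
    apply: le_trans (ler_wpM2l _ absD) _; first nneg.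
    by rewrite le_eqVlt; apply/orP; left; apply/eqP; ring.
  rewrite XE /K1 (mulrDl 4).
  have := cs _ _ n1 N3; have := cs _ _ n2 N4; have := cs _ _ n3 N1; have := cs _ _ n4 N2.
  rewrite !ler_norml; move: (hip _ _) (hip _ _) (hip _ _) (hip _ _) (`|b| * (4 / `|a|) * (n * N)) (n * N) (2 * b * D) => x1 x2 x3 x4 x6 nN x5; lra.
(* Modulus of a complex product: [|z|^2 >= a^2]. It recovers the pairings of real and imaginary
   parts jointly. *)
have comb (p q g h : R) : - a * p + b * q = g -> - a * q - b * p = h ->
    a ^+ 2 * (p ^+ 2 + q ^+ 2) <= g ^+ 2 + h ^+ 2.
  move=> <- <-; have := mulr_ge0 (sqr_ge0 b) (addr_ge0 (sqr_ge0 p) (sqr_ge0 q)) => k.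
  rewrite -subr_ge0; congr (0 <= _): k; ring.
have pE : a ^+ 2 * (hip (i v) (i psi) ^+ 2 + hip (i v') (i psi) ^+ 2) <= 2 * P * n ^+ 2.
  have h1 := cs2 f1 (i psi) n1; have h2 := cs2 f1' (i psi) n2.
  have h : forall t, hip (Lm t) (i psi) = 0 by move=> t; rewrite sLm (eqv_ipl sS _ Hpsi) (sip0l sS).
  have e1 : - a * hip (i v) (i psi) + b * hip (i v') (i psi) = hip f1 (i psi).
    by rewrite /f1 /= !(sipE sS) h; ring.
  have e2 : - a * hip (i v') (i psi) - b * hip (i v) (i psi) = hip f1' (i psi).
    by rewrite /f1' /= !(sipE sS) h; ring.
  apply: le_trans (comb _ _ _ _ e1 e2) _.
  by move: h1 h2; rewrite -/P; move: (hip _ _ ^+ 2) (hip _ _ ^+ 2) => x1 x2; rewrite -mulrA [P * _]mulrC; lra.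
set pp := _ + _ in pE.
have ppE : pp <= 2 * P / a ^+ 2 * n ^+ 2.
  by rewrite mulrAC ler_pdivlMr// mulrC.
(* [L_+ eta = - psi] brings back the pairings with [psi], already bounded by [ppE]; hence the second
   division by [a^2]. *)
have qE : a ^+ 2 * (hip (i w) (i eta) ^+ 2 + hip (i w') (i eta) ^+ 2) <= 2 * (2 * Q + 2 * P / a ^+ 2) * n ^+ 2.
  have h1 := cs2 f2 (i eta) n3; have h2 := cs2 f2' (i eta) n4.
  have h t : hip (Lp t) (i eta) = - hip (i t) (i psi).
    by rewrite sLp (eqv_ipl sS _ Heta) (sipNl sS) (sipC sS).
  have e1 : - a * hip (i w) (i eta) + b * hip (i w') (i eta) = hip f2 (i eta) - hip (i v) (i psi).
    by rewrite /f2 /= !(sipE sS) h; ring.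
  have e2 : - a * hip (i w') (i eta) - b * hip (i w) (i eta) = hip f2' (i eta) - hip (i v') (i psi).
    by rewrite /f2' /= !(sipE sS) h; ring.
  apply: le_trans (comb _ _ _ _ e1 e2) _.
  have sq (x y : R) : (x - y) ^+ 2 <= 2 * x ^+ 2 + 2 * y ^+ 2.
    by have := sqr_ge0 (x + y); rewrite sqrrB sqrrD !mulr2n; move: (x ^+ 2) (y ^+ 2) (x * y) => x2 y2 xy; lra.
  apply: le_trans (lerD (sq _ _) (sq _ _)) _.
  have -> : 2 * (2 * Q + 2 * P / a ^+ 2) * n ^+ 2 = 4 * (n ^+ 2 * Q) + 2 * (2 * P / a ^+ 2 * n ^+ 2) by ring.
  move: h1 h2 ppE; rewrite -/Q /pp.
  move: (hip _ _ ^+ 2) (hip _ _ ^+ 2) (hip _ _ ^+ 2) (hip _ _ ^+ 2) (2 * P / _ * _) (n ^+ 2 * Q) => x1 x2 x3 x4 x5 x6; lra.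
set qq := _ + _ in qE.
have qqE : qq <= 2 * (2 * Q + 2 * P / a ^+ 2) / a ^+ 2 * n ^+ 2.
  by rewrite [leRHS]mulrAC ler_pdivlMr// mulrC.
apply: (@le_trans _ _ (X + kp * pp + km * qq)).
  have := HP v; have := HP v'; have := HM w; have := HM w'.
  have C1 x : c * hip (i x) (i x) <= cp * hip (i x) (i x) by rewrite ler_wpM2r ?(sipP sS)// ge_min lexx.
  have C2 x : c * hip (i x) (i x) <= cm * hip (i x) (i x) by rewrite ler_wpM2r ?(sipP sS)// ge_min lexx orbT.
  have := C1 v; have := C1 v'; have := C2 w; have := C2 w'.
  rewrite NE /X /pp /qq !mulrDr; move: (cp * _) (cp * _) (cm * _) (cm * _) => y1 y2 y3 y4.
  move: (c * _) (c * _) (c * _) (c * _) => z1 z2 z3 z4.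
  move: (kp * _) (kp * _) (km * _) (km * _) => t1 t2 t3 t4.
  move: (hip _ _) (hip _ _) (hip _ _) (hip _ _) => r1 r2 r3 r4; lra.
rewrite -addrA; apply: lerD => //; rewrite /K2 mulrDl -!mulrA.
apply: lerD; rewrite ler_wpM2l//; first by apply: le_trans ppE _; rewrite -!mulrA.
by apply: le_trans qqE _; rewrite -!mulrA.
Qed.

(** Adding a multiple of the projection on [psi] makes [L_-] coercive, hence solvable. Pairing the
    solution with [psi] shows that the added term vanishes when the right-hand side is orthogonal to
    [psi]. The factor [K + 1] keeps its coefficient nonzero. *)
Lemma solv_orthogonal psi cm (u : S) : Lm psi ~~> 0 -> 0 < hip (i psi) (i psi) -> 0 < cm ->
  gap i Lm psi cm -> hip u (i psi) = 0 -> exists2 w, Lm w ~~> u & hip (i w) (i psi) = 0.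
Proof.
move=> Hpsi Npsi cm0 G up; have [c' [K [c'0 K0 HK]]] := gap_full li lLm sLm Npsi cm0 G.
pose W (v : S) := - Wm v + ((K + 1) * hip v (i psi)) *: i psi.
have lW : lin W.
  move=> a v w; rewrite /W lWm !(sipE sS) opprD scalerDr -scalerN scalerA addrACA; congr (_ + _).
  by rewrite -scalerDl; congr (_ *: _); ring.
have sW : symb W.
  by move=> v w; rewrite /W !(sipE sS) (sWm v w) (sipC sS (i psi) v) (sipC sS (i psi) w); ring.
have bW' : bdd W (bW + (K + 1) * hip (i psi) (i psi)).
  move=> v; rewrite mulrDl; apply: le_trans (nrmD sS _ _) _; rewrite (nrmN sS); apply: lerD => //.
  rewrite (nrmZ sS) normrM [`|K + 1|]ger0_norm ?addr_ge0// -!mulrA ler_wpM2l ?addr_ge0//.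
  apply: le_trans (ler_wpM2r (nrm_ge0 _ _) (cs_nrm sS _ _)) _.
  by rewrite -mulrA -expr2 (nrm_sqr sS) mulrC.
have cW : coer i (fun y => A0 y + W (i y)) c'.
  move=> y; apply: le_trans (HK y) _; rewrite LmE /W !(sipE sS) (sipC sS (i psi)).
  have := sqr_ge0 (hip (i y) (i psi)); rewrite !expr2.
  by move: (hip (i y) (i psi)) => p p0; rewrite -mulrA mulrDl mul1r addrA lerD2l lerDl.
have [||w Hw] := solv_symmetric li lA0 lW sA0 sW cA0 d0 oA0 bW' _ (coer_lb c'0 cW) _ u.
- by rewrite addr_ge0// mulr_ge0// ?addr_ge0// sipP.
- by rewrite invr_ge0 ltW.
have w0 : hip (i w) (i psi) = 0.
  have h := eqv_ipl sS (i psi) Hw; move: h; rewrite up addrA (sipDl sS) (sipZl sS) -LmE.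
  rewrite sLm (eqv_ipl sS _ Hpsi) (sip0l sS) add0r => /eqP; rewrite !mulf_eq0 (gt_eqF Npsi).
  by rewrite gt_eqF ?orbF ?orFb => [/eqP//|]; rewrite ltr_wpDl.
exists w => //; apply: eqv_trans Hw => //; rewrite LmE /W w0 mulr0 scale0r addr0.
exact: eqv_refl.
Qed.

(* [-lambda^2] is the infimum of [<L_+ u, u> / <L_-^-1 u, u>]. *)
Lemma unstable_JL psi cm u0 : Lm psi ~~> 0 -> 0 < hip (i psi) (i psi) -> 0 < cm ->
  gap i Lm psi cm -> hip (i u0) (i psi) = 0 -> hip (Lp u0) (i u0) < 0 ->
  exists2 l, 0 < l & ~ (solv (JL l 0) /\ exists C, lb emb4 (JL l 0) C).
Proof.
move=> Hpsi Npsi cm0 G u0psi u0neg.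
pose qp u := hip (Lp u) (i u); pose qm w := hip (Lm w) (i w).
have Lm0 : coer i Lm 0 := gap_ge0 li lLm sLm Hpsi Npsi (ltW cm0) G.
have qm0 w : 0 <= qm w by have := Lm0 w; rewrite mul0r.
have N0 u : 0 <= hip (i u) (i u) by exact: sipP.
have sF := form_sip lLm sLm Lm0.
have NN u w : Lm w ~~> i u -> hip (i u) (i u) ^+ 2 <= qm w * qm u.
  by move=> h; rewrite -{1}(eqv_ipl sS _ h); exact: (cauchy_schwarz sF w u).
(* The forms of [L_+] and [L_-] differ by at most [be |u|^2], and [|u|^4 <= <L_- w, w> <L_- u, u>]
   when [L_- w = u]. The arithmetic-geometric inequality then bounds the quotient below by
   [- be^2 / 4]. *)
pose be := 2 * bW; have be0 : 0 <= be by rewrite mulr_ge0.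
have low u w : Lm w ~~> i u -> - (be ^+ 2 / 4) * qm w <= qp u.
  move=> h; have h1 := NN u w h.
  have h2 : qm u - be * hip (i u) (i u) <= qp u.
    have -> : qp u = qm u - hip (Wp (i u)) (i u) + hip (Wm (i u)) (i u).
      by rewrite /qp /qm LpE LmE !(sipE sS); ring.
    have B W : bdd W bW -> `|hip (W (i u)) (i u)| <= bW * hip (i u) (i u).
      move=> b; apply: le_trans (cs_nrm sS _ _) _.
      by rewrite -(nrm_sqr sS) expr2 mulrA ler_wpM2r ?nrm_ge0.
    have := B _ bWp; have := B _ bWm; rewrite !ler_norml /be -mulrA.
    move: (hip (i u) (i u)) (hip (Wm _) _) (hip (Wp _) _) (qm u) => n y z t.
    by move: (bW * n) => x; lra.
  have h3 : be * hip (i u) (i u) <= qm u + be ^+ 2 / 4 * qm w.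
    have p0 := qm0 u; have p1 := qm0 w.
    have p2 : 0 <= be ^+ 2 / 4 * qm w by nneg.
    rewrite -ler_sqr ?nnegrE; [|by rewrite mulr_ge0|by rewrite addr_ge0].
    rewrite exprMn; apply: le_trans (ler_wpM2l (sqr_ge0 _) h1) _; rewrite -subr_ge0.
    by have := sqr_ge0 (qm u - be ^+ 2 / 4 * qm w); congr (0 <= _); field.
  by rewrite mulNr; move: h2 h3; move: (_ * qm w) (be * _) => x y; lra.
pose E := [set x | exists u w, [/\ Lm w ~~> i u, 0 < qm w & x = qp u / qm w]].
have Elb : has_lbound E.
  by exists (- (be ^+ 2 / 4)) => _ [u [w [h w0 ->]]]; rewrite ler_pdivlMr// low.
have [w0 Hw0 _] := solv_orthogonal Hpsi Npsi cm0 G u0psi.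
have Nu0 : 0 < hip (i u0) (i u0).
  rewrite lt0r N0 andbT; apply/eqP => h; move: u0neg; rewrite ltNge => /negP; apply.
  rewrite -[0](mulr0 (- no (Lp u0))) -(nrm_eq0 sS (i u0)).2//.
  by rewrite mulNr lerNl; apply: le_trans (ler_norm _) _; rewrite normrN; exact: cs_nrm.
have qw0 : 0 < qm w0.
  rewrite lt0r qm0 andbT; apply/eqP => h; have := NN _ _ Hw0; rewrite h mul0r.
  by rewrite leNgt exprn_gt0.
have E0 : E !=set0 by exists (qp u0 / qm w0), u0, w0.
pose m := inf E.
have m0 : m < 0.
  apply: (@le_lt_trans _ _ (qp u0 / qm w0)); last by rewrite pmulr_llt0 ?invr_gt0.
  by apply: ge_inf => //; exists u0, w0.
have pos u w : Lm w ~~> i u -> 0 <= qp u - m * qm w.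
  move=> h; rewrite subr_ge0; have [w1|] := ltP 0 (qm w).
    by rewrite -ler_pdivlMr//; apply: ge_inf => //; exists u, w.
  move=> w1; have wz : qm w = 0 by apply/eqP; rewrite eq_le w1 qm0.
  have Nu : hip (i u) (i u) = 0.
    by apply/eqP; rewrite -sqrf_eq0 eq_le sqr_ge0 andbT; have := NN _ _ h; rewrite wz mul0r.
  rewrite wz mulr0 -[0](mulr0 (- no (Lp u))) -(nrm_eq0 sS (i u)).2//.
  by rewrite mulNr lerNl; apply: le_trans (ler_norm _) _; rewrite normrN; exact: cs_nrm.
pose l := Num.sqrt (- m); have l0 : 0 < l by rewrite sqrtr_gt0 oppr_gt0.
have l2 : l ^+ 2 = - m by rewrite sqr_sqrtr// oppr_ge0 ltW.
exists l => // -[sol [C HC]].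
pose C1 := `|C| + 1; have C10 : 0 < C1 by rewrite ltr_wpDl.
have K0 : 0 < C1 / cm by rewrite divr_gt0.
(* Such an estimate says that every quotient is at least [m + cm / C1], against the choice of [m] as
   infimum. *)
suff key u w : Lm w ~~> i u -> 0 < qm w -> qm w <= C1 / cm * (qp u - m * qm w).
  have : m + (C1 / cm)^-1 <= m.
    apply: lb_le_inf => // _ [u [w [h w1 ->]]]; have := key u w h w1.
    rewrite mulrC -ler_pdivrMr// => h'; rewrite ler_pdivlMr// mulrDl -lerBrDl.
    by rewrite [(C1 / cm)^-1 * _]mulrC.
  by rewrite gerDl leNgt invr_gt0 K0.
move=> Hw w1.
(* The preimage [w] is free up to multiples of [psi]; it is normalized to be orthogonal to [psi] so
   that the gap of [L_-] bounds its norm by its form. *)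
pose t := hip (i w) (i psi) / hip (i psi) (i psi); pose w' := w - t *: psi.
have w'psi : hip (i w') (i psi) = 0.
  by rewrite /w' (linB li) (linZ li) !(sipE sS) /t divfK ?subrr// gt_eqF.
have Hw' : Lm w' ~~> i u.
  apply: eqv_trans Hw => //; apply: nrm_le0; rewrite -(linB lLm) /w' addrAC subrr add0r.
  by rewrite (linN lLm) (linZ lLm) (nrmN sS) (nrmZ sS); move: Hpsi; rewrite /eqv subr0 => ->; rewrite mulr0.
have qw' : qm w' = qm w.
  rewrite /qm (eqv_ipl sS _ Hw') -(eqv_ipl sS _ Hw) /w' (linB li) (linZ li) !(sipE sS).
  by rewrite (sLm w psi) (eqv_ipl sS _ Hpsi) (sip0l sS); ring.
rewrite -qw' in w1 *; clear Hw qw'; clearbody w'; clear t w; rename w' into w, w'psi into wpsi, Hw' into Hw.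
(* Eliminating [z = l L_-^-1 v] shows that [v] solves [(L_+ + l^2 L_-^-1) v = w]: the supposed
   resolvent inverts the operator of the minimization problem. *)
have [[[v v'] [z z']] Hy] := sol ((0, 0), (- i w, 0)).
set y : Y4 := (v, v', (z, z')) in Hy.
have [h1 _ h3 _] := nrm4_ge (JL l 0 y - ((0, 0), (- i w, 0)) : S4); rewrite Hy /= in h1 h3.
have e1 : Lm z ~~> l *: i v.
  apply: nrm_le0; apply: le_trans h1; rewrite scale0r addr0 subr0 le_eqVlt eqxx//.
have e2 : Lp v + l *: i z ~~> i w.
  apply: nrm_le0; apply: le_trans h3; rewrite scale0r addr0 opprK -(nrmN sS).
  by rewrite opprB opprD addrC le_eqVlt eqxx.
have Nv : no (i v) <= C1 * no (i w).
  have [h _ _ _] := nrm4_ge (emb4 y); apply: le_trans h _; apply: le_trans (HC y) _.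
  rewrite (eqv_nrm s4 Hy).
  have -> : no ((0, 0, (- i w, 0)) : S4) = no (i w).
    apply/eqP; rewrite -(@eqrXn2 _ 2) ?nrm_ge0// nrm4_sqr /= !(nrm0 sS) (nrmN sS); apply/eqP; ring.
  by rewrite ler_wpM2r ?nrm_ge0// (le_trans (ler_norm _))// lerDl.
have lz : Lm (l^-1 *: z) ~~> i v.
  rewrite (linZ lLm) -[i v](scale1r) -(mulVf (lt0r_neq0 l0)) -scalerA; exact: eqvZ.
have b11 : hip (i w) (i v) <= C1 / cm * qm w.
  apply: le_trans (ler_norm _) _; apply: le_trans (cs_nrm sS _ _) _.
  apply: le_trans (ler_wpM2l (nrm_ge0 _ _) Nv) _.
  rewrite mulrCA -expr2 (nrm_sqr sS) -mulrA ler_wpM2l ?(ltW C10)// mulrC ler_pdivlMr// mulrC.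
  exact: G.
(* Cauchy-Schwarz for the nonnegative form of [L_+ + l^2 L_-^-1] at [u] and [v]: the mixed value is
   [<w, u> = qm w], and the value at [v] is [<w, v>]. *)
have disc : qm w ^+ 2 <= (qp u - m * qm w) * hip (i w) (i v).
  apply: discriminant.
    have := pos _ _ lz; congr (0 <= _).
    rewrite -(eqv_ipl sS _ e2) (sipDl sS) (sipZl sS) /qp; congr (_ + _).
    rewrite /qm (eqv_ipl sS _ lz) (linZ li) (sipZr sS) -mulNr -l2 (sipC sS (i v)).
    by field; rewrite gt_eqF.
  move=> t; have hp : Lm (w - t *: (l^-1 *: z)) ~~> i (u - t *: v).
    by rewrite (linB lLm) (linB li) (linZ lLm t) (linZ li t); apply: eqvB => //; exact: eqvZ.
  have := pos _ _ hp; congr (0 <= _).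
  rewrite -[- (t *: v)]scaleNr -[- (t *: (l^-1 *: z))]scaleNr /qp {1}/qm (qDZ li lLp sLp) (qDZ li lLm sLm) sqrrN.
  have x1 : hip (Lp u) (i v) + l * hip (i z) (i u) = qm w.
    rewrite sLp -(sipZl sS) -(sipDl sS) (eqv_ipl sS _ e2) (sipC sS) -(eqv_ipl sS _ Hw) //.
  have x2 : hip (Lp v) (i v) + l * hip (i z) (i v) = hip (i w) (i v).
    by rewrite -(sipZl sS) -(sipDl sS) (eqv_ipl sS _ e2).
  have x3 : - m * hip (Lm w) (i (l^-1 *: z)) = l * hip (i z) (i u).
    rewrite (eqv_ipl sS _ Hw) (linZ li) (sipZr sS) -l2 (sipC sS (i z)); field; rewrite gt_eqF//.
  have x4 : - m * hip (Lm (l^-1 *: z)) (i (l^-1 *: z)) = l * hip (i z) (i v).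
    rewrite (eqv_ipl sS _ lz) (linZ li) (sipZr sS) -l2 (sipC sS (i z)); field; rewrite gt_eqF//.
  rewrite -x2 -[in 2 * t * qm w]x1 -x3 -x4 /qm; ring.
have a0 := pos _ _ Hw.
rewrite -(ler_pM2r w1) -expr2; apply: le_trans disc _.
by rewrite mulrAC mulrC ler_wpM2r.
Qed.

End Hamiltonian.

(** * Schroedinger operators on the line and on circles *)

Section L2Space.
Variables (R : realType) (s : domain R).
Notation leb := (@lebesgue_measure R).
Notation ip := (@L2inner R).

Definition L2pred : {pred R -> R^o} := [pred u | `[< L2 s u >]].

Lemma L2pred_submod : submod_closed L2pred.
Proof.
split; first by apply/asboolP; exact: L2_cst0.
by move=> a u v /asboolP hu /asboolP hv; apply/asboolP; exact: (L2_lin a hu hv).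
Qed.
HB.instance Definition _ := GRing.isSubmodClosed.Build R (R -> R^o) L2pred L2pred_submod.

Record L2T := MkL2 {l2val :> R -> R^o; _ : l2val \in L2pred}.
HB.instance Definition _ := [isSub for l2val].
HB.instance Definition _ := [Choice of L2T by <:].
HB.instance Definition _ := [SubChoice_isSubLmodule of L2T by <:].

Lemma L2TP (u : L2T) : L2 s u. Proof. by case: u => u /= /asboolP. Qed.

(** Zero outside L^2, so that inclusion, second derivative and multiplication are total maps; the
    [E] lemmas recover the functions. *)
Definition toL2 (f : R -> R) : L2T :=
  if pselect (L2 s f) is left h then MkL2 (asboolT h : f \in L2pred) else 0.
Lemma toL2E f : L2 s f -> (toL2 f : R -> R) = f.
Proof. by rewrite /toL2; case: pselect. Qed.

Definition L2ip (u v : L2T) : R := ip s u v.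
Lemma L2ip_sip : sip L2ip.
Proof.
split=> [u v|a u v w|u]; first exact: ipC; last exact: ip_ge0.
by rewrite /L2ip -(ip_lin a (L2TP u) (L2TP v) (L2TP w)).
Qed.

Lemma L2ip_complete (u : nat -> L2T) :
    (forall e, 0 < e -> exists N, forall m n, (N <= m)%N -> (N <= n)%N ->
       nrm L2ip (u m - u n) <= e) ->
    exists l, forall e, 0 < e -> exists N, forall n, (N <= n)%N -> nrm L2ip (u n - l) <= e.
Proof.
move=> cu; have [||l [Hl cl]] := @L2_complete R s (fun n => u n); first by move=> n; exact: L2TP.
  move=> e e0; have [N HN] := cu (Num.sqrt e) (etrans (sqrtr_gt0 e) e0).
  exists N => m n Nm Nn; have := HN m n Nm Nn.
  move=> h; rewrite -[e](sqr_sqrtr (ltW e0)) -[leLHS]/(L2ip (u m - u n) (u m - u n)).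
  by rewrite -(nrm_sqr L2ip_sip) ler_sqr ?nnegrE ?nrm_ge0 ?sqrtr_ge0.
exists (toL2 l) => e e0; have [N HN] := cl (e ^+ 2) (exprn_gt0 _ e0).
exists N => n Nn; rewrite -(ler_sqr (x := nrm _ _)) ?nnegrE ?nrm_ge0 ?(ltW e0)//.
by rewrite (nrm_sqr L2ip_sip); have := HN n Nn; rewrite /nsq /L2ip -{1 2}(toL2E Hl).
Qed.
Definition L2h : hspace R := Hspace L2ip_sip L2ip_complete.

Definition H2pred : {pred ((R -> R^o) * (R -> R^o) * (R -> R^o))%type} :=
  [pred u | `[< H2r s u.1.1 u.1.2 u.2 >]].
Lemma H2pred_submod : submod_closed H2pred.
Proof.
split.
  apply/asboolP; have h := L2_cst0 s; split => //; exact: ac_cst.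
move=> a u v /asboolP[h1 h2 h3 h4 h5] /asboolP[k1 k2 k3 k4 k5]; apply/asboolP; split.
- exact: (acD (acZ a h1) k1).
- exact: (acD (acZ a h2) k2).
- exact: (L2_lin a h3 k3).
- exact: (L2_lin a h4 k4).
- exact: (L2_lin a h5 k5).
Qed.
HB.instance Definition _ := GRing.isSubmodClosed.Build R ((R -> R^o) * (R -> R^o) * (R -> R^o))%type
  H2pred H2pred_submod.
(* An element of H^2 is a triple: the function, absolutely continuous together with its first
   derivative, and its first two derivatives. *)
Record H2T := MkH2 {h2val : ((R -> R^o) * (R -> R^o) * (R -> R^o))%type; _ : h2val \in H2pred}.
HB.instance Definition _ := [isSub for h2val].
HB.instance Definition _ := [Choice of H2T by <:].
HB.instance Definition _ := [SubChoice_isSubLmodule of H2T by <:].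

Definition h0 (y : H2T) : R -> R := (h2val y).1.1.
Definition h1 (y : H2T) : R -> R := (h2val y).1.2.
Definition h2 (y : H2T) : R -> R := (h2val y).2.
Lemma H2TP (y : H2T) : H2r s (h0 y) (h1 y) (h2 y).
Proof. by rewrite /h0 /h1 /h2; case: y => u /= /asboolP. Qed.
Lemma toH2_subproof u u1 u2 : H2r s u u1 u2 -> ((u, u1, u2) : (R -> R^o) * (R -> R^o) * (R -> R^o)) \in H2pred.
Proof. by move=> h; apply/asboolP. Qed.
Definition toH2 u u1 u2 (h : H2r s u u1 u2) : H2T := MkH2 (toH2_subproof h).

Definition incl (y : H2T) : L2h := toL2 (h0 y).
Definition lapl (y : H2T) : L2h := toL2 (fun x => - h2 y x).
Definition mulop (w : R -> R) (u : L2h) : L2h := toL2 (fun x => w x * (u : L2T) x).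
Definition mult (w : R -> R) (M : R) :=
  [/\ meas w, ae_periodic s w & {ae leb, forall x, `|w x| <= M}].

(** Truncation at the essential bound changes the multiplier on a null set only. *)
Lemma mult_clip w M : mult w M -> exists w', [/\ meas w', ae_periodic s w',
  forall x, `|w' x| <= `|M| & {ae leb, forall x, w x = w' x}].
Proof.
move=> [mw pw bw]; exists (fun x => Num.max (- `|M|) (Num.min `|M| (w x))); split.
- by apply: measurable_maxr; [exact: measurable_cst|apply: measurable_minr => //; exact: measurable_cst].
- by case: s pw => //= L; apply: aeS => x ->.
- move=> x; rewrite ler_norml le_max lexx/= ge_max ge_min lexx andbT.
  by rewrite (le_trans _ (normr_ge0 M))// oppr_le0.
- apply: aeS bw => x; move=> h; have : `|w x| <= `|M| by apply: le_trans h (ler_norm _).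
  by rewrite ler_norml => /andP[h1 h2]; rewrite (min_idPr h2) (max_idPr h1).
Qed.

Lemma mult_L2 w M u : mult w M -> L2 s u -> L2 s (fun x => w x * u x).
Proof.
move=> mw hu; have [w' [mw' pw' bw' ww']] := mult_clip mw.
apply: L2_ae (L2_mulb hu mw' pw' bw') _ _.
  by case: mw => mw _ _; apply: measM => //; exact: L2_meas hu.
by apply: aeS ww' => x ->.
Qed.

Lemma inclE y : (incl y : L2T) = h0 y :> (R -> R).
Proof. by apply: toL2E; case: (H2TP y). Qed.
Lemma laplE y : (lapl y : L2T) = (fun x => - h2 y x) :> (R -> R).
Proof. by apply: toL2E; apply: L2N; case: (H2TP y). Qed.
Lemma mulopE w M (u : L2h) : mult w M -> (mulop w u : L2T) = (fun x => w x * (u : L2T) x) :> (R -> R).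
Proof. by move=> mw; apply: toL2E; exact: mult_L2 mw (L2TP u). Qed.

Lemma L2T_ext (u v : L2T) : (u : R -> R) = v -> u = v.
Proof. by move=> h; exact: val_inj. Qed.

Lemma lin_incl : lin incl.
Proof.
move=> a u v; apply: L2T_ext; rewrite inclE; apply/funext => x.
have -> : (a *: incl u + incl v : L2T) x = a * (incl u : L2T) x + (incl v : L2T) x :> R by [].
by rewrite !inclE.
Qed.
Lemma lin_lapl : lin lapl.
Proof.
move=> a u v; apply: L2T_ext; rewrite laplE; apply/funext => x.
have -> : (a *: lapl u + lapl v : L2T) x = a * (lapl u : L2T) x + (lapl v : L2T) x :> R by [].
by rewrite !laplE /h2 /=; rewrite mulrN -opprD.
Qed.
Lemma lin_mulop w M : mult w M -> lin (mulop w).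
Proof.
move=> mw a u v; apply: L2T_ext; rewrite (mulopE _ mw); apply/funext => x.
have -> : (a *: mulop w u + mulop w v : L2T) x = a * (mulop w u : L2T) x + (mulop w v : L2T) x :> R by [].
rewrite !(mulopE _ mw) /=.
by rewrite (mulrCA a) -mulrDr.
Qed.
Lemma symb_mulop w M : mult w M -> symb (mulop w).
Proof.
move=> mw u v; rewrite /hip /= /L2ip /L2inner !(mulopE _ mw); congr (Rintegral _ _ _).
by apply/funext => x; ring.
Qed.
Lemma bdd_mulop w M : 0 <= M -> mult w M -> bdd (mulop w) M.
Proof.
move=> M0 mw u; have sS := hsip L2h.
rewrite -ler_sqr ?nnegrE ?mulr_ge0 ?nrm_ge0// exprMn !(nrm_sqr sS).
have [w' [mw' pw' bw' ww']] := mult_clip mw; have hu := L2TP (u : L2T).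
have hw := L2_mulb hu mw' pw' bw'; have hw0 := mult_L2 mw hu.
have e : {ae leb, forall x, w x * (u : L2T) x = w' x * (u : L2T) x} by apply: aeS ww' => x ->.
rewrite /hip /= /L2ip (mulopE _ mw) (ip_ae s (L2_meas hw0) (L2_meas hw0) (L2_meas hw) (L2_meas hw) e e).
rewrite /L2inner -cintZ; last exact: L2_mul.
apply: cint_le; first exact: L2_mul.
  by apply: integZ; apply: L2_mul.
move=> x; rewrite -!expr2 exprMn ler_wpM2r ?sqr_ge0// -[w' x ^+ 2]real_normK ?num_real//.
by rewrite -[M ^+ 2]real_normK ?num_real// ler_sqr ?nnegrE.
Qed.

Lemma eqv_aeE (u v : L2h) : dpos s ->
  eqv hip u v <-> {ae leb, forall x, (u : L2T) x = (v : L2T) x}.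
Proof.
move=> ds; have sS := hsip L2h; have hd := L2B (L2TP u) (L2TP v).
have E : hip (u - v) (u - v) = ip s (fun x => (u : L2T) x - (v : L2T) x) (fun x => (u : L2T) x - (v : L2T) x) by [].
split.
  move=> /(nrm_eq0 sS); rewrite E => /(ip0_ae ds hd); apply: aeS => x /eqP.
  by rewrite subr_eq0 => /eqP.
move=> h; apply/(nrm_eq0 sS); rewrite E.
have m := L2_meas hd; have m0 := meas_cst (0 : R).
rewrite (ip_ae s (u' := fun=> 0) (v' := fun=> 0) m m m0 m0); last 2 first.
- by apply: aeS h => x ->; rewrite subrr.
- by apply: aeS h => x ->; rewrite subrr.
rewrite /L2inner; under eq_Rintegral do rewrite mulr0.
by rewrite /Rintegral integral0.
Qed.

Lemma lapl_form a b : dpos s -> hip (lapl a) (incl b) = ip s (h1 a) (h1 b).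
Proof.
move=> ds; rewrite /hip /= /L2ip laplE inclE.
have := parts ds (H2TP a) (H2TP b); rewrite /L2inner => h.
rewrite -[RHS]opprK -h /Rintegral.
have [_ _ _ _ ha] := H2TP a; have [_ _ hb _ _] := H2TP b.
have := cintZ (-1) (L2_mul ha hb); rewrite mulN1r /Rintegral => <-.
by under eq_integral do rewrite mulNr -mulN1r.
Qed.

Lemma sym_lapl : dpos s -> symop incl lapl.
Proof. by move=> ds y z; rewrite !lapl_form// ipC. Qed.

End L2Space.

(** * Reduction of the complex operators to real components *)

Section ComplexParts.
Variable R : realType.
Notation leb := (@lebesgue_measure R).
Notation Re := complex.Re.
Notation Im := complex.Im.
Implicit Types z w : R[i].

Lemma ReD z w : Re (z + w) = Re z + Re w. Proof. by case: z w => [a b] [c d]. Qed.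
Lemma ImD z w : Im (z + w) = Im z + Im w. Proof. by case: z w => [a b] [c d]. Qed.
Lemma ReN z : Re (- z) = - Re z. Proof. by case: z. Qed.
Lemma ImN z : Im (- z) = - Im z. Proof. by case: z. Qed.
Lemma ReM z w : Re (z * w) = Re z * Re w - Im z * Im w. Proof. by case: z w => [a b] [c d]. Qed.
Lemma ImM z w : Im (z * w) = Re z * Im w + Im z * Re w. Proof. by case: z w => [a b] [c d]. Qed.
Definition partE := (ReD, ImD, ReN, ImN, ReM, ImM).
Lemma complex_ext z w : Re z = Re w -> Im z = Im w -> z = w.
Proof. by case: z w => [a b] [c d] /= -> ->. Qed.

Lemma ae_equalP m (u v : vfun R m) : ae_equal u v <->
  forall i, {ae leb, forall x, re u i x = re v i x} /\ {ae leb, forall x, im u i x = im v i x}.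
Proof.
split=> [h i|H]; first by split; apply: aeS h => x; rewrite /re /im => ->.
have : {ae leb, forall x, forall n (i : 'I_m), val i = n -> re u i x = re v i x /\ im u i x = im v i x}.
  apply: ae_foralln => n; have [nm|nm] := ltnP n m; last first.
    by apply: aeW => x i Hi; move: nm; rewrite -Hi leqNgt ltn_ord.
  have [h1 h2] := H (Ordinal nm); apply: aeS2 h1 h2 => x e1 e2 i Hi.
  by have -> : i = Ordinal nm by exact: val_inj.
apply: aeS => x h; apply/colP => i; apply: complex_ext; by have [] := h _ i erefl.
Qed.

Definition cof (f g : R -> R) : vfun R 1 := fun x => \col_i (f x +i* g x).
Lemma re_cof f g i : re (cof f g) i = f. Proof. by apply/funext => x; rewrite /re mxE. Qed.
Lemma im_cof f g i : im (cof f g) i = g. Proof. by apply/funext => x; rewrite /im mxE. Qed.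

Definition schr (Q : R -> R) (u : vfun R 1) : vfun R 1 :=
  fun x => - cwD (cwD u) x + (Q x)%:C *: u x.

Lemma LminusE (V : R -> R) mu om psi : Lminus V mu om psi = schr (fun x => mu * V x + om - psi x ^+ 2).
Proof.
apply/funext => u; apply/funext => x; rewrite /Lminus /schr !rmorphB !rmorphD /= scalerBl scalerDl.
by rewrite !addrA.
Qed.
Lemma LplusE (V : R -> R) mu om psi : Lplus V mu om psi = schr (fun x => mu * V x + om - 3 * psi x ^+ 2).
Proof.
apply/funext => u; apply/funext => x; rewrite /Lplus /schr !rmorphB !rmorphD /= scalerBl scalerDl.
by rewrite !addrA.
Qed.
Lemma HillE (V : R -> R) mu u x : Hill V mu u x = - schr (fun x => mu * V x) u x.
Proof. by rewrite /Hill /schr opprD opprK. Qed.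

Lemma re_cwD m (u : vfun R m) i : re (cwD u) i = wD (re u i).
Proof. by apply/funext => x; rewrite /re mxE. Qed.
Lemma im_cwD m (u : vfun R m) i : im (cwD u) i = wD (im u i).
Proof. by apply/funext => x; rewrite /im mxE. Qed.

Lemma re_schr Q u i x : re (schr Q u) i x = - wD (wD (re u i)) x + Q x * re u i x.
Proof. by rewrite -!re_cwD /re /schr !mxE !partE /= mul0r subr0. Qed.
Lemma im_schr Q u i x : im (schr Q u) i x = - wD (wD (im u i)) x + Q x * im u i x.
Proof. by rewrite -!im_cwD /im /schr !mxE !partE /= mul0r addr0. Qed.

Lemma re_shift m A z (u : vfun R m) i x :
  re (shift_op A z u) i x = re (A u) i x - (Re z * re u i x - Im z * im u i x).
Proof. by rewrite /re /im /shift_op; move: (A u) => v; rewrite !mxE !partE. Qed.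
Lemma im_shift m A z (u : vfun R m) i x :
  im (shift_op A z u) i x = im (A u) i x - (Re z * im u i x + Im z * re u i x).
Proof. by rewrite /re /im /shift_op; move: (A u) => v; rewrite !mxE !partE. Qed.

Definition vidx : 'I_(1 + 1) := lshift 1 ord0.
Definition widx : 'I_(1 + 1) := rshift 1 ord0.
Lemma idxP (P : 'I_(1 + 1) -> Prop) : P vidx -> P widx -> forall i, P i.
Proof.
move=> h1 h2 i; rewrite -(splitK i); case: (fintype.split i) => j; rewrite (ord1 j) //.
Qed.

Lemma J_mul (a b : 'cV[R[i]]_1) : J R *m col_mx a b = col_mx b (- a).
Proof. by rewrite /J mul_block_col mul0mx mul0mx mulNmx !mul1mx add0r addr0. Qed.

Lemma Lfull_v (V : R -> R) mu om psi u x : Lfull V mu om psi u x vidx 0 =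
  Lminus V mu om psi (fun y => dsubmx (u y)) x 0 0.
Proof.
rewrite /Lfull; move: (Lplus _ _ _ _ _ x) (Lminus _ _ _ _ _ x) => a b.
by rewrite J_mul /vidx col_mxEu.
Qed.
Lemma Lfull_w (V : R -> R) mu om psi u x : Lfull V mu om psi u x widx 0 =
  - Lplus V mu om psi (fun y => usubmx (u y)) x 0 0.
Proof.
rewrite /Lfull; move: (Lplus _ _ _ _ _ x) (Lminus _ _ _ _ _ x) => a b.
by rewrite J_mul /widx col_mxEd mxE.
Qed.

End ComplexParts.

Section Representatives.
Variables (R : realType) (s : domain R) (ds : dpos s).
Notation leb := (@lebesgue_measure R).
Notation S := (L2h s).
Notation Y := (H2T s).
Notation i := (@incl R s).
Notation no := (nrm hip).
Notation "f =ae g" := {ae leb, forall x, f x = g x} (at level 70).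
Notation "u ~~> v" := (eqv hip u v) (at level 70).

Lemma ae_trans (f g h : R -> R) : f =ae g -> g =ae h -> f =ae h.
Proof. by apply: aeS2 => x -> ->. Qed.
Lemma ae_sym (f g : R -> R) : f =ae g -> g =ae f.
Proof. by apply: aeS => x ->. Qed.
Lemma ae_refl (f : R -> R) : f =ae f.
Proof. exact: aeW. Qed.

Lemma H2_meas f : H2 s f -> meas f. Proof. by case=> _ _ /L2_meas. Qed.

Lemma H2_repY f : H2 s f -> exists y : Y, f =ae h0 y.
Proof. by move=> /H2_rep[v [v1 [v2 [h hf _ _]]]]; exists (toH2 h). Qed.

Lemma rep_H2Y f (y : Y) : meas f -> f =ae h0 y -> H2 s f /\ wD (wD f) =ae h2 y.
Proof. by move=> mf hf; have [] := rep_H2 (H2TP y) mf hf. Qed.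

Lemma meas_h0 (y : Y) : meas (h0 y). Proof. by have [_ _ /L2_meas] := H2TP y. Qed.
Lemma H2_h0 (y : Y) : H2 s (h0 y).
Proof. by have [] := rep_H2Y (meas_h0 y) (ae_refl _). Qed.

Lemma L2norm_rep f (u : S) : L2 s f -> f =ae (u : L2T s) -> L2norm s f = no u.
Proof.
move=> hf hfu; apply/eqP; rewrite -(@eqrXn2 _ 2) ?nrm_ge0 ?L2norm_ge0//.
rewrite (nrm_sqr (hsip S)) L2norm_sqr//; apply/eqP.
have m1 := L2_meas hf; have m2 := L2_meas (L2TP (u : L2T s)).
exact: ip_ae.
Qed.

Lemma L2_rep f : L2 s f -> f =ae (toL2 s f).
Proof. by move=> hf; rewrite toL2E//; exact: ae_refl. Qed.

Definition Aop Q (y : Y) : S := lapl y + mulop Q (i y).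

Section Multiplier.
Variables (Q : R -> R) (M : R) (mQ : mult s Q M).

Lemma AopE y : (Aop Q y : L2T s) = (fun x => - h2 y x + Q x * h0 y x) :> (R -> R).
Proof.
apply/funext => x.
have -> : (Aop Q y : L2T s) x = (lapl y : L2T s) x + (mulop Q (i y) : L2T s) x by [].
by rewrite laplE (mulopE _ mQ) inclE.
Qed.
Lemma lin_Aop : lin (Aop Q).
Proof. by apply: lin_add; [exact: lin_lapl|apply: lin_comp; [exact: lin_incl|exact: lin_mulop mQ]]. Qed.
Lemma sym_Aop : symop i (Aop Q).
Proof.
move=> y z; have sS := hsip S; rewrite /Aop !(sipDl sS) (sym_lapl ds); congr (_ + _).
exact: (symb_mulop mQ).
Qed.

Lemma schr_rep f y : meas f -> f =ae h0 y ->
  (fun x => - wD (wD f) x + Q x * f x) =ae (Aop Q y : L2T s).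
Proof.
move=> mf hf; have [_ h] := rep_H2Y mf hf; rewrite AopE.
by apply: aeS2 hf h => x -> ->.
Qed.

Lemma schr_shift_re u y r : meas (re u ord0) -> re u ord0 =ae h0 y ->
  re (shift_op (schr Q) r%:C u) ord0 =ae (Aop Q y - r *: i y : L2T s).
Proof.
move=> mu hu; have h := schr_rep mu hu; apply: aeS2 h hu => x e1 e2.
have -> : (Aop Q y - r *: i y : L2T s) x = (Aop Q y : L2T s) x - r * (i y : L2T s) x by [].
by rewrite -e1 inclE -e2 re_shift re_schr /= mul0r subr0.
Qed.
Lemma schr_shift_im u y r : meas (im u ord0) -> im u ord0 =ae h0 y ->
  im (shift_op (schr Q) r%:C u) ord0 =ae (Aop Q y - r *: i y : L2T s).
Proof.
move=> mu hu; have h := schr_rep mu hu; apply: aeS2 h hu => x e1 e2.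
have -> : (Aop Q y - r *: i y : L2T s) x = (Aop Q y : L2T s) x - r * (i y : L2T s) x by [].
by rewrite -e1 inclE -e2 im_shift im_schr /= mul0r addr0.
Qed.

End Multiplier.
End Representatives.

Lemma sqrt_sum_le (R : realType) (K a b c d : R) : 0 <= K -> 0 <= a -> 0 <= b -> a <= K * c -> b <= K * d ->
  Num.sqrt (a ^+ 2 + b ^+ 2) <= K * Num.sqrt (c ^+ 2 + d ^+ 2).
Proof.
move=> K0 a0 b0 h1 h2; rewrite -{1}[K]ger0_norm// -sqrtr_sqr -sqrtrM ?sqr_ge0//.
apply: ler_wsqrtr; rewrite mulrDr -!exprMn.
by apply: lerD; rewrite ler_sqr ?nnegrE// (le_trans _ h1, le_trans _ h2).
Qed.

Section Conversions.
Variables (R : realType) (s : domain R) (ds : dpos s).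
Notation leb := (@lebesgue_measure R).
Notation S := (L2h s).
Notation Y := (H2T s).
Notation i := (@incl R s).
Notation no := (nrm hip).
Notation "f =ae g" := {ae leb, forall x, f x = g x} (at level 70).
Notation "u ~~> v" := (eqv hip u v) (at level 70).
Let sS := hsip S.

Lemma cL2norm1 (u : vfun R 1) : cL2norm s u = Num.sqrt (L2norm s (re u ord0) ^+ 2 + L2norm s (im u ord0) ^+ 2).
Proof. by rewrite /cL2norm big_ord1. Qed.

Lemma L2_eqae (f : R -> R) (u : S) : meas f -> f =ae (u : L2T s) -> L2 s f.
Proof. by move=> mf h; apply: L2_ae (L2TP (u : L2T s)) mf _; exact: ae_sym. Qed.

Lemma meas_schr Q M f : mult s Q M -> H2 s f -> meas (fun x => - wD (wD f) x + Q x * f x).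
Proof.
move=> [mQ _ _] [_ _ /L2_meas h1 _ /L2_meas h2].
by apply: measD; [exact: measN|exact: measM].
Qed.

Lemma incl_eq (y : Y) : (i y : L2T s) = h0 y :> (R -> R). Proof. exact: inclE. Qed.

Section Scalar.
Variables (Q : R -> R) (M : R) (mQ : mult s Q M).
Let A r (y : Y) : S := Aop Q y - r *: i y.

Lemma lin_Ar r : lin (A r).
Proof.
have h := lin_Aop mQ; have h' := @lin_incl R s.
by move=> a u v; rewrite /A h h' [r *: (_ + _)]scalerDr opprD addrACA scalerA [r * a]mulrC -scalerA -scalerBr.
Qed.

Lemma shift_meas r u : cH2 s u ->
  meas (re (shift_op (schr Q) r%:C u) ord0) /\ meas (im (shift_op (schr Q) r%:C u) ord0).
Proof.
move=> hu; have [h1 h2] := hu ord0.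
split.
  have -> : re (shift_op (schr Q) r%:C u) ord0 = fun x => - wD (wD (re u ord0)) x + Q x * re u ord0 x - r * re u ord0 x.
    by apply/funext => x; rewrite re_shift re_schr /= mul0r subr0.
  by apply: measB; [exact: meas_schr mQ h1|apply: measZ; exact: (H2_meas h1)].
have -> : im (shift_op (schr Q) r%:C u) ord0 = fun x => - wD (wD (im u ord0)) x + Q x * im u ord0 x - r * im u ord0 x.
  by apply/funext => x; rewrite im_shift im_schr /= mul0r addr0.
by apply: measB; [exact: meas_schr mQ h2|apply: measZ; exact: (H2_meas h2)].
Qed.

Lemma cH2_cof (y z : Y) : cH2 s (cof (h0 y) (h0 z)).
Proof. by move=> j; rewrite re_cof im_cof; split; exact: H2_h0. Qed.
Lemma cL2_cof (f g : S) : cL2 s (cof f g).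
Proof. by move=> j; rewrite re_cof im_cof; split; exact: L2TP. Qed.

Lemma cL2norm_rep (u : vfun R 1) (f g : S) : cL2 s u -> re u ord0 =ae (f : L2T s) -> im u ord0 =ae (g : L2T s) ->
  cL2norm s u = Num.sqrt (no f ^+ 2 + no g ^+ 2).
Proof.
move=> hu h1 h2; rewrite cL2norm1.
by rewrite (L2norm_rep (hu ord0).1 h1) (L2norm_rep (hu ord0).2 h2).
Qed.

Lemma shift_rep r u (y z : Y) : cH2 s u -> re u ord0 =ae h0 y -> im u ord0 =ae h0 z ->
  [/\ cL2 s (shift_op (schr Q) r%:C u), re (shift_op (schr Q) r%:C u) ord0 =ae (A r y : L2T s) &
      im (shift_op (schr Q) r%:C u) ord0 =ae (A r z : L2T s)].
Proof.
move=> hu hy hz; have [m1 m2] := shift_meas r hu.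
have e1 := schr_shift_re mQ r (H2_meas (hu ord0).1) hy.
have e2 := schr_shift_im mQ r (H2_meas (hu ord0).2) hz.
split=> // j; rewrite (ord1 j); split; [exact: L2_eqae m1 e1|exact: L2_eqae m2 e2].
Qed.

(** For a real potential and a real spectral parameter the real and imaginary parts decouple; real
    data are tested as complex data with imaginary part zero. *)
Lemma resolvent_schr r : resolvent_set s (schr Q) r%:C -> solv (A r) /\ exists C, lb i (A r) C.
Proof.
move=> [[_ sur] [C HC]]; split.
  move=> f; have [u hu hf] := sur _ (cL2_cof f 0).
  have [y hy] := H2_repY (hu ord0).1; have [z hz] := H2_repY (hu ord0).2.
  have [_ e1 _] := shift_rep r hu hy hz.
  exists y; apply/(eqv_aeE _ _ ds); apply: ae_trans (ae_sym e1) _.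
  by have [h _] := (ae_equalP _ _).1 hf ord0; rewrite re_cof in h.
exists C => y; have hu := cH2_cof y 0.
have hy : re (cof (h0 y) (h0 (0 : Y))) ord0 =ae h0 y by rewrite re_cof; exact: ae_refl.
have hz : im (cof (h0 y) (h0 (0 : Y))) ord0 =ae h0 (0 : Y) by rewrite im_cof; exact: ae_refl.
have [k1 e1 e2] := shift_rep r hu hy hz.
have := HC _ hu; rewrite (cL2norm_rep k1 e1 e2) (lin0 (lin_Ar r)) (nrm0 sS).
have e3 : re (cof (h0 y) (h0 (0 : Y))) ord0 =ae (i y : L2T s) by rewrite incl_eq.
have e4 : im (cof (h0 y) (h0 (0 : Y))) ord0 =ae (i (0 : Y) : L2T s) by rewrite incl_eq.
have k2 : cL2 s (cof (h0 y) (h0 (0 : Y))).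
  by move=> j; rewrite re_cof im_cof; split; [have [] := H2TP y|have [] := H2TP (0 : Y)].
rewrite (cL2norm_rep k2 e3 e4) (lin0 (@lin_incl R s)) (nrm0 sS) expr0n/= !addr0.
by rewrite !sqrtr_sqr !ger0_norm ?nrm_ge0.
Qed.

Lemma A0E : A 0 = Aop Q. Proof. by apply/funext => y; rewrite /A scale0r subr0. Qed.
Lemma shift0 m (B : vfun R m -> vfun R m) : shift_op B 0%:C = B.
Proof.
have E : 0%:C = 0 :> R[i] by [].
by apply/funext => u; apply/funext => x; rewrite /shift_op E scale0r subr0.
Qed.

Lemma resolvent_invertible (B : vfun R 1 -> vfun R 1) : invertible_op s B -> resolvent_set s B 0%:C.
Proof.
move=> [bij [C HC]]; rewrite /resolvent_set /= shift0; split=> //; exists C => u hu.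
apply: le_trans (HC u hu); rewrite /cL2norm /cH2norm ler_sqrt ?sumr_ge0//; last first.
  by move=> j _; rewrite addr_ge0 ?sqr_ge0.
apply: ler_sum => j _; apply: lerD; rewrite ler_sqr ?nnegrE ?L2norm_ge0 ?sqrtr_ge0//.
  rewrite -[L2norm _ _]ger0_norm ?L2norm_ge0// -sqrtr_sqr ler_sqrt ?addr_ge0 ?sqr_ge0//.
  by rewrite -addrA lerDl addr_ge0 ?sqr_ge0.
rewrite -[L2norm _ _]ger0_norm ?L2norm_ge0// -sqrtr_sqr ler_sqrt ?addr_ge0 ?sqr_ge0//.
by rewrite -addrA lerDl addr_ge0 ?sqr_ge0.
Qed.

(* [h2 y = Q h0 y - A y] and [|h1 y|^2 = <A y, y> - <Q y, y>]. *)
Lemma H2norm_le C : 0 <= M -> 0 <= C -> lb i (Aop Q) C -> exists2 K, 0 <= K &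
  forall (y : Y) f, meas f -> f =ae h0 y -> H2norm s f <= K * no (Aop Q y).
Proof.
move=> M0 C0 lA; pose K2 := C ^+ 2 + (C + M * C ^+ 2) + (1 + M * C) ^+ 2.
have K20 : 0 <= K2 by rewrite /K2; nneg.
exists (Num.sqrt K2) => // y f mf hf.
rewrite -(ler_sqr (x := H2norm _ _)) ?nnegrE ?mulr_ge0 ?nrm_ge0 ?sqrtr_ge0// exprMn (sqr_sqrtr K20).
rewrite (H2norm_sqr (H2TP y) mf hf); set n := no (Aop Q y).
have n0 : 0 <= n by exact: nrm_ge0.
have bM := bdd_mulop M0 mQ.
have E0 : nsq s (h0 y) = no (i y) ^+ 2 by rewrite (nrm_sqr sS) /hip /= /L2ip inclE.
have E1 : nsq s (h1 y) = hip (Aop Q y) (i y) - hip (mulop Q (i y)) (i y).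
  by rewrite /Aop (sipDl sS) addrK lapl_form.
have E2 : nsq s (h2 y) = no (Aop Q y - mulop Q (i y)) ^+ 2.
  rewrite (nrm_sqr sS) /Aop addrK /hip /= /L2ip laplE /nsq /L2inner.
  by congr (Rintegral _ _ _); apply/funext => x; rewrite mulrNN.
have l := lA y; rewrite -/n in l.
have l' : no (mulop Q (i y)) <= M * C * n.
  by apply: le_trans (bM _) _; rewrite -mulrA ler_wpM2l.
rewrite E0 E1 E2 !mulrDl; apply: lerD; first apply: lerD.
- by rewrite -exprMn ler_sqr ?nnegrE ?mulr_ge0 ?nrm_ge0.
- have h1 := cs_nrm sS (Aop Q y) (i y); have h2 := cs_nrm sS (mulop Q (i y)) (i y).
  have h3 : n * no (i y) <= C * n ^+ 2 by rewrite expr2 mulrCA ler_wpM2l.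
  have h4 : no (mulop Q (i y)) * no (i y) <= M * C ^+ 2 * n ^+ 2.
    have -> : M * C ^+ 2 * n ^+ 2 = (M * C * n) * (C * n) by ring.
    by rewrite ler_pM ?nrm_ge0.
  move: h1 h2; rewrite !ler_norml -/n; move: (hip _ _) (hip _ _) (n * _) (no _ * _) h3 h4 => a b c d.
  by move: (C * _) (M * _ * _) => e g; lra.
rewrite -exprMn ler_sqr ?nnegrE ?mulr_ge0 ?addr_ge0 ?mulr_ge0 ?nrm_ge0//.
by apply: le_trans (nrmB sS _ _) _; rewrite mulrDl mul1r lerD2l.
Qed.

Lemma schr_invertible C : 0 <= M -> 0 <= C -> @solv R S Y (Aop Q) -> lb i (Aop Q) C -> invertible_op s (schr Q).
Proof.
move=> M0 C0 oA lA; rewrite -A0E in oA; have lAr := lin_Aop mQ.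
have rep u (y z : Y) : cH2 s u -> re u ord0 =ae h0 y -> im u ord0 =ae h0 z ->
  [/\ cL2 s (schr Q u), re (schr Q u) ord0 =ae (Aop Q y : L2T s) & im (schr Q u) ord0 =ae (Aop Q z : L2T s)].
  by move=> hu hy hz; have := shift_rep 0 hu hy hz; rewrite A0E shift0.
have [K K0 HK] := H2norm_le M0 C0 lA.
split; first split.
- move=> u v hu hv E.
  have [y hy] := H2_repY (hu ord0).1; have [z hz] := H2_repY (hu ord0).2.
  have [y' hy'] := H2_repY (hv ord0).1; have [z' hz'] := H2_repY (hv ord0).2.
  have [_ a1 a2] := rep u y z hu hy hz; have [_ b1 b2] := rep v y' z' hv hy' hz'.
  have [E1 E2] := (ae_equalP _ _).1 E ord0.
  have inj (x x' : Y) : Aop Q x ~~> Aop Q x' -> h0 x =ae h0 x'.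
    move=> h; rewrite -!incl_eq; apply/(eqv_aeE _ _ ds); apply: nrm_le0.
    rewrite -(linB (@lin_incl R s)); apply: le_trans (lA _) _; rewrite (linB lAr).
    by move: h; rewrite /eqv => ->; rewrite mulr0.
  apply/ae_equalP => j; rewrite (ord1 j); split.
    apply: ae_trans hy _; apply: ae_trans (ae_sym hy'); apply: inj; apply/(eqv_aeE _ _ ds).
    exact: ae_trans (ae_sym a1) (ae_trans E1 b1).
  apply: ae_trans hz _; apply: ae_trans (ae_sym hz'); apply: inj; apply/(eqv_aeE _ _ ds).
  exact: ae_trans (ae_sym a2) (ae_trans E2 b2).
- move=> f hf; have [y hy] := oA (toL2 s (re f ord0)); have [z hz] := oA (toL2 s (im f ord0)).
  rewrite A0E in hy hz.
  have hu := cH2_cof y z; exists (cof (h0 y) (h0 z)) => //.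
  have k1 : re (cof (h0 y) (h0 z)) ord0 =ae h0 y by rewrite re_cof; exact: ae_refl.
  have k2 : im (cof (h0 y) (h0 z)) ord0 =ae h0 z by rewrite im_cof; exact: ae_refl.
  have [_ a1 a2] := rep _ y z hu k1 k2.
  apply/ae_equalP => j; rewrite (ord1 j); split.
    apply: ae_trans a1 _; apply: ae_trans (ae_sym (L2_rep (hf ord0).1)).
    exact/(eqv_aeE _ _ ds).
  apply: ae_trans a2 _; apply: ae_trans (ae_sym (L2_rep (hf ord0).2)).
  exact/(eqv_aeE _ _ ds).
- exists K => u hu.
  have [y hy] := H2_repY (hu ord0).1; have [z hz] := H2_repY (hu ord0).2.
  have [k1 a1 a2] := rep u y z hu hy hz.
  have h1 := HK y _ (H2_meas (hu ord0).1) hy; have h2 := HK z _ (H2_meas (hu ord0).2) hz.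
  rewrite (cL2norm_rep k1 a1 a2) /cH2norm big_ord1.
  exact: (sqrt_sum_le K0 (sqrtr_ge0 _) (sqrtr_ge0 _) h1 h2).
Qed.

Lemma eigenvalue_schr r : eigenvalue_op s (schr Q) r%:C <->
  exists2 y, 0 < hip (i y) (i y) & Aop Q y ~~> r *: i y.
Proof.
have rep u (y z : Y) := @shift_rep 0 u y z; rewrite A0E shift0 in rep.
split.
  move=> [u [hu nz e]].
  have [y hy] := H2_repY (hu ord0).1; have [z hz] := H2_repY (hu ord0).2.
  have [_ a1 a2] := rep u y z hu hy hz; have [E1 E2] := (ae_equalP _ _).1 e ord0.
  have ey : Aop Q y ~~> r *: i y.
    apply/(eqv_aeE _ _ ds); apply: ae_trans (ae_sym a1) _; apply: ae_trans E1 _.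
    apply: aeS hy => x hx; have -> : (r *: i y : L2T s) x = r * (i y : L2T s) x by [].
    by rewrite incl_eq -hx /re mxE !partE /= mul0r subr0.
  have ez : Aop Q z ~~> r *: i z.
    apply/(eqv_aeE _ _ ds); apply: ae_trans (ae_sym a2) _; apply: ae_trans E2 _.
    apply: aeS hz => x hx; have -> : (r *: i z : L2T s) x = r * (i z : L2T s) x by [].
    by rewrite incl_eq -hx /im mxE !partE /= mul0r addr0.
  have [Ny|] := ltP 0 (hip (i y) (i y)); first by exists y.
  have [Nz _|] := ltP 0 (hip (i z) (i z)); first by exists z.
  have H0 x : hip (i x) (i x) <= 0 -> h0 x =ae (fun=> 0).
    move=> h; have /(nrm_eq0 sS) : hip (i x) (i x) = 0 by apply/eqP; rewrite eq_le h sipP.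
    move=> h'; have : i x ~~> 0 by rewrite /eqv subr0.
    by move=> /(eqv_aeE _ _ ds); rewrite incl_eq.
  move=> z0 y0; exfalso; apply: nz; apply/ae_equalP => j; rewrite (ord1 j); split.
    by apply: ae_trans hy _; apply: aeS (H0 _ y0) => x ->; rewrite /re mxE.
  by apply: ae_trans hz _; apply: aeS (H0 _ z0) => x ->; rewrite /im mxE.
move=> [y Ny ey]; have hu := cH2_cof y 0; exists (cof (h0 y) (h0 (0 : Y))).
have k1 : re (cof (h0 y) (h0 (0 : Y))) ord0 =ae h0 y by rewrite re_cof; exact: ae_refl.
have k2 : im (cof (h0 y) (h0 (0 : Y))) ord0 =ae h0 (0 : Y) by rewrite im_cof; exact: ae_refl.
have [_ a1 a2] := rep _ y 0 hu k1 k2; split=> //.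
- move=> /ae_equalP /(_ ord0)[h _]; move: Ny; rewrite (_ : hip _ _ = 0) ?ltxx//.
  apply/(nrm_eq0 sS); have : i y ~~> 0; last by rewrite /eqv subr0.
  by apply/(eqv_aeE _ _ ds); rewrite incl_eq; apply: aeS2 k1 h => x <- ->; rewrite /re mxE.
- apply/ae_equalP => j; rewrite (ord1 j); split.
    apply: ae_trans a1 _; move/(eqv_aeE _ _ ds): ey; apply: aeS => x ->.
    have -> : (r *: i y : L2T s) x = r * (i y : L2T s) x by [].
    by rewrite incl_eq /re !mxE !partE /= mul0r subr0.
  apply: ae_trans a2 _; rewrite (lin0 (lin_Aop mQ)); apply: aeW => x.
  by rewrite /im !mxE !partE /= mul0r mulr0 addr0.
Qed.

End Scalar.
End Conversions.

Section SimpleEigenvalue.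
Variables (R : realType) (s : domain R) (ds : dpos s).
Notation leb := (@lebesgue_measure R).
Notation S := (L2h s).
Notation Y := (H2T s).
Notation i := (@incl R s).
Notation no := (nrm hip).
Notation "f =ae g" := {ae leb, forall x, f x = g x} (at level 70).
Notation "u ~~> v" := (eqv hip u v) (at level 70).
Let sS := hsip S.
Variables (Q : R -> R) (M : R) (mQ : mult s Q M).

Lemma eqv_scale r (y : Y) (u : S) : u ~~> r *: i y <-> {ae leb, forall x, (u : L2T s) x = r * h0 y x}.
Proof.
split; first by move/(eqv_aeE _ _ ds); apply: aeS => x ->; rewrite -incl_eq.
by move=> h; apply/(eqv_aeE _ _ ds); apply: aeS h => x ->; rewrite -incl_eq.
Qed.

Lemma generalized_cof r (y : Y) : Aop Q y ~~> r *: i y ->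
  generalized_eigenspace s (schr Q) r%:C (cof (h0 y) (h0 (0 : Y))).
Proof.
move=> ey; have hu := cH2_cof y 0.
have k1 : re (cof (h0 y) (h0 (0 : Y))) ord0 =ae h0 y by rewrite re_cof; exact: ae_refl.
have k2 : im (cof (h0 y) (h0 (0 : Y))) ord0 =ae h0 (0 : Y) by rewrite im_cof; exact: ae_refl.
have [_ e1 e2] := shift_rep mQ r hu k1 k2; have [m1 m2] := shift_meas mQ r hu.
set u := cof _ _ in hu k1 k2 e1 e2 m1 m2 *.
have z1 : re (shift_op (schr Q) r%:C u) ord0 =ae h0 (0 : Y).
  apply: ae_trans e1 _; apply: (ae_trans (g := (0 : L2T s))); last exact: aeW.
  apply/(eqv_aeE _ _ ds); apply: nrm_le0; rewrite subr0; move: ey; rewrite /eqv => ->; exact: lexx.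
have z2 : im (shift_op (schr Q) r%:C u) ord0 =ae h0 (0 : Y).
  by apply: ae_trans e2 _; rewrite (lin0 (lin_Ar mQ r)); exact: aeW.
exists 1%N; split; [exact: hu|split].
  by move=> j; rewrite (ord1 j); split; [have [] := rep_H2Y m1 z1|have [] := rep_H2Y m2 z2].
apply/ae_equalP => j; rewrite (ord1 j); split.
  by apply: aeS z1 => x ->; rewrite /re mxE.
by apply: aeS z2 => x ->; rewrite /im mxE.
Qed.

(** Both eigenfunctions are complex multiples of one basis function. Their ratio is a complex
    constant, and since both are real its real part serves as the real ratio. *)
Lemma simple_schr r (y z : Y) : algebraic_multiplicity s (schr Q) r%:C 1 ->
  0 < hip (i y) (i y) -> Aop Q y ~~> r *: i y -> Aop Q z ~~> r *: i z ->
  exists c, i z ~~> c *: i y.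
Proof.
move=> [b [_ H]] Ny ey ez.
have [cy [hy _]] := H _ (generalized_cof ey); have [cz [hz _]] := H _ (generalized_cof ez).
pose p := cy 0 0; pose q := cz 0 0.
have p0 : p != 0.
  apply/eqP => pz; move: Ny; rewrite (_ : hip _ _ = 0) ?ltxx//.
  apply/(nrm_eq0 sS); have : i y ~~> 0; last by rewrite /eqv subr0.
  apply/(eqv_aeE _ _ ds); rewrite incl_eq; apply: aeS hy => x.
  rewrite big_ord1 -/p pz scale0r => /(congr1 (fun v : 'cV_1 => complex.Re (v 0 0))).
  by rewrite !mxE.
exists (complex.Re (q / p)); apply/eqv_scale; rewrite incl_eq; apply: aeS2 hy hz => x.
rewrite !big_ord1 -/p -/q => /(congr1 (fun v : 'cV_1 => v 0 0)) + /(congr1 (fun v : 'cV_1 => v 0 0)).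
rewrite !mxE => e1 e2.
have : h0 z x +i* h0 (0 : Y) x = (q / p) * (h0 y x +i* h0 (0 : Y) x) by rewrite e1 e2 mulrA divfK.
move=> /(congr1 (@complex.Re R)) /=; case: (q / p) => a d /=.
by have -> : h0 (0 : Y) x = 0 by []; rewrite mulr0 subr0.
Qed.

Lemma schr_simple r (phi : Y) : 0 < hip (i phi) (i phi) -> Aop Q phi ~~> r *: i phi ->
  (forall z, Aop Q z ~~> r *: i z -> exists c, i z ~~> c *: i phi) ->
  simple_eigenvalue s (schr Q) r%:C.
Proof.
move=> Np ep Hs; split; first by apply/(eigenvalue_schr ds mQ); exists phi.
exists (fun=> cof (h0 phi) (h0 (0 : Y))); split; first by move=> _; exact: generalized_cof.
(* Symmetry excludes Jordan chains: pairing with [phi] gives [c |phi|^2 = 0]. *)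
have Ar0 z c : Aop Q z - r *: i z ~~> c *: i phi -> Aop Q z ~~> r *: i z.
  move=> h; have h1 := eqv_ipl sS (i phi) h; rewrite (sipDl sS) (sipNl sS) !(sipZl sS) (sym_Aop ds mQ) in h1.
  rewrite (eqv_ipl sS _ ep) (sipZl sS) (sipC sS (i phi) (i z)) subrr in h1.
  move: h1 => /esym/eqP; rewrite mulf_eq0 (gt_eqF Np) orbF => /eqP c0.
  by move: h; rewrite /eqv c0 scale0r subr0.
have key k : forall u, power_kernel s (schr Q) r%:C k u -> cH2 s u /\ exists a b : R,
    {ae leb, forall x, re u ord0 x = a * h0 phi x} /\ {ae leb, forall x, im u ord0 x = b * h0 phi x}.
  elim: k => [|k IH] u /=.
    move=> [hu /ae_equalP /(_ ord0)[e1 e2]]; split=> //; exists 0, 0; split.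
      by apply: aeS e1 => x ->; rewrite mul0r /re mxE.
    by apply: aeS e2 => x ->; rewrite mul0r /im mxE.
  move=> [hu /IH[_ [a [b [e1 e2]]]]]; split=> //.
  have [y hy] := H2_repY (hu ord0).1; have [z hz] := H2_repY (hu ord0).2.
  have [_ a1 a2] := shift_rep mQ r hu hy hz.
  have [|c1 h1] := Hs y.
    apply: (Ar0 y a); apply/eqv_scale; apply: ae_trans (ae_sym a1) _; exact: e1.
  have [|c2 h2] := Hs z.
    apply: (Ar0 z b); apply/eqv_scale; apply: ae_trans (ae_sym a2) _; exact: e2.
  move/eqv_scale: h1; move/eqv_scale: h2; rewrite !incl_eq => h2 h1.
  by exists c1, c2; split; [exact: ae_trans hy h1|exact: ae_trans hz h2].
have uniq (a b : R) : {ae leb, forall x, a * h0 phi x = b * h0 phi x} -> a = b.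
  move=> h; apply/eqP; rewrite -subr_eq0 -normr_eq0; apply/eqP.
  have : (a - b) *: i phi ~~> 0 *: i phi.
    apply/eqv_scale; apply: aeS h => x e.
    have -> : ((a - b) *: i phi : L2T s) x = (a - b) * (i phi : L2T s) x by [].
    by rewrite incl_eq mul0r mulrBl e subrr.
  rewrite /eqv scale0r subr0 (nrmZ sS) => /eqP; rewrite mulf_eq0 => /orP[/eqP//|].
  by rewrite gt_eqF// (nrm_gt0 sS).
move=> u [k /key[hu [a [b [e1 e2]]]]].
exists (const_mx (a +i* b)); split.
  apply/ae_equalP => j; rewrite (ord1 j); split.
    by apply: aeS e1 => x ->; rewrite /re big_ord1 !mxE /= mulr0 subr0.
  by apply: aeS e2 => x ->; rewrite /im big_ord1 !mxE /= mulr0 add0r.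
move=> c /ae_equalP /(_ ord0)[f1 f2]; apply/rowP => j; rewrite (ord1 j) mxE.
case E : (c 0 0) => [a' b']; congr (_ +i* _); apply: uniq.
  apply: aeS2 e1 f1 => x <- ->; rewrite /re big_ord1 !mxE E /= mulr0 subr0 //.
apply: aeS2 e2 f2 => x <- ->; rewrite /im big_ord1 !mxE E /= mulr0 add0r //.
Qed.

End SimpleEigenvalue.

Lemma lin_JL (R : realType) (S : hspace R) (Y : lmodType R) (i Lp Lm : Y -> S) a b :
  lin i -> lin Lp -> lin Lm -> lin (JL i Lp Lm a b).
Proof.
move=> li lp lm c y z.
have E (p q r p' q' r' : S) : c *: p + p' - a *: (c *: q + q') + b *: (c *: r + r') =
    c *: (p - a *: q + b *: r) + (p' - a *: q' + b *: r').
  rewrite !scalerDr !scalerN !scalerA [a * c]mulrC [b * c]mulrC opprD.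
  by rewrite [c *: p + p' + _]addrACA [RHS]addrACA.
have E' (p q r p' q' r' : S) : c *: p + p' - a *: (c *: q + q') - b *: (c *: r + r') =
    c *: (p - a *: q - b *: r) + (p' - a *: q' - b *: r').
  rewrite !scalerDr !scalerN !scalerA [a * c]mulrC [b * c]mulrC !opprD.
  by rewrite [c *: p + p' + _]addrACA [RHS]addrACA.
by congr ((_, _), (_, _)) => /=; rewrite ?lm ?lp !li ?opprD -?[- (c *: _)]scalerN ?E ?E'.
Qed.

Section FullOperator.
Variables (R : realType) (s : domain R) (ds : dpos s).
Notation leb := (@lebesgue_measure R).
Notation S := (L2h s).
Notation Y := (H2T s).
Notation i := (@incl R s).
Notation no := (nrm hip).
Notation "f =ae g" := {ae leb, forall x, f x = g x} (at level 70).
Notation "u ~~> v" := (eqv hip u v) (at level 70).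
Let sS := hsip S.
Notation S4 := (S4 S).
Notation Y4 := (Y4 Y).
Notation i4 := (emb4 (i : Y -> S)).
Variables (V psi : R -> R) (mu om Mp Mm : R).
Notation Qp := (fun x => mu * V x + om - 3 * psi x ^+ 2).
Notation Qm := (fun x => mu * V x + om - psi x ^+ 2).
Hypotheses (mp : mult s Qp Mp) (mm : mult s Qm Mm).
Notation JLs := (JL (i : Y -> S) (Aop Qp) (Aop Qm)).
Notation op a b := (shift_op (Lfull V mu om psi) (a +i* b)).

Lemma re_usub (u : vfun R (1 + 1)) : re (fun y => usubmx (u y)) ord0 = re u vidx.
Proof. by apply/funext => x; rewrite /re mxE. Qed.
Lemma im_usub (u : vfun R (1 + 1)) : im (fun y => usubmx (u y)) ord0 = im u vidx.
Proof. by apply/funext => x; rewrite /im mxE. Qed.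
Lemma re_dsub (u : vfun R (1 + 1)) : re (fun y => dsubmx (u y)) ord0 = re u widx.
Proof. by apply/funext => x; rewrite /re mxE. Qed.
Lemma im_dsub (u : vfun R (1 + 1)) : im (fun y => dsubmx (u y)) ord0 = im u widx.
Proof. by apply/funext => x; rewrite /im mxE. Qed.

Definition cof4 (f f' g g' : R -> R) : vfun R (1 + 1) := fun x => col_mx (cof f f' x) (cof g g' x).
Lemma cof4E f f' g g' : [/\ re (cof4 f f' g g') vidx = f, im (cof4 f f' g g') vidx = f',
  re (cof4 f f' g g') widx = g & im (cof4 f f' g g') widx = g'].
Proof. by split; apply/funext => x; rewrite /re /im ?col_mxEu ?col_mxEd mxE. Qed.

Lemma re_Lfull_v u x : re (Lfull V mu om psi u) vidx x = - wD (wD (re u widx)) x + Qm x * re u widx x.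
Proof.
rewrite {1}/re Lfull_v -[LHS]/(re (Lminus V mu om psi (fun y => dsubmx (u y))) ord0 x).
by rewrite LminusE re_schr re_dsub.
Qed.
Lemma im_Lfull_v u x : im (Lfull V mu om psi u) vidx x = - wD (wD (im u widx)) x + Qm x * im u widx x.
Proof.
rewrite {1}/im Lfull_v -[LHS]/(im (Lminus V mu om psi (fun y => dsubmx (u y))) ord0 x).
by rewrite LminusE im_schr im_dsub.
Qed.
Lemma re_Lfull_w u x : re (Lfull V mu om psi u) widx x = - (- wD (wD (re u vidx)) x + Qp x * re u vidx x).
Proof.
rewrite {1}/re Lfull_w ReN -[X in - X = _]/(re (Lplus V mu om psi (fun y => usubmx (u y))) ord0 x).
by rewrite LplusE re_schr re_usub.
Qed.
Lemma im_Lfull_w u x : im (Lfull V mu om psi u) widx x = - (- wD (wD (im u vidx)) x + Qp x * im u vidx x).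
Proof.
rewrite {1}/im Lfull_w ImN -[X in - X = _]/(im (Lplus V mu om psi (fun y => usubmx (u y))) ord0 x).
by rewrite LplusE im_schr im_usub.
Qed.

Definition rep4 (u : vfun R (1 + 1)) (f : S4) := [/\ re u vidx =ae (f.1.1 : L2T s),
  im u vidx =ae (f.1.2 : L2T s), re u widx =ae (f.2.1 : L2T s) & im u widx =ae (f.2.2 : L2T s)].

Lemma eqv4 (f g : S4) : f ~~> g <->
  [/\ f.1.1 ~~> g.1.1, f.1.2 ~~> g.1.2, f.2.1 ~~> g.2.1 & f.2.2 ~~> g.2.2].
Proof.
split.
  move=> h; have [] := nrm4_ge (f - g); move: h; rewrite /eqv => -> /= k1 k2 k3 k4.
  by split; exact: nrm_le0.
move=> [k1 k2 k3 k4]; apply: nrm_le0; apply: le_trans (nrm4_le _) _ => /=.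
by rewrite [no (f.1.1 - _)]k1 [no (f.1.2 - _)]k2 [no (f.2.1 - _)]k3 [no (f.2.2 - _)]k4 !addr0.
Qed.

Lemma rep4_eqv u v f g : rep4 u f -> rep4 v g -> ae_equal u v <-> f ~~> g.
Proof.
move=> [u1 u2 u3 u4] [v1 v2 v3 v4]; split.
  move=> /ae_equalP h; have [a1 a2] := h vidx; have [a3 a4] := h widx.
  apply/eqv4; split; apply/(eqv_aeE _ _ ds).
  - exact: ae_trans (ae_sym u1) (ae_trans a1 v1).
  - exact: ae_trans (ae_sym u2) (ae_trans a2 v2).
  - exact: ae_trans (ae_sym u3) (ae_trans a3 v3).
  - exact: ae_trans (ae_sym u4) (ae_trans a4 v4).
move=> /eqv4[/(eqv_aeE _ _ ds) a1 /(eqv_aeE _ _ ds) a2 /(eqv_aeE _ _ ds) a3 /(eqv_aeE _ _ ds) a4].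
apply/ae_equalP; apply: idxP; split.
- exact: ae_trans u1 (ae_trans a1 (ae_sym v1)).
- exact: ae_trans u2 (ae_trans a2 (ae_sym v2)).
- exact: ae_trans u3 (ae_trans a3 (ae_sym v3)).
- exact: ae_trans u4 (ae_trans a4 (ae_sym v4)).
Qed.

Lemma rep4_norm u f : cL2 s u -> rep4 u f -> cL2norm s u = no f.
Proof.
move=> hu [u1 u2 u3 u4]; apply/eqP; rewrite -(@eqrXn2 _ 2) ?nrm_ge0 ?sqrtr_ge0//.
rewrite nrm4_sqr /cL2norm sqr_sqrtr; last by apply: sumr_ge0 => j _; rewrite addr_ge0 ?sqr_ge0.
rewrite big_split_ord /= !big_ord1 -/vidx -/widx.
rewrite (L2norm_rep (hu vidx).1 u1) (L2norm_rep (hu vidx).2 u2).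
by rewrite (L2norm_rep (hu widx).1 u3) (L2norm_rep (hu widx).2 u4) addrA.
Qed.

Lemma cL2_rep4 u : cL2 s u -> exists f, rep4 u f.
Proof.
move=> hu; exists ((toL2 s (re u vidx), toL2 s (im u vidx)), (toL2 s (re u widx), toL2 s (im u widx))).
by split; apply: L2_rep; have [? ?] := hu vidx; have [? ?] := hu widx.
Qed.

Lemma rep4_cL2 u f : (forall j, meas (re u j) /\ meas (im u j)) -> rep4 u f -> cL2 s u.
Proof.
move=> hm [u1 u2 u3 u4]; apply: idxP; split.
- exact: L2_eqae (hm vidx).1 u1.
- exact: L2_eqae (hm vidx).2 u2.
- exact: L2_eqae (hm widx).1 u3.
- exact: L2_eqae (hm widx).2 u4.
Qed.

Lemma cH2_rep4 u : cH2 s u -> exists y : Y4, rep4 u (i4 y).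
Proof.
move=> hu; have [v hv] := H2_repY (hu vidx).1; have [v' hv'] := H2_repY (hu vidx).2.
have [w hw] := H2_repY (hu widx).1; have [w' hw'] := H2_repY (hu widx).2.
by exists ((v, v'), (w, w')); split; rewrite /= incl_eq.
Qed.

Lemma cof4_rep4 (y : Y4) : let u := cof4 (h0 y.1.1) (h0 y.1.2) (h0 y.2.1) (h0 y.2.2) in
  cH2 s u /\ rep4 u (i4 y).
Proof.
have [e1 e2 e3 e4] := cof4E (h0 y.1.1) (h0 y.1.2) (h0 y.2.1) (h0 y.2.2); split.
  by apply: idxP; rewrite ?e1 ?e2 ?e3 ?e4; split; exact: H2_h0.
by split; rewrite ?e1 ?e2 ?e3 ?e4 /= incl_eq; exact: ae_refl.
Qed.

Lemma JL_rep4 a b u y : cH2 s u -> rep4 u (i4 y) -> cL2 s (op a b u) /\ rep4 (op a b u) (JLs a b y).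
Proof.
move=> hu [u1 u2 u3 u4]; rewrite /= !incl_eq in u1 u2 u3 u4.
have mv := (hu vidx).1; have mv' := (hu vidx).2; have mw := (hu widx).1; have mw' := (hu widx).2.
have R4 : rep4 (op a b u) (JLs a b y).
  have s1 := schr_rep mm (H2_meas mw) u3; have s2 := schr_rep mm (H2_meas mw') u4.
  have s3 := schr_rep mp (H2_meas mv) u1; have s4 := schr_rep mp (H2_meas mv') u2.
  split.
  - have -> : ((JLs a b y).1.1 : L2T s) = (fun x => (Aop Qm y.2.1 : L2T s) x - a * (i y.1.1 : L2T s) x
      + b * (i y.1.2 : L2T s) x) :> (R -> R) by [].
    rewrite !incl_eq; apply: aeS2 s1 (aeS2 (fun x => @conj _ _) u1 u2) => x e1 [e2 e3].
    by rewrite re_shift re_Lfull_v /= e1 e2 e3 opprB [b * _ - _]addrC addrA.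
  - have -> : ((JLs a b y).1.2 : L2T s) = (fun x => (Aop Qm y.2.2 : L2T s) x - a * (i y.1.2 : L2T s) x
      - b * (i y.1.1 : L2T s) x) :> (R -> R) by [].
    rewrite !incl_eq; apply: aeS2 s2 (aeS2 (fun x => @conj _ _) u1 u2) => x e1 [e2 e3].
    by rewrite im_shift im_Lfull_v /= e1 e2 e3 opprD addrA.
  - have -> : ((JLs a b y).2.1 : L2T s) = (fun x => - (Aop Qp y.1.1 : L2T s) x - a * (i y.2.1 : L2T s) x
      + b * (i y.2.2 : L2T s) x) :> (R -> R) by [].
    rewrite !incl_eq; apply: aeS2 s3 (aeS2 (fun x => @conj _ _) u3 u4) => x e1 [e2 e3].
    by rewrite re_shift re_Lfull_w /= e1 e2 e3 opprB [b * _ - _]addrC addrA.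
  - have -> : ((JLs a b y).2.2 : L2T s) = (fun x => - (Aop Qp y.1.2 : L2T s) x - a * (i y.2.2 : L2T s) x
      - b * (i y.2.1 : L2T s) x) :> (R -> R) by [].
    rewrite !incl_eq; apply: aeS2 s4 (aeS2 (fun x => @conj _ _) u3 u4) => x e1 [e2 e3].
    by rewrite im_shift im_Lfull_w /= e1 e2 e3 [- (_ * _ + _)]opprD addrA.
split=> //; apply: rep4_cL2 R4.
have H j : meas (re u j) /\ meas (im u j) by split; [exact: (H2_meas (hu j).1)|exact: (H2_meas (hu j).2)].
have K1 (f g : R -> R) : (forall x, f x = g x) -> meas f -> meas g.
  by move=> e; have -> : f = g by exact/funext.
have K2 j : meas (re (Lfull V mu om psi u) j) -> meas (re (op a b u) j).
  move=> h; apply: (K1 (fun x => re (Lfull V mu om psi u) j x - (a * re u j x - b * im u j x))).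
    by move=> x; rewrite re_shift.
  apply: (measB h); apply: measB; apply: measZ; [exact: (H j).1|exact: (H j).2].
have K3 j : meas (im (Lfull V mu om psi u) j) -> meas (im (op a b u) j).
  move=> h; apply: (K1 (fun x => im (Lfull V mu om psi u) j x - (a * im u j x + b * re u j x))).
    by move=> x; rewrite im_shift.
  apply: (measB h); apply: measD; apply: measZ; [exact: (H j).2|exact: (H j).1].
apply: idxP; split.
- by apply: K2; apply: K1 (meas_schr mm mw) => x; rewrite re_Lfull_v.
- by apply: K3; apply: K1 (meas_schr mm mw') => x; rewrite im_Lfull_v.
- by apply: K2; apply: K1 (measN (meas_schr mp mv)) => x; rewrite re_Lfull_w.
- by apply: K3; apply: K1 (measN (meas_schr mp mv')) => x; rewrite im_Lfull_w.
Qed.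

Lemma resolvent_JL a b : resolvent_set s (Lfull V mu om psi) (a +i* b) <->
  solv (JLs a b) /\ exists C, lb i4 (JLs a b) C.
Proof.
have cof4L (f : S4) : let u := cof4 (f.1.1 : L2T s) (f.1.2 : L2T s) (f.2.1 : L2T s) (f.2.2 : L2T s) in
    cL2 s u /\ rep4 u f.
  have [e1 e2 e3 e4] := cof4E (f.1.1 : L2T s) (f.1.2 : L2T s) (f.2.1 : L2T s) (f.2.2 : L2T s); split.
    by apply: idxP; rewrite ?e1 ?e2 ?e3 ?e4; split; exact: L2TP.
  by split; rewrite ?e1 ?e2 ?e3 ?e4 /=; exact: ae_refl.
have cH2L2 (u : vfun R (1 + 1)) : cH2 s u -> cL2 s u by move=> hu j; have [[_ _ ? _ _] [_ _ ? _ _]] := hu j.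
split.
  move=> [[_ sur] [C HC]]; split.
    move=> f; have [hf rf] := cof4L f; have [u hu e] := sur _ hf.
    have [y ry] := cH2_rep4 hu; exists y; have [_ r] := JL_rep4 a b hu ry.
    exact/(rep4_eqv r rf).
  exists C => y; have [hu ry] := cof4_rep4 y; have := HC _ hu.
  have [hL r] := JL_rep4 a b hu ry.
  by rewrite (rep4_norm hL r) (rep4_norm (cH2L2 _ hu) ry).
move=> [sol [C HC]]; split.
  split.
    move=> u v hu hv e; have [y ry] := cH2_rep4 hu; have [z rz] := cH2_rep4 hv.
    apply/(rep4_eqv ry rz); have [_ ru] := JL_rep4 a b hu ry; have [_ rv] := JL_rep4 a b hv rz.
    have E := (rep4_eqv ru rv).1 e.
    have l4 : lin i4 by move=> c p q; rewrite /emb4 /= !(@lin_incl R s).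
    have lJ := lin_JL a b (@lin_incl R s) (lin_Aop mp) (lin_Aop mm).
    apply: nrm_le0; rewrite -(linB l4); apply: le_trans (HC _) _.
    by rewrite (linB lJ); move: E; rewrite /eqv => ->; rewrite mulr0.
  move=> f hf; have [g rf] := cL2_rep4 hf; have [y hy] := sol g.
  have [hu ry] := cof4_rep4 y; exists (cof4 (h0 y.1.1) (h0 y.1.2) (h0 y.2.1) (h0 y.2.2)) => //.
  have [_ r] := JL_rep4 a b hu ry; exact/(rep4_eqv r rf).
exists C => u hu; have [y ry] := cH2_rep4 hu; have [hL r] := JL_rep4 a b hu ry.
by rewrite (rep4_norm hL r) (rep4_norm (cH2L2 _ hu) ry).
Qed.

End FullOperator.

(** * Compactness of multiplication by an integrable weight *)

Section Compactness.
Variables (R : realType).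
Notation leb := (@lebesgue_measure R).
Notation ip := (@L2inner R).

(** Inside [[- M, M]] the function [d] is small, outside it is bounded and little mass of the weight
    is left. *)
Lemma weighted_small (g d : R -> R) (B e M : R) : integ Line g -> (forall x, 0 <= g x) ->
  meas d -> (forall x, `|d x| <= B) -> (forall x, - M <= x <= M -> `|d x| <= e) -> 0 <= M ->
  \int[leb]_x (g x * d x ^+ 2) <=
  e ^+ 2 * \int[leb]_x g x + B ^+ 2 * (\int[leb]_x g x - \int[leb]_(x in `[- M, M]) g x).
Proof.
move=> ig g0 md bd sd M0; have MM : - M <= M by lra.
have mg : meas g by case: (integ_lint ig).
have sq x c : `|d x| <= c -> d x ^+ 2 <= c ^+ 2.
  by move=> h; rewrite -[d x ^+ 2]real_normK ?num_real// ler_sqr ?nnegrE// (le_trans _ h).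
have mgd : meas (fun x => g x * d x ^+ 2) by apply: measM => //; exact: measX.
have le1 x : g x * d x ^+ 2 <= B ^+ 2 * g x by rewrite mulrC ler_wpM2r// sq.
have igd : integ Line (fun x => g x * d x ^+ 2).
  apply: integ_le (integZ (B ^+ 2) ig); first exact: mgd.
  by move=> x; rewrite ger0_norm; [exact: le1|rewrite mulr_ge0 ?sqr_ge0].
have mA : measurable (~` `[- M, M] : set (measurableTypeR R)).
  by apply: measurableC; exact: measurable_cc.
have tail f : integ Line f -> integ Line (fun x => f x * \1_(~` `[- M, M]) x).
  move=> hf; have mf : meas f by case: (integ_lint hf).
  apply: (integ_le (g := fun x => `|f x|)).
  - by apply: measM => //; exact: measurable_indic.
  - by move=> x; rewrite indicE; case: (_ \in _); rewrite ?mulr1 ?mulr0 ?normr0.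
  - by apply: integrable_norm.
rewrite (line_split igd MM) (line_split ig MM) [_ + _ - _]addrAC subrr add0r.
apply: lerD.
  apply: (@le_trans _ _ (\int[leb]_(x in `[- M, M]) (e ^+ 2 * g x))).
    apply: le_int; [exact: integ_lint|by apply: lintZ; exact: integ_lint|].
    by move=> x xM; rewrite mulrC ler_wpM2r// sq// sd.
  rewrite intZ; last exact: integ_lint.
  rewrite ler_wpM2l ?sqr_ge0// lerDl; apply: (@cint_ge0 R Line) => x.
  by rewrite mulr_ge0// indicE ler0n.
rewrite -(@cintZ R Line); last exact: tail.
apply: (@cint_le R Line); [exact: tail|apply: integZ; exact: tail|].
move=> x; rewrite mulrA ler_wpM2r// indicE ler0n//.
Qed.

Definition circle1 (s : domain R) := if s is Circle L then 1 <= L else True.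
Lemma circle1_dpos s : circle1 s -> dpos s.
Proof. by case: s => //= L; exact: lt_le_trans. Qed.

Lemma int_sq_le s (u : R -> R) x y : circle1 s -> L2 s u -> lint (fun x => u x ^+ 2) -> x <= y <= x + 1 ->
  \int[leb]_(t in `[x, y]) (u t ^+ 2) <= nsq s u.
Proof.
move=> c1 hu lu /andP[xy yx]; have [_ pu iu] := (L2P s u).1 hu.
apply: le_trans (_ : \int[leb]_(t in `[x, x + 1]) (u t ^+ 2) <= _).
  by apply: int_subset => // t _; exact: sqr_ge0.
apply: le_trans (int_le_cell x c1 lu iu _ _) _.
- by move=> t; exact: sqr_ge0.
- by case: s pu {c1 hu iu} => //= L; apply: aeS => t ->.
- by rewrite /nsq /L2inner; under eq_Rintegral do rewrite expr2.
Qed.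

(* [2 eta |u'| <= 1 + eta^2 u'^2] replaces the Hoelder estimate. *)
Lemma oscillation s (y : H2T s) x x' eta : circle1 s -> 0 < eta -> `|x - x'| <= 1 ->
  `|h0 y x - h0 y x'| <= `|x - x'| / (2 * eta) + eta / 2 * nsq s (h1 y).
Proof.
move=> c1 e0; wlog xx : x x' / x' <= x.
  move=> H; case: (leP x' x) => [|/ltW] h; first exact: H.
  by move=> h'; rewrite (distrC x) (distrC (h0 y x)); apply: H => //; rewrite distrC.
rewrite [`|x - x'|]ger0_norm ?subr_ge0// => d1.
have [au au1 hu hu1 _] := H2TP y; have c := ac_continuous au1.
have l1 := cont_lint c.
have l2 : lint (fun x => h1 y x ^+ 2).
  by have := lintM l1 c; congr lint; apply/funext => t; rewrite expr2.
have := ac_norm_le au (a := x') (b := x) (x := x); rewrite lexx xx => /(_ isT) h.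
apply: le_trans h _.
have lc : lint (fun=> (2 * eta)^-1 : R) by apply: cont_lint; exact: cst_continuous.
apply: (@le_trans _ _ (\int[leb]_(t in `[x', x]) ((2 * eta)^-1 + eta / 2 * h1 y t ^+ 2))).
  apply: le_int => //; [exact: lint_norm|by apply: lintD => //; exact: lintZ|].
  move=> t _; have := sqr_ge0 (1 - eta * `|h1 y t|).
  rewrite -[h1 y t ^+ 2]real_normK ?num_real//; set a := `|_| => h2.
  rewrite -(ler_pM2l (_ : 0 < 2 * eta)) ?mulr_gt0//.
  have -> : 2 * eta * ((2 * eta)^-1 + eta / 2 * a ^+ 2) = 1 + (eta * a) ^+ 2 by field; rewrite gt_eqF.
  move: h2; rewrite sqrrB expr1n mul1r -mulrA mulr2n; lra.
rewrite intD//; last exact: lintZ.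
rewrite int_cst// intZ// mulrC; apply: lerD => //; rewrite ler_wpM2l ?divr_ge0 ?(ltW e0)//.
by apply: int_sq_le => //; rewrite xx; lra.
Qed.

Lemma nsq_h1 s (ds : dpos s) Q MQ (y : H2T s) : mult s Q MQ -> 0 <= MQ ->
  nsq s (h1 y) <= hip (Aop Q y) (@incl R s y) + MQ * hip (@incl R s y) (@incl R s y).
Proof.
move=> mQ M0; have sS := hsip (L2h s).
have -> : nsq s (h1 y) = hip (Aop Q y) (incl y) - hip (mulop Q (incl y)) (incl y).
  by rewrite /Aop (sipDl sS) addrK lapl_form.
rewrite lerD2l; apply: le_trans (ler_norm _) _; rewrite normrN.
apply: le_trans (cs_nrm sS _ _) _; rewrite -(nrm_sqr sS) expr2 mulrA ler_wpM2r ?nrm_ge0//.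
exact: (bdd_mulop M0 mQ).
Qed.

(** One ultrafilter gives a limit at every point at once, in place of a diagonal extraction over a
    dense set. *)
Lemma ultra_limit (U : set_system nat) (f : nat -> R) B : UltraFilter U -> (forall k, `|f k| <= B) ->
  exists l, forall e, 0 < e -> U [set k | `|f k - l| <= e].
Proof.
move=> UU fB; have [|l [_ Hl]] := @segment_compact R (- B) B (f @ U) _.
  have : U setT by exact: filterT.
  by apply: (@filterS _ U) => k _; rewrite /= in_itv /=; have := fB k; rewrite ler_norml.
exists l => e e0; have [//|h] := in_ultra_setVsetC [set k | `|f k - l| <= e] UU; exfalso.
have [z [/= h1 h2]] := Hl [set x | ~ (`|x - l| <= e)] _ h (nbhsx_ballx l e e0).
by apply: h1; rewrite distrC; exact: ltW.
Qed.

(** A form-bounded sequence is uniformly bounded and equicontinuous. It converges pointwise along an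
    ultrafilter, hence uniformly on segments, and the integrable weight makes the rest of the line
    negligible. *)
Lemma rel_compact_mulop s Q MQ w Mw : circle1 s -> mult s Q MQ -> 0 <= MQ -> mult s w Mw ->
  (forall x, 0 <= w x) -> integ s w -> rel_compact (@incl R s) (Aop Q) (mulop w).
Proof.
move=> c1 mQ MQ0 mw w0 iw y M HM HA; have ds := circle1_dpos c1.
pose K := M + MQ * M.
have N1 k : nsq s (h1 (y k)) <= K.
  apply: le_trans (nsq_h1 ds _ mQ MQ0) _; apply: lerD (HA k) _.
  by rewrite ler_wpM2l// HM.
have N0 k : nsq s (h0 (y k)) <= M by have := HM k; rewrite /hip /= /L2ip !incl_eq.
have M0 : 0 <= M by apply: le_trans (N0 0%N); exact: nsq_ge0.
have K0 : 0 <= K by apply: le_trans (N1 0%N); exact: nsq_ge0.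
pose B := 2 * M + K + 1.
have B1 : 1 <= B by rewrite lerDr addr_ge0// mulr_ge0.
have sup k x : `|h0 (y k) x| <= B.
  rewrite -(ler_sqr (x := `|_|)) ?nnegrE ?(le_trans _ B1)// real_normK ?num_real//.
  apply: le_trans (sup_bound x c1 (H2TP (y k))) _.
  apply: (@le_trans _ _ (2 * M + K)); first by have := N0 k; have := N1 k; lra.
  by apply: (@le_trans _ _ B); [rewrite lerDl|rewrite expr2 ler_peMl// (le_trans _ B1)].
have [U [UU HU]] := @ultraFilterLemma nat \oo _.
have [l Hl] := choice (fun x => @ultra_limit U (fun k => h0 (y k) x) B UU (fun k => sup k x)).
(* Extending the weight by zero from the cell treats the circle as a case of the line. *)
pose g := w \_ (cell s).
have g0 x : 0 <= g x by rewrite /g patchE; case: (_ \in _).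
have ig : integ Line g.
  have /integrable_mkcond : leb.-integrable (cell s) (EFin \o w) by [].
  move=> /(_ (measurable_cell s)); congr (leb.-integrable _ _); apply/funext => x.
  by rewrite /g /= !patchE; case: (_ \in _).
pose D := \int[leb]_x g x; have D0 : 0 <= D by exact: (@cint_ge0 R Line).
have hipE (u v : H2T s) : hip (mulop w (incl u - incl v)) (incl u - incl v) =
    \int[leb]_x (g x * (h0 u x - h0 v x) ^+ 2).
  rewrite /hip /= /L2ip /L2inner (mulopE _ mw) Rintegral_mkcond; congr (Rintegral _ _ _).
  apply/funext => x; rewrite /g !patchE; case: (_ \in _); last by rewrite mul0r.
  have -> : (incl u - incl v : L2T s) x = h0 u x - h0 v x.
    by rewrite -!incl_eq.
  by rewrite -mulrA -expr2.
have key e : 0 < e -> exists2 A, U A & forall j k, A j -> A k ->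
    hip (mulop w (incl (y j) - incl (y k))) (incl (y j) - incl (y k)) <= e.
  move=> e0; have e2 : 0 < e / 2 by rewrite divr_gt0.
  pose ep := Num.min 1 (e / 2 / (D + 1)); have D1 : 0 < D + 1 by rewrite ltr_wpDl.
  have ep0 : 0 < ep by rewrite lt_min ltr01 divr_gt0.
  have epD : ep ^+ 2 * D <= e / 2.
    have h1 : ep ^+ 2 <= ep by rewrite expr2 ler_piMl ?(ltW ep0)// ge_min lexx.
    apply: le_trans (ler_wpM2r D0 h1) _.
    have h2 : ep <= e / 2 / (D + 1) by rewrite ge_min lexx orbT.
    apply: le_trans (ler_wpM2r D0 h2) _; rewrite mulrAC ler_pdivrMr// ler_wpM2l ?(ltW e2)// lerDl//.
  have B2 : 0 < (2 * B) ^+ 2 by rewrite exprn_gt0// mulr_gt0// (lt_le_trans _ B1).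
  have [M' [M'0 HM']] := ge0_tail ig g0 (divr_gt0 e2 B2).
  (* Balances [oscillation]: over a mesh of width [hh] each function moves by at most [ep / 3]. Two
     such moves and two errors [ep / 6] at a mesh point add up to [ep]. *)
  pose eta := ep / (3 * (K + 1)); have K1 : 0 < K + 1 by rewrite ltr_wpDl.
  have eta0 : 0 < eta by rewrite divr_gt0// mulr_gt0.
  have etaK : eta / 2 * K <= ep / 6.
    have -> : ep / 6 = eta / 2 * (K + 1) by rewrite /eta; field; rewrite gt_eqF.
    by rewrite ler_wpM2l ?lerDl// divr_ge0// ltW.
  pose hh := Num.min 1 (ep * eta / 3).
  have hh0 : 0 < hh by rewrite lt_min ltr01 !divr_gt0// mulr_gt0.
  have hheta : hh / (2 * eta) <= ep / 6.
    have h1 : hh <= ep * eta / 3 by rewrite ge_min lexx orbT.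
    have e2' : 0 < 2 * eta by rewrite mulr_gt0.
    rewrite ler_pdivrMr//; apply: le_trans h1 _.
    by rewrite le_eqVlt; apply/orP; left; apply/eqP; field.
  pose p := Num.truncn (2 * M' / hh).
  pose xg m : R := - M' + m%:R * hh.
  exists [set k | forall m, (m <= p)%N -> `|h0 (y k) (xg m) - l (xg m)| <= ep / 6].
    elim: p => [|q IH].
      apply: filterS (Hl (xg 0%N) _ (divr_gt0 ep0 (ltr0n _ 6))) => k /= hk m.
      by rewrite leqn0 => /eqP ->.
    apply: filterS2 IH (Hl (xg q.+1) _ (divr_gt0 ep0 (ltr0n _ 6))) => k /= hk1 hk2 m.
    by rewrite leq_eqVlt => /orP[/eqP->//|]; exact: hk1.
  move=> j k Aj Ak; rewrite hipE.
  have sm x : - M' <= x <= M' -> `|h0 (y j) x - h0 (y k) x| <= ep.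
    move=> /andP[x1 x2]; pose m := Num.truncn ((x + M') / hh).
    have xM : 0 <= (x + M') / hh by rewrite divr_ge0 ?(ltW hh0)//; lra.
    have mp : (m <= p)%N.
      by apply: le_truncn; rewrite ler_wpM2r ?invr_ge0 ?(ltW hh0)//; lra.
    have xm : `|x - xg m| <= hh.
      have := truncn_itv xM; rewrite -/m => /andP[].
      rewrite ler_pdivlMr// ltr_pdivrMr// -natr1 mulrDl mul1r /xg => h1 h2.
      by rewrite ger0_norm; lra.
    have xm1 : `|x - xg m| <= 1 by apply: le_trans xm _; rewrite ge_min lexx.
    have osc q : `|h0 (y q) x - h0 (y q) (xg m)| <= ep / 3.
      apply: le_trans (oscillation _ c1 eta0 xm1) _.
      apply: (@le_trans _ _ (ep / 6 + ep / 6)); last by lra.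
      apply: lerD.
        by apply: le_trans hheta; rewrite ler_wpM2r// invr_ge0 mulr_ge0// ltW.
      apply: le_trans etaK; rewrite ler_wpM2l// divr_ge0// ltW//.
    have := osc j; have := osc k; have := Aj m mp; have := Ak m mp; rewrite !ler_norml.
    move: (l _) (h0 _ _) (h0 _ _) (h0 _ _) (h0 _ _) => a b c d f; lra.
  apply: le_trans (weighted_small (B := 2 * B) (e := ep) (M := M') ig g0 _ _ sm M'0) _.
  - by apply: measB; exact: meas_h0.
  - by move=> x; apply: le_trans (ler_normB _ _) _; have := sup j x; have := sup k x; lra.
  - rewrite [e]splitr; apply: lerD => //; rewrite mulrC -ler_pdivlMr//.

have key' n : exists A : set nat, U A /\ forall j k, A j -> A k ->
    hip (mulop w (incl (y j) - incl (y k))) (incl (y j) - incl (y k)) <= n.+1%:R^-1.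
  by have [A UA HA'] := key n.+1%:R^-1 (etrans (invr_gt0 _) (ltr0Sn R n)); exists A.
have [A HA'] := choice key'.
(* Members of the ultrafilter meet in finite number and contain arbitrarily late indices, which
   yields an honest subsequence. *)
have ex n : exists k, (n <= k)%N /\ forall m, (m <= n)%N -> A m k.
  apply: (@filter_ex _ U _); apply: filterI.
    by apply: HU; exists n.
  elim: n => [|n IH].
    by apply: filterS (HA' 0%N).1 => k hk m; rewrite leqn0 => /eqP ->.
  apply: filterS2 IH (HA' n.+1).1 => k h1 h2 m; rewrite leq_eqVlt => /orP[/eqP->//|].
  exact: h1.
have [t Ht] := choice ex; exists t; split; first by move=> k; have [] := Ht k.
move=> e e0; exists (Num.truncn e^-1).+1 => j k hj hk.
apply: le_trans ((HA' (Num.truncn e^-1)).2 _ _ _ _) _.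
- by have [_ h] := Ht j; apply: h; exact: ltnW.
- by have [_ h] := Ht k; apply: h; exact: ltnW.
- rewrite invf_ple ?posrE//; apply/ltW.
  have /andP[] // := truncn_itv (ltW (etrans (invr_gt0 e) e0)).
Qed.

End Compactness.

Section FormBottom.
Variables (R : realType) (S : hspace R) (Y : lmodType R) (i : Y -> S).
Hypothesis li : lin i.
Variables (A : Y -> S) (lA : lin A) (sA : symop i A).
Let sS := hsip S.

(** Let [r] be the least shift in [[r0, +oo)] making the form nonnegative. Invertibility there
    upgrades nonnegativity to coercivity, so the shift could be lowered further unless [r = r0]. *)
Lemma coer_of_resolvent (M r0 : R) : (forall y, - M * hip (i y) (i y) <= hip (A y) (i y)) ->
  (forall r, r0 <= r -> solv (fun y => A y + r *: i y) /\ exists C, lb i (fun y => A y + r *: i y) C) ->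
  exists2 d, 0 < d & coer i (fun y => A y + r0 *: i y) d.
Proof.
move=> AM HA; pose E := [set r | r0 <= r /\ coer i (fun y => A y + r *: i y) 0].
have N0 y : 0 <= hip (i y) (i y) by exact: sipP.
have qE r y : hip (A y + r *: i y) (i y) = hip (A y) (i y) + r * hip (i y) (i y).
  by rewrite (sipDl sS) (sipZl sS).
have EM : E (Num.max r0 M).
  split; first by rewrite le_max lexx.
  move=> y; rewrite mul0r qE; have := AM y; have : M * hip (i y) (i y) <= Num.max r0 M * hip (i y) (i y).
    by rewrite ler_wpM2r// le_max lexx orbT.
  rewrite mulNr; move: (hip (A y) _) (hip (i y) _) => a b.
  by move: (M * b) (_ * b) => c d; lra.
have E0 : E !=set0 by exists (Num.max r0 M).
have Elb : has_lbound E by exists r0 => r [].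
pose r := inf E.
have r0r : r0 <= r by apply: lb_le_inf => // x [].
have pr : coer i (fun y => A y + r *: i y) 0.
  move=> y; rewrite mul0r qE; apply/ler_addgt0Pl => e e0.
  have N1 : 0 < hip (i y) (i y) + 1 by rewrite ltr_wpDl.
  have [x [_ px] xr] := inf_adherent (divr_gt0 e0 N1) (conj E0 Elb).
  have := px y; rewrite mul0r qE => h; apply: le_trans h _; rewrite addrCA lerD2l addrC -lerBlDl -mulrBl.
  have h2 : x - r <= e / (hip (i y) (i y) + 1) by rewrite lerBlDl ltW.
  apply: le_trans (ler_wpM2r (N0 y) h2) _; rewrite mulrAC ler_pdivrMr// ler_wpM2l ?(ltW e0)//.
  by rewrite lerDl.
have lAr : lin (fun y => A y + r *: i y) by apply: lin_add => //; exact: lin_scale.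
have sAr : symop i (fun y => A y + r *: i y).
  by move=> y z; rewrite !(sipDl sS) !(sipZl sS) sA (sipC sS (i y)).
have [oA [C HC]] := HA r r0r; pose C1 := Num.max C 1.
have C10 : 0 < C1 by rewrite lt_max ltr01 orbT.
have HC1 : lb i (fun y => A y + r *: i y) C1.
  by move=> y; apply: le_trans (HC y) _; rewrite ler_wpM2r ?nrm_ge0// le_max lexx.
have cr := coer_of_inverse lAr sAr pr oA HC1 C10.
have Ci : 0 < C1^-1 by rewrite invr_gt0.
move: r0r; rewrite le_eqVlt => /orP[/eqP rr|rr]; first by exists C1^-1; rewrite ?rr.
have : E (Num.max r0 (r - C1^-1)).
  split; first by rewrite le_max lexx.
  move=> y; rewrite mul0r qE; have := cr y; rewrite qE.
  have : (r - C1^-1) * hip (i y) (i y) <= Num.max r0 (r - C1^-1) * hip (i y) (i y).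
    by rewrite ler_wpM2r// le_max lexx orbT.
  rewrite mulrBl; move: (hip (A y) _) (hip (i y) _) => a b.
  by move: (r * b) (C1^-1 * b) (_ * b) => c e f; lra.
move=> /(ge_inf Elb); rewrite -/r leNgt gt_max rr /=.
by rewrite gtrBl Ci.
Qed.

End FormBottom.

Section Uniqueness.
Variables (R : realType).
Notation leb := (@lebesgue_measure R).

Lemma bounded_lint (q : R -> R) M : meas q -> (forall x, `|q x| <= M) -> lint q.
Proof.
move=> mq bq; split=> // a b.
have l1 : lint (fun=> M : R) by apply: cont_lint; exact: cst_continuous.
apply: le_integrable (l1.2 a b) => //.
- by apply/measurable_EFinP; exact: measurable_funS mq.
- by move=> x _ /=; rewrite lee_fin; apply: le_trans (bq x) (ler_norm _).
Qed.

Lemma is_derive_expR_lin (k x : R) : is_derive x 1 (fun x => expR (k * x)) (expR (k * x) * k).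
Proof.
have h := is_derive_affine k 0 x.
have -> : (fun x => expR (k * x)) = expR \o (fun x => k * x + 0) by apply/funext => t; rewrite /= addr0.
by have := @is_derive1_comp R expR (fun x => k * x + 0) x _ _ _ h; rewrite addr0; apply.
Qed.

(** Gronwall for [F = z^2 + z1^2]: its derivative is at most [(1 + M) F] in absolute value, so [F]
    times a decaying exponential decreases to the right of [x0], and symmetrically to the left. *)
Lemma ode_zero (z z1 z2 q : R -> R) M x0 : ac z z1 -> ac z1 z2 -> meas q ->
  (forall x, `|q x| <= M) -> {ae leb, forall x, z2 x = q x * z x} ->
  z x0 = 0 -> z1 x0 = 0 -> forall x, z x = 0.
Proof.
move=> a0 a1 mq bq hz i0 i1.
have M0 : 0 <= M by apply: le_trans (bq 0).
pose F x := z x * z x + z1 x * z1 x.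
pose f x := (z1 x * z x + z x * z1 x) + (q x * z x * z1 x + z1 x * (q x * z x)).
have c0 := ac_continuous a0; have c1 := ac_continuous a1.
have a1' : ac z1 (fun x => q x * z x).
  by apply: ac_ae a1 _ hz; apply: lintM => //; exact: bounded_lint bq.
have aF : ac F f by apply: acD; exact: acM.
have F0 x : 0 <= F x by rewrite addr_ge0// -expr2 sqr_ge0.
have fF x : `|f x| <= (1 + M) * F x.
  have -> : f x = (1 + q x) * (2 * (z x * z1 x)) by rewrite /f; ring.
  rewrite normrM; apply: ler_pM => //; first by apply: le_trans (ler_normD _ _) _; rewrite normr1 lerD2l.
  rewrite ler_norml; have := sqr_ge0 (z x - z1 x); have := sqr_ge0 (z x + z1 x).
  rewrite sqrrB sqrrD /F -!expr2 !mulr2n; move: (z x ^+ 2) (z1 x ^+ 2) (z x * z1 x) => a b c; lra.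
have aE (k : R) : ac (fun x => expR (k * x)) (fun x => expR (k * x) * k).
  apply: ac_C1; first by move=> x; exact: is_derive_expR_lin.
  move=> x; apply: cvgM; last exact: cvg_cst.
  apply: (@continuous_comp _ _ _ (fun x : R => k * x) expR); last exact: continuous_expR.
  exact: mulrl_continuous.
have G k := acM aF (aE k); pose K := 1 + M.
have Fx x : F x = 0.
  apply/eqP; rewrite eq_le F0 andbT.
  have F00 : F x0 = 0 by rewrite /F i0 i1 mulr0 addr0.
  have [xx|/ltW xx] := leP x0 x.
    have [_ /(_ _ _ xx)] := G (- K); rewrite F00 mul0r subr0 => h.
    rewrite -(pmulr_lle0 _ (expR_gt0 (- K * x))) h.
    apply: le_trans (_ : \int[leb]_(t in `[x0, x]) (0 : R) <= 0).
      apply: le_int; [exact: (ac_lint (G (- K)))|by apply: cont_lint; exact: cst_continuous|].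
      move=> t _; move: (expR_ge0 (- K * t)); move: (expR _) => E E0.
      have -> : f t * E + F t * (E * - K) = E * (f t - K * F t) by ring.
      by rewrite mulr_ge0_le0// subr_le0; apply: le_trans (ler_norm _) (fF t).
    by rewrite int_cst// mul0r.
  have [_ /(_ _ _ xx)] := G K; rewrite F00 mul0r sub0r => h.
  rewrite -(pmulr_lle0 _ (expR_gt0 (K * x))) -[leLHS]opprK h oppr_le0.
  apply: int_ge0 => t _; move: (expR_ge0 (K * t)); move: (expR _) => E E0.
  have -> : f t * E + F t * (E * K) = E * (f t + K * F t) by ring.
  by rewrite mulr_ge0// -lerBlDr sub0r; have := fF t; rewrite ler_norml => /andP[].
move=> x; apply/eqP; rewrite -sqrf_eq0 eq_le sqr_ge0 andbT -(Fx x) /F expr2 lerDl -expr2 sqr_ge0//.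
Qed.

(* On the line the Wronskian of two elements of the kernel is constant and integrable. *)
Lemma kernel_simple (Q : R -> R) M (p y : H2T (Line : domain R)) : mult Line Q M ->
  eqv hip (Aop Q p) 0 -> eqv hip (Aop Q y) 0 -> 0 < hip (incl p) (incl p) ->
  hip (incl y) (incl p) = 0 -> hip (incl y) (incl y) = 0.
Proof.
move=> mQ kp ky Np yp; have ds : dpos (Line : domain R) by []; have sS := hsip (L2h (Line : domain R)).
have [q [mq _ bq Qq]] := mult_clip mQ.
have E (u : H2T (Line : domain R)) : eqv hip (Aop Q u) 0 -> {ae leb, forall x, h2 u x = q x * h0 u x}.
  move=> /(eqv_aeE _ _ ds); rewrite (AopE mQ); apply: aeS2 Qq => x <- /eqP.
  by rewrite addrC subr_eq0 => /eqP.
have ep := E _ kp; have ey := E _ ky.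
have [p0 p1 Lp Lp1 _] := H2TP p; have [y0 y1 Ly Ly1 _] := H2TP y.
pose Wr x := h0 y x * h1 p x - h1 y x * h0 p x.
have aW : ac Wr (fun=> 0).
  apply: ac_ae (acB (acM y0 p1) (acM y1 p0)) _ _; first by apply: cont_lint; exact: cst_continuous.
  by apply: aeS2 ep ey => x -> ->; ring.
have Wc x x' : Wr x = Wr x'.
  wlog xx : x x' / x' <= x.
    by move=> H; case: (leP x' x) => [|/ltW] h; [exact: H|rewrite (H x' x)].
  by apply/eqP; rewrite -subr_eq0; have [_ ->//] := aW; rewrite int_cst// mul0r.
have iW : integ Line Wr by apply: integB; apply: L2_mul.
have W0 x : Wr x = 0.
  apply/eqP; rewrite -normr_le0; apply/ler_addgt0Pl => e e0; rewrite addr0.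
  by have [[b _ hb] _] := line_small 0 (ac_continuous aW) iW e0; rewrite (Wc x b).
have [x0 px0] : exists x0, h0 p x0 != 0.
  apply: contrapT => h; move: Np; rewrite (_ : hip _ _ = 0) ?ltxx//.
  rewrite /hip /= /L2ip incl_eq /L2inner.
  have -> : (fun x => h0 p x * h0 p x) = fun=> 0.
    apply/funext => x; have [->|px] := eqVneq (h0 p x) 0; first by rewrite mulr0.
    by exfalso; apply: h; exists x.
  by rewrite /Rintegral integral0.
(* [z] vanishes at [x0] by the choice of [c], and its derivative vanishes there because the
   Wronskian does. *)
pose c := h0 y x0 / h0 p x0; pose z := y - c *: p.
have zE x : h0 z x = h0 y x - c * h0 p x by [].
have zE1 x : h1 z x = h1 y x - c * h1 p x by [].
have z0 : forall x, h0 z x = 0.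
  have [a0 a1 _ _ _] := H2TP z.
  apply: (ode_zero (x0 := x0) a0 a1 mq bq).
  - apply: aeS2 ep ey => x e1 e2.
    have -> : h2 z x = h2 y x - c * h2 p x by [].
    by rewrite zE e1 e2; ring.
  - by rewrite zE /c divfK// subrr.
  - rewrite zE1; apply: (mulIf px0); rewrite mul0r mulrBl.
    have := W0 x0; rewrite /Wr => /eqP; rewrite subr_eq0 => /eqP <-.
    by rewrite /c; field.
have iz : eqv hip (incl y) (c *: incl p).
  by apply/(eqv_scale ds); apply: aeW => x; rewrite incl_eq; apply/eqP; rewrite -subr_eq0 -zE z0.
rewrite (eqv_ipr sS _ iz) (sipZr sS) yp mulr0//.
Qed.

Lemma periodic_bounded (f : R -> R) T : continuous f -> periodic f T -> 0 < T ->
  exists M, 0 <= M /\ forall x, `|f x| <= M.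
Proof.
move=> cf pf T0; have [M [M0 HM]] := @cont_bnd R f 0 T cf; exists M; split=> //.
have pn x n : f (x + n%:R * T) = f x by rewrite mulr_natl periodicn.
have pos x : 0 <= x -> `|f x| <= M.
  move=> x0; have xT : 0 <= x / T by rewrite divr_ge0// ltW.
  have /andP[h1 h2] := truncn_itv xT; move: h1 h2; rewrite ler_pdivlMr// ltr_pdivrMr// => h1 h2.
  rewrite -(subrK ((Num.truncn (x / T))%:R * T) x) pn; apply: HM.
  by rewrite subr_ge0 h1/=; rewrite -natr1 mulrDl mul1r in h2; lra.
move=> x; pose n := Num.bound (- x / T).
rewrite -(pn x n); apply: pos.
have [x0|x0] := leP 0 x; first by rewrite addr_ge0// mulr_ge0// ltW.
have : - x / T < n%:R by apply: archi_boundP; rewrite divr_ge0 ?(ltW T0)// oppr_ge0 ltW.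
by rewrite ltr_pdivrMr// => h; rewrite -lerBlDl sub0r ltW.
Qed.

End Uniqueness.

(** * The operators at a pulse, on the line or on a circle *)

Section Pulse.
Variables (R : realType) (s : domain R) (c1 : circle1 s).
Notation leb := (@lebesgue_measure R).
Notation S := (L2h s).
Notation Y := (H2T s).
Notation i := (@incl R s).
Notation no := (nrm hip).
Notation "f =ae g" := {ae leb, forall x, f x = g x} (at level 70).
Notation "u ~~> v" := (eqv hip u v) (at level 70).
Let sS := hsip S.
Let ds := circle1_dpos c1.

Lemma mult_sub Q w M M' : mult s Q M -> mult s w M' -> mult s (fun x => Q x - w x) (M + M').
Proof.
move=> [q1 q2 q3] [w1 w2 w3]; split; first exact: measB.
  by case: s q2 w2 => //= L; apply: aeS2 => x -> ->.
by apply: aeS2 q3 w3 => x h k; apply: le_trans (ler_normB _ _) _; exact: lerD.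
Qed.

Lemma Aop_sub Q w M M' y : mult s Q M -> mult s w M' ->
  Aop (fun x => Q x - w x) y = Aop Q y - mulop w (i y) :> S.
Proof.
move=> mQ mw; apply: L2T_ext; rewrite (AopE (mult_sub mQ mw)); apply/funext => x.
have -> : (Aop Q y - mulop w (i y) : L2T s) x = (Aop Q y : L2T s) x - (mulop w (i y) : L2T s) x by [].
by rewrite (AopE mQ) (mulopE _ mw) incl_eq; ring.
Qed.

Lemma sup_h0 (y : Y) x : h0 y x ^+ 2 <= 2 * nsq s (h0 y) + nsq s (h1 y).
Proof. exact: sup_bound (H2TP y). Qed.

Variables (V psi : R -> R) (mu om M0 : R) (p : Y).
Notation Q0 := (fun x => mu * V x + om).
Notation Qp := (fun x => mu * V x + om - 3 * psi x ^+ 2).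
Notation Qm := (fun x => mu * V x + om - psi x ^+ 2).
Hypotheses (mQ0 : mult s Q0 M0) (hpsi : H2 s psi) (hp : psi =ae h0 p)
  (stat : stationary V mu om psi).

(** The bound of [sup_bound] for the square of the pulse; it bounds the multipliers. *)
Definition sup2 := 2 * nsq s (h0 p) + nsq s (h1 p).
Lemma sup2_ge0 : 0 <= sup2.
Proof. by apply: le_trans (sup_h0 p 0); exact: sqr_ge0. Qed.

Lemma mult_psi2 : mult s (fun x => psi x ^+ 2) sup2.
Proof.
split; first exact: measX (H2_meas hpsi).
  by have [_ _ [_ hper _] _ _] := hpsi; case: s hper => //= L; apply: aeS => x ->.
by apply: aeS hp => x ->; rewrite ger0_norm ?sqr_ge0//; exact: sup_h0.
Qed.
Lemma mult_3psi2 : mult s (fun x => 3 * psi x ^+ 2) (3 * sup2).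
Proof.
have [h1 h2 h3] := mult_psi2; split; first exact: measZ.
  by case: s h2 => //= L; apply: aeS => x ->.
by apply: aeS h3 => x h; rewrite normrM ger0_norm// ler_wpM2l.
Qed.
Definition mult_Qm := mult_sub mQ0 mult_psi2.
Definition mult_Qp := mult_sub mQ0 mult_3psi2.

Lemma Lm_psi : Aop Qm p ~~> (0 : S).
Proof.
apply/(eqv_aeE _ _ ds).
have h := schr_rep mult_Qm (H2_meas hpsi) hp.
apply: ae_trans (ae_sym h) _; apply: aeS stat => x; rewrite expr2 exprS => e.
have -> : (0 : L2T s) x = 0 by [].
by rewrite -[RHS]e; ring.
Qed.

(** [L_+] is [L_-] minus twice the multiplication by [psi^2], and [L_- psi = 0], so the value is
    minus twice the integral of [psi^4]. *)
Lemma psi_form_lt0 : 0 < hip (i p) (i p) -> hip (Aop Qp p) (i p) < 0.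
Proof.
move=> Np; have mw := mult_psi2; have mw3 := mult_3psi2.
have E : Aop Qp p = Aop Qm p - (mulop (fun x => psi x ^+ 2) (i p) + mulop (fun x => psi x ^+ 2) (i p)) :> S.
  apply: L2T_ext; apply/funext => x.
  have -> : forall a b : S, (a - (b + b) : L2T s) x = (a : L2T s) x - ((b : L2T s) x + (b : L2T s) x) by [].
  by rewrite (AopE mult_Qp) (AopE mult_Qm) (mulopE _ mw) incl_eq; ring.
rewrite E (sipDl sS) (sipNl sS) (sipDl sS (mulop _ _)) (eqv_ipl sS _ Lm_psi) (sip0l sS) sub0r oppr_lt0.
have L2sq : L2 s (fun x => h0 p x ^+ 2).
  have := mult_L2 mw (L2TP (0 : L2T s)) => _.
  have mp : mult s (h0 p) (Num.sqrt sup2).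
    split; first exact: meas_h0.
      by have [_ _ [_ hper _] _ _] := H2TP p.
    by apply: aeW => x; rewrite -sqrtr_sqr ler_wsqrtr// sup_h0.
  have := mult_L2 mp (L2TP (i p : L2T s)); rewrite incl_eq; congr L2.
set a := hip _ _; suff a0 : 0 < a by rewrite addr_gt0.
have aE : a = L2inner s (fun x => h0 p x ^+ 2) (fun x => h0 p x ^+ 2).
  rewrite /a /hip /= /L2ip incl_eq (mulopE _ mw) incl_eq.
  have [_ _ [mp _ _] _ _] := H2TP p.
  apply: (@etrans _ _ (L2inner s (fun x => h0 p x ^+ 2 * h0 p x) (h0 p))).
    apply: ip_ae => //; [|exact: measM (measX _ mp) mp| |exact: aeW].
      by apply: measM => //; exact: measX (H2_meas hpsi).
    by apply: aeS hp => x ->.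
  by congr (Rintegral _ _ _); apply/funext => x; rewrite -!exprSr -exprD.
rewrite lt0r aE ip_ge0 andbT; apply/eqP => a0.
have := ip0_ae ds L2sq a0 => h; move: Np; rewrite (_ : hip _ _ = 0) ?ltxx//.
apply/(nrm_eq0 sS); have : i p ~~> 0; last by rewrite /eqv subr0.
apply/(eqv_aeE _ _ ds); rewrite incl_eq; apply: aeS h => x /eqP.
by rewrite sqrf_eq0 => /eqP.
Qed.

Variables (d : R) (d0 : 0 < d) (cA0 : coer i (Aop Q0) d) (oA0 : @solv R S Y (Aop Q0)).

Let b0 := 3 * sup2.
Let bsup : bdd (mulop (fun x => psi x ^+ 2) : S -> S) b0.
Proof.
move=> u; apply: le_trans (bdd_mulop sup2_ge0 mult_psi2 u) _; rewrite ler_wpM2r ?nrm_ge0//.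
by rewrite /b0 mulrDl mul1r lerDl; have := sup2_ge0; lra.
Qed.
Let b00 : 0 <= b0. Proof. by rewrite mulr_ge0// sup2_ge0. Qed.
Let bsup3 : bdd (mulop (fun x => 3 * psi x ^+ 2) : S -> S) b0.
Proof. exact: bdd_mulop b00 mult_3psi2. Qed.

Lemma stable_of_gap cp cm (eta : Y) a b : 0 < cp -> gap i (Aop Qp) p cp -> 0 < cm ->
  gap i (Aop Qm) p cm -> Aop Qp eta ~~> - i p -> hip (i eta) (i p) != 0 -> 0 < hip (i p) (i p) ->
  a != 0 -> resolvent_set s (Lfull V mu om psi) (a +i* b).
Proof.
move=> cp0 Gp cm0 Gm He s0 Np a0.
have li := @lin_incl R s.
have lp := lin_Aop mult_Qp; have lm := lin_Aop mult_Qm.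
have sp := sym_Aop ds mult_Qp; have sm := sym_Aop ds mult_Qm.
have [c' [K [c'0 K0 HK]]] := gap_full li lp sp Np cp0 Gp.
have [c2 [K2 [c20 K20 HK2]]] := gap_kernel li lm sm Lm_psi Np cm0 Gm s0.
have E3 y := Aop_sub y mQ0 mult_3psi2; have E1 y := Aop_sub y mQ0 mult_psi2.
have lA0 : lin (Aop Q0 : Y -> S) := lin_Aop mQ0.
have sA0 : symop i (Aop Q0) := sym_Aop ds mQ0.
(* Needed at [b] for the bound and at [- b] for solvability. *)
have L b' : exists2 C, 0 <= C & lb (emb4 i) (JL i (Aop Qp) (Aop Qm) a b') C.
  exact: (lb_JL sA0 (symb_mulop mult_3psi2) (symb_mulop mult_psi2) E3 E1 b' a0 Lm_psi He c'0 K0 c20 K20 HK HK2).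
have [C C0 HC] := L b; have [C' C'0 HC'] := L (- b).
apply/(resolvent_JL ds mult_Qp mult_Qm); split; last by exists C.
exact: (solv_JL li lA0 sA0 d0 cA0 oA0 (lin_mulop mult_3psi2) (symb_mulop mult_3psi2) bsup3
  (lin_mulop mult_psi2) (symb_mulop mult_psi2) bsup b00 E3 E1 C'0 HC').
Qed.

Lemma unstable_of_direction cm u : 0 < cm -> gap i (Aop Qm) p cm -> 0 < hip (i p) (i p) ->
  hip (i u) (i p) = 0 -> hip (Aop Qp u) (i u) < 0 ->
  exists2 l, 0 < l & ~ resolvent_set s (Lfull V mu om psi) (l +i* 0).
Proof.
move=> cm0 Gm Np up qu; have li := @lin_incl R s.
have E3 y := Aop_sub y mQ0 mult_3psi2; have E1 y := Aop_sub y mQ0 mult_psi2.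
have lA0 : lin (Aop Q0 : Y -> S) := lin_Aop mQ0.
have sA0 : symop i (Aop Q0) := sym_Aop ds mQ0.
have [l l0 H] := unstable_JL li lA0 sA0 d0 cA0 oA0 (lin_mulop mult_3psi2) (symb_mulop mult_3psi2) bsup3
  (lin_mulop mult_psi2) (symb_mulop mult_psi2) bsup b00 E3 E1 Lm_psi Np cm0 Gm up qu.
by exists l => //; move=> /(resolvent_JL ds mult_Qp mult_Qm); exact: H.
Qed.

End Pulse.

Lemma ae_periodicM (R : realType) (s : domain R) (f g : R -> R) :
  ae_periodic s f -> ae_periodic s g -> ae_periodic s (fun x => f x * g x).
Proof. by case: s => //= L; apply: aeS2 => x -> ->. Qed.
Lemma ae_periodic_eq (R : realType) (s : domain R) (f g : R -> R) :
  {ae @lebesgue_measure R, forall x, f x = g x} -> ae_periodic s g -> ae_periodic s f.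
Proof.
case: s => //= L h k; have h' := ae_shift L h.
by apply: aeS2 (aeS2 (fun x => @conj _ _) h h') k => x [-> ->].
Qed.

Section Norms.
Variables (R : realType) (s : domain R).
Lemma nrm_incl (y : H2T s) : nrm hip (incl y) ^+ 2 = nsq s (h0 y).
Proof. by rewrite (nrm_sqr (hsip (L2h s))) /hip /= /L2ip incl_eq. Qed.
Lemma nrm_lapl (y : H2T s) : nrm hip (lapl y) ^+ 2 = nsq s (h2 y).
Proof.
rewrite (nrm_sqr (hsip (L2h s))) /hip /= /L2ip laplE.
by congr (Rintegral _ _ _); apply/funext => x; rewrite mulrNN.
Qed.
Lemma nrm_le_sqr (u : L2h s) (e : R) : 0 <= e -> nrm hip u ^+ 2 <= e ^+ 2 -> nrm hip u <= e.
Proof. by move=> e0; rewrite ler_sqr ?nnegrE ?nrm_ge0. Qed.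
End Norms.

(** * Differentiating the stationary equation in the frequency *)

Section Linearization.
Variables (R : realType) (s : domain R) (c1 : circle1 s).
Notation leb := (@lebesgue_measure R).
Notation S := (L2h s).
Notation Y := (H2T s).
Notation i := (@incl R s).
Notation no := (nrm hip).
Notation "f =ae g" := {ae leb, forall x, f x = g x} (at level 70).
Notation "u ~~> v" := (eqv hip u v) (at level 70).
Let sS := hsip S.
Let ds := circle1_dpos c1.
Variables (V psi : R -> R) (mu om M0 : R) (p : Y).
Notation Q0 := (fun x => mu * V x + om).
Notation Qp := (fun x => mu * V x + om - 3 * psi x ^+ 2).
Hypotheses (mQ0 : mult s Q0 M0) (M00 : 0 <= M0) (hpsi : H2 s psi) (hp : psi =ae h0 p)
  (stat : stationary V mu om psi).

Lemma nsqD (f g : R -> R) : L2 s f -> L2 s g -> nsq s (fun x => f x + g x) <= 2 * nsq s f + 2 * nsq s g.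
Proof.
move=> hf hg; rewrite /nsq /L2inner -!cintZ -?cintD; try exact: L2_mul; try by apply: integZ; exact: L2_mul.
apply: cint_le; [by apply: L2_mul; exact: L2D|by apply: integD; apply: integZ; exact: L2_mul|].
by move=> x; have := sqr_ge0 (f x - g x); nra.
Qed.

Lemma mult_h0M (f : R -> R) (u q : Y) : f =ae h0 q -> meas f ->
  mult s (fun x => f x * h0 u x) (2 * nsq s (h0 q) + nsq s (h1 q) + (2 * nsq s (h0 u) + nsq s (h1 u))).
Proof.
move=> hf mf; split; first by apply: measM => //; exact: meas_h0.
  have [_ _ [_ h _] _ _] := H2TP u; have [_ _ [_ k _] _ _] := H2TP q.
  exact: ae_periodicM (ae_periodic_eq hf k) h.
apply: aeS hf => x ->; have h := sup_h0 c1 u x; have k := sup_h0 c1 q x.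
rewrite -[h0 q x ^+ 2]real_normK ?num_real// in k.
rewrite -[h0 u x ^+ 2]real_normK ?num_real// in h; rewrite normrM.
apply: le_trans (lerD k h); have := normr_ge0 (h0 q x); have := normr_ge0 (h0 u x).
by move: (`|h0 q x|) (`|h0 u x|) => a b; nra.
Qed.

(** Subtracting the equations at [om + h] and [om] and dividing by [h] gives [L_+ e + psi] equal to
    a remainder. It tends to 0 with [h] and with the H^2 error of the difference quotient. *)
Lemma derivative_linearized (P : R -> R -> R) nu v (e : Y) : 0 < nu ->
  is_H2_derivative s P om v -> P om =ae psi -> v =ae h0 e ->
  (forall w, om - nu < w < om + nu -> H2 s (P w) /\ stationary V mu w (P w)) ->
  Aop Qp e ~~> - i p.
Proof.
move=> nu0 [hv dv] Pom hve HP.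
apply/(nrm_le0 (B := hip)); rewrite opprK; apply/ler_addgt0Pl => t t0; rewrite addr0.
pose s2 := sup2 p; have s20 : 0 <= s2 := sup2_ge0 c1 p.
(* Bounds the squared sup norm of every difference quotient [u = e + z] whose error [z] has H^2 norm
   at most 1. *)
pose be := 2 * (2 * nsq s (h0 e) + nsq s (h1 e)) + 6.
have be0 : 0 <= be by rewrite /be !addr_ge0// ?mulr_ge0 ?addr_ge0 ?mulr_ge0 ?nsq_ge0.
pose K1 := 1 + M0 + 3 * s2; have K10 : 0 < K1 by rewrite /K1 -addrA ltr_wpDr// addr_ge0// mulr_ge0.
pose K2 := (no (i e) + 1) * (1 + 3 * (s2 + be) + (be + be)).
have K20 : 0 <= K2 by rewrite /K2; nneg.
pose ep := Num.min 1 (t / 2 / K1).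
have ep0 : 0 < ep by rewrite lt_min ltr01 !divr_gt0.
have ep1 : ep <= 1 by rewrite ge_min lexx.
have epK : K1 * ep <= t / 2.
  by rewrite mulrC -ler_pdivlMr// ge_min lexx orbT.
pose hm := Num.min (Num.min 1 nu) (t / 2 / (K2 + 1)).
have K21 : 0 < K2 + 1 by rewrite ltr_wpDl.
have hm0 : 0 < hm by rewrite !lt_min ltr01 nu0 !divr_gt0.
have [h [Nh [hn0 hhm]]] : exists h, H2norm s (fun x => h^-1 * (P (om + h) x - P om x) - v x) <= ep /\
    (h != 0 /\ `|h| < hm).
  have /cvgrPdist_le /(_ ep ep0) N1 := dv.
  have N2 : \forall h \near (0 : R)^', h != 0 by exact: nbhs_dnbhs_neq.
  have N3 : \forall h \near (0 : R)^', `|h| < hm by exact: dnbhs0_lt.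
  apply: (@filter_ex _ (0 : R)^'); apply: filterS3 N1 N2 N3 => h; rewrite sub0r normrN => k1 k2 k3.
  by split=> //; apply: le_trans k1; exact: ler_norm.
have hle1 : `|h| <= 1 by apply: le_trans (ltW hhm) _; rewrite !ge_min lexx.
have hK : K2 * `|h| <= t / 2.
  apply: (@le_trans _ _ ((K2 + 1) * `|h|)); first by rewrite ler_wpM2r// lerDl.
  by rewrite mulrC -ler_pdivlMr//; apply: le_trans (ltW hhm) _; rewrite ge_min lexx orbT.
have hnu : om - nu < om + h < om + nu.
  have : `|h| < nu by apply: lt_le_trans hhm _; rewrite !ge_min lexx orbT.
  by rewrite ltr_norml; lra.
have [HPh stath] := HP _ hnu; have [y hy] := H2_repY HPh.
have [_ dd2] := rep_H2Y (H2_meas HPh) hy; have [_ ddp] := rep_H2Y (H2_meas hpsi) hp.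
have HPo : H2 s (P om) by apply: (HP om _).1; lra.
have [z [z0E z2E]] : exists z : Y, (forall x, h0 z x = h^-1 * (h0 y x - h0 p x) - h0 e x) /\
    (forall x, h2 z x = h^-1 * (h2 y x - h2 p x) - h2 e x) by exists (h^-1 *: (y - p) - e).
have hz : (fun x => h^-1 * (P (om + h) x - P om x) - v x) =ae h0 z.
  have hh := aeS2 (fun x => @conj _ _) Pom hp.
  by apply: aeS2 (aeS2 (fun x => @conj _ _) hy hve) hh => x [-> ->] [-> ->]; rewrite z0E.
have mz : meas (fun x => h^-1 * (P (om + h) x - P om x) - v x).
  exact: (measB (measZ _ (measB (H2_meas HPh) (H2_meas HPo))) (H2_meas hv)).
have NE := H2norm_sqr (H2TP z) mz hz.
have N2 : nsq s (h0 z) + nsq s (h1 z) + nsq s (h2 z) <= ep ^+ 2.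
  by rewrite -NE ler_sqr ?nnegrE ?sqrtr_ge0 ?(ltW ep0).
have z0 := @nsq_ge0 R s (h0 z); have z1 := @nsq_ge0 R s (h1 z); have z2 := @nsq_ge0 R s (h2 z).
have nz : no (i z) <= ep.
  apply: (nrm_le_sqr (ltW ep0)); rewrite nrm_incl.
  by apply: le_trans N2; rewrite -addrA lerDl addr_ge0.
have nlz : no (lapl z) <= ep.
  apply: (nrm_le_sqr (ltW ep0)); rewrite nrm_lapl.
  by apply: le_trans N2; rewrite lerDr addr_ge0.
have [u [uE u1E uI]] : exists u : Y, [/\ forall x, h0 u x = h0 e x + h0 z x,
    forall x, h1 u x = h1 e x + h1 z x & i u = i e + i z].
  by exists (e + z); split=> //; exact: (linD (@lin_incl R s)).
have yE x : h0 y x = h0 p x + h * h0 u x.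
  have -> : h0 u x = h^-1 * (h0 y x - h0 p x).
    by rewrite uE z0E addrC subrK.
  by rewrite mulrA divff// mul1r addrC subrK.
have yE2 x : h2 y x = h2 p x + h * (h2 e x + h2 z x).
  by rewrite z2E [h2 e x + _]addrC subrK mulrA divff// mul1r addrC subrK.
have bu : 2 * nsq s (h0 u) + nsq s (h1 u) <= be.
  have [_ _ le0 le1 _] := H2TP e; have [_ _ lz0 lz1 _] := H2TP z.
  have k1 := nsqD le0 lz0; have k2 := nsqD le1 lz1.
  have e2 : ep ^+ 2 <= 1 by rewrite expr2 mulr_ile1 ?(ltW ep0).
  have -> : h0 u = fun x => h0 e x + h0 z x by apply/funext.
  have -> : h1 u = fun x => h1 e x + h1 z x by apply/funext.
  rewrite /be; move: (nsq s (fun x => h0 e x + h0 z x)) (nsq s (fun x => h1 e x + h1 z x)) k1 k2 => a b k1 k2; lra.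
have m1 := mult_h0M u hp (H2_meas hpsi).
have m2 := mult_h0M u (ae_refl (h0 u)) (meas_h0 u).
have mw3 := mult_3psi2 c1 hpsi hp.
have mp := mult_Qp c1 mQ0 hpsi hp.
(* With [P (om + h) = psi + h u] and [u = e + z], this is
   [- L_+ z - h u + 3 h psi u^2 + h^2 u^3]. *)
pose T : S := - lapl z - mulop Q0 (i z) - h *: i u + mulop (fun x => 3 * psi x ^+ 2) (i z)
   + (3 * h) *: mulop (fun x => psi x * h0 u x) (i u) + h ^+ 2 *: mulop (fun x => h0 u x * h0 u x) (i u).
have TE : Aop Qp e + i p ~~> T.
  apply/(eqv_aeE _ _ ds).
  have -> : (Aop Qp e + i p : L2T s) = (fun x => (Aop Qp e : L2T s) x + (i p : L2T s) x) :> (R -> R) by [].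
  have -> : (T : L2T s) = (fun x => - (lapl z : L2T s) x - (mulop Q0 (i z) : L2T s) x - h * (i u : L2T s) x
      + (mulop (fun x => 3 * psi x ^+ 2) (i z) : L2T s) x
      + (3 * h) * (mulop (fun x => psi x * h0 u x) (i u) : L2T s) x
      + h ^+ 2 * (mulop (fun x => h0 u x * h0 u x) (i u) : L2T s) x) :> (R -> R) by [].
  rewrite (AopE mp) laplE (mulopE _ mQ0) (mulopE _ mw3) (mulopE _ m1) (mulopE _ m2) !incl_eq.
  have st1 := aeS2 (fun x => @conj _ _) stath stat.
  have st2 := aeS2 (fun x => @conj _ _) hy hp.
  have st3 := aeS2 (fun x => @conj _ _) dd2 ddp.
  apply: aeS2 st1 (aeS2 (fun x => @conj _ _) st2 st3) => x [e1 e2] [[e3 e4] [e5 e6]].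
  apply: (mulfI hn0); rewrite e5 e3 yE yE2 in e1; rewrite e6 e4 in e2; rewrite e4.
  have := congr2 (fun a b => a - b) e1 e2; rewrite subrr => e12.
  by apply/eqP; rewrite -subr_eq0 -e12 uE; apply/eqP; ring.
rewrite (eqv_nrm sS TE) /T.
have nu1 : no (i u) <= no (i e) + 1.
  by rewrite uI; apply: le_trans (nrmD sS _ _) _; rewrite lerD2l (le_trans nz).
have nn := nrm_ge0 hip (i u).
have tri (a b c d f g : S) : no (- a - b - c + d + f + g) <= no a + no b + no c + no d + no f + no g.
  apply: le_trans (nrmD sS _ _) _; rewrite lerD2r.
  apply: le_trans (nrmD sS _ _) _; rewrite lerD2r.
  apply: le_trans (nrmD sS _ _) _; rewrite lerD2r.
  apply: le_trans (nrmB sS _ _) _; rewrite lerD2r.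
  by apply: le_trans (nrmB sS _ _) _; rewrite lerD2r (nrmN sS).
apply: le_trans (tri _ _ _ _ _ _) _; rewrite !(nrmZ sS).
have k1 : no (mulop Q0 (i z)) <= M0 * ep.
  by apply: le_trans (bdd_mulop M00 mQ0 _) _; rewrite ler_wpM2l.
have k2 : no (mulop (fun x => 3 * psi x ^+ 2) (i z)) <= 3 * s2 * ep.
  by apply: le_trans (bdd_mulop _ mw3 _) _; rewrite ?mulr_ge0// ler_wpM2l// mulr_ge0.
have k3 : no (mulop (fun x => psi x * h0 u x) (i u)) <= (s2 + be) * no (i u).
  apply: le_trans (bdd_mulop _ m1 _) _; first by rewrite !addr_ge0 ?mulr_ge0 ?nsq_ge0.
  by rewrite ler_wpM2r// lerD2l.
have k4 : no (mulop (fun x => h0 u x * h0 u x) (i u)) <= (be + be) * no (i u).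
  apply: le_trans (bdd_mulop _ m2 _) _; first by rewrite !addr_ge0 ?mulr_ge0 ?nsq_ge0.
  by rewrite ler_wpM2r// lerD.
rewrite normrM [`|3|]ger0_norm// normrX.
have hh2 : `|h| ^+ 2 <= `|h| by rewrite expr2 ler_piMr.
have k5 : `|h| * no (i u) <= `|h| * (no (i e) + 1) by rewrite ler_wpM2l.
have k6 : 3 * `|h| * no (mulop (fun x => psi x * h0 u x) (i u)) <= 3 * `|h| * ((s2 + be) * (no (i e) + 1)).
  rewrite ler_wpM2l ?mulr_ge0//; apply: le_trans k3 _; rewrite ler_wpM2l// addr_ge0//.
have k7 : `|h| ^+ 2 * no (mulop (fun x => h0 u x * h0 u x) (i u)) <= `|h| * ((be + be) * (no (i e) + 1)).
  by apply: ler_pM => //; [exact: nrm_ge0|apply: le_trans k4 _; rewrite ler_wpM2l// addr_ge0].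
move: epK hK k1 k2 k5 k6 k7; rewrite /K1 /K2.
move: (no (mulop _ _)) (no (mulop _ _)) (no (mulop _ _)) (no (mulop _ _)) => x1 x2 x3 x4.
move: (no (lapl z)) nlz (no (i u)) (no (i e)) (`|h|) => x5 k8 x6 x7 x8 epK hK k1 k2 k5 k6 k7.
rewrite mulrDl mulrDl mul1r in epK.
have hK' : x8 * (x7 + 1) + 3 * x8 * ((s2 + be) * (x7 + 1)) + x8 * ((be + be) * (x7 + 1)) <= t / 2.
  by apply: le_trans hK; rewrite le_eqVlt; apply/orP; left; apply/eqP; ring.
move: (x8 ^+ 2 * x1) (x8 * x6) (3 * x8 * x2) k7 k5 k6 => y7 y5 y6 k7 k5 k6.
move: epK hK' k1 k2 k5 k6 k7 k8; clear; lra.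
Qed.

End Linearization.

Section Potential.
Variables (R : realType) (V : R -> R) (T : R) (V_C1 : C1 V) (V_per : periodic V T) (T0 : 0 < T).
Notation leb := (@lebesgue_measure R).

Lemma C1_continuous : continuous V.
Proof.
case: V_C1 => dV cV; apply: (@ac_continuous R V (derive1 V)); apply: ac_C1 => // x.
by have := @derivableP _ _ _ _ _ _ (dV x); rewrite derive1E.
Qed.

Lemma potential_mult mu om : exists2 M, 0 <= M & forall s : domain R,
  s = Line \/ (exists n : nat, s = Circle (n%:R * T)) ->
  mult s (fun x => mu * V x) M /\ mult s (fun x => mu * V x + om) M.
Proof.
have [B [B0 HB]] := periodic_bounded C1_continuous V_per T0.
have M0 : 0 <= `|mu| * B by rewrite mulr_ge0.
exists (`|mu| * B + `|om|); first by rewrite addr_ge0.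
have mV : meas V by apply: cont_meas; exact: C1_continuous.
have bV x : `|mu * V x| <= `|mu| * B by rewrite normrM ler_wpM2l.
move=> s hs; split; split.
- exact: measZ.
- by case: hs => [->//|[n ->]] /=; apply: aeW => x; rewrite mulr_natl periodicn.
- by apply: aeW => x; apply: le_trans (bV x) _; rewrite lerDl.
- by apply: measD; [exact: measZ|exact: meas_cst].
- by case: hs => [->//|[n ->]] /=; apply: aeW => x; rewrite mulr_natl periodicn.
- by apply: aeW => x; apply: le_trans (ler_normD _ _) _; rewrite lerD2r.
Qed.
End Potential.

Section HillOperator.
Variables (R : realType) (V : R -> R) (mu om M : R).
Notation Ln := (Line : domain R).
Notation S := (L2h Ln).
Notation Y := (H2T Ln).
Notation i := (@incl R Ln).
Notation no := (nrm hip).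
Let sS := hsip S.
Hypotheses (mV : mult Ln (fun x => mu * V x) M) (mQ : mult Ln (fun x => mu * V x + om) M) (M0 : 0 <= M).

Lemma Hill_resolvent (r : R) : resolvent_set Ln (Hill V mu) r%:C ->
  resolvent_set Ln (schr (fun x => mu * V x)) (- r)%:C.
Proof.
set A := schr _; move=> [[inj sur] [C HC]].
have E u x : shift_op A (- r)%:C u x = - shift_op (Hill V mu) r%:C u x.
  rewrite /shift_op HillE -/A; move: (A u x) => v.
  by rewrite rmorphN /= scaleNr opprD !opprK.
have EN (u v : vfun R 1) : (forall x, u x = - v x) -> cL2norm Ln u = cL2norm Ln v.
  move=> h; rewrite !cL2norm1.
  have k (f g : R -> R) : (forall x, f x = - g x) -> L2norm Ln f = L2norm Ln g.
    move=> e; rewrite /L2norm; have -> : f = (fun x => - g x) by apply/funext.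
    have -> : EFin \o ((fun x => - g x) \_ (cell Ln)) = (\- (EFin \o (g \_ (cell Ln))))%E.
      apply/funext => x; rewrite /= !patchE; case: (_ \in _) => //=.
      by rewrite oppr0.
    by rewrite oppe_Lnorm.
  by congr (Num.sqrt (_ ^+ 2 + _ ^+ 2)); apply: k => x; rewrite /re /im h !mxE ?ReN ?ImN.
split; first split.
- move=> u v hu hv h; apply: (inj _ _ hu hv); apply: aeS h => x; rewrite !E => /eqP.
  by rewrite eqr_opp => /eqP.
- move=> f hf; have hNf : cL2 Ln (fun x => - f x).
    move=> j; have [h1 h2] := hf j; split.
      have -> : re (fun x => - f x) j = (fun x => - re f j x).
        by apply/funext => x; rewrite /re !mxE ReN.
      exact: L2N h1.
    have -> : im (fun x => - f x) j = (fun x => - im f j x).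
      by apply/funext => x; rewrite /im !mxE ImN.
    exact: L2N h2.
  have [u hu h] := sur _ hNf; exists u => //; apply: aeS h => x.
  by rewrite E => ->; rewrite opprK.
- by exists C => u hu; rewrite (EN _ _ (E u)); exact: (HC u hu).
Qed.

Hypothesis bound : (ereal_sup [set (complex.Re z)%:E | z in spectrum Ln (Hill V mu)] < om%:E)%E.

(** Every real [r >= om] exceeds the spectral bound, so all the shifts required by
    [coer_of_resolvent] are invertible. *)
Lemma coercive_line : exists d, [/\ 0 < d, coer i (Aop (fun x => mu * V x + om)) d &
  @solv R S Y (Aop (fun x => mu * V x + om))].
Proof.
have E r (y : Y) : Aop (fun x => mu * V x) y - (- r) *: i y = Aop (fun x => mu * V x) y + r *: i y.
  by rewrite scaleNr opprK.
have E0 y : Aop (fun x => mu * V x + om) y = Aop (fun x => mu * V x) y + om *: i y :> S.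
  apply: L2T_ext; rewrite (AopE mQ); apply/funext => x.
  have -> : (Aop (fun x => mu * V x) y + om *: i y : L2T Ln) x =
    (Aop (fun x => mu * V x) y : L2T Ln) x + om * (i y : L2T Ln) x by [].
  by rewrite (AopE mV) incl_eq; ring.
have H r : om <= r -> @solv R S Y (fun y => Aop (fun x => mu * V x) y + r *: i y) /\
    exists C, lb i (fun y => Aop (fun x => mu * V x) y + r *: i y) C.
  move=> omr; have hr : resolvent_set Ln (Hill V mu) r%:C.
    apply: contrapT => h.
    have : (r%:E <= ereal_sup [set (complex.Re z)%:E | z in spectrum Ln (Hill V mu)])%E.
      by apply: ereal_sup_ubound; exists r%:C.
    by move=> /le_lt_trans /(_ bound); rewrite lte_fin ltNge omr.
  have ds : dpos Ln by [].
  have [oA [C HC]] := resolvent_schr ds mV (Hill_resolvent hr).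
  split; first by move=> f; have [y hy] := oA f; exists y; rewrite -E.
  by exists C => y; rewrite -E; exact: HC.
have ds : dpos Ln by [].
have low y : - M * hip (i y) (i y) <= hip (Aop (fun x => mu * V x) y) (i y).
  have := nsq_h1 ds y mV M0; have := @nsq_ge0 R Ln (h1 y); rewrite mulNr.
  by move: (hip (Aop _ y) _) (M * _) => a b; lra.
have [d d0 cd] := coer_of_resolvent (@lin_incl R Ln) (lin_Aop mV) (sym_Aop ds mV) low H.
exists d; split=> //; first by move=> y; rewrite E0; exact: cd.
by move=> f; have [y hy] := (H om (lexx _)).1 f; exists y; rewrite E0.
Qed.

End HillOperator.

Section LinePulse.
Variables (R : realType) (V psi : R -> R) (mu om M0 d : R) (p : H2T (Line : domain R)).
Notation leb := (@lebesgue_measure R).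
Notation Ln := (Line : domain R).
Notation S := (L2h Ln).
Notation Y := (H2T Ln).
Notation i := (@incl R Ln).
Notation no := (nrm hip).
Notation "f =ae g" := {ae leb, forall x, f x = g x} (at level 70).
Notation "u ~~> v" := (eqv hip u v) (at level 70).
Notation Q0 := (fun x => mu * V x + om).
Notation Qp := (fun x => mu * V x + om - 3 * psi x ^+ 2).
Notation Qm := (fun x => mu * V x + om - psi x ^+ 2).
Let sS := hsip S.
Let c1 : circle1 Ln := I.
Let ds : dpos Ln := I.
Hypotheses (mQ0 : mult Ln Q0 M0) (M00 : 0 <= M0) (hpsi : H2 Ln psi) (hp : psi =ae h0 p)
  (stat : stationary V mu om psi) (d0 : 0 < d) (cA0 : coer i (Aop Q0) d) (oA0 : @solv R S Y (Aop Q0)).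
Hypothesis Np : 0 < hip (i p) (i p).
Let mp : mult Ln Qp _ := mult_Qp c1 mQ0 hpsi hp.
Let mm : mult Ln Qm _ := mult_Qm c1 mQ0 hpsi hp.

Let integ_psi2 : integ Ln (fun x => psi x ^+ 2).
Proof. by have [_ _ hL _ _] := hpsi; have [_ _] := (L2P _ _).1 hL. Qed.

(** In the alternative of [gap_or_eigenvector], a negative eigenvalue is excluded by assumption, and
    a second kernel element orthogonal to [psi] by the Wronskian. *)
Lemma gap_Lminus : no_negative_eigenvalue Ln (Lminus V mu om psi) ->
  exists2 c, 0 < c & gap i (Aop Qm) p c.
Proof.
rewrite LminusE => H; have mw := mult_psi2 c1 hpsi hp.
have Hp : Aop Qm p ~~> 0 *: i p by rewrite scale0r; have := Lm_psi c1 mQ0 hpsi hp stat.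
have cW := rel_compact_mulop c1 mQ0 M00 mw (fun x => sqr_ge0 (psi x)) integ_psi2.
have AE y : Aop Qm y = Aop Q0 y - mulop (fun x => psi x ^+ 2) (i y) := Aop_sub y mQ0 mw.
have [[c [cp0 Hc]]|[m [y [m0 Ny yp ey]]]] := gap_or_eigenvector (@lin_incl R Ln) (lin_Aop mQ0)
  (lin_mulop mw) (sym_Aop ds mQ0) (symb_mulop mw) cA0 d0 oA0 (bdd_mulop (sup2_ge0 c1 p) mw) cW AE Hp.
  by exists c.
exfalso; move: m0; rewrite le_eqVlt => /orP[/eqP mz|m0]; last first.
  by apply: (H _ m0); apply/(eigenvalue_schr ds mm); exists y.
rewrite mz scale0r in ey; rewrite scale0r in Hp.
by move: Ny; rewrite (kernel_simple mm Hp ey Np yp) ltxx.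
Qed.

Lemma Lplus_inverse : invertible_op Ln (Lplus V mu om psi) ->
  @solv R S Y (Aop Qp) /\ exists2 C, 0 <= C & lb i (Aop Qp) C.
Proof.
rewrite LplusE => /resolvent_invertible /(resolvent_schr ds mp)[oA [C HC]].
have E y : Aop Qp y - 0 *: i y = Aop Qp y by rewrite scale0r subr0.
split; first by move=> f; have [y hy] := oA f; exists y; rewrite -E.
exists `|C| => // y; rewrite -E; apply: le_trans (HC y) _.
by rewrite ler_wpM2r ?nrm_ge0 ?ler_norm.
Qed.

(** The constraint vector is the eigenfunction of the negative eigenvalue. A second eigenvector
    orthogonal to it contradicts the lower bound if its eigenvalue is 0, and simplicity if it is
    negative. *)
Lemma gap_Lplus C : lb i (Aop Qp) C -> one_simple_negative_eigenvalue Ln (Lplus V mu om psi) ->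
  exists phi c, 0 < c /\ gap i (Aop Qp) phi c.
Proof.
rewrite LplusE => HC [r [r0 [er am] Hr]]; have mw := mult_3psi2 c1 hpsi hp.
have [phi Nphi ephi] := (eigenvalue_schr ds mp r).1 er; exists phi.
have w0 x : 0 <= 3 * psi x ^+ 2 by rewrite mulr_ge0 ?sqr_ge0.
have cW := rel_compact_mulop c1 mQ0 M00 mw w0 (integZ 3 integ_psi2).
have AE y : Aop Qp y = Aop Q0 y - mulop (fun x => 3 * psi x ^+ 2) (i y) := Aop_sub y mQ0 mw.
have s20 : 0 <= 3 * sup2 p by rewrite mulr_ge0// (sup2_ge0 c1).
have [[c [cp0 Hc]]|[m [y [m0 Ny yp ey]]]] := gap_or_eigenvector (@lin_incl R Ln) (lin_Aop mQ0)
  (lin_mulop mw) (sym_Aop ds mQ0) (symb_mulop mw) cA0 d0 oA0 (bdd_mulop s20 mw) cW AE ephi.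
  by exists c.
exfalso; move: m0; rewrite le_eqVlt => /orP[/eqP mz|m0].
  rewrite mz scale0r in ey; have := HC y; move: ey; rewrite /eqv subr0 => ->; rewrite mulr0.
  by move=> /(nrm_le0 (B := hip))/(nrm_eq0 sS) h; rewrite h ltxx in Ny.
have mr : m = r by apply: Hr => //; apply/(eigenvalue_schr ds mp); exists y.
rewrite mr in ey; have [c h] := simple_schr ds mp am Nphi ephi ey.
have c0 : c = 0.
  have := eqv_ipl sS (i phi) h; rewrite yp (sipZl sS) => /esym/eqP.
  by rewrite mulf_eq0 (gt_eqF Nphi) orbF => /eqP.
move: Ny; rewrite (eqv_ipl sS _ h) (eqv_ipr sS _ h) c0 scale0r (sip0l sS) ltxx//.
Qed.

End LinePulse.

(** * Solving on a circle *)

Section CircleSolver.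
Variables (R : realType) (L : R) (L0 : 0 < L).
Notation leb := (@lebesgue_measure R).
Notation s := (Circle L).
Notation S := (L2h s).
Notation Y := (H2T s).
Notation i := (@incl R s).
Notation "u ~~> v" := (eqv hip u v) (at level 70).

Lemma ac_expR (k : R) : ac (fun x => expR (k * x)) (fun x => expR (k * x) * k).
Proof.
apply: ac_C1; first by move=> x; exact: is_derive_expR_lin.
move=> x; apply: cvgM; last exact: cvg_cst.
apply: (@continuous_comp _ _ _ (fun x : R => k * x) expR); last exact: continuous_expR.
exact: mulrl_continuous.
Qed.

Lemma ac_const (F : R -> R) : ac F (fun=> 0) -> forall x, F x = F 0.
Proof.
move=> aF x; apply/eqP; rewrite -subr_eq0; case: (leP 0 x) => [|/ltW] h.
  by have [_ ->//] := aF; rewrite int_cst// mul0r.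
by rewrite -oppr_eq0 opprB; have [_ ->//] := aF; rewrite int_cst// mul0r.
Qed.

Lemma first_order (k : R) (f : R -> R) : k != 0 -> lint f -> ae_periodic s f ->
  exists g, ac g (fun x => f x - k * g x) /\ forall x, g (x + L) = g x.
Proof.
move=> k0 lf pf; have c (j : R) := ac_continuous (ac_expR j).
have lF : lint (fun x => f x * expR (k * x)) by exact: lintM.
pose F := prim (fun x => f x * expR (k * x)); have aF : ac F (fun x => f x * expR (k * x)) := ac_prim lF.
have F0 : F 0 = 0 by rewrite /F /prim lexx int_pt.
have kL : 1 - expR (- k * L) != 0.
  rewrite subr_eq0 eq_sym -expR0; apply/eqP => /expR_inj /eqP.
  by rewrite mulf_eq0 oppr_eq0 (negbTE k0) (gt_eqF L0).
(* Variation of constants; this value makes [g L = g 0]. The difference [dl] below then solves the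
   homogeneous equation with value 0 at 0, so [g] is periodic everywhere. *)
pose c0 := expR (- k * L) * F L / (1 - expR (- k * L)).
pose g x := (c0 + F x) * expR (- k * x).
have inv x : expR (k * x) * expR (- k * x) = 1 by rewrite -expRD mulNr subrr expR0.
have ag : ac g (fun x => f x - k * g x).
  have lg : lint (fun x => f x - k * g x).
    apply: lintB => //; apply: lintZ; apply: cont_lint; apply: ac_continuous.
    by apply: acM (ac_expR (- k)); exact: acD (ac_cst c0) aF.
  apply: ac_ae (acM (acD (ac_cst c0) aF) (ac_expR (- k))) lg _; apply: aeW => x.
  by rewrite add0r -mulrA inv mulr1 /g; ring.
exists g; split=> // x.
pose dl x := g (x + L) - g x.
have adl : ac dl (fun x => - k * dl x).
  have aL := ac_shift L ag; have aB := acB aL ag.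
  have cdl : continuous dl := ac_continuous aB.
  apply: ac_ae aB _ _; first by apply: lintZ; exact: cont_lint.
  by apply: aeS pf => y e; rewrite e /dl; ring.
have aE : ac (fun x => dl x * expR (k * x)) (fun=> 0).
  apply: ac_ae (acM adl (ac_expR k)) _ _; first by apply: cont_lint; exact: cst_continuous.
  by apply: aeW => y; ring.
have := ac_const aE x.
have -> : dl 0 = 0.
  by rewrite /dl add0r /g F0 mulr0 expR0 mulr1 addr0 /c0; field.
rewrite mul0r => /eqP; rewrite mulf_eq0 [expR _ == 0]gt_eqF ?expR_gt0// orbF /dl subr_eq0.
by move=> /eqP.
Qed.

Lemma L2_circle_cont (f : R -> R) : continuous f -> (forall x, f (x + L) = f x) -> L2 s f.
Proof.
move=> cf pf; apply/L2P; split; [exact: cont_meas|exact: aeW|].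
have := cont_lint cf => lf.
have := lintM lf cf => lff; have := lff.2 0 L.
by congr (leb.-integrable _ _); apply/funext => x; rewrite /= expr2.
Qed.

(** [- u'' + u = f] is factored into the first-order equations [g' + g = f] and [u - u' = g]. *)
Lemma solv_identity : @solv R S Y (Aop (fun=> 1)).
Proof.
move=> f; have hf := L2TP (f : L2T s).
have [mf pf sf] := (L2P _ _).1 hf.
have lf : lint (f : L2T s).
  apply: (period_integrable mf L0 pf).
  have i2 := integD sf (integZ 1 (_ : integ s (fun=> 1))).
  apply: (@integ_le R s _ (fun x => (f : L2T s) x ^+ 2 + 1 * 1)); [exact: mf| |].
    move=> x; rewrite mulr1 -[(f : L2T s) x ^+ 2]real_normK ?num_real//.
    by have := sqr_ge0 (`|(f : L2T s) x| - 1); have := normr_ge0 ((f : L2T s) x); nra.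
  by apply: i2; have := (cont_lint (@cst_continuous R R 1)).2 0 L.
have [g [ag pg]] := first_order (oner_neq0 R) lf pf.
have cg := ac_continuous ag.
have [|||u [au pu]] := @first_order (-1) (fun x => - g x).
- by rewrite oppr_eq0 oner_neq0.
- by apply: lintN; exact: cont_lint.
- by apply: aeW => x; rewrite pg.
have cu := ac_continuous au.
pose u1 x := u x - g x.
have au1 : ac u u1.
  have cu1 : continuous u1 by move=> x; apply: cvgB; [exact: cu|exact: cg].
  by apply: ac_ae au (cont_lint cu1) _; apply: aeW => x; rewrite /u1; ring.
have au2 : ac u1 (fun x => u x - (f : L2T s) x).
  apply: ac_ae (acB au1 ag) _ _; first by apply: lintB => //; exact: cont_lint.
  by apply: aeW => x; rewrite /u1; ring.
have h : H2r s u u1 (fun x => u x - (f : L2T s) x).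
  split=> //.
  - exact: L2_circle_cont.
  - by apply: L2_circle_cont; [exact: ac_continuous au2|move=> x; rewrite /u1 pu pg].
  - by apply: L2B hf; exact: L2_circle_cont.
exists (toH2 h); apply/(eqv_aeE (s := s) _ _ L0).
have m1 : mult s (fun=> 1) 1.
  by split; [exact: meas_cst|exact: aeW|apply: aeW => x; rewrite normr1].
by rewrite (AopE m1); apply: aeW => x; rewrite /h2 /h0 /= mul1r; ring.
Qed.

(** The operator is a bounded symmetric perturbation of [- d^2/dx^2 + 1], so the lower bound
    suffices. *)
Lemma circle_solv Q M C : 0 <= M -> mult s Q M -> 0 <= C -> lb i (Aop Q) C -> @solv R S Y (Aop Q).
Proof.
move=> M0 mQ C0 H; have sS := hsip S.
have m1 : mult s (fun=> 1) 1.
  by split; [exact: meas_cst|exact: aeW|apply: aeW => x; rewrite normr1].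
have mQ1 := mult_sub mQ m1.
have E y : Aop Q y = Aop (fun=> 1) y + mulop (fun x => Q x - 1) (i y) :> S.
  apply: L2T_ext; rewrite (AopE mQ); apply/funext => x.
  have -> : forall a b : S, (a + b : L2T s) x = (a : L2T s) x + (b : L2T s) x by [].
  by rewrite (AopE m1) (mulopE _ mQ1) incl_eq; ring.
have c1 : coer i (Aop (fun=> 1)) 1.
  move=> y; rewrite /Aop (sipDl sS) lapl_form// mul1r.
  have -> : mulop (fun=> 1) (i y) = i y :> S.
    by apply: L2T_ext; rewrite (mulopE _ m1); apply/funext => x; rewrite mul1r.
  by rewrite lerDr; exact: ip_ge0.
have M1 : 0 <= M + 1 by rewrite addr_ge0.
have H' : lb i (fun y => Aop (fun=> 1) y + mulop (fun x => Q x - 1) (i y)) C.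
  by move=> y; rewrite -E; exact: H.
have := solv_symmetric (@lin_incl R s) (lin_Aop m1) (lin_mulop mQ1) (sym_Aop (s := s) L0 m1)
  (symb_mulop mQ1) c1 ltr01 solv_identity (bdd_mulop M1 mQ1) M1 H' C0.
by move=> h f; have [y hy] := h f; exists y; rewrite E.
Qed.

End CircleSolver.

(** * From the line to long circles *)

Section Transfer.
Variables (R : realType) (S1 S0 : hspace R) (Y1 Y0 : lmodType R) (i1 : Y1 -> S1) (i0 : Y0 -> S0).
Hypotheses (li0 : lin i0).
Variables (cut1 cut2 : S1 -> S0) (loc1 loc2 : Y1 -> Y0) (D : Y1 -> R).
Variables (L1 : Y1 -> S1) (L0 A0 : Y0 -> S0) (M k : R).
Notation no := (nrm hip).
Notation "u ~~> v" := (eqv hip u v) (at level 70).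
Let s1 := hsip S1.
Let s0 := hsip S0.
Hypotheses (cutE : forall f g, hip (cut1 f) (cut1 g) + hip (cut2 f) (cut2 g) = hip f g)
  (loc1E : forall y, i0 (loc1 y) ~~> cut1 (i1 y)) (loc2E : forall y, i0 (loc2 y) ~~> cut2 (i1 y))
  (D0 : forall y, 0 <= D y)
  (comm1 : forall y, no (L0 (loc1 y) - cut1 (L1 y)) <= k * (no (i1 y) + D y))
  (comm2 : forall y, no (A0 (loc2 y) - cut2 (L1 y)) <= k * (no (i1 y) + D y))
  (DE : forall y, D y ^+ 2 <= hip (L1 y) (i1 y) + M * hip (i1 y) (i1 y))
  (M0 : 0 <= M) (k0 : 0 <= k).

Lemma cut1_le f : no (cut1 f) <= no f.
Proof.
rewrite -ler_sqr ?nnegrE ?nrm_ge0// (nrm_sqr s0) (nrm_sqr s1) -cutE lerDl.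
exact: sipP.
Qed.
Lemma cut2_le f : no (cut2 f) <= no f.
Proof.
rewrite -ler_sqr ?nnegrE ?nrm_ge0// (nrm_sqr s0) (nrm_sqr s1) -cutE lerDr.
exact: sipP.
Qed.
Lemma cut_ge f : no f <= no (cut1 f) + no (cut2 f).
Proof.
have n1 := nrm_ge0 hip (cut1 f); have n2 := nrm_ge0 hip (cut2 f).
rewrite -ler_sqr ?nnegrE ?nrm_ge0 ?addr_ge0// (nrm_sqr s1) -cutE -!(nrm_sqr s0) sqrrD mulr2n.
by have := mulr_ge0 n1 n2; move: (_ * _) => x; lra.
Qed.

Lemma D_le y : D y <= no (L1 y) + (M + 1) * no (i1 y).
Proof.
have n1 := nrm_ge0 hip (L1 y); have n2 := nrm_ge0 hip (i1 y).
have r0 : 0 <= no (L1 y) + (M + 1) * no (i1 y) by rewrite addr_ge0// mulr_ge0// addr_ge0.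
rewrite -(ler_sqr (x := D y)) ?nnegrE//; apply: le_trans (DE y) _.
have := le_trans (ler_norm _) (cs_nrm s1 (L1 y) (i1 y)); rewrite -(nrm_sqr s1).
move: (no (L1 y)) (no (i1 y)) n1 n2 => a b a0 b0 h.
have h1 := mulr_ge0 a0 b0; have h2 := mulr_ge0 M0 h1; have h3 := mulr_ge0 M0 (sqr_ge0 b).
have h4 := mulr_ge0 M0 h3; have h5 := sqr_ge0 a; have h6 := sqr_ge0 b.
have -> : (a + (M + 1) * b) ^+ 2 = a ^+ 2 + 2 * (M * (a * b)) + 2 * (a * b) + M * (M * b ^+ 2) + 2 * (M * b ^+ 2) + b ^+ 2 by ring.
move: (a * b) (M * (a * b)) (M * b ^+ 2) (M * (M * b ^+ 2)) (a ^+ 2) (b ^+ 2) h h1 h2 h3 h4 h5 h6.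
by move=> x1 x2 x3 x4 x5 x6; lra.
Qed.

Lemma comm_le y : no (i1 y) + D y <= no (L1 y) + (M + 2) * no (i1 y).
Proof. by have := D_le y; move: (no (i1 y)) => b; rewrite !mulrDl mul1r; move: (M * b) => c; lra. Qed.

Lemma transfer_lb C : 0 <= C -> lb i0 L0 C -> lb i0 A0 C -> 4 * C * k * (M + 2) <= 1 ->
  lb i1 L1 (4 * C + 1).
Proof.
move=> C0 HL HA small y; set E := no (i1 y) + D y.
have n1 := nrm_ge0 hip (L1 y); have n2 := nrm_ge0 hip (i1 y).
have E0 : 0 <= E by rewrite addr_ge0.
have key cut loc L : (forall y, i0 (loc y) ~~> cut (i1 y)) -> lb i0 L C ->
    no (L (loc y) - cut (L1 y)) <= k * E -> no (cut (L1 y)) <= no (L1 y) ->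
    no (cut (i1 y)) <= C * (no (L1 y) + k * E).
  move=> locE HL' cm cl; rewrite -(eqv_nrm s0 (locE y)); apply: le_trans (HL' _) _.
  rewrite ler_wpM2l//; apply: le_trans (nrm_le_dist s0 _ (cut (L1 y))) _.
  exact: lerD.
have k1 := key cut1 loc1 L0 loc1E HL (comm1 y) (cut1_le _).
have k2 := key cut2 loc2 A0 loc2E HA (comm2 y) (cut2_le _).
have E1 : C * (k * E) <= C * k * (no (L1 y) + (M + 2) * no (i1 y)).
  by rewrite mulrA ler_wpM2l ?mulr_ge0//; exact: comm_le.
have Ck : 0 <= C * k by rewrite mulr_ge0.
have s2 : C * k * (M + 2) <= 1 / 4 by rewrite ler_pdivlMr// mulrC !mulrA.
have s3 : C * k <= 1 / 8.
  have : C * k * 2 <= C * k * (M + 2) by rewrite ler_wpM2l// lerDr.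
  by move: (C * k) s2 => x; move: (x * (M + 2)) => z; lra.
have := cut_ge (i1 y); have h1 := ler_wpM2r n2 s2; have h2 := ler_wpM2r n1 s3.
move: k1 k2 E1.
have -> : C * (no (L1 y) + k * E) = C * no (L1 y) + C * (k * E) by ring.
have -> : C * k * (no (L1 y) + (M + 2) * no (i1 y)) = C * k * no (L1 y) + C * k * (M + 2) * no (i1 y) by ring.
have -> : (4 * C + 1) * no (L1 y) = 4 * (C * no (L1 y)) + no (L1 y) by ring.
move: h1 h2 (mulr_ge0 C0 n1).
move: (C * no (L1 y)) (C * (k * E)) (C * k * no (L1 y)) (C * k * (M + 2) * no (i1 y)).
move: (no (i1 y)) (no (L1 y)) (no (cut1 _)) (no (cut2 _)) n1 n2 => a b c d b0 a0 x1 x2 x3 x4; lra.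
Qed.

(** Orthogonality to [q] becomes near orthogonality of the first piece to [p], because [cut1] of [q]
    is close to [p] and [cut2] of [q] is small; the penalty then costs only [4 K k^2] times the
    squared norm. *)
Lemma transfer_gap (p : Y0) (q : Y1) c K : 0 < c -> 0 <= K ->
  (forall v, c * hip (i0 v) (i0 v) <= hip (L0 v) (i0 v) + K * hip (i0 v) (i0 p) ^+ 2) ->
  (forall v, c * hip (i0 v) (i0 v) <= hip (A0 v) (i0 v)) ->
  no (cut1 (i1 q) - i0 p) <= k -> no (cut2 (i1 q)) <= k ->
  6 * k * (1 + M) + 8 * K * k ^+ 2 <= c -> k <= 1 / 6 -> gap i1 L1 q (c / 4).
Proof.
move=> c0 K0 HL HA h1 h2 small k6 y yq.
set n := no (i1 y); set E := n + D y; set N := hip (i1 y) (i1 y).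
have nE : n ^+ 2 = N by rewrite (nrm_sqr s1).
have n0 : 0 <= n by exact: nrm_ge0.
have N0 : 0 <= N by exact: sipP.
have E0 : 0 <= E by rewrite addr_ge0.
have key cut loc L : (forall y, i0 (loc y) ~~> cut (i1 y)) ->
    no (L (loc y) - cut (L1 y)) <= k * E -> no (cut (i1 y)) <= n ->
    hip (L (loc y)) (i0 (loc y)) - k * E * n <= hip (cut (L1 y)) (cut (i1 y)).
  move=> locE cm cl; rewrite (eqv_ipr s0 _ (locE y)) lerBlDl -lerBlDr -(sipNl s0) -(sipDl s0).
  apply: le_trans (ler_norm _) _; apply: le_trans (cs_nrm s0 _ _) _.
  by apply: ler_pM => //; exact: nrm_ge0.
have k1 := key cut1 loc1 L0 loc1E (comm1 y) (cut1_le _).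
have k2 := key cut2 loc2 A0 loc2E (comm2 y) (cut2_le _).
have sum := cutE (L1 y) (i1 y).
have HL1 := HL (loc1 y); have HA2 := HA (loc2 y).
have NE : hip (i0 (loc1 y)) (i0 (loc1 y)) + hip (i0 (loc2 y)) (i0 (loc2 y)) = N.
  rewrite (eqv_ipl s0 _ (loc1E y)) (eqv_ipr s0 _ (loc1E y)) (eqv_ipl s0 _ (loc2E y)).
  by rewrite (eqv_ipr s0 _ (loc2E y)) cutE.
have ortho : `|hip (i0 (loc1 y)) (i0 p)| <= 2 * k * n.
  have e : hip (i0 (loc1 y)) (i0 p) = - hip (cut1 (i1 y)) (cut1 (i1 q) - i0 p) - hip (cut2 (i1 y)) (cut2 (i1 q)).
    rewrite (eqv_ipl s0 _ (loc1E y)) (sipDr s0) (sipNr s0) opprD opprK.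
    have := cutE (i1 y) (i1 q); rewrite yq => h.
    by move: h; move: (hip _ _) (hip _ _) (hip _ _) => a b d; lra.
  rewrite e; apply: le_trans (ler_normB _ _) _; rewrite normrN.
  have -> : 2 * k * n = n * k + n * k by ring.
  apply: lerD; apply: le_trans (cs_nrm s0 _ _) _; apply: ler_pM => //; try exact: nrm_ge0.
    exact: cut1_le.
  exact: cut2_le.
have ortho2 : hip (i0 (loc1 y)) (i0 p) ^+ 2 <= 4 * k ^+ 2 * N.
  rewrite -nE; have -> : 4 * k ^+ 2 * n ^+ 2 = (2 * k * n) ^+ 2 by ring.
  by rewrite -[leLHS]real_normK ?num_real// ler_sqr ?nnegrE ?mulr_ge0.
have En : k * E * n <= k * (2 * N + D y ^+ 2).
  rewrite -mulrA ler_wpM2l// /E -nE; have := sqr_ge0 (n - D y); rewrite sqrrB mulr2n mulrDl -expr2.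
  by rewrite [D y * n]mulrC; move: (n ^+ 2) (n * D y) (D y ^+ 2) (sqr_ge0 n) (sqr_ge0 (D y)) => a b d a0 d0; lra.
have Dy := ler_wpM2l k0 (DE y); rewrite -/N in Dy.
have KO := ler_wpM2l K0 ortho2.
have small' : (6 * k * (1 + M) + 8 * K * k ^+ 2) * N <= c * N by rewrite ler_wpM2r.
have kq : 0 <= hip (L1 y) (i1 y) \/ hip (L1 y) (i1 y) < 0.
  by case: (leP 0 (hip (L1 y) (i1 y))); [left|right].
have cN : c * N = c * hip (i0 (loc1 y)) (i0 (loc1 y)) + c * hip (i0 (loc2 y)) (i0 (loc2 y)) by rewrite -NE mulrDr.
rewrite -/N.
have X0 : 0 <= K * (4 * k ^+ 2 * N) by rewrite !mulr_ge0// sqr_ge0.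
have kN : 0 <= k * N by rewrite mulr_ge0.
have kMN : 0 <= k * (M * N) by rewrite !mulr_ge0.
have -> : c / 4 * N = (c * N) / 4 by rewrite mulrAC.
move: small' KO; rewrite mulrDl.
have -> : 6 * k * (1 + M) * N = 6 * (k * N) + 6 * (k * (M * N)) by ring.
have -> : 8 * K * k ^+ 2 * N = 2 * (K * (4 * k ^+ 2 * N)) by ring.
move: Dy En; rewrite (mulrDr k (hip _ _)) (mulrDr k (2 * _)) (mulrCA k 2).
have kl : k * hip (L1 y) (i1 y) <= `|hip (L1 y) (i1 y)| / 6.
  apply: le_trans (ler_wpM2l k0 (ler_norm _)) _.
  by rewrite mulrC ler_wpM2l//; move: k6; rewrite mul1r.
move: kl; case: kq => hq; [rewrite ger0_norm//|rewrite ltr0_norm//].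
all: move: HL1 HA2 k1 k2 sum cN hq kN kMN X0; move: (hip (cut1 _) _) (hip (cut2 _) _) (hip (L0 _) _) (hip (A0 _) _) (hip (L1 y) _) => z1 z2 z3 z4 z5;
  move: (k * z5) (k * D y ^+ 2) (k * E * n) (K * (4 * k ^+ 2 * N)) (K * _ ^+ 2) (k * N) (k * (M * N)) (c * N) (c * hip _ _) (c * hip _ _) => t1 t2 t3 t4 t5 t6 t7 t8 t9 t10; lra.
Qed.

(** [phi] solves the same linear equation as [e] up to errors of size [k], so by the lower bound of
    [L0] its localized piece is close to [e], while the far piece of [q] contributes little. *)
Lemma transfer_slope (p e : Y0) (q phi : Y1) C C1 B : 0 <= C -> 0 <= B ->
  lin L0 -> lb i0 L0 C -> L0 e ~~> - i0 p -> L1 phi ~~> - i1 q ->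
  no (i1 phi) <= C1 -> no (i1 q) <= B ->
  (forall f, cut1 (- f) ~~> - cut1 f) -> (forall f g, f ~~> g -> cut1 f ~~> cut1 g) ->
  no (cut1 (i1 q) - i0 p) <= k -> no (cut2 (i1 q)) <= k ->
  `|hip (i1 phi) (i1 q) - hip (i0 e) (i0 p)| <=
    k * (C * (1 + (B + (M + 2) * C1)) * B + no (i0 e) + C1).
Proof.
move=> C0 B0 lL HL He Hphi C1b Bb cutN cutv h1 h2.
have C10 : 0 <= C1 by apply: le_trans C1b; exact: nrm_ge0.
have n1 := eqv_nrm s1 Hphi; rewrite (nrmN s1) in n1.
have d1 : no (L0 (loc1 phi - e)) <= k * (1 + (B + (M + 2) * C1)).
  rewrite (linB lL).
  have c1 : cut1 (L1 phi) ~~> - cut1 (i1 q) := eqv_trans s0 (cutv _ _ Hphi) (cutN _).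
  have E : L0 (loc1 phi) - L0 e ~~> (L0 (loc1 phi) - cut1 (L1 phi)) - (cut1 (i1 q) - i0 p).
    have -> : L0 (loc1 phi) - L0 e = (L0 (loc1 phi) - cut1 (L1 phi)) - (L0 e - cut1 (L1 phi)).
      by rewrite opprB addrA subrK.
    apply: (eqvB s0); first exact: eqv_refl.
    rewrite [X in eqv _ _ X]addrC; apply: (eqvD s0) => //.
    by rewrite -[X in eqv _ _ X]opprK; exact: eqvN.
  rewrite (eqv_nrm s0 E); apply: le_trans (nrmB s0 _ _) _; rewrite mulrDr mulr1 addrC; apply: lerD => //.
  apply: le_trans (comm1 phi) _; rewrite ler_wpM2l//; apply: le_trans (comm_le phi) _.
  by rewrite n1; apply: lerD => //; rewrite ler_wpM2l// addr_ge0.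
have d2 : no (cut1 (i1 phi) - i0 e) <= k * (C * (1 + (B + (M + 2) * C1))).
  rewrite -(eqv_nrm s0 (eqvB s0 (loc1E phi) (eqv_refl s0 (i0 e)))) -(linB li0).
  by apply: le_trans (HL _) _; rewrite mulrCA ler_wpM2l.
have -> : hip (i1 phi) (i1 q) - hip (i0 e) (i0 p) = hip (cut1 (i1 phi) - i0 e) (cut1 (i1 q)) +
    hip (i0 e) (cut1 (i1 q) - i0 p) + hip (cut2 (i1 phi)) (cut2 (i1 q)).
  by rewrite -cutE !(sipDl s0) !(sipDr s0) !(sipNl s0) !(sipNr s0); ring.
apply: le_trans (ler_normD _ _) _; rewrite mulrDr; apply: lerD.
  apply: le_trans (ler_normD _ _) _; rewrite mulrDr; apply: lerD.
    apply: le_trans (cs_nrm s0 _ _) _; rewrite mulrA; apply: ler_pM; try exact: nrm_ge0.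
      exact: d2.
    by apply: le_trans (cut1_le _) _.
  by apply: le_trans (cs_nrm s0 _ _) _; rewrite mulrC ler_wpM2r// nrm_ge0.
apply: le_trans (cs_nrm s0 _ _) _; rewrite mulrC; apply: ler_pM; try exact: nrm_ge0; first by [].
by apply: le_trans (cut2_le _) _.
Qed.

End Transfer.

(** * Opening a circle into the line *)

Section Window.
Variable R : realType.
Notation leb := (@lebesgue_measure R).
Implicit Types (f g F G : R -> R) (a b x y : R).

Definition win a b f x : R := f x * (a <= x <= b)%R%:R.

Lemma win_patch a b f : win a b f = f \_ `[a, b]%classic.
Proof.
apply/funext => x; rewrite patchE /win; case: ifPn => [|/negP]; rewrite inE /= in_itv/=.
  by move=> ->; rewrite mulr1.
by move=> /negP/negbTE ->; rewrite mulr0.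
Qed.

Lemma meas_win a b f : meas f -> meas (win a b f).
Proof.
move=> mf; apply: measM => //.
have -> : (fun x : R => (a <= x <= b)%R%:R : R) = \1_`[a, b].
  by apply/funext => x; rewrite indicE mem_setE in_itv.
by apply: measurable_indic; exact: measurable_cc.
Qed.

Lemma win_out a b f x : ~~ (a <= x <= b) -> win a b f x = 0.
Proof. by rewrite /win => /negbTE ->; rewrite mulr0. Qed.
Lemma win_in a b f x : a <= x <= b -> win a b f x = f x.
Proof. by rewrite /win => ->; rewrite mulr1. Qed.

Lemma int_win a b f : \int[leb]_x win a b f x = \int[leb]_(x in `[a, b]) f x.
Proof. by rewrite win_patch [RHS]Rintegral_mkcond. Qed.

Lemma integ_win a b f : lint f -> integ Line (win a b f).
Proof.
move=> lf; have := lf.2 a b; rewrite integrable_mkcond; last exact: measurable_cc.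
rewrite win_patch; congr (leb.-integrable _ _); apply/funext => x.
by rewrite patchE /= patchE; case: ifP.
Qed.

Lemma int_win_cc a b f x y : a <= b -> x <= y -> \int[leb]_(t in `[x, y]) win a b f t =
  if (y < a) || (b < x) then 0 else \int[leb]_(t in `[Num.max x a, Num.min y b]) f t.
Proof.
move=> ab xy; rewrite win_patch -Rintegral_mkcondr.
case: ifPn => h.
  have -> : `[x, y]%classic `&` `[a, b]%classic = set0.
    apply/seteqP; split => t //=; rewrite !in_itv/= => -[/andP[t1 t2] /andP[t3 t4]].
    by case/orP: h => h; lra.
  by rewrite Rintegral_set0.
congr (Rintegral _ _ _); apply/seteqP; split => t /=; rewrite !in_itv/= ge_max le_min.
  by move=> [/andP[-> ->] /andP[-> ->]].
by move=> /andP[/andP[-> ->] /andP[-> ->]].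
Qed.

Lemma ac_win a b F f : a <= b -> ac F f -> F a = 0 -> F b = 0 -> ac (win a b F) (win a b f).
Proof.
move=> ab aF Fa Fb; split; first exact/integ_lint/integ_win/ac_lint/aF.
move=> x y xy; rewrite int_win_cc//; case: ifPn => [h|].
  by rewrite !win_out ?subrr//; case/orP: h => h; apply/negP => /andP[]; lra.
rewrite negb_or -!leNgt => /andP[ay xb].
have mm : Num.max x a <= Num.min y b by rewrite ge_max !le_min xy ay xb ab.
rewrite -(aF.2 _ _ mm); congr (_ - _).
  case: (leP y b) => h; first by rewrite win_in// ay h.
  by rewrite Fb win_out// ay -ltNge.
case: (leP a x) => h; first by rewrite win_in// h xb.
by rewrite Fa win_out// xb andbT -ltNge.
Qed.

Lemma L2_lint_sq L f : 0 < L -> L2 (Circle L) f -> lint (fun x => f x ^+ 2).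
Proof.
move=> L0 /L2P[mf pf sf]; apply: (period_integrable _ L0 _ sf); first exact: measX.
by apply: aeS pf => x ->.
Qed.

Lemma L2_lint_mul L f g : 0 < L -> L2 (Circle L) f -> L2 (Circle L) g -> lint (fun x => f x * g x).
Proof.
move=> L0 hf hg; have := L2_mul hf hg; case/L2P: hf => mf pf _; case/L2P: hg => mg pg _ h.
apply: (period_integrable _ L0 _ h); first exact: measM.
exact: (ae_periodicM (s := Circle L) pf pg).
Qed.

Lemma win_mul a b f g x : win a b f x * win a b g x = win a b (fun t => f t * g t) x.
Proof. by rewrite /win; case: (_ <= _ <= _); rewrite ?mulr1// !mulr0. Qed.

Lemma L2_win L a b f : 0 < L -> L2 (Circle L) f -> L2 Line (win a b f).
Proof.
move=> L0 hf; apply/L2P; split=> //; first exact: meas_win (L2_meas hf).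
have := integ_win a b (L2_lint_sq L0 hf); congr (leb.-integrable _ _).
by apply/funext => x /=; rewrite expr2 win_mul.
Qed.

(** Any window of one period gives the same inner product, so the two cut-offs may open the circle
    at different points. *)
Lemma ip_win L a f g : 0 < L -> L2 (Circle L) f -> L2 (Circle L) g ->
  L2inner Line (win a (a + L) f) (win a (a + L) g) = L2inner (Circle L) f g.
Proof.
move=> L0 hf hg; have lfg := L2_lint_mul L0 hf hg.
have -> : L2inner Line (win a (a + L) f) (win a (a + L) g) =
    \int[leb]_x win a (a + L) (fun t => f t * g t) x.
  by apply: eq_Rintegral => x _; exact: win_mul.
rewrite int_win int_period ?(ltW L0)//.
case/L2P: hf => mf pf _; case/L2P: hg => mg pg _.
exact: (ae_periodicM (s := Circle L) pf pg).
Qed.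

End Window.

Section Cutoff.
Variables (R : realType) (L al kap : R) (w w1 w2 : R -> R).
Notation leb := (@lebesgue_measure R).
Notation C := (Circle L).
Notation Sc := (L2h C).
Notation Sl := (L2h (Line : domain R)).
Notation Yc := (H2T C).
Notation Yl := (H2T (Line : domain R)).
Notation no := (nrm hip).
Notation "u ~~> v" := (eqv hip u v) (at level 70).
Notation W := (win al (al + L)).
Hypotheses (L0 : 0 < L) (dw : forall x : R, is_derive x 1 w (w1 x)) (dw1 : forall x : R, is_derive x 1 w1 (w2 x))
  (cw2 : continuous w2) (pw : forall x, w (x + L) = w x) (pw1 : forall x, w1 (x + L) = w1 x)
  (pw2 : forall x, w2 (x + L) = w2 x) (bw : forall x, `|w x| <= 1) (bw1 : forall x, `|w1 x| <= kap)
  (bw2 : forall x, `|w2 x| <= kap) (zw : w al = 0) (zw1 : w1 al = 0).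
Let dc : dpos C := L0.
Let dl : dpos (Line : domain R) := I.
Let sl := hsip Sl.
Let sc := hsip Sc.

Let acw1 : ac w1 w2 := ac_C1 dw1 cw2.
Let cw1 : continuous w1 := ac_continuous acw1.
Let acw : ac w w1 := ac_C1 dw cw1.
Let cw : continuous w := ac_continuous acw.

Let mult_cont v k : continuous v -> (forall x, v (x + L) = v x) -> (forall x, `|v x| <= k) -> mult C v k.
Proof. by move=> cv pv bv; split; [exact: cont_meas|exact: aeW|exact: aeW]. Qed.
Let mw : mult C w 1 := mult_cont cw pw bw.
Let mw1 : mult C w1 kap := mult_cont cw1 pw1 bw1.
Let mw2 : mult C w2 kap := mult_cont cw2 pw2 bw2.
Let kap0 : 0 <= kap. Proof. exact: le_trans (normr_ge0 _) (bw1 0). Qed.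

(** The circle is opened at [al], where [w] and its derivative vanish, so that extension by zero
    maps H^2 of the circle into H^2 of the line. *)
Definition cut (f : Sc) : Sl := toL2 Line (W (fun x => w x * (f : L2T C) x)).

Let L2w f : L2 C f -> L2 C (fun x => w x * f x). Proof. exact: mult_L2 mw. Qed.

Lemma cut_val f : (cut f : L2T Line) = W (fun x => w x * (f : L2T C) x) :> (R -> R).
Proof. by rewrite toL2E//; apply: (L2_win (L := L)) => //; apply: L2w; exact: L2TP. Qed.

Lemma cut_ip f g : hip (cut f) (cut g) =
  L2inner C (fun x => w x * (f : L2T C) x) (fun x => w x * (g : L2T C) x).
Proof.
rewrite [LHS]/(L2inner Line (cut f : L2T Line) (cut g : L2T Line)) !cut_val.
by apply: ip_win => //; apply: L2w; exact: L2TP.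
Qed.

Lemma cut_eqv f g : f ~~> g -> cut f ~~> cut g.
Proof.
move=> /(eqv_aeE _ _ dc) e; apply/(eqv_aeE _ _ dl); rewrite !cut_val.
by apply: aeS e => x ex; rewrite /win ex.
Qed.

Lemma cutN f : cut (- f) ~~> - cut f.
Proof.
apply/(eqv_aeE _ _ dl); apply: aeW => x.
have -> : (- cut f : L2T Line) x = - (cut f : L2T Line) x by [].
by rewrite !cut_val /win; have -> : (- f : L2T C) x = - (f : L2T C) x by []; rewrite mulrN mulNr.
Qed.

Let H2r_cut (y : Yc) : H2r Line (W (fun x => w x * h0 y x)) (W (fun x => w1 x * h0 y x + w x * h1 y x))
  (W (fun x => (w2 x * h0 y x + w1 x * h1 y x) + (w1 x * h1 y x + w x * h2 y x))).
Proof.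
have [a0 a1 l0 l1 l2] := H2TP y.
have aL : al <= al + L by rewrite lerDl ltW.
have e1 := acM acw a0; have e2 := acD (acM acw1 a0) (acM acw a1).
have zwL : w (al + L) = 0 by rewrite pw zw.
have zw1L : w1 (al + L) = 0 by rewrite pw1 zw1.
split.
- by apply: ac_win => //; rewrite ?zw ?zwL mul0r.
- by apply: ac_win => //; rewrite ?zw ?zwL ?zw1 ?zw1L !mul0r addr0.
- by apply: (L2_win (L := L)) => //; exact: mult_L2 mw l0.
- by apply: (L2_win (L := L)) => //; apply: L2D; [exact: mult_L2 mw1 l0|exact: mult_L2 mw l1].
- apply: (L2_win (L := L)) => //; apply: L2D; apply: L2D;
  [exact: mult_L2 mw2 l0|exact: mult_L2 mw1 l1|exact: mult_L2 mw1 l1|exact: mult_L2 mw l2].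
Qed.

Definition loc (y : Yc) : Yl := toH2 (H2r_cut y).

Lemma loc_incl y : incl (loc y) ~~> cut (incl y).
Proof. by apply/(eqv_aeE _ _ dl); rewrite cut_val !incl_eq; apply: aeW. Qed.

Definition slope_nrm (y : Yc) : R := no (toL2 C (h1 y) : Sc).

Lemma slope_nrm_sqr y : slope_nrm y ^+ 2 = nsq C (h1 y).
Proof.
rewrite /slope_nrm (nrm_sqr sc) [LHS]/(L2inner C _ _) toL2E//.
by case: (H2TP y).
Qed.

(** The error is the commutator [w'' y + 2 w' y'] together with the mismatch of the potentials on
    the support of [w]. *)
Lemma loc_comm Q Qp MQ Mp del k y : mult Line Q MQ -> mult C Qp Mp -> 0 <= del ->
  {ae leb, forall x, al <= x <= al + L -> `|(Q x - Qp x) * w x| <= del} ->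
  2 * kap <= k -> kap + del <= k ->
  no (Aop Q (loc y) - cut (Aop Qp y)) <= k * (no (incl y) + slope_nrm y).
Proof.
move=> mQ mQp d0 bd k1 k2; have [a0 a1 l0 l1 l2] := H2TP y.
pose r := W (fun x => (Q x - Qp x) * w x).
have mr : mult Line r del.
  case: mQ => mq _ _; case: mQp => mqp _ _; split=> //.
    by apply: meas_win; apply: measM; [exact: measB|exact: cont_meas].
  by apply: aeS bd => x; rewrite /r /win; case: (_ <= _ <= _) => h; rewrite ?mulr1 ?mulr0 ?normr0//; exact: h.
have lW : L2 Line (W (h0 y)) by exact: (L2_win (L := L)).
have lG : L2 C (fun x => w2 x * h0 y x + 2 * (w1 x * h1 y x)).
  by apply: L2D; [exact: mult_L2 mw2 l0|apply: L2Z; exact: mult_L2 mw1 l1].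
have lWG : L2 Line (W (fun x => w2 x * h0 y x + 2 * (w1 x * h1 y x))) by exact: (L2_win (L := L)).
have E : Aop Q (loc y) - cut (Aop Qp y) =
    mulop r (toL2 Line (W (h0 y))) - toL2 Line (W (fun x => w2 x * h0 y x + 2 * (w1 x * h1 y x))) :> Sl.
  apply: L2T_ext; apply/funext => x.
  have sub (a b : Sl) : (a - b : L2T Line) x = (a : L2T Line) x - (b : L2T Line) x by [].
  rewrite !sub (AopE mQ) cut_val (mulopE _ mr) !toL2E// (AopE mQp) /loc /h0 /h2 /= -/(h0 y) -/(h1 y) -/(h2 y).
  by rewrite /r /win; case: (_ <= _ <= _); rewrite ?mulr1 ?mulr0; ring.
rewrite E; apply: le_trans (nrmB sl _ _) _.
have n1 : no (mulop r (toL2 Line (W (h0 y)))) <= del * no (incl y).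
  apply: le_trans (bdd_mulop d0 mr _) _; rewrite ler_wpM2l// /nrm ler_wsqrtr//.
  have -> : hip (toL2 Line (W (h0 y)) : Sl) (toL2 Line (W (h0 y)) : Sl) = L2inner C (h0 y) (h0 y).
    rewrite [LHS]/(L2inner Line (toL2 Line (W (h0 y)) : L2T Line) (toL2 Line (W (h0 y)) : L2T Line)) toL2E//.
    exact: ip_win.
  by rewrite [leRHS]/(L2inner C _ _) incl_eq.
have n2 : no (toL2 Line (W (fun x => w2 x * h0 y x + 2 * (w1 x * h1 y x))) : Sl) <=
    kap * no (incl y) + 2 * kap * slope_nrm y.
  have -> : no (toL2 Line (W (fun x => w2 x * h0 y x + 2 * (w1 x * h1 y x))) : Sl) =
      no (mulop w2 (incl y) + 2 *: mulop w1 (toL2 C (h1 y) : Sc)).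
    congr Num.sqrt; set G := W _.
    transitivity (L2inner Line G G); first by rewrite [LHS]/(L2inner Line (toL2 Line G : L2T Line) (toL2 Line G : L2T Line)) toL2E.
    rewrite /G ip_win//.
    set H := mulop w2 _ + _; rewrite [RHS]/(L2inner C (H : L2T C) (H : L2T C)).
    suff -> : (H : L2T C) = (fun x => w2 x * h0 y x + 2 * (w1 x * h1 y x)) :> (R -> R) by [].
    apply/funext => x; rewrite /H.
    have add (a b : Sc) : (a + 2 *: b : L2T C) x = (a : L2T C) x + 2 * (b : L2T C) x by [].
    by rewrite add (mulopE _ mw2) (mulopE _ mw1) incl_eq toL2E.
  apply: le_trans (nrmD sc _ _) _; rewrite (nrmZ sc) ger0_norm// -mulrA.
  by apply: lerD; [exact: (bdd_mulop kap0 mw2)|rewrite ler_wpM2l//; exact: (bdd_mulop kap0 mw1)].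
apply: le_trans (lerD n1 n2) _.
have := ler_wpM2r (nrm_ge0 hip (incl y)) k2; have := ler_wpM2r (nrm_ge0 hip (toL2 C (h1 y) : Sc)) k1.
rewrite -/(slope_nrm y) (mulrDr k) (mulrDl kap).
by move: (kap * _) (del * _) (k * _) (k * _) (2 * kap * _) => t1 t2 t3 t4 t5; lra.
Qed.

End Cutoff.

(** * The partition of unity on a circle *)

Section CutoffPair.
Variable R : realType.

Definition cutoff_fn (L al kap : R) (w w1 w2 : R -> R) :=
  [/\ (forall x : R, is_derive x 1 w (w1 x)) /\ (forall x : R, is_derive x 1 w1 (w2 x)),
      continuous w2,
      [/\ forall x, w (x + L) = w x, forall x, w1 (x + L) = w1 x & forall x, w2 (x + L) = w2 x],
      [/\ forall x, `|w x| <= 1, forall x, `|w1 x| <= kap & forall x, `|w2 x| <= kap] &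
      w al = 0 /\ w1 al = 0].

(** For the phase [t = pi / 2 * sin^2 (pi x / L)] the summands come from bounds on [t'], [t'^2] and
    [t''], in this order, each at most the summand divided by [L] when [L >= 1]. *)
Definition cutoff_cst : R := pi ^+ 2 + (pi ^+ 4 + 2 * pi ^+ 3).

Lemma cutoff_cst_ge0 : 0 <= cutoff_cst.
Proof. by rewrite /cutoff_cst !addr_ge0 ?mulr_ge0 ?exprn_ge0 ?pi_ge0. Qed.

(** The pair is [cos t] and [sin t]. The phase [t] is 0 at the pulse, [pi / 2] at the antipode, and
    stationary at both, so each function vanishes with its derivative at the point where its circle
    is opened. *)
Lemma cutoff_pair (L : R) : 1 <= L -> exists u u1 u2 v v1 v2,
  [/\ cutoff_fn L (- (L / 2)) (cutoff_cst / L) u u1 u2, cutoff_fn L 0 (cutoff_cst / L) v v1 v2,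
      forall x, u x ^+ 2 + v x ^+ 2 = 1, u 0 = 1 & v 0 = 0].
Proof.
move=> L1; have L0 : 0 < L by exact: lt_le_trans L1.
have [b [b0 bL bE]] : exists b : R, [/\ 0 <= b, b * L = pi & b = pi / L].
  by exists (pi / L); rewrite divr_ge0 ?pi_ge0 ?ltW// divfK// gt_eqF.
pose S x := sin (b * x); pose C x := cos (b * x).
have dlin (f df : R -> R) : (forall x : R, is_derive x 1 f (df x)) ->
    forall x : R, is_derive x 1 (fun x => f (b * x)) (df (b * x) * b).
  move=> hf x; have h := is_derive_affine b 0 x.
  have -> : (fun x => f (b * x)) = f \o (fun x => b * x + 0) by apply/funext => t; rewrite /= addr0.
  by have := @is_derive1_comp R f (fun x => b * x + 0) x _ _ _ h; rewrite addr0; apply.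
have dS : forall x : R, is_derive x 1 S (C x * b) by apply: (dlin sin cos) => y; exact: is_derive_sin.
have dC : forall x : R, is_derive x 1 C (- S x * b) by apply: (dlin cos (fun y => - sin y)) => y; exact: is_derive_cos.
have cS : continuous S by move=> x; apply/differentiable_continuous/derivable1_diffP; case: (dS x).
have cC : continuous C by move=> x; apply/differentiable_continuous/derivable1_diffP; case: (dC x).
have SC x : C x ^+ 2 + S x ^+ 2 = 1 by exact: cos2Dsin2.
have S1 x : `|S x| <= 1 by exact: sin_max.
have C1 x : `|C x| <= 1 by exact: cos_max.
have pS x : S (x + L) = - S x by rewrite /S mulrDr bL sinDpi.
have pC x : C (x + L) = - C x by rewrite /C mulrDr bL cosDpi.
have dM (f df g dg : R -> R) : (forall x : R, is_derive x 1 f (df x)) -> (forall x : R, is_derive x 1 g (dg x)) ->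
    forall x : R, is_derive x 1 (fun x => f x * g x) (f x * dg x + g x * df x).
  by move=> hf hg x; exact: (is_deriveM (hf x) (hg x)).
have dZ k (f df : R -> R) : (forall x : R, is_derive x 1 f (df x)) -> forall x : R, is_derive x 1 (fun x => k * f x) (k * df x).
  by move=> hf x; exact: (is_deriveZ k (hf x)).
have dD (f df g dg : R -> R) : (forall x : R, is_derive x 1 f (df x)) -> (forall x : R, is_derive x 1 g (dg x)) ->
    forall x : R, is_derive x 1 (fun x => f x + g x) (df x + dg x).
  by move=> hf hg x; exact: (is_deriveD (hf x) (hg x)).
have dext (f df df' : R -> R) : (forall x : R, is_derive x 1 f (df x)) -> (forall x, df x = df' x) -> forall x : R, is_derive x 1 f (df' x).
  by move=> h e x; rewrite -e.
pose t x := pi / 2 * (S x * S x); pose t1 x := pi * b * (S x * C x); pose t2 x := pi * b ^+ 2 * (C x ^+ 2 - S x ^+ 2).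
have dt : forall x : R, is_derive x 1 t (t1 x).
  by apply: (dext _ _ _ (dZ (pi / 2) _ _ (dM _ _ _ _ dS dS))) => x; rewrite /t1; field.
have dt1 : forall x : R, is_derive x 1 t1 (t2 x).
  by apply: (dext _ _ _ (dZ (pi * b) _ _ (dM _ _ _ _ dS dC))) => x; rewrite /t2; ring.
have comp (f df : R -> R) : (forall x : R, is_derive x 1 f (df x)) ->
    forall x : R, is_derive x 1 (fun x => f (t x)) (df (t x) * t1 x).
  by move=> hf x; exact: (@is_derive1_comp R f t x _ _ (hf (t x)) (dt x)).
have ds := comp _ _ (@is_derive_sin R).
have dc := comp _ _ (@is_derive_cos R).
have du1 : forall x : R, is_derive x 1 (fun x => - sin (t x) * t1 x) (- cos (t x) * t1 x ^+ 2 - sin (t x) * t2 x).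
  have dN : forall x : R, is_derive x 1 (fun x => - sin (t x)) (- (cos (t x) * t1 x)).
    by move=> x; exact: (is_deriveN (ds x)).
  by apply: (dext _ _ _ (dM _ _ _ _ dN dt1)) => x; ring.
have dv1 : forall x : R, is_derive x 1 (fun x => cos (t x) * t1 x) (- sin (t x) * t1 x ^+ 2 + cos (t x) * t2 x).
  by apply: (dext _ _ _ (dM _ _ _ _ dc dt1)) => x; ring.
have ct : continuous t by move=> x; apply/differentiable_continuous/derivable1_diffP; case: (dt x).
have ct1 : continuous t1 by move=> x; apply/differentiable_continuous/derivable1_diffP; case: (dt1 x).
have sqE (f : R -> R) : (fun x => f x ^+ 2) = (fun x => f x * f x) by apply/funext => x; rewrite expr2.
have cM (f g : R -> R) : continuous f -> continuous g -> continuous (fun x => f x * g x).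
  by move=> cf cg x; apply: cvgM; [exact: cf|exact: cg].
have ct2 : continuous t2.
  move=> x; apply: cvgM; first exact: cvg_cst.
  by apply: cvgB; rewrite (sqE S, sqE C); apply: cM.
have cst : continuous (fun x => sin (t x)) by move=> x; apply: (@continuous_comp _ _ _ t sin); [exact: ct|exact: continuous_sin].
have cct : continuous (fun x => cos (t x)) by move=> x; apply: (@continuous_comp _ _ _ t cos); [exact: ct|exact: continuous_cos].
have ct12 : continuous (fun x => t1 x ^+ 2) by rewrite sqE; exact: cM.
have pt x : t (x + L) = t x by rewrite /t pS mulrNN.
have pt1 x : t1 (x + L) = t1 x by rewrite /t1 pS pC mulrNN.
have pt2 x : t2 (x + L) = t2 x by rewrite /t2 pS pC !sqrrN.
have prod1 (c e k : R) : `|c| <= 1 -> `|e| <= k -> `|c * e| <= k.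
  by move=> hc he; rewrite normrM; apply: le_trans he; rewrite ler_piMl.
have bt1 x : `|t1 x| <= pi * b.
  have pb0 : 0 <= pi * b by rewrite mulr_ge0 ?pi_ge0.
  rewrite /t1 mulrC; apply: (prod1); last by rewrite (ger0_norm pb0).
  by apply: prod1.
have bt2 x : `|t2 x| <= 2 * pi * b ^+ 2.
  have pb0 : 0 <= pi * b ^+ 2 by rewrite mulr_ge0 ?pi_ge0 ?exprn_ge0.
  apply: (@le_trans _ _ (pi * b ^+ 2)); last by rewrite -mulrA; lra.
  rewrite /t2 mulrC; apply: (prod1); last by rewrite (ger0_norm pb0).
  by have := SC x; have := sqr_ge0 (C x); have := sqr_ge0 (S x); rewrite ler_norml; lra.
have b2L : b ^+ 2 <= pi ^+ 2 / L.
  rewrite bE expr_div_n ler_wpM2l ?exprn_ge0 ?pi_ge0// lef_pV2 ?posrE ?exprn_gt0//.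
  by rewrite expr2 ler_peMr// ltW.
have k1 : pi * b <= cutoff_cst / L.
  rewrite bE mulrA ler_wpM2r ?invr_ge0 ?(ltW L0)// /cutoff_cst -expr2 lerDl.
  by rewrite addr_ge0 ?mulr_ge0 ?exprn_ge0 ?pi_ge0.
have k2 : pi ^+ 2 * b ^+ 2 + 2 * pi * b ^+ 2 <= cutoff_cst / L.
  rewrite -mulrDl; apply: (@le_trans _ _ ((pi ^+ 2 + 2 * pi) * (pi ^+ 2 / L))).
    by rewrite ler_wpM2l// addr_ge0 ?mulr_ge0 ?exprn_ge0 ?pi_ge0.
  rewrite mulrA ler_wpM2r ?invr_ge0 ?(ltW L0)// /cutoff_cst mulrDl -exprD -mulrA -exprS lerDr.
  by rewrite exprn_ge0 ?pi_ge0.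
have bt12 x : `|t1 x ^+ 2| <= pi ^+ 2 * b ^+ 2.
  by rewrite -exprMn normrX ler_sqr ?nnegrE ?mulr_ge0 ?pi_ge0.
have S0 : S 0 = 0 by rewrite /S mulr0 sin0.
have half : b * (- (L / 2)) = - (pi / 2) by rewrite mulrN mulrA bL.
have Sh : S (- (L / 2)) = - 1 by rewrite /S half sinN sin_pihalf.
have Ch : C (- (L / 2)) = 0 by rewrite /C half cosN cos_pihalf.
exists (fun x => cos (t x)), (fun x => - sin (t x) * t1 x), (fun x => - cos (t x) * t1 x ^+ 2 - sin (t x) * t2 x).
exists (fun x => sin (t x)), (fun x => cos (t x) * t1 x), (fun x => - sin (t x) * t1 x ^+ 2 + cos (t x) * t2 x).
split.
- split=> //.
  + move=> x; apply: cvgB; apply: cvgM; [apply: cvgN; exact: cct|exact: ct12|exact: cst|exact: ct2].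
  + by split=> x; rewrite ?pt ?pt1 ?pt2.
  + split=> x; first exact: cos_max.
      by apply: le_trans k1; apply: prod1 => //; rewrite normrN; exact: sin_max.
    apply: le_trans k2; apply: le_trans (ler_normB _ _) _; apply: lerD; apply: prod1 => //;
      rewrite ?normrN; [exact: cos_max|exact: sin_max].
  + by rewrite /t1 Ch !mulr0 /t Sh mulrNN mulr1 mulr1 cos_pihalf.
- split=> //.
  + move=> x; apply: cvgD; apply: cvgM; [apply: cvgN; exact: cst|exact: ct12|exact: cct|exact: ct2].
  + by split=> x; rewrite ?pt ?pt1 ?pt2.
  + split=> x; first exact: sin_max.
      by apply: le_trans k1; apply: prod1 => //; exact: cos_max.
    apply: le_trans k2; apply: le_trans (ler_normD _ _) _; apply: lerD; apply: prod1 => //;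
      rewrite ?normrN; [exact: sin_max|exact: cos_max].
  + by rewrite /t1 S0 mul0r !mulr0 /t S0 !mulr0 sin0.
- by move=> x; exact: cos2Dsin2.
- by rewrite /t S0 !mulr0 cos0.
- by rewrite /t S0 !mulr0 sin0.
Qed.

Lemma cutoff_lipschitz (L al kap : R) w w1 w2 x : cutoff_fn L al kap w w1 w2 -> `|w x - w 0| <= kap * `|x|.
Proof.
move=> [[dw dw1] cw2 _ [_ bw1 _] _].
have cw1 := ac_continuous (ac_C1 dw1 cw2); have aw := ac_C1 dw cw1.
have key a b : a <= b -> `|w b - w a| <= kap * (b - a).
  move=> ab; apply: le_trans (ac_norm_le aw (a := a) (b := b) (x := b) _) _; first by rewrite ab lexx.
  rewrite -int_cst//; apply: le_int => //; first exact/lint_norm/cont_lint.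
  by apply: cont_lint; exact: cst_continuous.
case: (leP 0 x) => [h|/ltW h]; first by have := key _ _ h; rewrite subr0 (ger0_norm h).
by rewrite distrC; have := key _ _ h; rewrite sub0r (ler0_norm h).
Qed.

End CutoffPair.

(** * The periodic pulse compared with the pulse on the line *)

Section PulseLocalization.
Variables (R : realType) (L : R) (L1 : 1 <= L).
Notation leb := (@lebesgue_measure R).
Notation C := (Circle L).
Notation Ln := (Line : domain R).
Notation Sc := (L2h C).
Notation Sl := (L2h Ln).
Notation Yc := (H2T C).
Notation Yl := (H2T Ln).
Notation no := (nrm hip).
Notation "u ~~> v" := (eqv hip u v) (at level 70).
Notation "f =ae g" := {ae leb, forall x, f x = g x} (at level 70).
Let L0 : 0 < L := lt_le_trans ltr01 L1.
Let sl := hsip Sl.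
Let sc := hsip Sc.

Lemma cutoff_val al be kap w w1 w2 (f : Sc) : cutoff_fn L al kap w w1 w2 ->
  (cut be w f : L2T Ln) = win be (be + L) (fun x => w x * (f : L2T C) x) :> (R -> R).
Proof. by move=> [[d1 d2] c [p _ _] [b _ _] _]; exact: (cut_val be L0 d1 d2 c p b). Qed.

Lemma cutoff_ip al be kap w w1 w2 (f g : Sc) : cutoff_fn L al kap w w1 w2 ->
  hip (cut be w f) (cut be w g) =
  L2inner C (fun x => w x * (f : L2T C) x) (fun x => w x * (g : L2T C) x).
Proof. by move=> [[d1 d2] c [p _ _] [b _ _] _]; exact: (cut_ip be L0 d1 d2 c p b). Qed.

Lemma cutoff_mult al kap w w1 w2 : cutoff_fn L al kap w w1 w2 -> mult C w 1.
Proof.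
move=> [[d1 d2] c [p _ _] [b _ _] _]; split; [|exact: aeW|exact: aeW].
have c1 := ac_continuous (ac_C1 d2 c); exact: (cont_meas (ac_continuous (ac_C1 d1 c1))).
Qed.

Lemma localization al kap w w1 w2 : cutoff_fn L al kap w w1 w2 -> exists loc : Yc -> Yl,
  (forall y, incl (loc y) ~~> cut al w (incl y)) /\
  forall Q Qp MQ Mp del k y, mult Ln Q MQ -> mult C Qp Mp -> 0 <= del ->
  {ae leb, forall x, al <= x <= al + L -> `|(Q x - Qp x) * w x| <= del} ->
  2 * kap <= k -> kap + del <= k ->
  no (Aop Q (loc y) - cut al w (Aop Qp y)) <= k * (no (incl y) + slope_nrm y).
Proof.
move=> [[d1 d2] c [p p1 p2] [b b1 b2] [z z1]].
exists (loc L0 d1 d2 c p p1 p2 b b1 b2 z z1); split; first exact: loc_incl.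
by move=> *; apply: loc_comm; eassumption.
Qed.

Lemma ae_neq (c : R) : {ae leb, forall x, x != c}.
Proof.
exists [set c]; split; [exact: measurable_set1|exact: lebesgue_measure_set1|].
by move=> x /= /negP; rewrite negbK => /eqP.
Qed.

(* [cut1] and [cut2] localize near the pulse and away from it; [c] is 0, 1, 3 for the Hill operator,
   L- and L+. *)
Definition transfer_data (Q0 psi0 psi : R -> R) (p : Yl) (q : Yc) (B k : R) :=
  exists (cut1 cut2 : Sc -> Sl) (loc1 loc2 : Yc -> Yl),
  [/\ forall f g, hip (cut1 f) (cut1 g) + hip (cut2 f) (cut2 g) = hip f g,
      (forall y, incl (loc1 y) ~~> cut1 (incl y)) /\ (forall y, incl (loc2 y) ~~> cut2 (incl y)),
      (forall f, cut1 (- f) ~~> - cut1 f) /\ (forall f g, f ~~> g -> cut1 f ~~> cut1 g),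
      [/\ no (cut1 (incl q) - incl p) <= k, no (cut2 (incl q)) <= k & {ae leb, forall x, `|psi x| <= B}] &
      forall c Q Qp MA MQ Mp, 0 <= c <= 3 -> mult Ln Q0 MA -> mult Ln Q MQ -> mult C Qp Mp ->
        (forall x, Q x = Q0 x - c * psi0 x ^+ 2) -> (forall x, Qp x = Q0 x - c * psi x ^+ 2) ->
        forall y, no (Aop Q (loc1 y) - cut1 (Aop Qp y)) <= k * (no (incl y) + slope_nrm y) /\
                  no (Aop Q0 (loc2 y) - cut2 (Aop Qp y)) <= k * (no (incl y) + slope_nrm y)].

Variables (Q0 psi0 psi chi a : R -> R) (p : Yl) (q b : Yc) (P N e M kap : R).
Hypotheses (P0 : 0 <= P) (e0 : 0 <= e) (e1 : e <= 1) (M0 : 0 <= M) (ML : M <= L / 6)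
  (kap0 : 0 <= kap) (kM : kap * M <= e) (ke : kap <= e).
Hypotheses (hp : psi0 =ae h0 p) (hq : psi =ae h0 q) (hb : a =ae h0 b).
Hypotheses (pP : forall x, `|h0 p x| <= P) (pe : forall x, M <= `|x| -> `|h0 p x| <= e)
  (pN : nsq Ln (h0 p) = N) (ptail : \int[leb]_x (h0 p x ^+ 2) - \int[leb]_(x in `[- M, M]) (h0 p x ^+ 2) <= e ^+ 2)
  (be : forall x, `|h0 b x| <= e) (bn : no (incl b) <= e).
Hypotheses (mchi : meas chi) (chi01 : forall x, 0 <= chi x <= 1)
  (chi1 : forall x, - (L / 6) <= x <= L / 6 -> chi x = 1)
  (dec : {ae leb, forall x, - (L / 2) <= x < L / 2 -> psi x = chi x * psi0 x + a x}).
Let W := win (- (L / 2)) (- (L / 2) + L).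
Let N0 : 0 <= N. Proof. by rewrite -pN; exact: nsq_ge0. Qed.
Let halves : - (L / 2) + L = L / 2. Proof. by field. Qed.

Let dec' : {ae leb, forall x, - (L / 2) <= x <= - (L / 2) + L -> h0 q x = chi x * h0 p x + h0 b x}.
Proof.
rewrite halves.
have A1 := aeS2 (fun x (h : psi0 x = h0 p x) (h' : psi x = h0 q x) => conj h h') hp hq.
have A2 := aeS2 (fun x (h : a x = h0 b x) (h' : x != L / 2) => conj h h') hb (ae_neq _).
have A := aeS2 (fun x h h' => conj h h') A1 A2.
apply: aeS2 A dec => x [[ep eq] [eb xn]] ed /andP[x1 x2].
by rewrite -eq ed ?ep ?eb// x1 lt_neqAle xn.
Qed.

(** On [[- M, M]], where the pulse has almost all its mass, [w] is within [kap * M <= e] of [w 0]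
    and [chi] is 1; outside, [w chi - w 0] is bounded by 2 and the mass is at most [e^2]. Used with
    [w 0 = 1] and with [w 0 = 0]. *)
Lemma cut_close al w w1 w2 : cutoff_fn L al kap w w1 w2 -> 0 <= w 0 <= 1 ->
  no (cut (- (L / 2)) w (incl q) - w 0 *: incl p) <= (N + 3) * e.
Proof.
move=> cw /andP[w00 w01]; have mw := cutoff_mult cw.
have [_ _ _ [bw _ _] _] := cw.
have cwx : meas w by case: mw.
pose d x := W (fun t => w t * chi t) x - w 0.
have md : mult Ln d 2.
  split=> //; first by apply: measB; [apply: meas_win; exact: measM|exact: meas_cst].
  apply: aeW => x; apply: le_trans (ler_normB _ _) _; rewrite [`|w 0|]ger0_norm//.
  have -> : 2 = 1 + 1 :> R by [].
  apply: lerD => //; rewrite /W /win; case: (_ <= _ <= _); rewrite ?mulr1 ?mulr0 ?normr0//.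
  by rewrite normrM mulr_ile1 ?bw//; have := chi01 x; rewrite ler_norml; lra.
have E : cut (- (L / 2)) w (incl q) - w 0 *: incl p ~~> mulop d (incl p) + cut (- (L / 2)) w (incl b).
  apply/(eqv_aeE (s := Ln) _ _ I); apply: aeS dec' => x hx.
  have sub (f g : Sl) : (f - w 0 *: g : L2T Ln) x = (f : L2T Ln) x - w 0 * (g : L2T Ln) x by [].
  have add (f g : Sl) : (f + g : L2T Ln) x = (f : L2T Ln) x + (g : L2T Ln) x by [].
  rewrite sub add (cutoff_val _ _ cw) (cutoff_val _ _ cw) (mulopE _ md) !incl_eq /d /W /win.
  move: hx; case: (- (L / 2) <= x <= _); last by move=> _; rewrite !mulr0; ring.
  by move=> /(_ isT) ->; rewrite !mulr1; ring.
rewrite (eqv_nrm sl E); apply: le_trans (nrmD sl _ _) _.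
have n2 : no (cut (- (L / 2)) w (incl b)) <= e.
  apply: le_trans bn; apply: (@le_trans _ _ (no (mulop w (incl b)))).
    rewrite /nrm ler_wsqrtr// (cutoff_ip _ _ _ cw).
    by rewrite [leRHS]/(L2inner C (mulop w (incl b) : L2T C) (mulop w (incl b) : L2T C)) (mulopE _ mw).
  by rewrite -[leRHS]mul1r; exact: (bdd_mulop ler01 mw).
have n1 : no (mulop d (incl p)) <= (N + 2) * e.
  apply: nrm_le_sqr; first by rewrite mulr_ge0// addr_ge0.
  rewrite (nrm_sqr sl) [leLHS]/(L2inner Ln (mulop d (incl p) : L2T Ln) (mulop d (incl p) : L2T Ln)) (mulopE _ md).
  have -> : \int[leb]_(x in cell Ln) (d x * (incl p : L2T Ln) x * (d x * (incl p : L2T Ln) x)) =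
      \int[leb]_x (h0 p x ^+ 2 * d x ^+ 2).
    by apply: eq_Rintegral => x _; rewrite incl_eq; ring.
  have [_ _ ip2] := (L2P Ln (h0 p)).1 (let: And5 _ _ h _ _ := H2TP p in h).
  have small x : - M <= x <= M -> `|d x| <= e.
    move=> /andP[x1 x2]; have M6 := ML.
    rewrite /d /W win_in; last by rewrite halves; lra.
    rewrite chi1 ?mulr1; last by lra.
    apply: le_trans (cutoff_lipschitz x cw) _; apply: le_trans kM; rewrite ler_wpM2l//.
    by rewrite ler_norml x1.
  have mdd : meas d by case: md.
  have b2 x : `|d x| <= 2.
    apply: le_trans (ler_normB _ _) _; rewrite [`|w 0|]ger0_norm//.
    have -> : 2 = 1 + 1 :> R by [].
    apply: lerD => //; rewrite /W /win; case: (_ <= _ <= _); rewrite ?mulr1 ?mulr0 ?normr0//.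
    by rewrite normrM mulr_ile1 ?bw//; have := chi01 x; rewrite ler_norml; lra.
  apply: le_trans (weighted_small ip2 _ mdd b2 small M0) _; first by move=> x; exact: sqr_ge0.
  have -> : \int[leb]_x (h0 p x ^+ 2) = N.
    by rewrite -pN; apply: eq_Rintegral => x _; rewrite expr2.
  move: ptail; have -> : \int[leb]_x (h0 p x ^+ 2) = N.
    by rewrite -pN; apply: eq_Rintegral => x _; rewrite expr2.
  move: (_ - _) => t ht.
  have -> : ((N + 2) * e) ^+ 2 = N ^+ 2 * e ^+ 2 + 4 * (N * e ^+ 2) + 4 * e ^+ 2 by ring.
  have := mulr_ge0 N0 (sqr_ge0 e); have := mulr_ge0 (sqr_ge0 N) (sqr_ge0 e).
  rewrite (mulrC (e ^+ 2) N); move: (e ^+ 2) ht => e2 ht.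
  have -> : 2 ^+ 2 * t = 4 * t by ring.
  by move: (N ^+ 2 * e2) (N * e2) => t1 t2; lra.
by apply: le_trans (lerD n1 n2) _; rewrite -[X in _ + X]mul1r -mulrDl -addrA ler_wpM2r//; lra.
Qed.

(** In [k], the part [N + 3] comes from [cut_close]. The part [12 (P + 1) (P + 2)] bounds
    [3 |psi0^2 - psi^2|] near the pulse and [3 psi^2 |v|] away from it. *)
Lemma transfer_pulse u u1 u2 v v1 v2 k :
  cutoff_fn L (- (L / 2)) kap u u1 u2 -> cutoff_fn L 0 kap v v1 v2 ->
  (forall x, u x ^+ 2 + v x ^+ 2 = 1) -> u 0 = 1 -> v 0 = 0 ->
  k = (12 * (P + 1) * (P + 2) + N + 3) * e -> transfer_data Q0 psi0 psi p q (P + 2) k.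
Proof.
move=> cu cv uv u0 v0 kE.
have [loc1 [inc1 com1]] := localization cu; have [loc2 [inc2 com2]] := localization cv.
have mu := cutoff_mult cu; have mv := cutoff_mult cv.
have [_ _ [pu _ _] [bu _ _] _] := cu; have [_ _ [pv _ _] [bv _ _] _] := cv.
exists (cut (- (L / 2)) u), (cut 0 v), loc1, loc2.
have k0 : 0 <= 12 * (P + 1) * (P + 2) by rewrite !mulr_ge0 ?addr_ge0.
have kN : (N + 3) * e <= k by rewrite kE ler_wpM2r// -!addrA lerDr.
have PP : 2 * (P + 1) <= (P + 1) * (P + 2) by rewrite mulrC ler_wpM2l ?addr_ge0// lerDr.
have k1 : 2 * kap <= k.
  apply: le_trans kN; apply: (@le_trans _ _ (2 * e)); first by rewrite ler_wpM2l.
  by rewrite ler_wpM2r//; have := N0; lra.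
have kd del : del <= 12 * (P + 1) * (P + 2) * e -> kap + del <= k.
  move=> h; rewrite kE mulrDl mulrDl -addrA addrC; apply: lerD => //.
  by apply: le_trans ke _; rewrite -mulrDl ler_peMl//; have := N0; lra.
have near0 : {ae leb, forall x, - (L / 2) <= x <= - (L / 2) + L ->
    `|h0 q x - h0 p x| <= 2 * e /\ `|h0 q x * v x| <= (P + 2) * e}.
  apply: aeS dec' => x hx xW; rewrite (hx xW).
  have [c0 c1'] := andP (chi01 x).
  have l1 : `|(chi x - 1) * h0 p x| <= e.
    case: (leP M `|x|) => xM.
      rewrite normrM -[leRHS]mul1r; apply: ler_pM => //; last exact: pe.
      by rewrite ler_norml; lra.
    move: xM; rewrite ltr_norml => /andP[x1 x2]; have := ML => ML'.
    by rewrite chi1 ?subrr ?mul0r ?normr0//; lra.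
  have l2 : `|h0 p x * v x| <= (P + 1) * e.
    have := cutoff_lipschitz x cv; rewrite v0 subr0 => lv.
    rewrite normrM; case: (leP M `|x|) => xM.
      apply: (@le_trans _ _ (e * 1)); first by apply: ler_pM => //; exact: pe.
      by rewrite mulr1 ler_peMl// lerDr.
    apply: (@le_trans _ _ (P * e)); last by rewrite ler_wpM2r// lerDl.
    apply: ler_pM => //; apply: le_trans lv _; apply: le_trans kM; rewrite ler_wpM2l//.
    exact: ltW.
  split.
    have -> : chi x * h0 p x + h0 b x - h0 p x = (chi x - 1) * h0 p x + h0 b x by ring.
    by apply: le_trans (ler_normD _ _) _; have := be x; lra.
  rewrite mulrDl; apply: le_trans (ler_normD _ _) _.
  have -> : (P + 2) * e = (P + 1) * e + e by ring.
  apply: lerD.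
    rewrite -mulrA normrM; apply: le_trans l2; rewrite ler_piMl//.
    by rewrite ger0_norm.
  by rewrite normrM -[leRHS]mulr1; apply: ler_pM.
have pq x : h0 q (x + L) = h0 q x.
  have [a0 _ l0 _ _] := H2TP q; have [_ pl _] := (L2P _ _).1 l0.
  exact: (ae_periodic_cont (s := C) (ac_continuous a0) pl x).
(* The decomposition of the pulse lives on the window centred at 0, the far cut-off on [[0, L]];
   periodicity carries the bounds over. *)
have spread (g : R -> R) (del : R) : (forall x, g (x + L) = g x) ->
    {ae leb, forall x, - (L / 2) <= x <= - (L / 2) + L -> `|g x| <= del} -> {ae leb, forall x, `|g x| <= del}.
  move=> pg H.
  have A : {ae leb, forall x, `|g (x - L / 2)| <= del}.
    apply: (ae_cell (P := fun x => `|g (x - L / 2)| <= del) L0).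
      by move=> x; rewrite addrAC pg.
    have := ae_shift (- (L / 2)) H; apply: aeS => x hx; rewrite /= in_itv/= => /andP[x1 x2].
    by apply: hx; lra.
  by have := ae_shift (L / 2) A; apply: aeS => x; rewrite addrK.
have near0' : {ae leb, forall x, - (L / 2) <= x <= - (L / 2) + L ->
    [/\ psi0 x = h0 p x, psi x = h0 q x, `|h0 q x - h0 p x| <= 2 * e, `|h0 q x| <= P + 2 & `|h0 q x * v x| <= (P + 2) * e]}.
  have A1 := aeS2 (fun x (h : psi0 x = h0 p x) (h' : psi x = h0 q x) => conj h h') hp hq.
  apply: aeS2 A1 near0 => x [ep eq] hx xW; have [n1 n2] := hx xW; split=> //.
  have -> : h0 q x = h0 p x + (h0 q x - h0 p x) by ring.
  by apply: le_trans (ler_normD _ _) _; have := pP x; have := e1; lra.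
have qB : {ae leb, forall x, `|psi x| <= P + 2}.
  have : {ae leb, forall x, `|h0 q x| <= P + 2}.
    by apply: (spread _ _ pq); apply: aeS near0' => x hx xW; have [] := hx xW.
  by apply: aeS2 hq => x ->.
split=> //.
- move=> f g; rewrite (cutoff_ip _ _ _ cu) (cutoff_ip _ _ _ cv) -cintD; last first.
  + by apply: L2_mul; apply: mult_L2 mv _; exact: L2TP.
  + by apply: L2_mul; apply: mult_L2 mu _; exact: L2TP.
  apply: eq_Rintegral => x _.
  by rewrite -[RHS]mul1r -(uv x); ring.
- have [[d1 d2] c [p' _ _] [b' _ _] _] := cu; split=> [f|f g].
    exact: (cutN _ L0 d1 d2 c p' b').
  exact: (cut_eqv _ L0 d1 d2 c p' b').
- split=> //; apply: le_trans kN.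
    by have := cut_close cu; rewrite u0 scale1r; apply; rewrite ler01 lexx.
  (* The norm does not see where the circle is opened, and [cut_close] is stated for the centred
     window. *)
  have -> : no (cut 0 v (incl q)) = no (cut (- (L / 2)) v (incl q)).
    by rewrite /nrm !(cutoff_ip _ _ _ cv).
  by have := cut_close cv; rewrite v0 scale0r subr0; apply; rewrite lexx ler01.
have bound c0 (x1 x2 : R) k1' k2' K : 0 <= c0 <= 3 -> `|x1| <= k1' -> `|x2| <= k2' -> 3 * (k1' * k2') <= K ->
    `|c0 * (x1 * x2)| <= K.
  move=> /andP[c00 c3] h1 h2; apply: le_trans; rewrite !normrM (ger0_norm c00).
  by apply: ler_pM; [|exact: mulr_ge0| |exact: ler_pM].
move=> c Q Qp MA MQ Mp /andP[c0 c3] mA mQ mQp QE QpE y; split.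
  apply: (com1 _ _ _ _ (12 * (P + 1) * (P + 2) * e)) => //; [exact: mQ|exact: mQp|by rewrite mulr_ge0| |exact: kd].
  apply: aeS near0' => x hx xW; have [e1' e2' n1 n2 _] := hx xW.
  rewrite QE QpE e1' e2'.
  have -> : (Q0 x - c * h0 p x ^+ 2 - (Q0 x - c * h0 q x ^+ 2)) * u x =
      c * ((h0 q x - h0 p x) * ((h0 q x + h0 p x) * u x)) by ring.
  apply: (@bound _ _ _ (2 * e) (2 * P + 2)); [by rewrite c0|by []| |].
    rewrite normrM -[leRHS]mulr1; apply: ler_pM => //.
    by apply: le_trans (ler_normD _ _) _; have := pP x; lra.
  have -> : 3 * (2 * e * (2 * P + 2)) = 12 * (P + 1) * 1 * e by ring.
  by rewrite ler_wpM2r// ler_wpM2l ?mulr_ge0 ?addr_ge0//; have := P0; lra.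
apply: (com2 _ _ _ _ (12 * (P + 1) * (P + 2) * e)) => //; [exact: mA|exact: mQp|by rewrite mulr_ge0| |exact: kd].
apply: (@aeS R (fun x => `|c * (h0 q x ^+ 2 * v x)| <= 12 * (P + 1) * (P + 2) * e /\ psi x = h0 q x)).
  by move=> x [h ex] _; rewrite QpE ex; congr (`|_| <= _): h; ring.
have sq2 : {ae leb, forall x, `|h0 q x ^+ 2 * v x| <= (P + 2) * ((P + 2) * e)}.
  apply: (spread (fun x => h0 q x ^+ 2 * v x)); first by move=> x; rewrite pq pv.
  apply: aeS near0' => x hx xW; have [_ _ _ n2 n3] := hx xW.
  by rewrite expr2 -mulrA normrM; apply: ler_pM.
apply: aeS2 sq2 hq => x hx ex; split=> //.
rewrite normrM (ger0_norm c0); apply: (@le_trans _ _ (3 * ((P + 2) * ((P + 2) * e)))).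
  exact: ler_pM.
have -> : 3 * ((P + 2) * ((P + 2) * e)) = 3 * (P + 2) * (P + 2) * e by ring.
by rewrite ler_wpM2r// ler_wpM2r ?addr_ge0//; have := P0; lra.
Qed.
End PulseLocalization.

(** * From the sequence of pulses to one small parameter *)

Section PulseSequence.
Variables (R : realType).
Notation leb := (@lebesgue_measure R).
Notation Ln := (Line : domain R).
Notation Sl := (L2h Ln).
Notation Yl := (H2T Ln).
Notation no := (nrm hip).
Notation "f =ae g" := {ae leb, forall x, f x = g x} (at level 70).

Lemma tail_mono (g : R -> R) (e M M' : R) : integ Line g -> (forall x, 0 <= g x) -> 0 <= M -> M <= M' ->
  \int[leb]_x g x - \int[leb]_(x in `[- M, M]) g x <= e ->
  \int[leb]_x g x - \int[leb]_(x in `[- M', M']) g x <= e.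
Proof.
move=> ig g0 M0 MM; apply: le_trans; rewrite lerB//; apply: int_subset => //; first exact: integ_lint.
- by rewrite lerN2.
- by rewrite ge0_cp.
Qed.

(** Beyond [M] the square of [p] varies by at most the tail of [p^2 + p'^2], and [line_small] finds
    farther points where it is small. *)
Lemma H2_decay (p : Yl) (e : R) : 0 < e -> exists2 M, 0 <= M & forall x, M <= `|x| -> `|h0 p x| <= e.
Proof.
move=> e0; have [a0 a1 l0 l1 _] := H2TP p.
have [_ _ i0] := (L2P _ _).1 l0; have [_ _ i1] := (L2P _ _).1 l1.
pose g x := h0 p x ^+ 2 + h1 p x ^+ 2.
have ig : integ Line g := integD i0 i1.
have g0 x : 0 <= g x by rewrite addr_ge0// sqr_ge0.
have lg := integ_lint ig.
have e2 : 0 < e ^+ 2 / 2 by rewrite divr_gt0// exprn_gt0.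
have [M [M0 HM]] := ge0_tail ig g0 e2.
have ah := acM a0 a0; have ch := ac_continuous ah.
have var x b : x <= b -> (M <= x \/ b <= - M) -> `|h0 p b * h0 p b - h0 p x * h0 p x| <= e ^+ 2 / 2.
  move=> xb out.
  apply: le_trans (ac_norm_le ah (a := x) (b := b) (x := b) _) _; first by rewrite xb lexx.
  apply: (@le_trans _ _ (\int[leb]_(t in `[x, b]) g t)).
    apply: le_int => //; first exact/lint_norm/ac_lint/ah.
    move=> t _; rewrite [_ * h0 p t]mulrC -mulr2n -mulr_natl normrM normr_nat normrM /g.
    rewrite -[h0 p t ^+ 2]real_normK ?num_real// -[h1 p t ^+ 2]real_normK ?num_real//.
    by have := sqr_ge0 (`|h0 p t| - `|h1 p t|); rewrite sqrrB mulr2n; lra.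
  apply: le_trans HM; case: out => out.
    have h1' : - M <= M by lra. have h2' : - M <= x by lra.
    have := int_le_line (- M) b ig g0; rewrite (int_split lg (b := x)) ?(int_split lg (a := - M) (b := M) (c := x))//.
    have := @int_ge0 R g M x (fun t _ => g0 t); lra.
  have h1' : - M <= M by lra. have h2' : b <= M by lra.
  have := int_le_line x M ig g0; rewrite (int_split lg (b := b)) ?(int_split lg (a := b) (b := - M) (c := M))//.
  have := @int_ge0 R g b (- M) (fun t _ => g0 t); lra.
exists M => // x Mx.
have ih : integ Line (fun x => h0 p x * h0 p x).
  by apply: (L2_mul l0 l0).
have [[b b1 b2] [c c1 c2]] := line_small `|x| ch ih e2.
rewrite -ler_sqr ?nnegrE ?(ltW e0)// real_normK ?num_real// expr2.
have /andP[n1 n2] : - `|x| <= x <= `|x| by rewrite -ler_norml.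
case: (leP 0 x) => x0.
  rewrite (ger0_norm x0) in Mx; have := var x b (le_trans n2 b1) (or_introl Mx).
  by move: b2; rewrite !ler_norml; lra.
rewrite (ltr0_norm x0) in Mx; have := var c x (le_trans c1 n1) (or_intror _).
have xM : x <= - M by lra.
by move=> /(_ xM); move: c2; rewrite !ler_norml; lra.
Qed.

Variables (T mu om : R) (V psi0 : R -> R) (N0 : nat) (psi_per chi a : nat -> R -> R) (p : Yl).
Hypotheses (T0 : 0 < T) (pulses : periodic_pulses T V mu om psi0 N0 psi_per chi a) (hp : psi0 =ae h0 p).

Lemma pulses_transfer (Q0 : R -> R) : exists2 B, 0 <= B & forall k, 0 < k <= 1 -> exists N, forall n, (N <= n)%N ->
  [/\ (N0 <= n)%N, 1 <= n%:R * T & forall q : H2T (Circle (n%:R * T)), psi_per n =ae h0 q ->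
      transfer_data Q0 psi0 (psi_per n) p q B k].
Proof.
have [Hn Hchi Ha] := pulses.
pose c1 : circle1 Ln := I.
have [P [P0 PP]] : exists P, 0 <= P /\ forall x, `|h0 p x| <= P.
  pose s2 := 2 * nsq Ln (h0 p) + nsq Ln (h1 p); have s20 : 0 <= s2 by rewrite addr_ge0 ?mulr_ge0 ?nsq_ge0.
  exists (Num.sqrt s2); split=> // x.
  by rewrite -ler_sqr ?nnegrE// sqr_sqrtr// real_normK ?num_real//; exact: (sup_h0 c1).
exists (P + 2); first by rewrite addr_ge0.
move=> k /andP[k0 k1].
pose Np := nsq Ln (h0 p); have Np0 : 0 <= Np by exact: nsq_ge0.
pose K := 12 * (P + 1) * (P + 2) + Np + 3.
have K1 : 1 <= K.
  have : 0 <= 12 * (P + 1) * (P + 2) by rewrite !mulr_ge0// addr_ge0.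
  by rewrite /K; move: (12 * _ * _) => t; lra.
have K00 : 0 < K by exact: lt_le_trans K1.
have [e [e0 e1 Ke]] : exists e : R, [/\ 0 < e, e <= 1 & k = K * e].
  exists (k / K); split; first by rewrite divr_gt0.
    by rewrite ler_pdivrMr// mul1r (le_trans _ K1).
  by rewrite mulrC divfK// gt_eqF.
have [M1 M10 HM1] := H2_decay p e0.
have [_ _ ip2] := (L2P Ln (h0 p)).1 (let: And5 _ _ h _ _ := H2TP p in h).
have sq0 x : 0 <= h0 p x ^+ 2 by exact: sqr_ge0.
have e20 : 0 < e ^+ 2 by rewrite exprn_gt0.
have [M2 [M20 HM2]] := ge0_tail ip2 sq0 e20.
have [M [M0 M1M HM3]] : exists M, [/\ 0 <= M, M1 <= M &
    \int[leb]_x (h0 p x ^+ 2) - \int[leb]_(x in `[- M, M]) (h0 p x ^+ 2) <= e ^+ 2].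
  exists (M1 + M2); rewrite addr_ge0// lerDl M20; split=> //.
  by apply: tail_mono HM2 => //; rewrite lerDr.
pose cst := cutoff_cst R; have cst0 : 0 <= cst := cutoff_cst_ge0 R.
(* A length above [X] gives at once [L >= 1], [M <= L / 6] and [cst / L * (M + 1) <= e]; the last
   yields both bounds on [kap]. *)
pose X := 1 + 6 * M + cst * (M + 1) / e.
have X0 : 0 <= cst * (M + 1) / e by rewrite divr_ge0 ?(ltW e0)// mulr_ge0// addr_ge0.
have [N1 HN1] : exists N1 : nat, forall n, (N1 <= n)%N -> X <= n%:R * T.
  have X00 : 0 <= X by rewrite /X; move: M0 X0; clear - T0 pulses hp; lra.
  have XT : 0 <= X / T by rewrite divr_ge0 ?(ltW T0).
  exists (Num.Def.archi_bound (X / T)) => n nN; rewrite -ler_pdivrMr//.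
  by apply: le_trans (ltW (archi_boundP XT)) _; rewrite ler_nat.
have [N2 _ HN2] := Hchi.
have [N3 _ HN3] : \forall n \near \oo, H2norm (Circle (n%:R * T)) (a n) <= e / 2.
  have /cvgrPdist_le/(_ (e / 2)) := Ha; rewrite divr_gt0// => /(_ isT); apply: filterS => n /=.
  by rewrite sub0r normrN; apply: le_trans; exact: ler_norm.
exists (maxn N0 (maxn N1 (maxn N2 N3))) => n; rewrite !geq_max => /and4P[n0 n1 n2 n3].
have XL := HN1 n n1; set L := n%:R * T in XL *.
have L1 : 1 <= L by move: XL M0 X0; rewrite /X; clear - T0 pulses hp; lra.
have L0 : 0 < L by exact: lt_le_trans L1.
split=> // q hq.
have [hpsi st ha dec] := Hn n n0.
have [[sm per chi01] [_ chi1 _]] := HN2 n n2.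
have [b hb] := H2_repY ha.
have an := HN3 n n3; rewrite -/L in an.
have hn2 : nsq (Circle L) (h0 b) + nsq (Circle L) (h1 b) + nsq (Circle L) (h2 b) <= (e / 2) ^+ 2.
  rewrite -(H2norm_sqr (H2TP b) (H2_meas ha) hb) ler_sqr ?nnegrE ?divr_ge0 ?(ltW e0)//; exact: sqrtr_ge0.
have g0 := nsq_ge0 (Circle L) (h0 b); have g1 := nsq_ge0 (Circle L) (h1 b); have g2 := nsq_ge0 (Circle L) (h2 b).
have e22 : (e / 2) ^+ 2 = e ^+ 2 / 4 by rewrite expr_div_n; congr (_ / _); ring.
have be x : `|h0 b x| <= e.
  rewrite -ler_sqr ?nnegrE ?(ltW e0)// real_normK ?num_real//.
  have := sup_h0 (s := Circle L) L1 b x; have := sqr_ge0 e; move: hn2 g0 g1 g2; rewrite e22 /sup2; clear - T0 pulses hp; lra.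
have bn : nrm hip (incl b) <= e.
  apply: nrm_le_sqr; first exact: ltW.
  by rewrite nrm_incl; have := sqr_ge0 e; move: hn2 g0 g1 g2; rewrite e22; clear - T0 pulses hp; lra.
have [u [u1 [u2 [v [v1 [v2 [cu cv uv u00 v00]]]]]]] := cutoff_pair L1.
have kE : cutoff_cst R / L <= e / (M + 1).
  rewrite ler_pdivrMr// mulrAC ler_pdivlMr ?ltr_wpDl// -ler_pdivrMl// mulrC.
  by apply: le_trans XL; rewrite /X -/cst; move: M0 X0; clear - T0 pulses hp; lra.
have M11 : 0 < M + 1 by rewrite ltr_wpDl.
have chi1' x : - (L / 6) <= x <= L / 6 -> chi n x = 1.
  have -> : L / 6 = n%:R / 6 * T by rewrite /L mulrAC.
  exact: chi1.
have dec' : {ae leb, forall x, - (L / 2) <= x < L / 2 -> psi_per n x = chi n x * psi0 x + a n x}.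
  by have -> : L / 2 = n%:R / 2 * T by rewrite /L mulrAC.
have mchi : meas (chi n).
  by apply: cont_meas => x; apply/differentiable_continuous/derivable1_diffP; exact: (sm 0%N).
have ML : M <= L / 6 by move: XL X0; rewrite /X; clear - T0 pulses hp; lra.
have kap0 : 0 <= cutoff_cst R / L by rewrite divr_ge0// ltW.
have kapM : cutoff_cst R / L * M <= e.
  by apply: le_trans (ler_wpM2r M0 kE) _; rewrite mulrAC ler_pdivrMr// ler_wpM2l ?(ltW e0)// lerDl.
have kape : cutoff_cst R / L <= e.
  by apply: le_trans kE _; rewrite ler_pdivrMr// ler_peMr ?(ltW e0)// lerDr.
have HM4 x : M <= `|x| -> `|h0 p x| <= e by move=> Mx; apply: HM1; exact: le_trans Mx.
exact: (transfer_pulse L1 Q0 P0 (ltW e0) e1 M0 ML kap0 kapM kape hp hq hb PP HM4 erefl HM3 be bn mchi chi01 chi1' dec' cu cv uv u00 v00).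
Qed.
End PulseSequence.

Lemma small_factor (R : realFieldType) (X Y : R) : 0 <= X -> 0 < Y -> exists k : R, [/\ 0 < k, k <= 1 & k * X <= Y].
Proof.
move=> X0 Y0; have X1 : 0 < X + 1 by rewrite ltr_wpDl.
exists (Num.min 1 (Y / (X + 1))); split.
- by rewrite lt_min ltr01 divr_gt0.
- by rewrite ge_min lexx.
- apply: (@le_trans _ _ (Y / (X + 1) * X)); first by rewrite ler_wpM2r// ge_min lexx orbT.
  by rewrite mulrAC ler_pdivrMr// ler_wpM2l ?(ltW Y0)// lerDl.
Qed.

(** Collects the smallness conditions of the three transfer lemmas, so that one [k] serves them
    all. *)
Lemma small_parameter (R : realFieldType) (m d cm km cp kp C n s K : R) : 0 <= m -> 0 < d -> 0 < cm -> 0 <= km -> 0 < cp ->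
  0 <= kp -> 0 <= C -> 0 < n -> 0 < s -> 0 <= K ->
  exists k : R, [/\ 0 < k <= 1, k <= 1 / 6,
    [/\ 6 * k * (1 + m) + 8 * 0 * k ^+ 2 <= d, 6 * k * (1 + m) + 8 * km * k ^+ 2 <= cm &
        6 * k * (1 + m) + 8 * kp * k ^+ 2 <= cp], 4 * C * k * (m + 2) <= 1 & 6 * k <= n /\ k * K <= s].
Proof.
move=> m0 d0 cm0 km0 cp0 kp0 C0 n0 s0 K0.
have [Y [Y0 Y1 [Yd Ycm Ycp] Yn Ys]] : exists Y, [/\ 0 < Y, Y <= 1, [/\ Y <= d, Y <= cm & Y <= cp], Y <= n & Y <= s].
  exists (Num.min 1 (Num.min d (Num.min cm (Num.min cp (Num.min n s))))).
  by rewrite !lt_min ltr01 d0 cm0 cp0 n0 s0 !ge_min !lexx ?orbT.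
have x1 : 0 <= 6 * (1 + m) by rewrite mulr_ge0// addr_ge0.
have x4 : 0 <= 4 * C * (m + 2) by rewrite !mulr_ge0// addr_ge0.
have X0 : 0 <= 6 + 6 * (1 + m) + 8 * km + 8 * kp + 4 * C * (m + 2) + K.
  by move: x1 x4; move: (6 * (1 + m)) (4 * C * _) => a b; lra.
have [k [k0 k1 kX]] := small_factor X0 Y0.
have kle x : x <= 6 + 6 * (1 + m) + 8 * km + 8 * kp + 4 * C * (m + 2) + K -> k * x <= Y.
  by move=> hx; apply: le_trans kX; rewrite ler_wpM2l// ltW.
have kk : k ^+ 2 <= k by rewrite expr2 ler_piMl// ltW.
have kc c z : 0 <= z -> Y <= c -> 6 * (1 + m) + 8 * z <= 6 + 6 * (1 + m) + 8 * km + 8 * kp + 4 * C * (m + 2) + K ->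
    6 * k * (1 + m) + 8 * z * k ^+ 2 <= c.
  move=> z0 Yc hx; apply: le_trans Yc; apply: le_trans (kle _ hx).
  have -> : k * (6 * (1 + m) + 8 * z) = 6 * k * (1 + m) + 8 * z * k by ring.
  by rewrite lerD2l ler_wpM2l// mulr_ge0.
have kle' := kle (4 * C * (m + 2)).
have e4 : 4 * C * k * (m + 2) = k * (4 * C * (m + 2)) by ring.
exists k; rewrite e4; move: x1 x4 kle kc kle' {e4}; move: (6 * (1 + m)) (erefl (6 * (1 + m))) (4 * C * (m + 2)) (erefl (4 * C * (m + 2))) => a ea b eb x1 x4 kle kc kle'.
split; first by rewrite k0.
- by have := kle 6; lra.
- by split; apply: kc => //; lra.
- by apply: le_trans Y1; apply: kle'; lra.
- by split; [rewrite mulrC; apply: le_trans Yn; apply: kle; lra|apply: le_trans Ys; apply: kle; lra].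
Qed.

Section Consequences.
Variables (R : realType).
Notation leb := (@lebesgue_measure R).
Notation Ln := (Line : domain R).
Notation Sl := (L2h Ln).
Notation Yl := (H2T Ln).
Notation no := (nrm hip).
Notation "f =ae g" := {ae leb, forall x, f x = g x} (at level 70).
Notation "u ~~> v" := (eqv hip u v) (at level 70).
Notation N y := (hip (incl y) (incl y)).
Let sl := hsip Sl.

Variables (V psi0 : R -> R) (mu om M0 B : R) (p e : Yl).
Notation Q0 := (fun x => mu * V x + om).
Notation Qp f := (fun x => mu * V x + om - 3 * f x ^+ 2).
Notation Qm f := (fun x => mu * V x + om - f x ^+ 2).
Let M := M0 + 3 * B ^+ 2.
Hypotheses (mQl : mult Ln Q0 M0) (M00 : 0 <= M0) (hpsi0 : H2 Ln psi0) (hp : psi0 =ae h0 p).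
Variables (d cm km cp kp Cl : R).
Let sg := hip (incl e) (incl p).
Hypotheses (d0 : 0 < d) (cA : coer (@incl R Ln) (Aop Q0) d) (Np : 0 < N p).
Hypotheses (cm0 : 0 < cm) (cmd : cm <= d) (km0 : 0 <= km) (cp0 : 0 < cp) (cpd : cp <= d) (kp0 : 0 <= kp).
Hypothesis gm : forall y, cm * N y <= hip (Aop (Qm psi0) y) (incl y) + km * hip (incl y) (incl p) ^+ 2.
Hypothesis gp : 0 < sg ->
  forall y, cp * N y <= hip (Aop (Qp psi0) y) (incl y) + kp * hip (incl y) (incl p) ^+ 2.
Hypotheses (Cl0 : 0 <= Cl) (lbp : lb (@incl R Ln) (Aop (Qp psi0)) Cl) (dCl : d^-1 <= Cl).
Hypotheses (ep : Aop (Qp psi0) e ~~> - incl p) (sg0 : sg != 0).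

Let M_ge0 : 0 <= M. Proof. by rewrite addr_ge0// mulr_ge0// sqr_ge0. Qed.

Let mlm := mult_Qm (I : circle1 Ln) mQl hpsi0 hp.
Let mlp := mult_Qp (I : circle1 Ln) mQl hpsi0 hp.

(** [k] is chosen from data on the line alone, before the circle is introduced; this makes the final
    threshold uniform in the length. *)
Lemma periodic_consequences : exists k, 0 < k <= 1 /\
  forall (L : R) (psi : R -> R) (q : H2T (Circle L)), 1 <= L -> mult (Circle L) Q0 M0 ->
  H2 (Circle L) psi -> psi =ae h0 q ->
  transfer_data Q0 psi0 psi p q B k ->
  [/\ exists d', [/\ 0 < d', coer (@incl R (Circle L)) (Aop Q0) d' & @solv R _ (H2T (Circle L)) (Aop Q0 : _ -> L2h (Circle L))],
      exists2 c, 0 < c & gap (@incl R (Circle L)) (Aop (Qm psi)) q c,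
      exists C, [/\ 0 <= C, lb (@incl R (Circle L)) (Aop (Qp psi)) C &
        @solv R _ (H2T (Circle L)) (Aop (Qp psi) : _ -> L2h (Circle L))],
      0 < N q &
      (forall phi : H2T (Circle L), Aop (Qp psi) phi ~~> - incl q -> 0 < sg * hip (incl phi) (incl q)) /\
      (0 < sg -> exists2 c, 0 < c & gap (@incl R (Circle L)) (Aop (Qp psi)) q c)].
Proof.
have np0 : 0 < no (incl p) by apply/(nrm_gt0 sl).
(* A priori bounds on the circle: [Bq] for the pulse, [C1] for the solution of [L_+ phi = - q]
   through the transferred lower bound [4 Cl + 1], and [Kst] for the resulting error of the
   slope. *)
pose Bq := no (incl p) + 2; have Bq0 : 0 <= Bq by rewrite addr_ge0// ltW.
pose C1 := (4 * Cl + 1) * Bq; have C10 : 0 <= C1 by rewrite mulr_ge0// addr_ge0// mulr_ge0.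
pose Kst := Cl * (1 + (Bq + (M + 2) * C1)) * Bq + no (incl e) + C1.
have Kst0 : 0 <= Kst.
  have m2 : 0 <= (M + 2) * C1 by apply: mulr_ge0 => //; exact: addr_ge0.
  have m3 : 0 <= 1 + (Bq + (M + 2) * C1) by apply: addr_ge0 => //; exact: addr_ge0.
  apply: addr_ge0 => //; apply: addr_ge0; last exact: nrm_ge0.
  by apply: mulr_ge0 => //; exact: mulr_ge0.
have [Kst' [KE Kst0']] : exists K', K' = Kst /\ 0 <= K' by exists Kst.
have sgn0 : 0 < `|sg| / 2 by rewrite divr_gt0// normr_gt0.
have [k [/andP[k0 k1] k6 [kd kcm kcp] klb [kn kK]]] := small_parameter M_ge0 d0 cm0 km0 cp0 kp0 Cl0 np0 sgn0 Kst0'.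
exists k; split; first by rewrite k0.
move=> L psi q L1 mQc hpsi hq [cut1 [cut2 [loc1 [loc2 [cutE [loc1E loc2E] [cN cv] [cl1 cl2 pB] comm]]]]].
have ds : dpos (Circle L) := circle1_dpos (s := Circle L) L1.
have L0 : 0 < L := ds.
have sc := hsip (L2h (Circle L)).
have mper c Q : 0 <= c <= 3 -> (forall x, Q x = Q0 x - c * psi x ^+ 2) -> mult (Circle L) Q M.
  move=> /andP[c0 c3] QE; have [mq pq _] := mQc; have mpsi := H2_meas hpsi.
  have [_ pf _] : [/\ meas psi, ae_periodic (Circle L) psi & integ (Circle L) (fun x => psi x ^+ 2)].
    by apply/L2P; case: hpsi.
  split.
  - by have -> : Q = (fun x => Q0 x - c * psi x ^+ 2);
      [exact/funext|apply: measB => //; apply: measZ; exact: measX].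
  - by apply: aeS2 pq (ae_periodicM (s := Circle L) pf pf) => x h1 h2; rewrite !QE h1; congr (_ - c * _); rewrite !expr2.
  - case: mQc => _ _ bq; apply: aeS2 bq pB => x h1 h2; rewrite QE.
    apply: le_trans (ler_normB _ _) _; apply: lerD => //.
    have B0 : 0 <= B := le_trans (normr_ge0 _) h2.
    rewrite normrM normrX (ger0_norm c0); apply: ler_pM => //.
    by rewrite lerXn2r// nnegrE.
have DE c Q (y : H2T (Circle L)) : 0 <= c <= 3 -> (forall x, Q x = Q0 x - c * psi x ^+ 2) ->
    slope_nrm y ^+ 2 <= hip (Aop Q y) (incl y) + M * hip (incl y) (incl y).
  by move=> h1 h2; rewrite slope_nrm_sqr; exact: (nsq_h1 ds y (mper _ _ h1 h2) M_ge0).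
have D0 (y : H2T (Circle L)) : 0 <= slope_nrm y by exact: nrm_ge0.
have e3 : 0 <= (3 : R) <= 3 by rewrite lexx ler0n.
have e1 : 0 <= (1 : R) <= 3 by rewrite ler01 ler1n.
have e0 : 0 <= (0 : R) <= 3 by rewrite lexx ler0n.
have Q3 (f : R -> R) x : Qp f x = Q0 x - 3 * f x ^+ 2 by [].
have Q1 (f : R -> R) x : Qm f x = Q0 x - 1 * f x ^+ 2 by rewrite mul1r.
have Qz (f : R -> R) x : Q0 x = Q0 x - 0 * f x ^+ 2 by rewrite mul0r subr0.
have m3 := mper _ _ e3 (Q3 psi); have m1 := mper _ _ e1 (Q1 psi).
have cm3 y := comm _ _ _ _ _ _ e3 mQl mlp m3 (Q3 psi0) (Q3 psi) y.
have cm1 y := comm _ _ _ _ _ _ e1 mQl mlm m1 (Q1 psi0) (Q1 psi) y.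
have cmz y := comm _ _ _ _ _ _ e0 mQl mQl mQc (Qz psi0) (Qz psi) y.
have lbA : lb (@incl R Ln) (Aop Q0) Cl.
  by move=> y; apply: le_trans (coer_lb d0 cA y) _; rewrite ler_wpM2r// nrm_ge0.
have n1 := cut1_le cutE; have n2 := cut2_le cutE.
have nq : no (incl q) <= Bq.
  apply: le_trans (cut_ge cutE (incl q)) _; rewrite /Bq.
  have := nrm_le_dist sl (cut1 (incl q)) (incl p); lra.
have Nq : 0 < N q.
  apply/(nrm_gt0 sc); have := n1 (incl q); have := nrm_le_dist sl (incl p) (cut1 (incl q)).
  rewrite (nrmBC sl (incl p)); lra.
have lb3 : lb (@incl R (Circle L)) (Aop (Qp psi)) (4 * Cl + 1).
  by apply: (transfer_lb cutE loc1E loc2E D0 (fun y => (cm3 y).1) (fun y => (cm3 y).2) (fun y => DE _ _ y e3 (Q3 psi)) M_ge0 (ltW k0) Cl0 lbp lbA klb).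
have C4 : 0 <= 4 * Cl + 1 by rewrite addr_ge0// mulr_ge0.
split.
- have c4 : 0 < d / 4 by rewrite divr_gt0.
  (* Plain coercivity is the case of [transfer_gap] with both constraint vectors equal to 0 and no
     penalty. *)
  have co : coer (@incl R (Circle L)) (Aop Q0) (d / 4).
    have i0 : incl (0 : H2T (Circle L)) = 0 := lin0 (@lin_incl R (Circle L)).
    have j0 : incl (0 : Yl) = 0 := lin0 (@lin_incl R Ln).
    have z1 : no (cut1 (incl (0 : H2T (Circle L))) - incl (0 : Yl)) <= k.
      by rewrite j0 subr0; apply: le_trans (n1 _) _; rewrite i0 (nrm0 sc) ltW.
    have z2 : no (cut2 (incl (0 : H2T (Circle L)))) <= k.
      by apply: le_trans (n2 _) _; rewrite i0 (nrm0 sc) ltW.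
    move=> y; apply: (transfer_gap cutE loc1E loc2E D0 (fun y => (cmz y).1) (fun y => (cmz y).2) (fun y => DE _ _ y e0 (Qz psi)) M_ge0 (ltW k0) d0 (lexx 0) _ cA z1 z2 kd k6).
      by move=> v; rewrite mul0r addr0; exact: cA.
    by rewrite i0 (sip0r sc).
  exists (d / 4); split=> //; apply: (circle_solv L0 M00 mQc _ (coer_lb c4 co)).
  by rewrite invr_ge0 ltW.
- exists (cm / 4); first by rewrite divr_gt0.
  apply: (transfer_gap cutE loc1E loc2E D0 (fun y => (cm1 y).1) (fun y => (cm1 y).2) (fun y => DE _ _ y e1 (Q1 psi)) M_ge0 (ltW k0) cm0 km0 gm _ cl1 cl2 _ k6).
    by move=> v; apply: le_trans (cA v); rewrite ler_wpM2r// (sipP sl).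
  exact: kcm.
- by exists (4 * Cl + 1); split=> //; exact: (circle_solv L0 M_ge0 m3 C4 lb3).
- by [].
split.
- move=> phi hphi.
  have phiB : no (incl phi) <= C1.
    apply: le_trans (lb3 phi) _; rewrite (eqv_nrm sc hphi) (nrmN sc) /C1 ler_wpM2l//.
  have := transfer_slope (@lin_incl R Ln) cutE loc1E D0 (fun y => (cm3 y).1) (fun y => DE _ _ y e3 (Q3 psi)) M_ge0 (ltW k0) Cl0 Bq0 (lin_Aop mlp) lbp ep hphi phiB nq cN cv cl1 cl2.
  rewrite -/Kst -KE -/sg => /le_trans/(_ kK).
  move: (hip (incl phi) (incl q)) => x.
  case: (ltgtP sg 0) sg0 => // s0 _; [rewrite (ltr0_norm s0)|rewrite (gtr0_norm s0)] => h.
    by rewrite nmulr_rgt0//; move: h; rewrite ler_norml; lra.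
  by rewrite pmulr_rgt0//; move: h; rewrite ler_norml; lra.
move=> sg_gt0; exists (cp / 4); first by rewrite divr_gt0.
apply: (transfer_gap cutE loc1E loc2E D0 (fun y => (cm3 y).1) (fun y => (cm3 y).2) (fun y => DE _ _ y e3 (Q3 psi)) M_ge0 (ltW k0) cp0 kp0 (gp sg_gt0) _ cl1 cl2 _ k6).
  by move=> v; apply: le_trans (cA v); rewrite ler_wpM2r// (sipP sl).
exact: kcp.
Qed.
End Consequences.

(** * Continuation in the frequency *)

Section RealEstimates.
Variable R : realType.

Lemma bernoulli_le (y : R) k : 0 <= y -> 1 + k%:R * y <= (1 + y) ^+ k.
Proof.
move=> y0; elim: k => [|k IH]; first by rewrite mul0r addr0 expr0.
rewrite exprS; apply: le_trans (ler_wpM2l (_ : 0 <= 1 + y) IH); last by rewrite addr_ge0.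
rewrite -natr1; have := mulr_ge0 (ler0n R k) (sqr_ge0 y); rewrite expr2 mulrA.
by rewrite !mulrDl !mulrDr !mul1r !mulr1 mulrA (mulrC y k%:R); lra.
Qed.

(** Bernoulli's inequality gives [(k + 1) (1 - x) <= (2 - x)^k], and
    [x (2 - x) = 1 - (1 - x)^2 <= 1]. *)
Lemma linear_geometric (x : R) : 0 <= x < 1 -> exists2 C, 0 <= C & forall k, k.+1%:R * x ^+ k <= C.
Proof.
move=> /andP[x0 x1]; have y0 : 0 < 1 - x by rewrite subr_gt0.
exists (1 - x)^-1 => [|k]; first by rewrite invr_ge0 ltW.
rewrite -[leRHS]mul1r ler_pdivlMr// mulrAC.
have h : k.+1%:R * (1 - x) <= (1 + (1 - x)) ^+ k.
  by apply: le_trans (bernoulli_le k (ltW y0)); rewrite -natr1 mulrDl mul1r; move: (k%:R * _) => z; lra.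
apply: le_trans (ler_wpM2r (exprn_ge0 k x0) h) _; rewrite -exprMn exprn_ile1//.
  by apply: mulr_ge0 => //; lra.
by have := sqr_ge0 (1 - x); rewrite expr2; nra.
Qed.

Lemma geometric_small (x A e : R) : 0 <= x < 1 -> 0 <= A -> 0 < e -> exists N, forall n, (N <= n)%N -> A * x ^+ n <= e.
Proof.
move=> hx A0 e0; have [C C0 HC] := linear_geometric hx; have /andP[x0 _] := hx.
have z : 0 <= A * C / e by rewrite divr_ge0 ?mulr_ge0// ltW.
exists (Num.Def.archi_bound (A * C / e)) => n nN.
have h : A * C / e <= n.+1%:R.
  by apply: le_trans (ltW (archi_boundP z)) _; rewrite ler_nat leqW.
rewrite -(ler_pM2l (_ : 0 < n.+1%:R)) ?ltr0n// mulrCA; apply: le_trans (ler_wpM2l A0 (HC n)) _.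
by rewrite -ler_pdivrMr.
Qed.

Lemma linear_geometric_small (x A e : R) : 0 <= x < 1 -> 0 <= A -> 0 < e ->
  exists N, forall n, (N <= n)%N -> A * (n%:R * x ^+ n) <= e.
Proof.
move=> /andP[x0 x1] A0 e0; have [y xy y1] : exists2 y, x < y & y < 1 by exists ((x + 1) / 2); lra.
have y0 : 0 < y := le_lt_trans x0 xy.
have [C C0 HC] := @linear_geometric (x / y) (ltac:(rewrite divr_ge0 ?(ltW y0)//= ltr_pdivrMr// mul1r//)).
have y01 : 0 <= y < 1 by rewrite ltW.
have [N HN] := geometric_small y01 (mulr_ge0 A0 C0) e0; exists N => n nN.
apply: le_trans (HN n nN); rewrite -mulrA ler_wpM2l//.
have -> : x ^+ n = (x / y) ^+ n * y ^+ n by rewrite -exprMn divfK// gt_eqF.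
rewrite mulrA ler_wpM2r ?exprn_ge0 ?(ltW y0)//; apply: le_trans (HC n).
by rewrite ler_wpM2r ?exprn_ge0 ?divr_ge0 ?(ltW y0)// ler_nat.
Qed.

Lemma geometric_sum_le (x : R) n : 0 <= x < 1 -> \sum_(k < n) x ^+ k <= (1 - x)^-1.
Proof.
move=> /andP[x0 x1]; have y0 : 0 < 1 - x by rewrite subr_gt0.
rewrite -[leRHS]mul1r ler_pdivlMr// mulrC.
have := subrX1 x n => h; have : (1 - x) * \sum_(i < n) x ^+ i = 1 - x ^+ n.
  by rewrite -[LHS]opprK -mulNr opprB -h opprB.
by move=> ->; rewrite gerBl exprn_ge0.
Qed.

Lemma taylor2_power (t h M : R) k : `|t| <= M -> `|t + h| <= M ->
  `|(t + h) ^+ k.+2 - t ^+ k.+2 - k.+2%:R * (h * t ^+ k.+1)| <= h ^+ 2 * (k.+1%:R * k.+2%:R * M ^+ k).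
Proof.
move=> tM hM; have M0 : 0 <= M := le_trans (normr_ge0 _) tM.
have h20 : 0 <= h ^+ 2 := sqr_ge0 h.
elim: k => [|k IH].
  have -> : (t + h) ^+ 2 - t ^+ 2 - 2%:R * (h * t ^+ 1) = h ^+ 2 by ring.
  by rewrite ger0_norm// expr0 ler_peMr// !mulr1 mul1r ler1n.
have -> : (t + h) ^+ k.+3 - t ^+ k.+3 - k.+3%:R * (h * t ^+ k.+2) =
    (t + h) * ((t + h) ^+ k.+2 - t ^+ k.+2 - k.+2%:R * (h * t ^+ k.+1)) + k.+2%:R * (h ^+ 2 * t ^+ k.+1).
  by rewrite -[k.+3%:R]natr1 !exprS; ring.
apply: le_trans (ler_normD _ _) _.
have h1 : `|(t + h) * ((t + h) ^+ k.+2 - t ^+ k.+2 - k.+2%:R * (h * t ^+ k.+1))| <=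
    M * (h ^+ 2 * (k.+1%:R * k.+2%:R * M ^+ k)) by rewrite normrM; apply: ler_pM.
have h2 : `|k.+2%:R * (h ^+ 2 * t ^+ k.+1)| <= k.+2%:R * (h ^+ 2 * M ^+ k.+1).
  rewrite normrM normr_nat ler_wpM2l// normrM (ger0_norm h20) ler_wpM2l// normrX.
  by rewrite lerXn2r// nnegrE.
apply: le_trans (lerD h1 h2) _.
have -> : M * (h ^+ 2 * (k.+1%:R * k.+2%:R * M ^+ k)) + k.+2%:R * (h ^+ 2 * M ^+ k.+1) =
    h ^+ 2 * (k.+2%:R * k.+2%:R * M ^+ k.+1) by rewrite (exprS M) -[k.+2%:R]natr1; ring.
by rewrite ler_wpM2l// ler_wpM2r ?exprn_ge0// ler_wpM2l// ler_nat.
Qed.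

(* Both sides are read off from the square of the polynomial with coefficients [u]. *)
Lemma convolution_le (u : nat -> R) n : (forall k, 0 <= u k) -> u 0%N = 0 ->
  \sum_(k < n.+1) \sum_(i < k.+1) u i * u (k - i)%N <= (\sum_(k < n) u k) ^+ 2.
Proof.
move=> u0 u00; pose p : {poly R} := \poly_(i < n) u i.
have pk k : 0 <= p`_k by rewrite coef_poly; case: ifP.
have pp k : 0 <= (p * p)`_k by rewrite coefM sumr_ge0// => i _; rewrite mulr_ge0.
have -> : \sum_(k < n) u k = p.[1].
  by rewrite horner_poly; apply: eq_bigr => i _; rewrite expr1n mulr1.
rewrite expr2 -hornerM (horner_coef_wide 1 (_ : (size (p * p)%R <= n.+1 + size (p * p)%R)%N)) ?leq_addl//.
rewrite big_split_ord/= -[leLHS]addr0; apply: lerD; last first.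
  by apply: sumr_ge0 => i _; rewrite expr1n mulr1.
apply: ler_sum => k _; rewrite expr1n mulr1 coefM; apply: ler_sum => i _.
have [ki|] := ltnP i n; last first.
  move=> ni; have -> : (k - i)%N = 0%N.
    by have := ltn_ord k; have := ltn_ord i; rewrite !ltnS => h1 h2; apply/eqP; rewrite subn_eq0; exact: leq_trans h2 ni.
  by rewrite u00 mulr0 mulr_ge0.
have [kj|kj] := ltnP (k - i) n; first by rewrite !coef_poly ki kj.
have -> : (i : nat) = 0%N.
  have := ltn_ord k; rewrite ltnS => h1; apply/eqP; rewrite -leqn0.
  by rewrite -(leq_add2l (k - i)) addn0 subnK ?(leq_trans h1 kj)// -ltnS.
by rewrite u00 mul0r mulr_ge0.
Qed.
End RealEstimates.

(** * Power series with coefficients in a semi-inner product space *)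

Section PowerSeries.
Variables (R : realType) (S : hspace R).
Notation no := (nrm hip).
Notation "u ~~> v" := (eqv hip u v) (at level 70).
Let sS := hsip S.
Implicit Types (c : nat -> S) (t : R).

Definition tends (u : nat -> S) (l : S) := forall e, 0 < e -> exists N, forall n, (N <= n)%N -> no (u n - l) <= e.

Lemma tends_lin (a : R) u l v m : tends u l -> tends v m -> tends (fun n => a *: u n + v n) (a *: l + m).
Proof.
move=> ul vm e e0; have a0 : 0 < 2 * (`|a| + 1) by rewrite mulr_gt0// ltr_wpDl.
have [N1 H1] := ul (e / (2 * (`|a| + 1))) (divr_gt0 e0 a0).
have [N2 H2] := vm (e / 2) (divr_gt0 e0 (ltr0n _ 2)).
exists (maxn N1 N2) => n; rewrite geq_max => /andP[n1 n2].
rewrite opprD addrACA -scalerBr; apply: le_trans (nrmD sS _ _) _; rewrite (nrmZ sS).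
have h1 : `|a| * no (u n - l) <= e / 2.
  apply: le_trans (ler_wpM2l (normr_ge0 a) (H1 n n1)) _.
  move: (`|a|) (normr_ge0 a) => b b0; have b1 : 0 < b + 1 by rewrite ltr_wpDl.
  have -> : b * (e / (2 * (b + 1))) = e / 2 * (b / (b + 1)) by field; rewrite gt_eqF.
  by rewrite ler_piMr ?divr_ge0 ?(ltW e0)// ler_pdivrMr// mul1r lerDl.
by have := H2 n n2; lra.
Qed.

Lemma tends_le u l B : tends u l -> (forall n, no (u n) <= B) -> no l <= B.
Proof.
move=> ul HB; apply/ler_addgt0Pr => e e0; have [N HN] := ul e e0.
apply: le_trans (nrm_le_dist sS l (u N)) _; rewrite (nrmBC sS); apply: lerD => //; exact: HN.
Qed.

Lemma tends_shift u l : tends u l -> tends (fun n => u n.+1) l.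
Proof. by move=> ul e e0; have [N HN] := ul e e0; exists N => n nN; apply: HN; rewrite leqW. Qed.

Lemma tends0 u : (forall e : R, 0 < e -> exists N, forall n, (N <= n)%N -> no (u n) <= e) -> tends u 0.
Proof. by move=> H e e0; have [N HN] := H e e0; exists N => n nN; rewrite subr0; exact: HN. Qed.

Lemma tends_uniq u l m : tends u l -> tends u m -> l ~~> m.
Proof.
move=> ul um; apply: nrm_le0; apply/ler_addgt0Pr => e e0; rewrite add0r.
have [N1 H1] := ul (e / 2) (divr_gt0 e0 (ltr0n _ 2)).
have [N2 H2] := um (e / 2) (divr_gt0 e0 (ltr0n _ 2)).
have h1 := H1 (maxn N1 N2) (leq_maxl _ _); have h2 := H2 (maxn N1 N2) (leq_maxr _ _).
move: (u _) h1 h2 => x h1 h2.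
have -> : l - m = (x - m) - (x - l) by rewrite opprB [RHS]addrC addrA subrK.
by apply: le_trans (nrmB sS _ _) _; lra.
Qed.

Definition partial c t n : S := \sum_(k < n) t ^+ k *: c k.

(** [rho] bounds the reciprocal of the radius of convergence. Asking for geometric growth at every
    rate above [rho] leaves room for polynomial factors, so termwise differentiation keeps the same
    [rho]. *)
Definition radius c (rho : R) := forall sg, rho < sg -> exists2 A, 0 <= A & forall k, no (c k) <= A * sg ^+ k.

Definition dcoef c k : S := k.+1%:R *: c k.+1.

Lemma radius_dcoef c rho : 0 < rho -> radius c rho -> radius (dcoef c) rho.
Proof.
move=> r0 rc sg rs.
have [s' [s1 s2]] : exists s', rho < s' /\ s' < sg by exists ((rho + sg) / 2); split; lra.
have sg0 : 0 < sg by lra. have s'0 : 0 < s' by lra.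
have [A A0 HA] := rc s' s1.
have hx : 0 <= s' / sg < 1 by rewrite divr_ge0 ?(ltW s'0) ?(ltW sg0)//= ltr_pdivrMr// mul1r.
have [C C0 HC] := linear_geometric hx.
exists (A * s' * C) => [|k]; first by rewrite !mulr_ge0// ltW.
rewrite (nrmZ sS) normr_nat; apply: le_trans (ler_wpM2l (ler0n _ _) (HA k.+1)) _.
have -> : k.+1%:R * (A * s' ^+ k.+1) = A * s' * (k.+1%:R * (s' / sg) ^+ k) * sg ^+ k.
  by rewrite expr_div_n exprS; field; rewrite expf_neq0// gt_eqF.
by rewrite ler_wpM2r ?exprn_ge0 ?(ltW sg0)// ler_wpM2l// mulr_ge0// ltW.
Qed.

Lemma nrm_sum n (u : 'I_n -> S) : no (\sum_(k < n) u k) <= \sum_(k < n) no (u k).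
Proof.
elim: n u => [|n IH] u; first by rewrite !big_ord0 (nrm0 sS).
by rewrite !big_ord_recr/=; apply: le_trans (nrmD sS _ _) _; rewrite lerD2r.
Qed.

Lemma radius_room (t rho : R) : 0 <= t -> t * rho < 1 -> exists2 sg, rho < sg & t * sg < 1.
Proof.
rewrite le_eqVlt => /orP[/eqP <- _|t0 h].
  by exists (rho + 1); [rewrite ltrDl|rewrite mul0r].
have h' : rho < t^-1 by rewrite -[t^-1]mul1r ltr_pdivlMr// mulrC.
exists ((rho + t^-1) / 2); first lra.
rewrite mulrC -ltr_pdivlMr// mul1r; lra.
Qed.

Lemma partial_tends c rho t : 0 < rho -> radius c rho -> `|t| * rho < 1 -> exists F, tends (partial c t) F.
Proof.
move=> r0 rc tr.
have [sg rs ts] := radius_room (normr_ge0 t) tr.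
have [A A0 HA] := rc sg rs; have sg0 : 0 < sg := lt_trans r0 rs.
pose x := `|t| * sg; have hx : 0 <= x < 1 by rewrite mulr_ge0// ltW.
have x1 : 0 < 1 - x by rewrite subr_gt0.
apply: hcomplete.
have step m d : no (partial c t (m + d) - partial c t m) <= A / (1 - x) * (x ^+ m - x ^+ (m + d)).
  elim: d => [|d IH]; first by rewrite addn0 !subrr (nrm0 sS) mulr0.
  rewrite addnS /partial big_ord_recr/= -/(partial c t (m + d)) -/(partial c t m) addrAC.
  apply: le_trans (nrmD sS _ _) _; rewrite (nrmZ sS) normrX.
  have h : `|t| ^+ (m + d) * no (c (m + d)%N) <= A * x ^+ (m + d).
    by rewrite /x exprMn mulrCA ler_wpM2l ?exprn_ge0//.
  apply: le_trans (lerD IH h) _.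
  have -> : A * x ^+ (m + d) = A / (1 - x) * (x ^+ (m + d) - x ^+ (m + d).+1).
    by rewrite exprS; field; rewrite gt_eqF.
  by rewrite -mulrDr addrA subrK.
move=> e e0; have B0 : 0 <= A / (1 - x) by rewrite divr_ge0// ltW.
have [N HN] := geometric_small hx B0 e0.
have key m n : (N <= m)%N -> (m <= n)%N -> no (partial c t n - partial c t m) <= e.
  move=> Nm mn; rewrite -(subnKC mn); apply: le_trans (step _ _) _; apply: le_trans (HN m Nm).
  by rewrite ler_wpM2l// gerBl exprn_ge0// mulr_ge0// ltW.
exists N => m n Nm Nn; have [mn|/ltnW nm] := leqP m n; last exact: key.
by rewrite (nrmBC sS); exact: key.
Qed.

(** Each power contributes a second-order Taylor remainder, whose coefficients are those of the
    second derivative series. The quadratic bound is uniform in [t]. *)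
Lemma power_series_derivative c rho M : 0 < rho -> radius c rho -> 0 <= M -> M * rho < 1 ->
  exists2 B, 0 <= B & forall t h F Fh F', `|t| <= M -> `|t + h| <= M -> tends (partial c t) F ->
   tends (partial c (t + h)) Fh -> tends (partial (dcoef c) t) F' -> no (Fh - F - h *: F') <= B * h ^+ 2.
Proof.
move=> r0 rc M0 Mr; have [sg rs Ms] := radius_room M0 Mr; have sg0 : 0 < sg := lt_trans r0 rs.
have [A A0 HA] := radius_dcoef r0 (radius_dcoef r0 rc) rs.
have hx : 0 <= M * sg < 1 by rewrite mulr_ge0// ltW.
have x1 : 0 < 1 - M * sg by rewrite subr_gt0.
exists (A / (1 - M * sg)) => [|t h F Fh F' tM hM tF tFh tF']; first by rewrite divr_ge0// ltW.
have T1 := tends_lin (-1) (tends_shift tF) (tends_shift tFh).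
have T := tends_lin (- h) tF' T1.
have -> : Fh - F - h *: F' = - h *: F' + (-1 *: F + Fh) by rewrite scaleN1r scaleNr addrC [Fh - F]addrC.
apply: tends_le T _ => n; rewrite scaleN1r scaleNr /partial.
have -> : - (h *: (\sum_(k < n) t ^+ k *: dcoef c k)) + (- (\sum_(k < n.+1) t ^+ k *: c k) + \sum_(k < n.+1) (t + h) ^+ k *: c k)
    = \sum_(k < n) ((t + h) ^+ k.+1 - t ^+ k.+1 - k.+1%:R * (h * t ^+ k)) *: c k.+1.
  rewrite !big_ord_recl/= !expr0 !scale1r opprD addrACA addNr add0r scaler_sumr -!sumrN -!big_split/=.
  apply: eq_bigr => k _; rewrite /fintype.bump/= add1n /dcoef 2!scalerA -(scaleNr _ (c k.+1)) -(scaleNr _ (c k.+1)) -2!(scalerDl (c k.+1)).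
  by congr (_ *: _); ring.
case: n => [|n]; first by rewrite big_ord0 (nrm0 sS) mulr_ge0 ?sqr_ge0// divr_ge0// ltW.
have e0 : (t + h) ^+ 1 - t ^+ 1 - 1%:R * (h * t ^+ 0) = 0 by ring.
rewrite big_ord_recl /= e0 scale0r add0r; apply: le_trans (nrm_sum _) _.
apply: (@le_trans _ _ (\sum_(k < n) h ^+ 2 * A * (M * sg) ^+ k)).
  apply: ler_sum => k _; rewrite /fintype.bump/= add1n (nrmZ sS).
  apply: le_trans (ler_wpM2r (nrm_ge0 _ _) (taylor2_power k tM hM)) _.
  have := HA k; rewrite /dcoef !(nrmZ sS) !normr_nat => hk.
  rewrite exprMn; move: (no (c k.+2)) hk => z hk.
  have -> : h ^+ 2 * (k.+1%:R * k.+2%:R * M ^+ k) * z = h ^+ 2 * (M ^+ k * (k.+1%:R * (k.+2%:R * z))) by ring.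
  have -> : h ^+ 2 * A * (M ^+ k * sg ^+ k) = h ^+ 2 * (M ^+ k * (A * sg ^+ k)) by ring.
  by rewrite ler_wpM2l ?sqr_ge0// ler_wpM2l ?exprn_ge0.
rewrite -mulr_sumr [leRHS]mulrC -mulrA ler_wpM2l ?sqr_ge0// ler_wpM2l//.
exact: geometric_sum_le.
Qed.
End PowerSeries.

(** * Power series solution of [F = t (al + T F) + Q (F, F)] *)

Section QuadraticEquation.
Variables (R : realType) (S : hspace R) (al : S) (T : S -> S) (Q : S -> S -> S) (tau kap : R).
Notation no := (nrm hip).
Notation "u ~~> v" := (eqv hip u v) (at level 70).
Let sS := hsip S.
Hypotheses (lT : lin T) (bT : forall u, no (T u) <= tau * no u) (tau0 : 0 <= tau)
  (lQ1 : forall v, lin (fun u => Q u v)) (lQ2 : forall u, lin (Q u))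
  (bQ : forall u v, no (Q u v) <= kap * (no u * no v)) (kap0 : 0 <= kap).

Definition stage (g : nat -> S) k : S :=
  (if k == 1%N then al else 0) + (if k is j.+1 then T (g j) else 0) + \sum_(i < k.+1) Q (g i) (g (k - i)%N).

(** The coefficient recursion refers to all earlier coefficients; iterating it on whole sequences
    avoids course-of-values recursion, since coefficient [k] is stable after [k + 1] passes. *)
Fixpoint stages m : nat -> S := if m is m'.+1 then stage (stages m') else fun=> 0.

Definition sol k : S := stages k.+1 k.

Let Q0l v : Q 0 v = 0. Proof. exact: (lin0 (lQ1 v)). Qed.
Let Q0r u : Q u 0 = 0. Proof. exact: (lin0 (lQ2 u)). Qed.

Lemma stages0 m : stages m 0%N = 0.
Proof. by elim: m => //= m IH; rewrite /stage/= big_ord_recl big_ord0 IH Q0l !addr0. Qed.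

(** The end terms of the convolution contain coefficient [k] itself, but multiplied by coefficient
    0, which vanishes. *)
Lemma stage_ext g g' k : g 0%N = 0 -> g' 0%N = 0 -> (forall i, (i < k)%N -> g i = g' i) -> stage g k = stage g' k.
Proof.
move=> g0 g'0 E; rewrite /stage; congr (_ + _ + _).
  by case: k E => // k E; rewrite E.
apply: eq_bigr => i _; have [->|i0] := posnP i; first by rewrite g0 g'0 !Q0l.
have [ik|] := ltnP i k.
  by rewrite !E// ltn_subrL i0 (leq_ltn_trans _ ik).
by rewrite -subn_eq0 => /eqP ->; rewrite g0 g'0 !Q0r.
Qed.

Lemma stages_stable k m : (k < m)%N -> stages m k = sol k.
Proof.
elim/ltn_ind: k m => k IH [//|m] km; apply: stage_ext; [exact: stages0|exact: stages0|].
move=> i ik; transitivity (sol i); first exact: (IH i ik m (leq_trans ik km)).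
by symmetry; exact: (IH i ik k ik).
Qed.

Lemma sol0 : sol 0%N = 0. Proof. exact: stages0. Qed.

Lemma solE k : sol k = stage sol k.
Proof. by apply: stage_ext; [exact: stages0|exact: sol0|move=> i ik; exact: stages_stable]. Qed.

Lemma sol_le k : no (sol k.+1) <= (if k == 0%N then no al else 0) + tau * no (sol k) +
  kap * \sum_(i < k.+2) no (sol i) * no (sol (k.+1 - i)%N).
Proof.
rewrite solE /stage; apply: le_trans (nrmD sS _ _) _; apply: lerD.
  apply: le_trans (nrmD sS _ _) _; apply: lerD => //.
  by rewrite eqSS; case: ifP => _ //; rewrite (nrm0 sS).
by apply: le_trans (nrm_sum _) _; rewrite mulr_sumr; apply: ler_sum => i _; exact: bQ.
Qed.

(** A majorant argument: the partial sums of [|c_k| r^k] satisfy [S_(n+1) <= r |al| + r tau S_n +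
    kap S_n^2], and for small [r] they never leave [[0, d]]. *)
Lemma sol_radius : exists2 rho, 0 < rho & radius sol rho.
Proof.
have a0 := nrm_ge0 hip al.
(* [d] and [r] are chosen so that each of the three terms is at most [d / 4] when the sum is at most
   [d]. *)
pose d : R := (4 * (kap + 1))^-1; have d0 : 0 < d by rewrite invr_gt0 mulr_gt0// ltr_wpDl.
have dk : kap * d <= 4^-1.
  rewrite /d invfM mulrCA -[leRHS]mulr1 ler_wpM2l// ler_pdivrMr ?ltr_wpDl// mul1r; lra.
have [r [r0 ra rt]] : exists r, [/\ 0 < r, r * no al <= d / 4 & r * tau <= 4^-1].
  have b0 : 0 < 4 * (no al + d * tau + d) by rewrite mulr_gt0// ltr_wpDl// addr_ge0// mulr_ge0// ltW.
  have dt : 0 <= d * tau by rewrite mulr_ge0// ltW.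
  exists (d / (4 * (no al + d * tau + d))); split; first by rewrite divr_gt0.
    rewrite mulrAC ler_pdivrMr//; have -> : d / 4 * (4 * (no al + d * tau + d)) = d * (no al + d * tau + d) by field.
    by rewrite ler_wpM2l ?(ltW d0)//; lra.
  rewrite mulrAC ler_pdivrMr// mulrA mulVf ?pnatr_eq0// mul1r; lra.
pose u k := no (sol k) * r ^+ k.
have u0 k : 0 <= u k by rewrite mulr_ge0 ?nrm_ge0 ?exprn_ge0 ?ltW.
have u00 : u 0%N = 0 by rewrite /u sol0 (nrm0 sS) mul0r.
pose Sn n := \sum_(k < n) u k.
have Sn0 n : 0 <= Sn n by exact: sumr_ge0.
have rec n : Sn n.+1 <= r * no al + r * tau * Sn n + kap * Sn n ^+ 2.
  rewrite {1}/Sn big_ord_recl u00 add0r.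
  have step (k : 'I_n) : u (lift ord0 k) <= (if k == 0%N :> nat then r * no al else 0) + r * tau * u k +
      kap * \sum_(i < k.+2) u i * u (k.+1 - i)%N.
    rewrite lift0 {1}/u; apply: le_trans (ler_wpM2r (exprn_ge0 _ (ltW r0)) (sol_le k)) _.
    rewrite !mulrDl; apply: lerD; first apply: lerD.
    - by case: eqP => [->|_]; rewrite ?mul0r// expr1 mulrC.
    - by rewrite /u exprS; have -> : forall x y z w : R, x * y * (z * w) = z * x * (y * w) by move=> *; ring.
    rewrite -mulrA ler_wpM2l// mulr_suml; apply: ler_sum => i _.
    by rewrite /u mulrACA -exprD subnKC// -ltnS.
  apply: le_trans (ler_sum _ (fun k _ => step k)) _; rewrite !big_split/= -!mulr_sumr.
  apply: lerD; first apply: lerD => //.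
    case: n step => [|n] step; first by rewrite big_ord0 mulr_ge0// ltW.
    by rewrite big_ord_recl/= big1 ?addr0.
  rewrite ler_wpM2l//; apply: le_trans (convolution_le n u0 u00).
  rewrite [leRHS]big_ord_recl/= lerDr big_ord_recl big_ord0 u00 mul0r add0r.
  by apply: le_trans (_ : 0 <= _).
have Snd n : Sn n <= d.
  elim: n => [|n IH]; first by rewrite /Sn big_ord0 ltW.
  apply: le_trans (rec n) _.
  have h1 : r * tau * Sn n <= 4^-1 * d by apply: ler_pM => //; rewrite mulr_ge0// ltW.
  have h2 : kap * Sn n ^+ 2 <= 4^-1 * d.
    rewrite expr2 mulrA; apply: ler_pM => //; first by rewrite mulr_ge0.
    by apply: le_trans dk; rewrite ler_wpM2l.
  by lra.
exists r^-1; first by rewrite invr_gt0.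
move=> sg rs; exists d => [|k]; first exact: ltW.
have h : u k <= d.
  apply: le_trans (Snd k.+1); rewrite /Sn big_ord_recr/= lerDr; exact: Sn0.
have : no (sol k) <= d * r^-1 ^+ k by rewrite exprVn ler_pdivlMr ?exprn_gt0.
move=> /le_trans; apply; rewrite ler_wpM2l ?(ltW d0)// lerXn2r ?nnegrE ?invr_ge0 ?(ltW r0)//.
  by rewrite (le_trans _ (ltW rs))// invr_ge0 ltW.
exact: ltW.
Qed.

Lemma sum_tail (V : nmodType) (u : nat -> V) i N : (i <= N)%N ->
  \sum_(j < N) u j = \sum_(j < N - i) u j + \sum_(j < i) u (N - i + j)%N.
Proof.
move=> iN; rewrite -!(big_mkord xpredT) (big_cat_nat _ (n := (N - i)%N))//= ?leq_subr//; congr (_ + _).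
by rewrite -{1}[(N - i)%N]add0n big_addn subKn// big_mkord; apply: eq_bigr => j _; rewrite addnC.
Qed.

Lemma triangle (V : nmodType) (a : nat -> nat -> V) n :
  \sum_(k < n) \sum_(i < k.+1) a i (k - i)%N = \sum_(i < n) \sum_(j < n - i) a i j.
Proof.
elim: n => [|n IH]; first by rewrite !big_ord0.
rewrite big_ord_recr/= IH [RHS](eq_bigr (fun i : 'I_n.+1 => \sum_(j < n - i) a i j + a i (n - i)%N)).
  by rewrite big_split/= [X in _ = X + _]big_ord_recr/= subnn big_ord0 addr0.
by move=> i _; rewrite subSn ?big_ord_recr// -ltnS.
Qed.

Let lin_sum (V W : lmodType R) (f : V -> W) n (u : 'I_n -> V) : lin f -> f (\sum_(k < n) u k) = \sum_(k < n) f (u k).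
Proof.
move=> lf; elim: n u => [|n IH] u; first by rewrite !big_ord0 (lin0 lf).
by rewrite !big_ord_recr/= (linD lf) IH.
Qed.

(** The truncated series solves the truncated equation exactly. The defect [D n] between [Q] of the
    partial sums and the truncated convolution contains only terms of degree above [n], and is
    bounded by a multiple of [(n + 1) x^(n + 1)] with [x < 1]. *)
Lemma sol_equation rho t F : 0 < rho -> radius sol rho -> `|t| * rho < 1 -> tends (partial sol t) F ->
  F ~~> t *: (al + T F) + Q F F.
Proof.
move=> r0 rs tr tF.
have [sg rsg ts] := radius_room (normr_ge0 t) tr; have sg0 : 0 < sg := lt_trans r0 rsg.
have [A A0 HA] := rs sg rsg.
have tT : tends (fun n => T (partial sol t n)) (T F).
  move=> e e0; have t1 : 0 < tau + 1 by rewrite ltr_wpDl.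
  have [N HN] := tF (e / (tau + 1)) (divr_gt0 e0 t1); exists N => n nN.
  rewrite -(linB lT); apply: le_trans (bT _) _; apply: le_trans (ler_wpM2l tau0 (HN n nN)) _.
  by rewrite mulrCA -[leRHS]mulr1 ler_wpM2l ?(ltW e0)// ler_pdivrMr// mul1r lerDl.
have tQ : tends (fun n => Q (partial sol t n.+1) (partial sol t n.+1)) (Q F F).
  move=> e e0.
  pose B := kap * (2 * no F + 1) + 1; have B0 : 0 < B.
    by rewrite ltr_wpDl// mulr_ge0// addr_ge0// mulr_ge0// nrm_ge0.
  have m0 : 0 < Num.min 1 (e / B) by rewrite lt_min ltr01 divr_gt0.
  have [N HN] := tends_shift tF m0; exists N => n nN; have := HN n nN.
  move: (partial sol t n.+1) => p; rewrite le_min => /andP[p1 p2].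
  have -> : Q p p - Q F F = Q (p - F) p + Q F (p - F).
    by rewrite (linB (lQ1 p)) (linB (lQ2 F)) addrA subrK.
  apply: le_trans (nrmD sS _ _) _; apply: le_trans (lerD (bQ _ _) (bQ _ _)) _.
  have np : no p <= no F + 1 by apply: le_trans (nrm_le_dist sS p F) _; rewrite lerD2l.
  have nd := nrm_ge0 hip (p - F); have nF := nrm_ge0 hip F.
  apply: (@le_trans _ _ (B * no (p - F))); last by rewrite mulrC -ler_pdivlMr.
  have h1 : kap * (no (p - F) * no p) <= kap * (no (p - F) * (no F + 1)) by rewrite ler_wpM2l// ler_wpM2l.
  apply: le_trans (lerD h1 (lexx _)) _.
  have -> : B * no (p - F) = kap * (no (p - F) * (no F + 1)) + kap * (no F * no (p - F)) + no (p - F) by rewrite /B; ring.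
  by rewrite lerDl.
pose a i j : S := t ^+ (i + j) *: Q (sol i) (sol j).
pose C n := \sum_(k < n.+1) \sum_(i < k.+1) a i (k - i)%N.
pose D n := Q (partial sol t n.+1) (partial sol t n.+1) - C n.
have rec n : partial sol t n.+2 = t *: al + t *: T (partial sol t n.+1) + C n.+1.
  rewrite {1}/partial (eq_bigr (fun k : 'I_n.+2 => t ^+ k *: (if k == 1%N :> nat then al else 0) +
    t ^+ k *: (if k : nat is j.+1 then T (sol j) else 0) + \sum_(i < k.+1) a i (k - i)%N)); last first.
    move=> k _; rewrite solE /stage !scalerDr scaler_sumr; congr (_ + _ + _); apply: eq_bigr => i _.
    by rewrite /a subnKC// -ltnS.
  rewrite !big_split/=; congr (_ + _ + _).
    rewrite !big_ord_recl/= scaler0 add0r expr1 big1 ?addr0// => k _.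
    by rewrite scaler0.
  rewrite big_ord_recl/= scaler0 add0r /partial (lin_sum _ lT) scaler_sumr; apply: eq_bigr => k _.
  by rewrite (linZ lT) scalerA -exprS.
pose x := `|t| * sg; have hx : 0 <= x < 1 by rewrite mulr_ge0// ltW.
have x1 : 0 < 1 - x by rewrite subr_gt0.
have al_le i j : no (a i j) <= kap * A ^+ 2 * x ^+ (i + j).
  rewrite (nrmZ sS) normrX /x exprMn mulrCA ler_wpM2l ?exprn_ge0//.
  apply: le_trans (bQ _ _) _; rewrite -mulrA ler_wpM2l//.
  have -> : A ^+ 2 * sg ^+ (i + j) = (A * sg ^+ i) * (A * sg ^+ j) by rewrite exprD; ring.
  by apply: ler_pM => //; exact: nrm_ge0.
have DB n : no (D n) <= kap * A ^+ 2 / (1 - x) * (n.+1%:R * x ^+ n.+1).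
  have -> : D n = \sum_(i < n.+1) \sum_(j < i) a i (n.+1 - i + j)%N.
    rewrite /D /C triangle /partial (lin_sum _ (lQ1 _)) -sumrB; apply: eq_bigr => i _.
    rewrite (lin_sum _ (lQ2 _)).
    rewrite (eq_bigr (fun j : 'I_n.+1 => a i j)); last first.
      by move=> j _; rewrite (linZ (lQ1 _)) (linZ (lQ2 _)) scalerA -exprD.
    by rewrite (sum_tail (a i) (ltnW (ltn_ord i))) addrAC subrr add0r.
  apply: le_trans (nrm_sum _) _.
  apply: (@le_trans _ _ (\sum_(i < n.+1) kap * A ^+ 2 / (1 - x) * x ^+ n.+1)); last first.
    by rewrite sumr_const card_ord -[leLHS]mulr_natl [leRHS]mulrCA.
  apply: ler_sum => i _; apply: le_trans (nrm_sum _) _.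
  apply: (@le_trans _ _ (\sum_(j < i) kap * A ^+ 2 * x ^+ n.+1 * x ^+ j)).
    apply: ler_sum => j _; apply: le_trans (al_le _ _) _.
    by rewrite addnA subnKC ?(ltnW (ltn_ord i))// exprD mulrA.
  rewrite -mulr_sumr [leRHS]mulrAC ler_wpM2l ?geometric_sum_le//.
  by rewrite !mulr_ge0 ?sqr_ge0// exprn_ge0//; case/andP: hx.
have D0 : tends D 0.
  apply: tends0 => e e0.
  have B0 : 0 <= kap * A ^+ 2 / (1 - x) by rewrite divr_ge0 ?(ltW x1)// mulr_ge0 ?sqr_ge0.
  have [N HN] := linear_geometric_small hx B0 e0.
  exists N => n nN; apply: le_trans (DB n) _; apply: HN; exact: leqW.
have T1 := tends_shift (tends_lin t tT tQ).
have T2 := tends_lin (-1) (tends_shift D0) T1.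
have T3 : tends (fun=> t *: al) (t *: al).
  by move=> e e0; exists 0%N => n _; rewrite subrr (nrm0 sS) ltW.
have T4 := tends_lin 1 T3 T2.
rewrite scalerDr -addrA -[t *: al]scale1r -[X in 1 *: _ + X]add0r -[X in 1 *: _ + (X + _)](scaler0 _ (-1)).
apply: tends_uniq (tends_shift (tends_shift tF)) _.
move: T4; congr (tends _ _); apply/funext => n.
rewrite [RHS]rec scale1r /D scaleN1r opprB -[RHS]addrA; congr (_ + _).
by rewrite addrACA addNr addr0 addrC.
Qed.

End QuadraticEquation.

(** * The smooth family of solutions through a pulse *)

Section Continuation.
Variables (R : realType) (s : domain R) (c1 : circle1 s).
Notation leb := (@lebesgue_measure R).
Notation S := (L2h s).
Notation Y := (H2T s).
Notation i := (@incl R s).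
Notation no := (nrm hip).
Notation "f =ae g" := {ae leb, forall x, f x = g x} (at level 70).
Notation "u ~~> v" := (eqv hip u v) (at level 70).
Let sS := hsip S.
Let ds := circle1_dpos c1.

Lemma H2norm_incl (y : Y) f : meas f -> f =ae h0 y -> no (i y) <= H2norm s f.
Proof.
move=> mf hf; apply: nrm_le_sqr; first exact: sqrtr_ge0.
by rewrite nrm_incl (H2norm_sqr (H2TP y) mf hf) -addrA lerDl addr_ge0 ?nsq_ge0.
Qed.

Lemma near_le (f : R -> R) (e : R) : f h @[h --> 0^'] --> 0 -> 0 < e -> \forall h \near 0^', f h <= e.
Proof.
move=> /cvgrPdist_le/(_ e) cf e0; apply: filterS (cf e0) => h; rewrite sub0r normrN.
by apply: le_trans; exact: ler_norm.
Qed.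

Lemma cvg0_linear (f : R -> R) (D r : R) : 0 <= D -> 0 < r -> (forall h, 0 <= f h) ->
  (forall h, h != 0 -> `|h| < r -> f h <= D * `|h|) -> f h @[h --> 0^'] --> 0.
Proof.
move=> D0 r0 f0 fD; apply/cvgrPdist_le => e e0; have D1 : 0 < D + 1 by rewrite ltr_wpDl.
have N2 : \forall h \near (0 : R)^', `|h| < e / (D + 1) by apply: dnbhs0_lt; rewrite divr_gt0.
apply: filterS3 (nbhs_dnbhs_neq 0) (dnbhs0_lt r0) N2 => h hn h1 h2.
rewrite sub0r normrN (ger0_norm (f0 h)); apply: le_trans (fD h hn h1) _.
apply: (@le_trans _ _ ((D + 1) * `|h|)); first by rewrite ler_wpM2r// lerDl.
by rewrite mulrC -ler_pdivlMr// ltW.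
Qed.

Lemma near_pick (f g : R -> R) (e nu : R) : f h @[h --> 0^'] --> 0 -> g h @[h --> 0^'] --> 0 -> 0 < e ->
  0 < nu -> exists h, [/\ f h <= e, g h <= e, h != 0 & `|h| < nu].
Proof.
move=> cf cg e0 nu0; have N1 := near_le cf e0; have N2 := near_le cg e0.
have N3 : \forall h \near (0 : R)^', h != 0 /\ `|h| < nu.
  by apply: filterS2 (nbhs_dnbhs_neq 0) (dnbhs0_lt nu0) => h; split.
by apply: (@filter_ex _ (0 : R)^'); apply: filterS3 N1 N2 N3 => h a b [].
Qed.

(** Needed because [dH2] is a choice: it identifies the chosen derivative with the computed one. *)
Lemma H2_derivative_unique (P : R -> R -> R) w (nu : R) v v' : 0 < nu ->
  (forall h, `|h| < nu -> H2 s (P (w + h))) ->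
  is_H2_derivative s P w v -> is_H2_derivative s P w v' -> v =ae v'.
Proof.
move=> nu0 HP [hv dv] [hv' dv'].
have [e he] := H2_repY hv; have [e' he'] := H2_repY hv'.
suff /(eqv_aeE _ _ ds) : i e ~~> i e'.
  by rewrite !incl_eq => E; exact: ae_trans (ae_trans he E) (ae_sym he').
apply: nrm_le0; apply/ler_addgt0Pr => t t0; rewrite add0r.
have t2 : 0 < t / 2 by rewrite divr_gt0.
have [h [k1 k2 hn0 hnu]] := near_pick dv dv' t2 nu0.
have [y hy] := H2_repY (HP h hnu).
have Hw := HP 0; rewrite normr0 addr0 in Hw; have {}Hw := Hw nu0.
have [y0 hy0] := H2_repY Hw.
have key u g : H2 s g -> g =ae h0 u -> H2norm s (fun x => h^-1 * (P (w + h) x - P w x) - g x) <= t / 2 ->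
    no (i (h^-1 *: (y - y0) - u)) <= t / 2.
  move=> hg hgu; apply: le_trans; apply: H2norm_incl.
    exact: (measB (measZ _ (measB (H2_meas (HP h hnu)) (H2_meas Hw))) (H2_meas hg)).
  have hh := aeS2 (fun x => @conj _ _) hy hy0.
  apply: aeS2 hh hgu => x [-> ->] ->; by [].
have z1 := key _ _ hv he k1; have z2 := key _ _ hv' he' k2.
have -> : i e - i e' = i (h^-1 *: (y - y0) - e') - i (h^-1 *: (y - y0) - e).
  move: (h^-1 *: (y - y0)) => d; rewrite -!(linB (@lin_incl R s)); congr i.
  by rewrite opprB [RHS]addrC addrA subrK.
by apply: le_trans (nrmB sS _ _) _; rewrite [t]splitr; exact: lerD.
Qed.

Variables (V psi : R -> R) (mu om M0 : R) (p : Y).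
Notation Q0 := (fun x => mu * V x + om).
Notation Qp := (fun x => mu * V x + om - 3 * psi x ^+ 2).
Hypotheses (mQ0 : mult s Q0 M0) (M00 : 0 <= M0) (hpsi : H2 s psi) (hp : psi =ae h0 p)
  (stat : stationary V mu om psi).
Variable (C : R).
Hypotheses (C0 : 0 <= C) (lbC : lb i (Aop Qp) C) (oL : @solv R S Y (Aop Qp)).
Let mp := mult_Qp c1 mQ0 hpsi hp.
Let lL : lin (Aop Qp : Y -> S) := lin_Aop mp.

Definition inv (f : S) : Y := projT1 (cid (oL f)).
Definition ev (f : S) : R -> R := h0 (inv f).
Lemma invE f : Aop Qp (inv f) ~~> f. Proof. exact: projT2 (cid (oL f)). Qed.

Lemma h0_eq (y z : Y) : Aop Qp y ~~> Aop Qp z -> h0 y = h0 z.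
Proof.
move=> e; have : i y ~~> i z.
  apply: nrm_le0; rewrite -(linB (@lin_incl R s)); apply: le_trans (lbC _) _.
  by rewrite (linB lL) [no (_ - _)]e mulr0.
move=> /(eqv_aeE _ _ ds); rewrite !incl_eq => E.
have [ay _ _ _ _] := H2TP y; have [az _ _ _ _] := H2TP z.
by apply/funext; exact: (cont_ae_eq (ac_continuous ay) (ac_continuous az) E).
Qed.

Lemma ev_lin a f g x : ev (a *: f + g) x = a * ev f x + ev g x.
Proof.
have -> : ev (a *: f + g) = h0 (a *: inv f + inv g).
  apply: h0_eq; rewrite lL; apply: (eqv_trans sS (invE _)); apply: eqv_sym => //.
  by apply: (eqvD sS) => //; [apply: (eqvZ sS)|]; exact: invE.
by [].
Qed.

Lemma ev_eqv f g : f ~~> g -> ev f = ev g.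
Proof.
move=> e; apply: h0_eq; apply: (eqv_trans sS (invE _)); apply: (eqv_trans sS e).
by apply: (eqv_sym sS); exact: (invE g).
Qed.

Lemma lin_inv : lin (fun f : S => i (inv f)).
Proof.
move=> a f g; apply: L2T_ext; apply/funext => x; rewrite incl_eq [LHS](ev_lin a f g x).
have -> : (a *: i (inv f) + i (inv g) : L2T s) x = a * (i (inv f) : L2T s) x + (i (inv g) : L2T s) x by [].
by rewrite !incl_eq.
Qed.

Lemma inv_le f : no (i (inv f)) <= C * no f.
Proof. by rewrite -(eqv_nrm sS (invE f)); exact: lbC. Qed.

Let Mp0 : 0 <= M0 + 3 * sup2 p. Proof. by rewrite addr_ge0// mulr_ge0// (sup2_ge0 c1). Qed.

Lemma inv_bound : exists2 K, 0 <= K & forall f g, meas g -> g =ae ev f ->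
  H2norm s g <= K * no f /\ forall x, `|ev f x| <= 2 * K * no f.
Proof.
have [K K0 HK] := H2norm_le ds mp Mp0 C0 lbC.
exists K => // f g mg hg; have hK := HK (inv f) g mg hg; rewrite (eqv_nrm sS (invE f)) in hK.
split=> // x; have n0 := nrm_ge0 hip f.
rewrite -ler_sqr ?nnegrE ?mulr_ge0// real_normK ?num_real//.
have sq : H2norm s g ^+ 2 <= (K * no f) ^+ 2 by rewrite ler_sqr ?nnegrE ?sqrtr_ge0// mulr_ge0.
rewrite (H2norm_sqr (H2TP (inv f)) mg hg) in sq.
have g0 := nsq_ge0 s (h0 (inv f)); have g1 := nsq_ge0 s (h1 (inv f)); have g2 := nsq_ge0 s (h2 (inv f)).
have := sup_h0 c1 (inv f) x; rewrite -/(ev f).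
have -> : (2 * K * no f) ^+ 2 = 4 * (K * no f) ^+ 2 by ring.
by move: ((K * no f) ^+ 2) (ev f x ^+ 2) sq => X Z; lra.
Qed.

Let S2 : hspace R := prodh S S.
Let s2 := hsip S2.
Notation no2 := (nrm (@hip R S2)).
Lemma prod_eqv (F G : S2) : eqv (@hip R S2) F G -> F.1 ~~> G.1 /\ F.2 ~~> G.2.
Proof.
move=> e; split; apply: nrm_le0.
  by apply: le_trans (prod_nrm_ge1 (F - G)) _; rewrite [leLHS]e.
by apply: le_trans (prod_nrm_ge2 (F - G)) _; rewrite [leLHS]e.
Qed.

(* With [y = inv f], the deviation [y] from [psi] at frequency [om + t] solves the stationary equation iff
   [f = - t (psi + y) + 3 psi y^2 + y^3]; the pair [(f, y^2)] makes this equation quadratic. *)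
Definition force : S2 := (- i p, 0).
Definition drift (F : S2) : S2 := (- i (inv F.1), 0).
Definition quad (F F' : S2) : S2 :=
  (mulop (fun x => 3 * h0 p x * ev F.1 x) (i (inv F'.1)) + mulop (ev F.1) F'.2,
   mulop (ev F.1) (i (inv F'.1))).

Lemma meas_ev f : meas (ev f). Proof. exact: meas_h0. Qed.
Lemma mult_h0 (y : Y) k : (forall x, `|h0 y x| <= k) -> mult s (h0 y) k.
Proof.
move=> b; split; [exact: meas_h0| |exact: aeW].
by have [_ _ l _ _] := H2TP y; have [] := (L2P _ _).1 l.
Qed.

Lemma quad_spec : exists tau kap, [/\ 0 <= tau, 0 <= kap,
  lin drift /\ (forall F, no2 (drift F) <= tau * no2 F),
  (forall F', lin (fun F => quad F F')) /\ (forall F, lin (quad F)) &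
  forall F F', no2 (quad F F') <= kap * (no2 F * no2 F')].
Proof.
have [K K0 HK] := inv_bound.
have sup f x : `|ev f x| <= 2 * K * no f := (HK f (ev f) (meas_ev f) (ae_refl _)).2 x.
have [P P0 HP] : exists2 P, 0 <= P & forall x, `|h0 p x| <= P.
  exists (Num.sqrt (sup2 p)); first exact: sqrtr_ge0.
  move=> x; rewrite -ler_sqr ?nnegrE ?sqrtr_ge0// sqr_sqrtr ?(sup2_ge0 c1)// real_normK ?num_real//.
  exact: (sup_h0 c1).
have m1 f : mult s (ev f) (2 * K * no f) := mult_h0 (sup f).
have m3 f : mult s (fun x => 3 * h0 p x * ev f x) (3 * P * (2 * K * no f)).
  have [a1 a2 _] := mult_h0 HP; have [b1 b2 _] := m1 f; split.
  - by apply: measM => //; exact: measZ.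
  - have p3 : ae_periodic s (fun=> 3 : R) by apply: periodic_ae; case: (s).
    exact: ae_periodicM (ae_periodicM p3 a2) b2.
  - apply: aeW => x; rewrite normrM; apply: ler_pM => //.
    by rewrite normrM ger0_norm// ler_wpM2l.
have e1 f (g : S) x : (mulop (ev f) g : L2T s) x = ev f x * (g : L2T s) x by rewrite (mulopE _ (m1 f)).
have e3 f (g : S) x : (mulop (fun y => 3 * h0 p y * ev f y) g : L2T s) x = 3 * h0 p x * ev f x * (g : L2T s) x.
  by rewrite (mulopE _ (m3 f)).
have n0 (f : S) := nrm_ge0 hip f.
exists C, ((3 * P * (2 * K) * C + 2 * K) + 2 * K * C); split=> //.
- by rewrite !addr_ge0 ?mulr_ge0.
- split=> [a F F'|F].
    apply: injective_projections; rewrite /=; last by rewrite scaler0 addr0.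
    by rewrite lin_inv opprD scalerN.
  apply: le_trans (prod_nrm_le _) _; rewrite /= (nrm0 sS) addr0 (nrmN sS).
  by apply: le_trans (inv_le _) _; rewrite ler_wpM2l//; exact: (prod_nrm_ge1 F).
- split=> [F' a F G|F a G H]; apply: injective_projections; rewrite /=.
  + apply: L2T_ext; apply/funext => x.
    have dec (u v w z : S) : (a *: (u + v) + (w + z) : L2T s) x =
      a * ((u : L2T s) x + (v : L2T s) x) + ((w : L2T s) x + (z : L2T s) x) by [].
    have dec' (u v : S) : (u + v : L2T s) x = (u : L2T s) x + (v : L2T s) x by [].
    have c31 f g h := congr2 +%R (e3 f g x) (e1 f h x).
    rewrite dec dec'; apply: etrans (c31 _ _ _) _.
    by apply: etrans _ (esym (congr2 +%R (congr2 *%R (erefl a) (c31 _ _ _)) (c31 _ _ _))); rewrite ev_lin; ring.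
  + apply: L2T_ext; apply/funext => x.
    have dec (u v : S) : (a *: u + v : L2T s) x = a * (u : L2T s) x + (v : L2T s) x by [].
    rewrite dec; apply: etrans (e1 _ _ _) _.
    by apply: etrans _ (esym (congr2 +%R (congr2 *%R (erefl a) (e1 _ _ _)) (e1 _ _ _))); rewrite ev_lin; ring.
  + rewrite lin_inv (lin_mulop (m3 _)) (lin_mulop (m1 _)) /= scalerDr.
    by rewrite addrACA.
  + by rewrite lin_inv (lin_mulop (m1 _)).
move=> F F'; apply: le_trans (prod_nrm_le _) _; rewrite /=.
have f1 := prod_nrm_ge1 F; have f2 := prod_nrm_ge1 F'; have f3 := prod_nrm_ge2 F'.
have N0 := nrm_ge0 (@hip R S2) F; have N1 := nrm_ge0 (@hip R S2) F'.
have b1 : no (mulop (fun x => 3 * h0 p x * ev F.1 x) (i (inv F'.1))) <= 3 * P * (2 * K) * C * (no2 F * no2 F').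
  apply: le_trans (bdd_mulop _ (m3 _) _) _; first by rewrite !mulr_ge0.
  have -> : 3 * P * (2 * K) * C * (no2 F * no2 F') = (3 * P * (2 * K * no2 F)) * (C * no2 F') by ring.
  apply: ler_pM => //; first by rewrite !mulr_ge0.
    by rewrite !ler_wpM2l// !mulr_ge0.
  by apply: le_trans (inv_le _) _; rewrite ler_wpM2l.
have b2 : no (mulop (ev F.1) F'.2) <= 2 * K * (no2 F * no2 F').
  apply: le_trans (bdd_mulop _ (m1 _) _) _; first by rewrite !mulr_ge0.
  by rewrite mulrA; apply: ler_pM => //; [rewrite !mulr_ge0|rewrite ler_wpM2l// mulr_ge0].
have b3 : no (mulop (ev F.1) (i (inv F'.1))) <= 2 * K * C * (no2 F * no2 F').
  apply: le_trans (bdd_mulop _ (m1 _) _) _; first by rewrite !mulr_ge0.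
  have -> : 2 * K * C * (no2 F * no2 F') = (2 * K * no2 F) * (C * no2 F') by ring.
  apply: ler_pM => //; [by rewrite !mulr_ge0|by rewrite ler_wpM2l// mulr_ge0|].
  by apply: le_trans (inv_le _) _; rewrite ler_wpM2l.
apply: le_trans (lerD (nrmD sS _ _) (lexx _)) _.
by rewrite 2!mulrDl; apply: lerD => //; apply: lerD.
Qed.

Lemma ev0 x : ev 0 x = 0.
Proof. by have := ev_lin (-1) 0 0 x; rewrite scaler0 addr0 mulN1r addNr. Qed.

Lemma mult_products f : exists2 k, mult s (ev f) k & exists k, mult s (fun x => 3 * h0 p x * ev f x) k.
Proof.
have bound (y : Y) : exists2 b, 0 <= b & forall x, `|h0 y x| <= b.
  exists (Num.sqrt (2 * nsq s (h0 y) + nsq s (h1 y))); first exact: sqrtr_ge0.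
  move=> x; rewrite -ler_sqr ?nnegrE ?sqrtr_ge0// sqr_sqrtr ?addr_ge0 ?mulr_ge0 ?nsq_ge0//.
  by rewrite real_normK ?num_real//; exact: (sup_h0 c1).
have [b b0 hb] := bound (inv f); have [d d0 hd] := bound p.
have [a1 a2 _] := mult_h0 hd; have m1 := mult_h0 hb; have [b1 b2 _] := m1.
exists b => //; exists (3 * d * b); split.
- by apply: measM => //; exact: measZ.
- have p3 : ae_periodic s (fun=> 3 : R) by apply: periodic_ae; case: (s).
  exact: ae_periodicM (ae_periodicM p3 a2) b2.
- apply: aeW => x; rewrite normrM; apply: ler_pM => //.
    by rewrite normrM ger0_norm// ler_wpM2l.
  exact: hb.
Qed.

Definition psum (c : nat -> S2) t : S2 := xget 0 [set F | tends (partial c t) F].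

Lemma psum_tends c rho t : 0 < rho -> radius c rho -> `|t| * rho < 1 -> tends (partial c t) (psum c t).
Proof.
move=> r0 rc tr; have [F HF] := partial_tends r0 rc tr.
exact: (@xgetPex _ 0 [set F | tends (partial c t) F] (ex_intro _ F HF)).
Qed.

(** The fixed part [z] drops out of difference quotients, and the quadratic remainder of the series
    becomes an H^2 error of order [h] through the bounded inverse of [L_+]. *)
Lemma curve_derivative (P : R -> R -> R) (z : R -> R) c rho nu w : 0 < rho -> radius c rho -> 0 < nu ->
  nu * rho < 1 ->
  (forall w, `|w - om| < nu -> H2 s (P w) /\ P w =ae (fun x => z x + ev (psum c (w - om)).1 x)) ->
  `|w - om| < nu -> is_H2_derivative s P w (ev (psum (dcoef c) (w - om)).1).
Proof.
move=> r0 rc nu0 nur HP wI; split; first exact: H2_h0.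
have [K K0 HK] := inv_bound.
have [B B0 HB] := power_series_derivative r0 rc (ltW nu0) nur.
have small (t : R) : `|t| < nu -> `|t| * rho < 1.
  by move=> h; apply: le_lt_trans nur; rewrite ler_wpM2r// ltW.
have key h : h != 0 -> `|w + h - om| < nu ->
    H2norm s (fun x => h^-1 * (P (w + h) x - P w x) - ev (psum (dcoef c) (w - om)).1 x) <= K * B * `|h|.
  move=> h0' hI; have [Hw Ew] := HP w wI; have [Hh Eh] := HP _ hI.
  have tE : w + h - om = (w - om) + h by rewrite addrAC.
  rewrite tE in Eh hI.
  have T0 := psum_tends r0 rc (small _ wI); have T1 := psum_tends r0 rc (small _ hI).
  have T2 := psum_tends r0 (radius_dcoef r0 rc) (small _ wI).
  have est := HB _ _ _ _ _ (ltW wI) (ltW hI) T0 T1 T2.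
  move: (psum c (w - om)) (psum c (w - om + h)) (psum (dcoef c) (w - om)) Ew Eh est => F Fh F' Ew Eh est.
  have mf : meas (fun x => h^-1 * (P (w + h) x - P w x) - ev F'.1 x).
    exact: (measB (measZ _ (measB (H2_meas Hh) (H2_meas Hw))) (meas_ev _)).
  have ef : (fun x => h^-1 * (P (w + h) x - P w x) - ev F'.1 x) =ae ev (h^-1 *: (Fh.1 - F.1 - h *: F'.1)).
    apply: aeS2 Ew Eh => x -> ->.
    have -> : h^-1 *: (Fh.1 - F.1 - h *: F'.1) = h^-1 *: (-1 *: F.1 + Fh.1) + (-1 *: F'.1 + 0).
      by rewrite addr0 !scaleN1r [- F.1 + _]addrC scalerBr scalerA mulVf// scale1r.
    rewrite !ev_lin ev0; ring.
  apply: le_trans (HK _ _ mf ef).1 _; rewrite (nrmZ sS) -mulrA ler_wpM2l// normfV.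
  have n1 : no (Fh.1 - F.1 - h *: F'.1) <= B * h ^+ 2.
    by apply: le_trans est; exact: (prod_nrm_ge1 (Fh - F - h *: F')).
  rewrite mulrC ler_pdivrMr ?normr_gt0//; apply: le_trans n1 _.
  by rewrite -mulrA ler_wpM2l// -expr2 real_normK ?num_real.
have pos h : 0 <= H2norm s (fun x => h^-1 * (P (w + h) x - P w x) - ev (psum (dcoef c) (w - om)).1 x).
  exact: sqrtr_ge0.
have room : 0 < nu - `|w - om| by rewrite subr_gt0.
apply: (cvg0_linear (mulr_ge0 K0 B0) room pos) => h hn h1; apply: (key h hn).
rewrite addrAC; apply: le_lt_trans (ler_normD _ _) _; lra.
Qed.

Lemma analytic_curve_smooth (P : R -> R -> R) (z : R -> R) c rho nu : 0 < rho -> radius c rho -> 0 < nu ->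
  nu * rho < 1 ->
  (forall w, `|w - om| < nu -> H2 s (P w) /\ P w =ae (fun x => z x + ev (psum c (w - om)).1 x)) ->
  smooth_H2_curve s `]om - nu, om + nu[%classic P.
Proof.
move=> r0 rc nu0 nur HP.
have IE w : `]om - nu, om + nu[%classic w -> `|w - om| < nu.
  by rewrite /= in_itv/= ltr_norml => /andP[a b]; lra.
have it k : exists zk ck, radius ck rho /\ forall w, `|w - om| < nu ->
    H2 s (iter k (dH2 s) P w) /\ iter k (dH2 s) P w =ae (fun x => zk x + ev (psum ck (w - om)).1 x).
  elim: k => [|k [zk [ck [rk Hk]]]]; first by exists z, c.
  (* The derivative is again a curve of this kind, with fixed part 0 and the same [rho], so all
     orders share one interval. *)
  exists (fun=> 0), (dcoef ck); split; first exact: radius_dcoef.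
  move=> w wI; have D := curve_derivative r0 rk nu0 nur Hk wI.
  have D' : is_H2_derivative s (iter k (dH2 s) P) w (iter k.+1 (dH2 s) P w).
    by rewrite iterS; exact: (@xgetPex _ (cst 0) [set v | is_H2_derivative s (iter k (dH2 s) P) w v] (ex_intro _ _ D)).
  split; first exact: (proj1 D').
  have room : 0 < nu - `|w - om| by rewrite subr_gt0.
  have Hn h : `|h| < nu - `|w - om| -> H2 s (iter k (dH2 s) P (w + h)).
    move=> hh; apply: (proj1 (Hk _ _)); rewrite addrAC; apply: le_lt_trans (ler_normD _ _) _; lra.
  by have E := H2_derivative_unique room Hn D' D; apply: aeS E => x ->; rewrite add0r.
split=> [w /IE wI|k w /IE wI]; first by have [] := HP w wI.
have [zk [ck [rk Hk]]] := it k.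
by exists (ev (psum (dcoef ck) (w - om)).1); exact: (curve_derivative r0 rk nu0 nur Hk wI).
Qed.

Lemma continuation_exists : exists nu P, continuation s V mu om psi nu P /\
  exists2 e : Y, dH2 s P om =ae h0 e & Aop Qp e ~~> - i p.
Proof.
have [tau [kap [tau0 kap0 [lT bT] [lQ1 lQ2] bQ]]] := quad_spec.
have [rho r0 rs] := sol_radius force bT tau0 lQ1 lQ2 bQ kap0.
set c := sol force drift quad in rs *.
(* Half the guaranteed radius, so that the closed interval stays strictly inside the disc of
   convergence. *)
pose nu := rho^-1 / 2; have nu0 : 0 < nu by rewrite divr_gt0// invr_gt0.
have nur : nu * rho < 1 by rewrite /nu mulrAC mulVf ?gt_eqF//; lra.
pose P w x := h0 p x + ev (psum c (w - om)).1 x.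
have PY w : P w = h0 (p + inv (psum c (w - om)).1) by apply/funext.
have HP w : `|w - om| < nu -> H2 s (P w) /\ P w =ae (fun x => h0 p x + ev (psum c (w - om)).1 x).
  by move=> _; split; [rewrite PY; exact: H2_h0|exact: ae_refl].
have sm := analytic_curve_smooth r0 rs nu0 nur HP.
have small (t : R) : `|t| < nu -> `|t| * rho < 1.
  by move=> h; apply: le_lt_trans nur; rewrite ler_wpM2r// ltW.
have Pom : P om =ae psi.
  have z : psum c 0 ~~> 0.
    apply: (tends_uniq (psum_tends r0 rs (small 0 _))); first by rewrite normr0.
    move=> e e0; exists 0%N => n _; rewrite subr0 /partial big1 ?(nrm0 s2) ?ltW// => k _.
    case: k => -[|k] ? /=; first by rewrite [c _]sol0 ?scaler0//.
    by rewrite exprS mul0r scale0r.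
  have z1 : (psum c 0).1 ~~> (0 : S).
    by apply: nrm_le0; apply: le_trans (prod_nrm_ge1 (psum c 0 - 0)) _; rewrite [leLHS]z.
  by apply: aeS hp => x ->; rewrite /P subrr (ev_eqv z1) ev0 addr0.
have st w : om - nu < w < om + nu -> stationary V mu w (P w).
  move=> wI; have wn : `|w - om| < nu by rewrite ltr_norml; lra.
  have eq := sol_equation lT bT tau0 lQ1 lQ2 bQ kap0 r0 rs (small _ wn) (psum_tends r0 rs (small _ wn)).
  move: (psum c (w - om)) (PY w) eq => F PE eq; rewrite PE.
  have [e1 e2] := prod_eqv eq.
  have eq1 : F.1 ~~> (w - om) *: (- i p + - i (inv F.1)) +
      (mulop (fun x => 3 * h0 p x * ev F.1 x) (i (inv F.1)) + mulop (ev F.1) F.2) := e1.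
  have eq2 : F.2 ~~> (w - om) *: (0 + 0) + mulop (ev F.1) (i (inv F.1)) := e2.
  have [k1 m1 [k3 m3]] := mult_products F.1.
  have add (f g : S) x : (f + g : L2T s) x = (f : L2T s) x + (g : L2T s) x by [].
  have scl a' (f : S) x : (a' *: f : L2T s) x = a' * (f : L2T s) x by [].
  have opp (f : S) x : (- f : L2T s) x = - (f : L2T s) x by [].
  have {}eq1 : {ae leb, forall x, (F.1 : L2T s) x = (w - om) * (- h0 p x - ev F.1 x) +
      (3 * h0 p x * ev F.1 x * ev F.1 x + ev F.1 x * (F.2 : L2T s) x)}.
    move/(eqv_aeE _ _ ds): eq1; apply: aeS => x ->; rewrite !add scl add !opp !incl_eq.
    by rewrite (mulopE _ m3) (mulopE _ m1) incl_eq.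
  have {}eq2 : {ae leb, forall x, (F.2 : L2T s) x = ev F.1 x * ev F.1 x}.
    move/(eqv_aeE _ _ ds): eq2; apply: aeS => x ->; rewrite addr0 scaler0 add0r.
    by rewrite (mulopE _ m1) incl_eq.
  have /(eqv_aeE _ _ ds) eq3 := invE F.1; rewrite (AopE mp) in eq3.
  have /(eqv_aeE _ _ ds) eq4 := Lm_psi c1 mQ0 hpsi hp stat; rewrite (AopE (mult_Qm c1 mQ0 hpsi hp)) in eq4.
  have [_ eq5] := rep_H2Y (meas_h0 (p + inv F.1)) (ae_refl _).
  have E1 := aeS2 (fun x => @conj _ _) eq1 eq2; have E2 := aeS2 (fun x => @conj _ _) eq3 eq4.
  have E3 := aeS2 (fun x => @conj _ _) eq5 hp.
  have E4 := aeS2 (fun x => @conj _ _) E1 E2.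
  apply: aeS2 E4 E3 => x [[a1 a2] [a3 a4]] [a5 a6]; rewrite a5.
  have -> : h2 (p + inv F.1) x = h2 p x + h2 (inv F.1) x by [].
  have -> : h0 (p + inv F.1) x = h0 p x + ev F.1 x by [].
  rewrite a6 in a3 a4; rewrite a2 in a1; rewrite -/(ev F.1) a1 in a3.
  have z0 : (0 : L2T s) x = 0 by [].
  rewrite z0 in a4; move: a3 a4; move: (h2 p x) (h2 (inv F.1) x) (h0 p x) (ev F.1 x) => b c' d e a3 a4.
  have b1 : b = (mu * V x + om - d ^+ 2) * d by lra.
  have c1' : c' = (mu * V x + om - 3 * d ^+ 2) * e - ((w - om) * (- d - e) + (3 * d * e * e + e * (e * e))) by lra.
  by rewrite b1 c1'; ring.
exists nu, P; split; first by split.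
have [v dv] := sm.2 0%N om (ltac:(by rewrite /= in_itv/= ltrBlDr ltrDl andbb)).
have D : is_H2_derivative s P om (dH2 s P om).
  exact: (@xgetPex _ (cst 0) [set v | is_H2_derivative s P om v] (ex_intro _ v dv)).
have [e he] := H2_repY (proj1 D); exists e => //.
apply: (derivative_linearized c1 mQ0 M00 hpsi hp stat nu0 D Pom he) => w wI; split; last exact: st.
by rewrite PY; exact: H2_h0.
Qed.

End Continuation.

(** * The equivalence *)

Section NegativeEigenvalues.
Variables (R : realType) (S : hspace R) (Y : lmodType R) (i : Y -> S).
Hypothesis li : lin i.
Variables (L : Y -> S) (p : Y) (c : R).
Hypotheses (lL : lin L) (sL : symop i L) (c0 : 0 < c) (gp : gap i L p c).
Notation "u ~~> v" := (eqv hip u v) (at level 70).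
Notation N y := (hip (i y) (i y)).
Let sS := hsip S.

Lemma eigenvalue_not_orthogonal m y : L y ~~> m *: i y -> m < 0 -> 0 < N y -> hip (i y) (i p) != 0.
Proof.
move=> ey m0 Ny; apply/negP => /eqP yp; have := gp yp; rewrite (eqv_ipl sS _ ey) (sipZl sS).
by have := mulr_gt0 c0 Ny; have := nmulr_rlt0 (N y) m0; rewrite Ny => h1 h2; lra.
Qed.

(** The gap on the complement of [p] leaves no room for two negative directions: the combination of
    [y] and [z] orthogonal to [p] would have a negative form unless it has norm zero. *)
Lemma negative_eigenvectors m m' y z : L y ~~> m *: i y -> L z ~~> m' *: i z -> m < 0 -> m' < 0 ->
  0 < N y -> 0 < N z -> m' = m /\ exists k, i z ~~> k *: i y.
Proof.
move=> ey ez m0 m'0 Ny Nz.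
have yp := eigenvalue_not_orthogonal ey m0 Ny; have zp := eigenvalue_not_orthogonal ez m'0 Nz.
pose a := hip (i z) (i p); pose b := - hip (i y) (i p).
have [u [uE uL up]] : exists u, [/\ i u = a *: i y + b *: i z, L u = a *: L y + b *: L z & hip (i u) (i p) = 0].
  exists (a *: y + b *: z); split; first by rewrite li (linZ li).
    by rewrite lL (linZ lL).
  by rewrite li (linZ li) (sipDl sS) !(sipZl sS) /a /b; ring.
have yz : (m' - m) * hip (i y) (i z) = 0.
  have := sL y z; rewrite (eqv_ipl sS _ ey) (eqv_ipl sS _ ez) !(sipZl sS) (sipC sS (i z)) mulrBl => ->.
  exact: subrr.
have Nu : N u = a ^+ 2 * N y + 2 * a * b * hip (i y) (i z) + b ^+ 2 * N z.
  by rewrite uE !(sipDl sS) !(sipDr sS) !(sipZl sS) !(sipZr sS) (sipC sS (i z) (i y)); ring.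
have qu : hip (L u) (i u) = m * (a ^+ 2 * N y) + (m + m') * a * b * hip (i y) (i z) + m' * (b ^+ 2 * N z).
  rewrite uL uE !(sipDl sS) !(sipDr sS) !(sipZl sS) !(sipZr sS) !(eqv_ipl sS _ ey) !(eqv_ipl sS _ ez).
  by rewrite !(sipZl sS) (sipC sS (i z) (i y)); ring.
have gu := gp up; have Nu0 : 0 <= N u := sipP sS _.
have b0 : b != 0 by rewrite oppr_eq0.
have [mm|mm] := eqVneq m' m; last first.
  move: yz => /eqP; rewrite mulf_eq0 subr_eq0 (negbTE mm)/= => /eqP yz.
  have b2 : 0 < b ^+ 2 * N z by rewrite mulr_gt0// exprn_even_gt0.
  have a2 : 0 <= a ^+ 2 * N y by rewrite mulr_ge0 ?sqr_ge0 ?ltW.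
  move: gu qu Nu; rewrite yz !mulr0 addr0 => gu qu Nu; rewrite qu in gu.
  have h1 : 0 <= c * N u by rewrite mulr_ge0// ltW.
  have h2 : m * (a ^+ 2 * N y) <= 0 by rewrite nmulr_rle0.
  have h3 : m' * (b ^+ 2 * N z) < 0 by rewrite nmulr_rlt0.
  exfalso; lra.
split=> //; have qm : hip (L u) (i u) = m * N u by rewrite qu Nu mm; ring.
have Nu00 : N u = 0.
  apply/eqP; rewrite eq_le Nu0 andbT leNgt; apply/negP => h.
  by move: gu; rewrite qm; have := mulr_gt0 c0 h; have := nmulr_rlt0 (N u) m0; rewrite h => h1 h2; lra.
exists (- a / b); have u0 : i u ~~> 0 by rewrite /eqv subr0; apply/nrm_eq0.
have -> : i z = b^-1 *: (i u - a *: i y) by rewrite uE addrAC subrr add0r scalerA mulVf// scale1r.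
apply: (eqv_trans sS (eqvZ sS _ (eqvB sS u0 (eqv_refl sS _)))).
by rewrite sub0r -scaleNr scalerA [b^-1 * _]mulrC; exact: eqv_refl.
Qed.

End NegativeEigenvalues.

Section PulseSpectrum.
Variables (R : realType) (s : domain R) (c1 : circle1 s).
Notation leb := (@lebesgue_measure R).
Notation S := (L2h s).
Notation Y := (H2T s).
Notation i := (@incl R s).
Notation no := (nrm hip).
Notation "f =ae g" := {ae leb, forall x, f x = g x} (at level 70).
Notation "u ~~> v" := (eqv hip u v) (at level 70).
Let sS := hsip S.
Let ds := circle1_dpos c1.
Variables (V psi : R -> R) (mu om M0 d : R) (p e : Y).
Notation Q0 := (fun x => mu * V x + om).
Notation Qp := (fun x => mu * V x + om - 3 * psi x ^+ 2).
Notation Qm := (fun x => mu * V x + om - psi x ^+ 2).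
Notation Lop := (Lfull V mu om psi).
Hypotheses (mQ0 : mult s Q0 M0) (M00 : 0 <= M0) (hpsi : H2 s psi) (hp : psi =ae h0 p)
  (stat : stationary V mu om psi) (d0 : 0 < d) (cA0 : coer i (Aop Q0) d) (oA0 : @solv R S Y (Aop Q0)).
Hypotheses (Np : 0 < hip (i p) (i p)) (ep : Aop Qp e ~~> - i p).
Variables (cm : R).
Hypotheses (cm0 : 0 < cm) (gm : gap i (Aop Qm) p cm).
Let mp := mult_Qp c1 mQ0 hpsi hp.
Let mm := mult_Qm c1 mQ0 hpsi hp.

Lemma spectrum_imaginary cp z : 0 < cp -> gap i (Aop Qp) p cp -> hip (i e) (i p) != 0 ->
  spectrum s Lop z -> complex.Re z = 0.
Proof.
move=> cp0 gp ep0; case: z => a b hz; apply/eqP; apply/negPn/negP => a0; apply: hz.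
exact: (stable_of_gap c1 mQ0 hpsi hp stat d0 cA0 oA0 b cp0 gp cm0 gm ep ep0 Np a0).
Qed.

Lemma spectrum_unstable : hip (i e) (i p) < 0 -> exists2 z, spectrum s Lop z & 0 < complex.Re z.
Proof.
move=> ep0.
have [u up qu] := slope_neg_direction (@lin_incl R s) (lin_Aop mp) (sym_Aop ds mp) ep ep0
  (psi_form_lt0 c1 mQ0 hpsi hp stat Np).
have [l l0 hl] := unstable_of_direction c1 mQ0 hpsi hp stat d0 cA0 oA0 cm0 gm Np up qu.
by exists (l +i* 0).
Qed.

Lemma Lminus_spectrum : no_negative_eigenvalue s (Lminus V mu om psi) /\
  simple_eigenvalue s (Lminus V mu om psi) 0.
Proof.
have Hp : Aop Qm p ~~> 0 *: i p by rewrite scale0r; exact: (Lm_psi c1 mQ0 hpsi hp stat).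
have orth r y : Aop Qm y ~~> r *: i y -> r != 0 -> hip (i y) (i p) = 0.
  move=> ey r0; have := sym_Aop ds mm y p; rewrite (eqv_ipl sS _ ey) (eqv_ipl sS _ Hp) !(sipZl sS) mul0r.
  by move=> /eqP; rewrite mulf_eq0 (negbTE r0) => /eqP.
rewrite LminusE; split.
  move=> r r0 /(eigenvalue_schr ds mm)[y Ny ey].
  have := gm (orth r y ey (ltr0_neq0 r0)); rewrite (eqv_ipl sS _ ey) (sipZl sS).
  by have := mulr_gt0 cm0 Ny; have := nmulr_rlt0 (hip (i y) (i y)) r0; rewrite Ny => h1 h2; lra.
apply: (schr_simple ds mm Np Hp) => z ez.
pose k := hip (i z) (i p) / hip (i p) (i p); exists k.
have [u [uE uL]] : exists u : Y, i u = i z - k *: i p /\ Aop Qm u = Aop Qm z - k *: Aop Qm p :> S.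
  exists (z - k *: p); rewrite (linB (@lin_incl R s)) (linZ (@lin_incl R s)).
  by rewrite (linB (lin_Aop mm)) (linZ (lin_Aop mm)).
have up : hip (i u) (i p) = 0.
  by rewrite uE (sipDl sS) (sipNl sS) (sipZl sS) /k divfK ?subrr// gt_eqF.
have Lu : Aop Qm u ~~> 0.
  rewrite uL; have := eqvB sS ez (eqvZ sS k Hp); rewrite !scale0r scaler0 subr0; exact.
have := gm up; rewrite (eqv_ipl sS _ Lu) (sip0l sS) => h.
have Nu : hip (i u) (i u) = 0.
  by apply/eqP; rewrite eq_le (sipP sS) andbT -(pmulr_rle0 _ cm0).
by have := (nrm_eq0 sS (i u)).2 Nu; rewrite uE.
Qed.

Lemma Lplus_spectrum C cp : 0 <= C -> lb i (Aop Qp) C -> @solv R S Y (Aop Qp) -> 0 < cp ->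
  gap i (Aop Qp) p cp -> invertible_op s (Lplus V mu om psi) /\
  one_simple_negative_eigenvalue s (Lplus V mu om psi).
Proof.
move=> C0 lbC oL cp0 gp; rewrite LplusE; split.
  by apply: (schr_invertible ds mp _ C0 oL lbC); rewrite addr_ge0// mulr_ge0// (sup2_ge0 c1).
have mw := mult_3psi2 c1 hpsi hp.
have w0 x : 0 <= 3 * psi x ^+ 2 by rewrite mulr_ge0 ?sqr_ge0.
have ipsi : integ s (fun x => psi x ^+ 2).
  by have [_ _ hL _ _] := hpsi; have [_ _] := (L2P _ _).1 hL.
have cW := rel_compact_mulop c1 mQ0 M00 mw w0 (integZ 3 ipsi).
have AE y : Aop Qp y = Aop Q0 y - mulop (fun x => 3 * psi x ^+ 2) (i y) := Aop_sub y mQ0 mw.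
have s20 : 0 <= 3 * sup2 p by rewrite mulr_ge0// (sup2_ge0 c1).
(* Existence of the negative eigenvalue: [gap_or_eigenvector] is used with the constraint vector 0,
   which constrains nothing. Its first alternative would make [L_+] coercive, contradicting the
   negative form at the pulse. *)
have i0 : i (0 : Y) = 0 := lin0 (@lin_incl R s).
have e0 : Aop Qp (0 : Y) ~~> 0 *: i 0 by rewrite scale0r (lin0 (lin_Aop mp)); exact: eqv_refl.
have [[k [k0 Hk]]|[m [y [m0 Ny _ ey]]]] := gap_or_eigenvector (@lin_incl R s) (lin_Aop mQ0)
  (lin_mulop mw) (sym_Aop ds mQ0) (symb_mulop mw) cA0 d0 oA0 (bdd_mulop s20 mw) cW AE e0.
  exfalso; have := Hk p; rewrite i0 (sip0r sS) => /(_ erefl).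
  have := psi_form_lt0 c1 mQ0 hpsi hp stat Np; have := mulr_gt0 k0 Np; lra.
have m00 : m < 0.
  move: m0; rewrite le_eqVlt => /orP[/eqP mz|//]; exfalso.
  rewrite mz scale0r in ey; have := lbC y; move: ey; rewrite /eqv subr0 => ->; rewrite mulr0.
  by move=> /(nrm_le0 (B := hip))/(nrm_eq0 sS) h; rewrite h ltxx in Ny.
have uniq := negative_eigenvectors (@lin_incl R s) (lin_Aop mp) (sym_Aop ds mp) cp0 gp ey.
exists m; split=> //.
  apply: (schr_simple ds mp Ny ey) => z ez.
  have [Nz|Nz] := eqVneq (hip (i z) (i z)) 0.
    by exists 0; rewrite scale0r /eqv subr0; apply/nrm_eq0.
  have Nz0 : 0 < hip (i z) (i z) by rewrite lt_neqAle eq_sym Nz (sipP sS).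
  exact: (uniq _ _ ez m00 m00 Ny Nz0).2.
move=> m' m'0 /(eigenvalue_schr ds mp)[z Nz ez].
exact: (uniq _ _ ez m00 m'0 Ny Nz).1.
Qed.
End PulseSpectrum.

Theorem theorem8p20 (R : realType) (T mu omega0 : R) (V psi0 : R -> R)
    (nu : R) (psit : R -> R -> R)
    (N0 : nat) (psi_per chi a : nat -> R -> R)
    (T_gt0 : 0 < T) (V_C1 : C1 V) (V_periodic : periodic V T)
    (psi0_nondegenerate : nondegenerate_solution V mu omega0 psi0)
    (psit_continuation : continuation Line V mu omega0 psi0 nu psit)
    (Lplus_psi0 :
       one_simple_negative_eigenvalue Line (Lplus V mu omega0 psi0))
    (Lminus_psi0 : no_negative_eigenvalue Line (Lminus V mu omega0 psi0))
    (slope_neq0 : L2inner Line (dH2 Line psit omega0) psi0 <> 0)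
    (spectral_bound :
       (ereal_sup [set (complex.Re z)%:E | z in spectrum Line (Hill V mu)]
          < omega0%:E)%E)
    (pulses : periodic_pulses T V mu omega0 psi0 N0 psi_per chi a) :
  exists2 N : nat, (N0 <= N)%N &
  forall n : nat, (N <= n)%N ->
    let per := Circle (n%:R * T) in
    let stable := spectrally_stable V mu omega0 psi0 in
    let slope := 0 < L2inner Line (dH2 Line psit omega0) psi0 in
    let per_stable := coperiodically_stable T V mu omega0 n (psi_per n) in
    ((stable <-> slope) /\ (slope <-> per_stable)) /\
    (stable \/ slope \/ per_stable ->
     [/\ no_negative_eigenvalue per (Lminus V mu omega0 (psi_per n)) /\
         simple_eigenvalue per (Lminus V mu omega0 (psi_per n)) 0,
         invertible_op per (Lplus V mu omega0 (psi_per n)) /\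
         one_simple_negative_eigenvalue per (Lplus V mu omega0 (psi_per n)) &
         exists nu_n : R, exists psit_n : R -> R -> R,
           continuation per V mu omega0 (psi_per n) nu_n psit_n /\
           0 < L2inner per (dH2 per psit_n omega0) (psi_per n)]).
Proof.
have [hpsi stat inv] := psi0_nondegenerate.
have [p hp] := H2_repY hpsi.
have [M0 M00 HM] := potential_mult V_C1 V_periodic T_gt0 mu omega0.
have [mV mQ] := HM Line (or_introl erefl).
have [d [d0 cA oA]] := coercive_line mV mQ M00 spectral_bound.
pose c1 : circle1 (Line : domain R) := I.
have sl := hsip (L2h (Line : domain R)).
have [nu0 [smH smD] Pom st] := psit_continuation.
have [v dv] := smD 0%N omega0 (ltac:(by rewrite /= in_itv/= ltrBlDr ltrDl andbb)).
have D : is_H2_derivative Line psit omega0 (dH2 Line psit omega0).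
  exact: (@xgetPex _ (cst 0) [set v | is_H2_derivative Line psit omega0 v] (ex_intro _ v dv)).
have [e he] := H2_repY (proj1 D).
have ep := derivative_linearized c1 mQ M00 hpsi hp stat nu0 D Pom he (fun w wI =>
  conj (smH w (ltac:(by rewrite /= in_itv/=))) (st w wI)).
have slopeE : L2inner Line (dH2 Line psit omega0) psi0 = hip (incl e) (incl p).
  rewrite [RHS]/(L2inner Line _ _) !incl_eq.
  exact: (ip_ae Line (H2_meas (proj1 D)) (H2_meas hpsi) (meas_h0 e) (meas_h0 p) he hp).
rewrite slopeE in slope_neq0 *.
have sg0 : hip (incl e) (incl p) != 0 by apply/eqP.
have Np : 0 < hip (incl p) (incl p).
  rewrite lt_neqAle (sipP sl) andbT eq_sym; apply/negP => /eqP h; move/eqP: sg0; apply.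
  have z : eqv hip (incl p) 0 by rewrite /eqv subr0; apply/nrm_eq0.
  by rewrite (eqv_ipr sl _ z) (sip0r sl).
have mp := mult_Qp c1 mQ hpsi hp; have mm := mult_Qm c1 mQ hpsi hp.
have ds : dpos (Line : domain R) := I.
have [cm cm0 gm] := gap_Lminus mQ M00 hpsi hp stat d0 cA oA Np Lminus_psi0.
have [oL [Cl0 Cl00 lbL0]] := Lplus_inverse mQ hpsi hp inv.
have [phi [cphi [cphi0 gphi]]] := gap_Lplus mQ M00 hpsi hp d0 cA oA lbL0 Lplus_psi0.
(* The constant is capped by [d] so that the far operator, coercive with constant [d], satisfies the
   same estimate. *)
have full_min q c : 0 < c -> gap (@incl R Line) q p c -> lin q -> symop (@incl R Line) q ->
    exists c' K, [/\ 0 < c', c' <= d, 0 <= K &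
      forall y, c' * hip (incl y) (incl y) <= hip (q y) (incl y) + K * hip (incl y) (incl p) ^+ 2].
  move=> c0 gq lq sq; have [c' [K [c'0 K0 H]]] := gap_full (@lin_incl R Line) lq sq Np c0 gq.
  exists (Num.min c' d), K; rewrite lt_min c'0 d0 ge_min lexx orbT; split=> // y.
  by apply: le_trans (H y); rewrite ler_wpM2r ?(sipP sl)// ge_min lexx.
have [cm' [km [cm'0 cm'd km0 gm']]] := full_min _ _ cm0 gm (lin_Aop mm) (sym_Aop ds mm).
have gappos : 0 < hip (incl e) (incl p) -> exists2 c, 0 < c & gap (@incl R Line) (Aop (fun x => mu * V x + omega0 - 3 * psi0 x ^+ 2)) p c.
  exact: (gap_slope_pos (@lin_incl R Line) (lin_Aop mp) (sym_Aop ds mp) cphi0 gphi ep).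
(* [L_+] has this estimate only for positive slope; otherwise placeholder values allow one choice of
   [k] for both signs. *)
have [cp [kp [cp0 cpd kp0 gp]]] : exists cp kp, [/\ 0 < cp, cp <= d, 0 <= kp & 0 < hip (incl e) (incl p) ->
    forall y, cp * hip (incl y) (incl y) <= hip (Aop (fun x => mu * V x + omega0 - 3 * psi0 x ^+ 2) y) (incl y)
      + kp * hip (incl y) (incl p) ^+ 2].
  case: (ltP 0 (hip (incl e) (incl p))) => h.
    have [c c0 gc] := gappos h; have [c' [K [a1 a2 a3 a4]]] := full_min _ _ c0 gc (lin_Aop mp) (sym_Aop ds mp).
    by exists c', K.
  by exists d, 0.
(* One constant for the lower bounds of [L_+] and of the far operator. *)
pose Cl := Num.max Cl0 d^-1.
have Cl1 : 0 <= Cl by rewrite le_max Cl00.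
have lbL : lb (@incl R Line) (Aop (fun x => mu * V x + omega0 - 3 * psi0 x ^+ 2)) Cl.
  by move=> y; apply: le_trans (lbL0 y) _; rewrite ler_wpM2r ?nrm_ge0// le_max lexx.
have dCl : d^-1 <= Cl by rewrite le_max lexx orbT.
have [B B0 HB] := pulses_transfer T_gt0 pulses hp (fun x => mu * V x + omega0).
have [k [k01 Hk]] := periodic_consequences B mQ M00 hpsi hp d0 cA Np cm'0 cm'd km0 cp0 cpd kp0 gm' gp Cl1 lbL dCl ep sg0.
have [N HN] := HB k k01.
exists (maxn N0 N); first exact: leq_maxl.
move=> n nN per stable slope per_stable.
have [N0n L1 HT] := HN n (leq_trans (leq_maxr _ _) nN).
have [pulse_n _ _] := pulses; have [hpn statn _ _] := pulse_n n N0n.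
have [q hq] := H2_repY hpn.
have c1n : circle1 per := L1.
have dsn := circle1_dpos c1n.
have sn := hsip (L2h per).
have [_ mQn] := HM per (or_intror (ex_intro _ n erefl)).
have [[d' [d'0 cAn oAn]] [cmn cmn0 gmn] [C' [C'0 lbn oLn]] Nq [sign gpn]] :=
  Hk _ _ q L1 mQn hpn hq (HT q hq).
have [phin ephin] := oLn (- incl q : L2h per).
have sg' := sign phin ephin.
have line_unstable : ~ slope -> ~ stable.
  move=> ns st0; have neg : hip (incl e) (incl p) < 0.
    by rewrite lt_neqAle sg0 leNgt; apply/negP.
  have [z hz z0] := spectrum_unstable c1 mQ hpsi hp stat d0 cA oA Np ep cm0 gm neg.
  by have := st0 z hz; rewrite leNgt z0.
have line_stable : slope -> stable.
  move=> sp z hz; have [cp' cp'0 gp'] := gappos sp.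
  by rewrite (spectrum_imaginary c1 mQ hpsi hp stat d0 cA oA Np ep cm0 gm cp'0 gp' sg0 hz).
have per_unstable : ~ slope -> ~ per_stable.
  move=> ns st0; have neg : hip (incl e) (incl p) < 0.
    by rewrite lt_neqAle sg0 leNgt; apply/negP.
  have neg' : hip (incl phin) (incl q) < 0 by rewrite -(nmulr_rgt0 _ neg).
  have [z hz z0] := spectrum_unstable c1n mQn hpn hq statn d'0 cAn oAn Nq ephin cmn0 gmn neg'.
  by have := st0 z hz => z0'; rewrite z0' ltxx in z0.
have per_pos : slope -> per_stable.
  move=> sp z hz; have [cp' cp'0 gp'] := gpn sp.
  have pos' : hip (incl phin) (incl q) != 0 by rewrite gt_eqF// -(pmulr_rgt0 _ sp).
  exact: (spectrum_imaginary c1n mQn hpn hq statn d'0 cAn oAn Nq ephin cmn0 gmn cp'0 gp' pos' hz).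
have line_slope : stable -> slope by move=> h; apply: contrapT => ns; exact: (line_unstable ns h).
have per_slope : per_stable -> slope by move=> h; apply: contrapT => ns; exact: (per_unstable ns h).
split; first by split; split.
move=> any; have sp : slope by case: any => [/line_slope|[|/per_slope]].
have [cp' cp'0 gp'] := gpn sp.
split.
- exact: (Lminus_spectrum c1n mQn hpn hq statn Nq cmn0 gmn).
- exact: (Lplus_spectrum c1n mQn M00 hpn hq statn d'0 cAn oAn Nq C'0 lbn oLn cp'0 gp').
have [nu_n [psit_n [cont [e' he' ee']]]] := continuation_exists c1n mQn M00 hpn hq statn C'0 lbn oLn.
exists nu_n, psit_n; split; first exact: cont.
have [nu_n0 [smHn smDn] _ _] := cont.
have [v' dv'] := smDn 0%N omega0 (ltac:(by rewrite /= in_itv/= ltrBlDr ltrDl andbb)).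
have D' : is_H2_derivative per psit_n omega0 (dH2 per psit_n omega0).
  exact: (@xgetPex _ (cst 0) [set v | is_H2_derivative per psit_n omega0 v] (ex_intro _ v' dv')).
have -> : L2inner per (dH2 per psit_n omega0) (psi_per n) = hip (incl e') (incl q).
  rewrite [RHS]/(L2inner per _ _) !incl_eq.
  exact: (ip_ae per (H2_meas (proj1 D')) (H2_meas hpn) (meas_h0 e') (meas_h0 q) he' hq).
by have := sign e' ee'; rewrite (pmulr_rgt0 _ sp).
Qed.
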